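(* Assume that $c_1,c_2,c_3,c_4<\infty$ and that $a_2(x_1,x_2)\le a_1(x_1,x_2)$ for a.a. $x_1,x_2\in\mathbb{R}^d$. Fix a measure $\mu\in\mathcal{M}^1_{\mathrm{fm}}(\Gamma)$ which has a correlation functional $k_\mu\in\mathcal{K}_{C_0}$, $C_0>0$. Consider the evolution $k_\mu\mapsto k_t\in\mathcal{K}_{C_t}$, $t\in(0,T)$, where $T=\frac{1}{(c_3+c_4)C_0}$. Then, for any $t\in(0,T)$, there exists a unique measure $\mu_t\in\mathcal{M}^1_{\mathrm{fm}}(\Gamma)$ such that $k_t$ is the correlation functional of $\mu_t$.
   Context: Configuration spaces. $d\in\mathbb{N}$. $\Gamma$ is the set of all locally finite subsets of $\mathbb{R}^d$, with the $\sigma$-algebra generated by the maps $\gamma\mapsto|\gamma\cap\Lambda|$, $\Lambda$ bounded Borel. $\Gamma_0=\bigsqcup_{n\ge0}\Gamma^{(n)}$ is the set of all finite subsets of $\mathbb{R}^d$ ($\Gamma^{(n)}$ the $n$-point subsets, with the Borel structure of the quotient of the off-diagonal part of $(\mathbb{R}^d)^n$ by permutations), with Lebesgue--Poisson measure $\lambda=\sum_{n\ge0}\frac1{n!}m^{(n)}$, $m^{(n)}$ the image of Lebesgue measure on $\Gamma^{(n)}$, $m^{(0)}=\delta_{\{\emptyset\}}$. A function $G$ on $\Gamma_0$ is identified with the sequence $(G^{(n)})_{n\ge0}$ of symmetric functions $G^{(n)}(x_1,\dots,x_n)=G(\{x_1,\dots,x_n\})$. $B_{\mathrm{bs}}(\Gamma_0)$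 is the set of bounded measurable functions on $\Gamma_0$ vanishing outside $\bigsqcup_{n=0}^N\{\eta\subset\Lambda:|\eta|=n\}$ for some $N\in\mathbb{N}$ and bounded Borel $\Lambda$. Correlation functionals. $\mathcal{M}^1_{\mathrm{fm}}(\Gamma)$ is the set of probability measures $\mu$ on $\Gamma$ with $\int_\Gamma|\gamma\cap\Lambda|^n\mu(d\gamma)<\infty$ for all bounded Borel $\Lambda$ and $n\in\mathbb{N}_0$. With $(KG)(\gamma)=\sum_{\eta\subset\gamma,|\eta|<\infty}G(\eta)$, the correlation measure $\rho_\mu$ of $\mu\in\mathcal{M}^1_{\mathrm{fm}}(\Gamma)$ is the measure on $\Gamma_0$ with $\int_\Gamma KG\,d\mu=\int_{\Gamma_0}G\,d\rho_\mu$ for all $G\in B_{\mathrm{bs}}(\Gamma_0)$. If $\mu$ is locally absolutely continuous with respect to the Poisson measure of intensity $1$ (i.e. for each bounded Borel $\Lambda$ the image of $\mu$ under $\gamma\mapsto\gamma\cap\Lambda$ is absolutely continuous with respect to that of the Poisson measure), then $\rho_\mu\ll\lambda$ and the correlation functional of $\mu$ is $k_\mu:=d\rho_\mu/d\lambda$. Function spaces. $X_n:=L^1((\mathbb{R}^d)^n,dx_1\cdots dx_n)$, $X_0:=\mathbb{R}$. For $C>0$, $\mathcal{L}_C:=L^1(\Gamma_0,C^{|\eta|}d\lambda(\eta))$ and $\mathcal{K}_C:=\{k:\Gamma_0\to\mathbb{R}\mid k\cdot C^{-|\cdot|}\in L^\infty(\Gamma_0,\lambda)\}$; $\langle\!\langle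 G,k\rangle\!\rangle:=\int_{\Gamma_0}G\,k\,d\lambda$. Rate. $c:(\mathbb{R}^d)^4\to[0,\infty)$ is measurable, depends only on the unordered pairs $\{x_1,x_2\}$, $\{y_1,y_2\}$ (i.e. $c(x_1,x_2,y_1,y_2)=c(x_2,x_1,y_1,y_2)=c(x_1,x_2,y_2,y_1)$), and $$c_1=\operatorname*{ess\,sup}_{x_1,x_2}\iint c(x_1,x_2,y_1,y_2)\,dy_1dy_2,\qquad c_2=\operatorname*{ess\,sup}_{x_1,x_2}\iint c(y_1,y_2,x_1,x_2)\,dy_1dy_2,$$ $$c_3=\operatorname*{ess\,sup}_{x_1}\iiint c(x_1,x_2,y_1,y_2)\,dy_1dy_2dx_2,\qquad c_4=\operatorname*{ess\,sup}_{x_1}\iiint c(y_1,y_2,x_1,x_2)\,dy_1dy_2dx_2,$$ $$a_1(x_1,x_2)=\iint c(x_1,x_2,y_1,y_2)\,dy_1dy_2,\quad a_2(x_1,x_2)=\iint c(y_1,y_2,x_1,x_2)\,dy_1dy_2,\quad \tilde c(x_1,x_2,y_1)=\int c(x_1,x_2,y_1,y_2)\,dy_2 .$$ Evolution. For functions $G$ on $\Gamma_0$ put $$(L_0G)(\eta)=\sum_{\{x_1,x_2\}\subset\eta}\iint c(x_1,x_2,y_1,y_2)\bigl(G(\eta\setminus\{x_1,x_2\}\cup\{y_1,y_2\})-G(\eta)\bigr)dy_1dy_2,$$ $$(WG)(\eta)=\sum_{x_2\in\eta}\sum_{x_1\in\eta\setminus\{x_2\}}\int\tilde c(x_1,x_2,y_1)\bigl(G((\eta\setminus\{x_1,x_2\})\cup\{y_1\})-G(\eta\setminus\{x_2\})\bigr)dy_1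 .$$ (These are the two parts of $K^{-1}LK$, where $(LF)(\gamma)=\sum_{\{x_1,x_2\}\subset\gamma}\iint c(x_1,x_2,y_1,y_2)(F(\gamma\setminus\{x_1,x_2\}\cup\{y_1,y_2\})-F(\gamma))dy_1dy_2$ is the generator of the binary jump dynamics.) Let $B=c_3+c_4$ and $\rho(t,C)=\frac{C}{1+BCt}$. Under the assumptions of the claim, for every $C>0$ and $G_0\in\mathcal{L}_C$ the problem $\frac{\partial}{\partial t}G_t=L_0G_t+WG_t$, $G_t|_{t=0}=G_0$ (understood componentwise in the spaces $X_n$) has a unique solution $G_t=:V(t)G_0\in\mathcal{L}_{\rho(t,C)}$, and $\|V(t)G_0\|_{\mathcal{L}_{\rho(t,C)}}\le\|G_0\|_{\mathcal{L}_C}$. For $t\in(0,T)$ put $C_t=\frac{C_0}{1-BC_0t}$, so that $\rho(t,C_t)=C_0$. The evolution $k_\mu\mapsto k_t$ is defined by duality: $k_t\in\mathcal{K}_{C_t}$ is the unique element with $$\langle\!\langle G_0,k_t\rangle\!\rangle=\langle\!\langle V(t)G_0,k_\mu\rangle\!\rangle\quad\text{for all }G_0\in\mathcal{L}_{C_t}.$$ It satisfies $\frac{d}{dt}\langle\!\langle G,k_t\rangle\!\rangle=\langle\!\langle(L_0+W)G,k_t\rangle\!\rangle$ for $G\in B_{\mathrm{bs}}(\Gamma_0)$. If $c_3+c_4=0$, then $T:=+\infty$. *)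

(* Defs.v *)
From HB Require Import structures.
From mathcomp Require Import all_boot all_order all_algebra finmap.
From mathcomp Require Import all_classical all_reals all_analysis.
From mathcomp Require Import ess_sup_inf measurable_realfun.

Set Implicit Arguments.
Unset Strict Implicit.
Unset Printing Implicit Defensive.

Import Order.TTheory GRing.Theory Num.Theory.
Import numFieldNormedType.Exports.

Local Open Scope classical_set_scope.
Local Open Scope ring_scope.

Lemma product_sigma_finite d1 d2 (T1 : measurableType d1)
    (T2 : measurableType d2) (R : realType)
    (m1 : {sigma_finite_measure set T1 -> \bar R})
    (m2 : {sigma_finite_measure set T2 -> \bar R}) :
  sigma_finite setT (m1 \x m2)%E.
Proof.
have /sigma_finiteP[F [TF ndF Foo]] := sigma_finiteT m1.
have /sigma_finiteP[G [TG ndG Goo]] := sigma_finiteT m2.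
exists (fun n => F n `*` G n).
  rewrite -setXTT TF TG predeqE => -[x y]; split.
    move=> [/= [n _ Fnx] [k _ Gky]]; exists (maxn n k) => //; split.
    - by move: x Fnx; exact/subsetPset/ndF/leq_maxl.
    - by move: y Gky; exact/subsetPset/ndG/leq_maxr.
  by move=> [n _ []/= ? ?]; split; exists n.
move=> k; have [? ?] := Foo k; have [? ?] := Goo k.
split; first exact: measurableX.
by rewrite product_measure1E// lte_mul_pinfty// ge0_fin_numE.
Qed.

(* mathcomp-analysis equips [n.-tuple T] with the product sigma-algebra but
   with no product measure; it is built here by recursion on [n]. *)
Section tuple_measure.
Context {d} {T : measurableType d} {R : realType}.

Definition tuple_cons n (p : T * n.-tuple T) : n.+1.-tuple T :=
  [the n.+1.-tuple T of p.1 :: p.2].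

Lemma measurable_tuple_cons n : measurable_fun setT (@tuple_cons n).
Proof. exact: measurable_cons. Qed.

Section cons_measure.
Variables (m : {sigma_finite_measure set T -> \bar R}) (n : nat).
Variable nu : {sigma_finite_measure set (n.-tuple T) -> \bar R}.

Definition cons_measure : set (n.+1.-tuple T) -> \bar R :=
  pushforward (m \x nu)%E (@tuple_cons n).

Let cons_measure0 : cons_measure set0 = 0%E.
Proof. by rewrite /cons_measure /pushforward preimage_set0 measure0. Qed.

Let cons_measure_ge0 A : (0 <= cons_measure A)%E.
Proof. by rewrite /cons_measure /pushforward measure_ge0. Qed.

Let cons_measure_sigma_additive : semi_sigma_additive cons_measure.
Proof.
move=> F mF tF mUF; rewrite /cons_measure /pushforward preimage_bigcup.
apply: measure_semi_sigma_additive.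
- by move=> k; rewrite -[X in measurable X]setTI; exact: measurable_tuple_cons.
- apply/trivIsetP => /= i j _ _ ij; rewrite -preimage_setI.
  by move/trivIsetP : tF => /(_ _ _ _ _ ij) ->//; rewrite preimage_set0.
- rewrite -preimage_bigcup -[X in measurable X]setTI.
  exact: measurable_tuple_cons.
Qed.

HB.instance Definition _ := isMeasure.Build _ _ _ cons_measure
  cons_measure0 cons_measure_ge0 cons_measure_sigma_additive.

Let cons_measure_sigma_finite : sigma_finite setT cons_measure.
Proof.
have [F TF mF] := product_sigma_finite m nu.
pose s (t : n.+1.-tuple T) : T * n.-tuple T := (thead t, [tuple of behead t]).
have ms : measurable_fun setT s.
  apply/measurable_fun_pair; first exact: measurable_tnth.
  exact: measurable_behead.
have sK : cancel (@tuple_cons n) s.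
  by case=> x t; rewrite /s/=; congr (_, _); apply/val_inj.
exists (fun k => s @^-1` F k).
  by rewrite -preimage_bigcup -TF preimage_setT.
move=> k; have [mFk Fk] := mF k; split.
  by rewrite -[X in measurable X]setTI; exact: ms.
rewrite /cons_measure /pushforward.
rewrite [X in (m \x nu)%E X](_ : _ = F k)//.
by apply/seteqP; split => x /=; rewrite sK.
Qed.

HB.instance Definition _ := Measure_isSigmaFinite.Build _ _ _ cons_measure
  cons_measure_sigma_finite.

End cons_measure.

Fixpoint tuple_measure (m : {sigma_finite_measure set T -> \bar R}) (n : nat) :
    {sigma_finite_measure set (n.-tuple T) -> \bar R} :=
  match n with
  | 0 => dirac ([tuple] : 0.-tuple T)
  | n'.+1 => cons_measure m (tuple_measure m n')
  end.

End tuple_measure.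

Notation euclid R d := (d.-tuple (measurableTypeR R)).

Definition lebesgue_space (R : realType) (d : nat) :
    {sigma_finite_measure set (euclid R d) -> \bar R} :=
  tuple_measure (@lebesgue_measure R) d.

Definition bounded_region (R : realType) (d : nat) (L : set (euclid R d)) :=
  exists M : R, forall x, L x -> forall i, `|tnth x i| <= M.

Definition bounded_Borel (R : realType) (d : nat) (L : set (euclid R d)) :=
  measurable L /\ bounded_region L.

Record conf (R : realType) (d : nat) := Conf {
  points :> set (euclid R d) ;
  points_locally_finite :
    forall L, bounded_region L -> finite_set (points `&` L) }.

Lemma set0_locally_finite (R : realType) (d : nat) (L : set (euclid R d)) :
  bounded_region L -> finite_set (set0 `&` L).
Proof. by move=> _; rewrite set0I; exact: finite_set0. Qed.

Definition conf0 (R : realType) (d : nat) : conf R d :=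
  Conf (@set0_locally_finite R d).

HB.instance Definition _ (R : realType) (d : nat) :=
  gen_eqMixin (conf R d).
HB.instance Definition _ (R : realType) (d : nat) :=
  gen_choiceMixin (conf R d).
HB.instance Definition _ (R : realType) (d : nat) :=
  isPointed.Build (conf R d) (conf0 R d).

Definition count_in (R : realType) (d : nat) (L : set (euclid R d))
    (g : conf R d) : nat := #|` fset_set (g `&` L)|%fset.

Definition count_events (R : realType) (d : nat) : set (set (conf R d)) :=
  [set A | exists2 L, bounded_Borel L &
           exists n, A = [set g | count_in L g = n]].

HB.instance Definition _ (R : realType) (d : nat) :=
  Measurable.copy (conf R d) (g_sigma_algebraType (@count_events R d)).

Lemma setI_locally_finite (R : realType) (d : nat) (L : set (euclid R d))
    (g : conf R d) (M : set (euclid R d)) :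
  bounded_region M -> finite_set ((g `&` L) `&` M).
Proof.
by move=> bM; rewrite setIAC; apply: finite_setIl; exact: points_locally_finite.
Qed.

Definition restrict_conf (R : realType) (d : nat) (L : set (euclid R d))
    (g : conf R d) : conf R d :=
  Conf (@setI_locally_finite R d L g).

Definition fconf (R : realType) (d : nat) : Type := {fset euclid R d}.

HB.instance Definition _ (R : realType) (d : nat) :=
  Choice.copy (fconf R d) {fset euclid R d}.
HB.instance Definition _ (R : realType) (d : nat) :=
  isPointed.Build (fconf R d) fset0.

Definition fconf_of (R : realType) (d n : nat) (x : n.-tuple (euclid R d)) :
  fconf R d := [fset y in tval x]%fset.

(* The n-point part of a set of finite configurations, pulled back to the
   off-diagonal part of (R^d)^n. *)
Definition unorder (R : realType) (d n : nat) (A : set (fconf R d)) :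
    set (n.-tuple (euclid R d)) :=
  [set x : n.-tuple (euclid R d) | uniq x /\ A (fconf_of x)].
Arguments unorder {R d} n A.

Section fconf_measurable.
Context {R : realType} {d : nat}.

Lemma unorder_bigcup n (F : (set (fconf R d))^nat) :
  unorder n (\bigcup_i F i) = \bigcup_i unorder n (F i).
Proof.
apply/seteqP; split => x /=; first by move=> [ux [i _ Fx]]; exists i.
by move=> [i _ [ux Fx]]; split => //; exists i.
Qed.

Lemma measurable_uniq n :
  measurable [set x : n.-tuple (euclid R d) | uniq x].
Proof.
rewrite [X in measurable X](_ : _ =
  \bigcap_(p in [set p : 'I_n * 'I_n | p.1 != p.2])
    ~` (\bigcap_(k in [set: 'I_d])
      [set x | tnth (tnth x p.1) k = tnth (tnth x p.2) k])); last first.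
  apply/seteqP; split => x /=.
    move=> /tuple_uniqP ux [i j] /= ij exij; move/eqP: ij; apply; apply: ux.
    by apply: eq_from_tnth => k; exact: exij.
  move=> xE; apply/tuple_uniqP => i j xij; apply/eqP; apply: contrapT => ij.
  by apply: (xE (i, j)) => [|k _ /=]; [exact/negP|rewrite xij].
apply: fin_bigcap_measurable => [|[i j] _]; first exact: finite_finset.
apply: measurableC; apply: fin_bigcap_measurable => [|k _].
  exact: finite_finset.
have mf (l : 'I_n) : measurable_fun [set: n.-tuple (euclid R d)]
    (fun x => tnth (tnth x l) k : measurableTypeR R).
  exact: (measurableT_comp (measurable_tnth k) (measurable_tnth l)).
rewrite -[X in measurable X]setTI.
have /(_ measurableT [set true]) := measurable_fun_eqr (mf i) (mf j).
rewrite (_ : _ @^-1` _ =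
  [set x : n.-tuple (euclid R d) | tnth (tnth x i) k = tnth (tnth x j) k]).
  by apply.
by apply/seteqP; split => x /= /eqP.
Qed.

Let fconf_sets : set (set (fconf R d)) :=
  [set A | forall n, measurable (unorder n A)].

Let fconf_sets0 : fconf_sets set0.
Proof.
by move=> n; rewrite (_ : unorder n set0 = set0)//; apply/seteqP; split=> x []//.
Qed.

Let fconf_setsC A : fconf_sets A -> fconf_sets (~` A).
Proof.
move=> mA n; rewrite (_ : unorder n (~` A) =
    [set x : n.-tuple (euclid R d) | uniq x] `\` unorder n A).
  by apply: measurableD; [exact: measurable_uniq|exact: mA].
apply/seteqP; split => x /=; first by move=> [ux nAx]; split => // -[].
by move=> [ux nAx]; split => // Ax; apply: nAx.
Qed.

Let fconf_sets_bigcup (F : (set (fconf R d))^nat) :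
  (forall i, fconf_sets (F i)) -> fconf_sets (\bigcup_i F i).
Proof.
move=> mF n; rewrite unorder_bigcup.
by apply: bigcupT_measurable => i; exact: mF.
Qed.

Fact fconf_display : measure_display.
Proof. exact: default_measure_display. Qed.

HB.instance Definition _ := isMeasurable.Build fconf_display
  (fconf R d) fconf_sets0 fconf_setsC fconf_sets_bigcup.

Definition npoint_measure (n : nat) (A : set (fconf R d)) : \bar R :=
  tuple_measure (lebesgue_space R d) n (unorder n A).

Section npoint_measure.
Variable n : nat.

Let npoint_measure0 : npoint_measure n set0 = 0%E.
Proof.
rewrite /npoint_measure (_ : unorder n set0 = set0) ?measure0//.
by apply/seteqP; split=> x [].
Qed.

Let npoint_measure_ge0 A : (0 <= npoint_measure n A)%E.
Proof. exact: measure_ge0. Qed.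

Let npoint_measure_sigma_additive : semi_sigma_additive (npoint_measure n).
Proof.
move=> F mF tF mUF; rewrite /npoint_measure unorder_bigcup.
apply: measure_semi_sigma_additive.
- by move=> k; exact: mF.
- apply/trivIsetP => i j _ _ ij; apply/seteqP; split => // x /=.
  move=> [[_ Fi] [_ Fj]]; move/trivIsetP : tF => /(_ _ _ _ _ ij).
  by move=> /(_ I I)/seteqP[+ _] => /(_ (fconf_of x)); apply.
- by rewrite -unorder_bigcup; exact: mUF.
Qed.

HB.instance Definition _ := isMeasure.Build _ _ _ (npoint_measure n)
  npoint_measure0 npoint_measure_ge0 npoint_measure_sigma_additive.

End npoint_measure.

End fconf_measurable.

Definition lebesgue_poisson (R : realType) (d : nat) :
    {measure set (fconf R d) -> \bar R} :=
  mseries (fun n => mscale (n`!%:R^-1)%:nng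
                           (npoint_measure n : {measure set _ -> \bar R})) 0.

Section correlation.
Context {R : realType} {d : nat}.
Implicit Types (mu : probability (conf R d) R) (G k : fconf R d -> R).

Definition Bbs G :=
  [/\ measurable_fun setT G,
      exists M : R, forall eta, `|G eta| <= M &
      exists N L, bounded_Borel L /\
        forall eta : fconf R d,
          ~ ((#|` eta| <= N)%N /\ [set` eta] `<=` L) -> G eta = 0].

(* The sum has finite support for [G] in [Bbs]; [\sum_(_ \in _) _] is then the
   honest sum over all finite [eta] contained in [g]. *)
Definition Ktransform G (g : conf R d) : R :=
  \sum_(eta \in [set eta : fconf R d | [set` eta] `<=` g]) G eta.

Definition finite_moments mu :=
  forall L, bounded_Borel L -> forall n : nat,
    (\int[mu]_g ((count_in L g)%:R ^+ n)%:E < +oo)%E.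

Definition is_correlation_measure mu
    (rho : {measure set (fconf R d) -> \bar R}) :=
  forall G, Bbs G ->
    (\int[mu]_g (Ktransform G g)%:E = \int[rho]_eta (G eta)%:E)%E.

(* Intensity 1; [poisson_pmf] is not used because its value at rate 0 is 1
   for every [k]. *)
Definition is_poisson (pi : probability (conf R d) R) :=
  forall (m : nat) (L : 'I_m -> set (euclid R d)),
    (forall i, bounded_Borel (L i)) -> trivIset setT L ->
    forall k : 'I_m -> nat,
      pi [set g | forall i, count_in (L i) g = k i] =
      (\prod_i (let v := fine (lebesgue_space R d (L i)) in
                expR (- v) * v ^+ k i / (k i)`!%:R))%:E.

(* [is_poisson] determines [pi] on measurable sets, so the existential below
   only names the Poisson measure. *)
Definition locally_absolutely_continuous mu :=
  exists2 pi : probability (conf R d) R, is_poisson pi &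
    forall L, bounded_Borel L ->
      pushforward mu (restrict_conf L) `<< pushforward pi (restrict_conf L).

Definition is_correlation_functional mu k :=
  [/\ locally_absolutely_continuous mu,
      measurable_fun setT k &
      exists2 rho : {measure set (fconf R d) -> \bar R},
        is_correlation_measure mu rho &
        forall A, measurable A ->
          rho A = (\int[lebesgue_poisson R d]_(eta in A) (k eta)%:E)%E].

Definition L_space (C : R) G :=
  (fun eta : fconf R d => G eta * C ^+ #|` eta|)
    \in Lfun (lebesgue_poisson R d) 1%E.

Definition K_space (C : R) k :=
  (fun eta : fconf R d => k eta * C ^- #|` eta|)
    \in Lfun (lebesgue_poisson R d) +oo%E.

Definition pairing G k : R := \int[lebesgue_poisson R d]_eta (G eta * k eta).

End correlation.

Section dynamics.
Context {R : realType} {d : nat}.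
Local Notation Rd := (euclid R d).
Local Notation m := (lebesgue_space R d).
Local Notation mm := (m \x m)%E.

Variable c : Rd -> Rd -> Rd -> Rd -> R.

Definition jump_rate :=
  [/\ forall x1 x2 y1 y2, 0 <= c x1 x2 y1 y2,
      measurable_fun setT (fun p : Rd * Rd * (Rd * Rd) =>
        c p.1.1 p.1.2 p.2.1 p.2.2),
      forall x1 x2 y1 y2, c x1 x2 y1 y2 = c x2 x1 y1 y2 &
      forall x1 x2 y1 y2, c x1 x2 y1 y2 = c x1 x2 y2 y1].

Definition a1 (x : Rd * Rd) : \bar R :=
  (\int[mm]_y (c x.1 x.2 y.1 y.2)%:E)%E.
Definition a2 (x : Rd * Rd) : \bar R :=
  (\int[mm]_y (c y.1 y.2 x.1 x.2)%:E)%E.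

Definition c1 : \bar R := ess_sup mm a1.
Definition c2 : \bar R := ess_sup mm a2.
Definition c3 : \bar R :=
  ess_sup m (fun x1 => \int[m]_x2 \int[mm]_y (c x1 x2 y.1 y.2)%:E)%E.
Definition c4 : \bar R :=
  ess_sup m (fun x1 => \int[m]_x2 \int[mm]_y (c y.1 y.2 x1 x2)%:E)%E.

Definition ctilde (x1 x2 y1 : Rd) : R := \int[m]_y2 c x1 x2 y1 y2.

(* Every unordered pair {x1, x2} occurs twice in the double sum, and the
   summand is symmetric in x1, x2 for a [jump_rate]. *)
Definition L0 (G : fconf R d -> R) (eta : fconf R d) : R :=
  2^-1 * \sum_(x1 <- eta) \sum_(x2 <- (eta `\ x1)%fset)
    \int[mm]_y (c x1 x2 y.1 y.2 *
      (G ((eta `\ x1 `\ x2) `|` [fset y.1; y.2])%fset - G eta)).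

Definition W (G : fconf R d -> R) (eta : fconf R d) : R :=
  \sum_(x2 <- eta) \sum_(x1 <- (eta `\ x2)%fset)
    \int[m]_y1 (ctilde x1 x2 y1 *
      (G ((eta `\ x1 `\ x2) `|` [fset y1])%fset - G (eta `\ x2)%fset)).

Definition B : R := fine c3 + fine c4.

Definition rho (t C : R) : R := C / (1 + B * C * t).

Definition Xnorm (n : nat) (G : fconf R d -> R) : \bar R :=
  (\int[tuple_measure m n]_x `|G (fconf_of x)|%:E)%E.

(* The derivative is taken in every X_n, and is one-sided at t = 0. *)
Definition solution (C : R) (G0 : fconf R d -> R) (G : R -> fconf R d -> R) :=
  [/\ forall t : R, 0 <= t -> L_space (rho t C) (G t),
      {ae lebesgue_poisson R d, forall eta, G 0 eta = G0 eta} &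
      forall (t : R) (n : nat), 0 <= t ->
        Xnorm n (fun eta => (G (t + h) eta - G t eta) / h
                            - (L0 (G t) eta + W (G t) eta))
          @[h --> within [set h | 0 <= t + h] (0 : R)^'] --> 0%E].

Definition lifetime (C0 : R) : \bar R :=
  if B == 0 then +oo%E else (1 / (B * C0))%:E.

Definition Ct (C0 t : R) : R := C0 / (1 - B * C0 * t).

(* [solution] determines V(t)G0 := G t up to lebesgue_poisson-null sets. *)
Definition evolution (C0 : R) (kmu : fconf R d -> R)
    (k : R -> fconf R d -> R) :=
  forall t : R, 0 < t -> (t%:E < lifetime C0)%E ->
    K_space (Ct C0 t) (k t) /\
    forall G0 G, L_space (Ct C0 t) G0 -> solution (Ct C0 t) G0 G ->
      pairing G0 (k t) = pairing (G t) kmu.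

End dynamics.

(* Main.v *)
(* In terms of the K-transform, the generator A = L0 + W acts by
     K A G (gam) = 1/2 sum_{x1,x2 in gam} int c(x,y) (K G (gam - x + y) - K G (gam)) dy,
   so for small s the Euler step 1 + sA preserves nonnegativity of K G on the
   configurations with at most n points, while a2 <= a1 bounds the X_n-norm of
   the step by the norms of G on the levels n and n-1.  Both properties pass to
   the limit (1 + tA/N)^N G -> sum_j t^j/j! A^j G = V(t)G.  Since <<V(t)G, k_mu>>
   is a limit of mu-integrals of K V(t)G over bounded regions, duality yields
   <<G, k_t>> >= 0 whenever K G >= 0.
   Taking G = 1_{eta in L} K^-1 1_A shows that
     dens L eta = int_{zeta in L} (-1)^|zeta| k_t(eta + zeta) dlambda(zeta)
   is nonnegative almost everywhere, hence a probability density on the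
   configurations in L.  These densities are consistent for increasing L, and an
   Ionescu-Tulcea argument along boxes gives sigma-additivity on cylinders, hence
   the measure mu_t.  Inverting K shows that k_t is its correlation functional and
   that k_t determines the densities, which is uniqueness.  Local absolute
   continuity holds because the Poisson measure projects to e^{-|L|} lambda. *)

Require Import Defs.
From HB Require Import structures.
From mathcomp Require Import all_boot all_order all_algebra finmap.
From mathcomp Require Import all_classical all_reals all_analysis.
From mathcomp Require Import ess_sup_inf measurable_realfun lra.

Set Implicit Arguments.
Unset Strict Implicit.
Unset Printing Implicit Defensive.

Import Order.TTheory GRing.Theory Num.Theory.
Import numFieldNormedType.Exports.

Local Open Scope classical_set_scope.
Local Open Scope ring_scope.

(** * Finite configurations and counting maps *)

(** The generator need not be bounded on a weighted space, but its n-point component uses only the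
    components of G on n and n-1 points. It is therefore bounded on finitely many levels, the
    exponential series converges in every X_n, and limits are taken level by level; the admissible
    Euler step, of order 1/(n^2 c1), may depend on n. The weight [rho] comes from the Euler scheme:
    a step of size s turns the radius r into r(1 + sBr), a discretization of r' = B r^2, and N steps
    of size t/N lead from C/(1 + BCt) to at most C. Most identities hold only almost everywhere,
    because the integrals in the generator may diverge on null sets and [k t] is determined up to
    null sets. Mecke's and Minlos' formulas carry null sets from configurations to their subsets and
    to their successors after a jump. Before densities are formed, [k t] is replaced by a version
    bounded everywhere, so that consistency holds at every point and only the sign of the densities
    remains an almost-everywhere statement. Decreasing cylinders then meet because a common point
    can be built region by region, keeping the conditional masses bounded below. *)

Section counting.
Context {R : realType} {d : nat}.
Local Notation E := (euclid R d).
Local Notation F := (fconf R d).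
Local Open Scope ereal_scope.

(** A sum of Dirac measures: sums over the points become integrals, and a configuration depending
    measurably on a parameter becomes a kernel. *)
Definition cmeas (eta : F) : {measure set E -> \bar R} :=
  msum (fun i => \d_(nth point (enum_fset eta) i)) #|` eta|%fset.

Lemma integral_cmeas (eta : F) (f : E -> \bar R) :
  (forall x, 0 <= f x) -> measurable_fun setT f ->
  \int[cmeas eta]_x f x = \sum_(x <- eta) f x.
Proof.
move=> f0 mf; rewrite /cmeas ge0_integral_measure_sum// (big_nth point) big_mkord.
by apply: eq_bigr => i _; rewrite integral_dirac// diracT mul1e.
Qed.

Lemma cmeasE (eta : F) (A : set E) : cmeas eta A = \sum_(x <- eta) (\1_A x)%:E.
Proof. by rewrite (big_nth point) big_mkord. Qed.

Lemma cmeas_lty (eta : F) : exists M : R, forall A, measurable A -> cmeas eta A < M%:E.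
Proof.
exists (#|` eta|%:R + 1)%R => A _; rewrite cmeasE.
apply: (@le_lt_trans _ _ (\sum_(x <- eta) 1%:E)).
  by apply: lee_sum => x _; rewrite lee_fin indicE lern1 leq_b1.
by rewrite sumEFin big_const_seq count_predT iter_addr_0 lte_fin ltrDl.
Qed.

End counting.

Lemma measurable_EFin_indic {R : realType} dS (S : measurableType dS) dT
    (T : measurableType dT) (L : set T) (f : S -> T) :
  measurable L -> measurable_fun setT f ->
  measurable_fun setT (fun s => (\1_L (f s) : R)%:E).
Proof.
move=> mL mf; apply/measurable_EFinP.
by apply: (measurableT_comp (f := \1_L : T -> R)); [exact: measurable_indic|].
Qed.

Section count_measurability.
Context {R : realType} {d : nat}.
Local Notation E := (euclid R d).
Local Notation F := (fconf R d).
Local Open Scope ereal_scope.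

(** The working criterion for measurability into finite configurations; [count_measurableP] shows
    that it agrees with the quotient structure. *)
Definition count_measurable dS (S : measurableType dS) (e : S -> F) :=
  forall L : set E, measurable L -> measurable_fun setT (fun s => cmeas (e s) L).

Section kernel.
Context dS (S : measurableType dS) (e : S -> F).
Hypothesis me : count_measurable e.

Let ckernel (s : S) := cmeas (e s).

HB.instance Definition _ := @isKernel.Build _ _ S E R ckernel me.

Import HBNNSimple.

Lemma measurable_sum_count (h : S * E -> \bar R) :
  (forall z, 0 <= h z) -> measurable_fun setT h ->
  measurable_fun setT (fun s => \sum_(x <- e s) h (s, x)).
Proof.
move=> h0 mh.
have := @measurable_fun_xsection_integral _ _ S E R h ckernel
  (nnsfun_approx measurableT mh).
move=> /(_ (fun a b ab => nd_nnsfun_approx measurableT mh ab)).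
move=> /(_ (fun z => cvg_nnsfun_approx measurableT mh (fun z _ => h0 z) I)).
have -> : (fun x : S => \int[ckernel x]_y h (x, y)) =
    (fun s => \sum_(x <- e s) h (s, x)).
  by apply/funext => s; rewrite integral_cmeas//; exact/measurableT_comp.
apply => n r.
pose A := (nnsfun_approx measurableT mh n : _ -> _) @^-1` [set r].
have mA : measurable A by exact: measurable_sfunP.
(* The kernel lemma asks, for each parameter, for a bound on the measure restricted to [setT]; the
   number of points plus one is such a bound. *)
have [_] := @measurable_prod_subset_xsection_kernel _ _ S E R ckernel setT measurableT
  (fun s => let: ex_intro M hM := cmeas_lty (e s) in
     ex_intro _ M (fun X mX => hM (X `&` setT) (measurableI _ _ mX measurableT))) A mA.
by congr measurable_fun; apply/funext => s; rewrite /mrestr setIT.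
Qed.

End kernel.

(** Repeated points are included: the iterated form admits an induction on n in which the first
    entry moves into the parameter. Repetitions are discarded later by [unorder]. *)
Fixpoint tuple_sum (eta : F) n : (n.-tuple E -> \bar R) -> \bar R :=
  match n return (n.-tuple E -> \bar R) -> \bar R with
  | 0 => fun h => h [tuple]
  | n'.+1 => fun h => \sum_(x <- eta) tuple_sum eta (fun t => h [tuple of x :: t])
  end.

Lemma tuple_sum_ge0 (eta : F) n (h : n.-tuple E -> \bar R) :
  (forall t, 0 <= h t) -> 0 <= tuple_sum eta h.
Proof.
elim: n h => [|n IH] h h0 //=; apply: sume_ge0 => x _; apply: IH => t; exact: h0.
Qed.

Lemma tuple_sum_ge (eta : F) n (h : n.-tuple E -> \bar R) t :
  (forall t, 0 <= h t) -> {subset t <= eta} -> h t <= tuple_sum eta h.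
Proof.
elim: n h t => [|n IH] h t h0 /=; first by rewrite (tuple0 t).
case/tupleP: t => x t st.
have xe : x \in (eta : {fset E}) by apply: st; rewrite mem_head.
rewrite (big_fsetD1 x)//=; apply: (le_trans (y := tuple_sum eta (fun t => h [tuple of x :: t]))).
  apply: (IH (fun t => h [tuple of x :: t])) => [|y yt]; first by move=> ?; exact: h0.
  by apply: st; rewrite inE yt orbT.
apply: leeDl; apply: sume_ge0 => y _; apply: tuple_sum_ge0 => ?; exact: h0.
Qed.

Lemma tuple_sum_eq0 (eta : F) n (h : n.-tuple E -> \bar R) :
  (forall t, {subset t <= eta} -> h t = 0) -> tuple_sum eta h = 0.
Proof.
elim: n h => [|n IH] h h0 /=; first exact: h0.
rewrite big1_seq// => x /= xe; apply: IH => t te; apply: h0 => y.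
by rewrite inE => /predU1P[->//|/te].
Qed.

Lemma measurable_tuple_sum n dS (S : measurableType dS) (e : S -> F)
    (h : S -> n.-tuple E -> \bar R) :
  count_measurable e -> (forall s t, 0 <= h s t) ->
  measurable_fun setT (fun z : S * n.-tuple E => h z.1 z.2) ->
  measurable_fun setT (fun s => tuple_sum (e s) (h s)).
Proof.
elim: n dS S e h => [|n IH] dS S e h me h0 mh /=.
  apply: (measurableT_comp mh (g := fun s => (s, [tuple] : 0.-tuple E))).
  exact/measurable_fun_pair.
apply: (@measurable_sum_count _ _ e me
  (fun z => tuple_sum (e z.1) (fun t => h z.1 [tuple of z.2 :: t]))).
  by move=> z; apply: tuple_sum_ge0.
apply: (IH _ _ (fun z : S * E => e z.1) (fun z t => h z.1 [tuple of z.2 :: t])) => //.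
  by move=> L mL; apply: measurableT_comp (me _ mL) _; exact: measurable_fst.
apply: (measurableT_comp mh (g := fun z : S * E * n.-tuple E => (z.1.1, [tuple of z.1.2 :: z.2]))).
apply/measurable_fun_pair => /=.
  exact: measurableT_comp.
by apply: measurable_cons => //; exact: measurableT_comp.
Qed.

Lemma fconf_of_card (n : nat) (t : n.-tuple E) : uniq t -> #|` fconf_of t|%fset = n.
Proof. by move=> ut; rewrite /fconf_of card_fseq undup_id// size_tuple. Qed.

Lemma mem_fconf_of n (t : n.-tuple E) x : (x \in (fconf_of t : {fset E})) = (x \in t).
Proof. by rewrite /fconf_of !inE. Qed.

Definition tuple_of (eta : F) : #|` eta|%fset.-tuple E := in_tuple (enum_fset eta).

Lemma tuple_ofK (eta : F) : fconf_of (tuple_of eta) = eta.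
Proof. by apply/fsetP => x; rewrite mem_fconf_of. Qed.

Lemma uniq_tuple_of (eta : F) : uniq (tuple_of eta).
Proof. exact: fset_uniq. Qed.

Lemma fconf_of_eq n (eta : F) (t : n.-tuple E) : {subset t <= eta} -> uniq t ->
  #|` eta|%fset = n -> fconf_of t = eta.
Proof.
move=> st ut en; apply/eqP; rewrite eqEfcard.
rewrite en fconf_of_card// leqnn andbT; apply/fsubsetP => x.
by rewrite mem_fconf_of; exact: st.
Qed.

(* The quotient sigma-algebra of [fconf] is generated by the counting maps. *)
Lemma measurable_fconf dS (S : measurableType dS) (e : S -> F) :
  count_measurable e -> measurable_fun setT e.
Proof.
move=> me _ A mA; rewrite setTI.
(* If [e s] has n points, it belongs to [A] exactly when some tuple with entries in [e s] lies in
   [unorder n A]: such a tuple has distinct entries and so lists all points. The tuple sum detects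
   such a tuple by being positive. *)
have -> : e @^-1` A = \bigcup_n ([set s | cmeas (e s) setT = n%:R%:E] `&`
    [set s | 0 < tuple_sum (e s) (fun t => (\1_(unorder n A) t)%:E)]).
  have ct s : cmeas (e s) setT = #|` e s|%fset%:R%:E.
    rewrite cmeasE; under eq_bigr do rewrite indicT.
    by rewrite sumEFin big_const_seq count_predT iter_addr_0.
  apply/seteqP; split => s /=.
    move=> As; exists #|` e s|%fset => //=; split; first exact: ct.
    apply: (@lt_le_trans _ _ (\1_(unorder #|` e s|%fset A) (tuple_of (e s)))%:E).
      rewrite indicE mem_set ?lte01//; split; first exact: uniq_tuple_of.
      by rewrite tuple_ofK.
    by apply: (@tuple_sum_ge (e s) _ (fun t => (\1_(unorder #|` e s|%fset A) t)%:E)) => // t; rewrite lee_fin.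
  move=> [n _ /= [cn]].
  move: cn; rewrite [LHS]ct => -[] /eqP; rewrite eqr_nat => /eqP en.
  apply: contraPP => nA; rewrite tuple_sum_eq0 ?ltxx// => t te.
  rewrite indicE memNset// => -[ut At]; apply: nA.
  by rewrite -(fconf_of_eq te ut en).
apply: bigcupT_measurable => n; apply: measurableI.
  have := me setT measurableT measurableT [set n%:R%:E] (emeasurable_set1 _).
  by rewrite setTI.
have : measurable_fun setT (fun s => tuple_sum (e s) (fun t => (\1_(unorder n A) t)%:E)).
  apply: (measurable_tuple_sum (h := fun s t => (\1_(unorder n A) t)%:E)) => //.
  by apply: measurable_EFin_indic => //; exact: (mA n).
move=> /(_ measurableT `]0, +oo[%classic (emeasurable_itv _)); rewrite setTI.
congr (measurable _); apply/seteqP; split => s /=; rewrite in_itv/= ?andbT//.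
Qed.

End count_measurability.

Section fconf_operations.
Context {R : realType} {d : nat}.
Local Notation E := (euclid R d).
Local Notation F := (fconf R d).
Local Open Scope ereal_scope.

(** Distinct tuples suffice, because events are tested through [unorder] only. *)
Lemma measurable_of_fconf dY (Y : measurableType dY) (g : F -> Y) :
  (forall n, measurable_fun [set t : n.-tuple E | uniq t] (fun t => g (fconf_of t))) ->
  measurable_fun setT g.
Proof.
move=> mg mT B mB; rewrite setTI.
suff : forall n, measurable (unorder n (g @^-1` B)) by [].
move=> n.
have := mg n (@measurable_uniq R d n) B mB.
by congr (measurable _); apply/seteqP; split.
Qed.

Lemma sum_fconf_of n (t : n.-tuple E) (f : E -> \bar R) : uniq t ->
  \sum_(x <- fconf_of t) f x = \sum_(i < n) f (tnth t i).
Proof.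
move=> ut; rewrite -(big_tuple _ _ t predT f); apply: perm_big.
by apply: uniq_perm => // x; rewrite mem_fconf_of.
Qed.

Lemma count_measurable_id : count_measurable (fun eta : F => eta).
Proof.
move=> L mL; apply: measurable_of_fconf => n.
apply: (eq_measurable_fun (fun t => \sum_(i < n) (\1_L (tnth t i))%:E)).
  by move=> t; rewrite inE /= => ut; rewrite cmeasE sum_fconf_of.
apply: measurable_funTS; apply: emeasurable_sum => i.
by apply: measurable_EFin_indic => //; exact: measurable_tnth.
Qed.

Lemma count_measurableP dS (S : measurableType dS) (e : S -> F) :
  measurable_fun setT e <-> count_measurable e.
Proof.
split; last exact: measurable_fconf.
by move=> me L mL; exact: (measurableT_comp (count_measurable_id mL) me).
Qed.

Lemma measurable_diag : measurable [set z : E * E | z.1 = z.2].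
Proof.
have mT : measurable_fun setT (fun z : E * E => [tuple z.1; z.2]).
  apply: measurable_cons => //; apply: measurable_cons => //.
have := mT measurableT _ (@measurable_uniq R d 2); rewrite setTI => /measurableC.
congr measurable; apply/seteqP; split => -[x y] /=; rewrite !inE andbT.
  by move=> /negP; rewrite negbK => /eqP.
by move=> ->; rewrite eqxx.
Qed.

Section param.
Context dS (S : measurableType dS).
Implicit Types (e : S -> F) (x : S -> E).

Lemma measurable_sum_fconf e (h : S -> E -> \bar R) : measurable_fun setT e ->
  (forall s y, 0 <= h s y) -> measurable_fun setT (fun z : S * E => h z.1 z.2) ->
  measurable_fun setT (fun s => \sum_(x <- e s) h s x).
Proof.
move=> /count_measurableP me h0 mh.
by apply: (measurable_sum_count me (h := fun z => h z.1 z.2)).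
Qed.

(** The diagonal is measurable, and its indicator summed over the configuration is 1 or 0 according
    to membership. *)
Lemma measurable_in_fconf x e : measurable_fun setT x -> measurable_fun setT e ->
  measurable_fun setT (fun s => x s \in (e s : {fset E})).
Proof.
move=> mx me.
have mS : measurable_fun setT (fun s =>
    \sum_(y <- e s) (\1_[set z : E * E | z.1 = z.2] (x s, y) : R)%:E).
  apply: (measurable_sum_fconf
    (h := fun s y => (\1_[set z : E * E | z.1 = z.2] (x s, y) : R)%:E) me) => //.
  apply: measurable_EFin_indic; first exact: measurable_diag.
  by apply/measurable_fun_pair => //; exact: measurableT_comp.
apply: (measurable_fun_bool true); rewrite setTI.
have := mS measurableT [set 1] (emeasurable_set1 _); rewrite setTI.
congr measurable; apply/seteqP; split => s /=.
  apply: contraPT => xe; rewrite big1_seq//; first by move=> /esym/eqP; rewrite onee_eq0.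
  move=> y /= ye; rewrite indicE memNset//= => xy; move: xe.
  by rewrite xy ye.
move=> xe; rewrite (big_fsetD1 (x s))//= indicE mem_set//= big1_seq ?adde0// => y.
rewrite !inE => /andP[_ /andP[yx _]]; rewrite indicE memNset//= => xy.
by rewrite xy eqxx in yx.
Qed.

Lemma measurable_notin_if x e (f : S -> \bar R) : measurable_fun setT x ->
  measurable_fun setT e -> measurable_fun setT f ->
  measurable_fun setT (fun s => if x s \in (e s : {fset E}) then 0 else f s).
Proof.
by move=> mx me mf; apply: measurable_fun_ifT => //; exact: measurable_in_fconf.
Qed.

Lemma measurable_fsetU1 x e : measurable_fun setT x -> measurable_fun setT e ->
  measurable_fun setT (fun s => (x s |` e s)%fset : F).
Proof.
move=> mx me; apply: measurable_fconf => L mL.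
apply: (eq_measurable_fun (fun s => (if x s \in (e s : {fset E}) then 0
  else (\1_L (x s))%:E) + cmeas (e s) L)).
  move=> s _; rewrite !cmeasE; case: ifPn => xe; last by rewrite big_fsetU1.
  rewrite add0e; congr (\sum_(y <- _) _).
  by rewrite (fsetUidPr _ _ _) // fsub1set.
apply: emeasurable_funD; last by move/count_measurableP : me => /(_ _ mL).
apply: measurable_fun_ifT => //; first exact: measurable_in_fconf.
exact: measurable_EFin_indic.
Qed.

Lemma measurable_fsetD1 x e : measurable_fun setT x -> measurable_fun setT e ->
  measurable_fun setT (fun s => (e s `\ x s)%fset : F).
Proof.
move=> mx me; apply: measurable_fconf => L mL.
apply: (eq_measurable_fun (fun s => cmeas (e s) L - (if x s \in (e s : {fset E})
  then (\1_L (x s))%:E else 0))).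
  move=> s _; rewrite !cmeasE; case: ifPn => xe; last first.
    by rewrite sube0; congr (\sum_(y <- _) _); rewrite mem_fsetD1.
  by rewrite (big_fsetD1 (x s) xe)/= addeAC subee// add0e.
apply: emeasurable_funB; first by move/count_measurableP : me => /(_ _ mL).
apply: measurable_fun_ifT => //; first exact: measurable_in_fconf.
exact: measurable_EFin_indic.
Qed.

End param.

Lemma measurable_notin_if_pair dS (S : measurableType dS) (e : S -> F) (L : set E) :
  measurable L -> measurable_fun setT e ->
  measurable_fun setT (fun z : S * E =>
    if z.2 \in (e z.1 : {fset E}) then 0 else (\1_L z.2 : R)%:E).
Proof.
move=> mL me; apply: (measurable_notin_if (x := snd) (e := e \o fst)) => //.
  exact: measurableT_comp.
exact: measurable_EFin_indic.
Qed.

Section param2.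
Context dS (S : measurableType dS).
Implicit Types (e : S -> F) (x : S -> E).

Lemma measurable_fsetU e (f : S -> F) : measurable_fun setT e -> measurable_fun setT f ->
  measurable_fun setT (fun s => (e s `|` f s)%fset : F).
Proof.
move=> me mf; apply: measurable_fconf => L mL.
apply: (eq_measurable_fun (fun s => cmeas (e s) L + \sum_(y <- f s)
    (if y \in (e s : {fset E}) then 0 else (\1_L y)%:E))).
  move=> s _; rewrite !cmeasE /=.
  rewrite [RHS](perm_big (enum_fset (e s) ++
      [seq y <- enum_fset (f s) | y \notin (e s : {fset E})])).
    rewrite big_cat/= big_filter; congr (_ + _); rewrite [RHS]big_mkcond/=.
    by under [RHS]eq_bigr do rewrite if_neg.
  apply: uniq_perm => //.
    rewrite cat_uniq fset_uniq filter_uniq// andbT; apply/hasPn => y.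
    by rewrite mem_filter => /andP[].
  by move=> y; rewrite mem_cat mem_filter !inE; case: (y \in (e s : {fset E})).
apply: emeasurable_funD; first by move/count_measurableP : me => /(_ _ mL).
apply: (measurable_sum_fconf (h := fun s y => if y \in (e s : {fset E}) then 0 else (\1_L y)%:E)) => //.
  by move=> s y; case: ifP => // _; rewrite lee_fin.
exact: measurable_notin_if_pair.
Qed.

Definition frestr (L : set E) (eta : F) : F := [fset y in (eta : {fset E}) | y \in L]%fset.

Lemma mem_frestr L (eta : F) y :
  (y \in (frestr L eta : {fset E})) = (y \in (eta : {fset E})) && (y \in L).
Proof. by rewrite /frestr !inE. Qed.

Lemma sum_frestr (L : set E) (eta : F) (f : E -> \bar R) :
  \sum_(y <- frestr L eta) f y = \sum_(y <- eta | y \in L) f y.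
Proof.
rewrite -[RHS]big_filter; apply: perm_big; apply: uniq_perm => //.
  by rewrite filter_uniq.
by move=> y; rewrite mem_filter andbC -mem_frestr.
Qed.

Lemma measurable_frestr (L : set E) e : measurable L -> measurable_fun setT e ->
  measurable_fun setT (fun s => frestr L (e s)).
Proof.
move=> mL me; apply: measurable_fconf => M mM.
apply: (eq_measurable_fun (fun s => cmeas (e s) (L `&` M))).
  move=> s _; rewrite !cmeasE sum_frestr [RHS]big_mkcond/=; apply: eq_bigr => y _.
  by rewrite !indicE in_setI; case: ifP.
by move/count_measurableP : me; apply; exact: measurableI.
Qed.

End param2.

Lemma fconf_of_cons n x (t : n.-tuple E) :
  fconf_of [tuple of x :: t] = (x |` fconf_of t)%fset.
Proof. by apply/fsetP => y; rewrite /fconf_of !inE. Qed.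

Lemma measurable_fconf_of n : measurable_fun setT (@fconf_of R d n).
Proof.
elim: n => [|n IH].
  apply: (eq_measurable_fun (fun=> fset0 : F)) => // t _.
  by apply/fsetP => x; rewrite (tuple0 t) /fconf_of !inE.
apply: (eq_measurable_fun (fun t : n.+1.-tuple E => (thead t |` fconf_of [tuple of behead t])%fset : F)).
  move=> t _; rewrite -fconf_of_cons; congr fconf_of.
  by rewrite [RHS]tuple_eta; apply/val_inj.
apply: (measurable_fsetU1 (S := n.+1.-tuple E)); first exact: measurable_tnth.
by apply: measurableT_comp => //; exact: measurable_behead.
Qed.

Lemma measurable_card_fconf : measurable_fun setT (fun eta : F => #|` eta|%fset).
Proof.
move=> mT A _; rewrite setTI.
have -> : (fun eta : F => #|` eta|%fset) @^-1` A =
    \bigcup_(n in A) [set eta : F | cmeas eta setT = n%:R%:E].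
  have ct (s : F) : cmeas s setT = #|` s|%fset%:R%:E.
    rewrite cmeasE; under eq_bigr do rewrite indicT.
    by rewrite sumEFin big_const_seq count_predT iter_addr_0.
  apply/seteqP; split => s /=; first by move=> As; exists #|` s|%fset => //; exact: ct.
  by move=> [n An] /=; rewrite [LHS]ct => -[] /eqP; rewrite eqr_nat => /eqP ->.
apply: bigcup_measurable => n _.
have := count_measurable_id measurableT measurableT (emeasurable_set1 n%:R%:E).
by rewrite setTI.
Qed.

End fconf_operations.

(** * Integrals over labelled tuples *)

Section tuple_integral.
Context {dT} {T : measurableType dT} {R : realType}.
Variable m : {sigma_finite_measure set T -> \bar R}.
Local Open Scope ereal_scope.

Lemma integral_tuple0 (f : 0.-tuple T -> \bar R) : (forall t, 0 <= f t) ->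
  measurable_fun setT f -> \int[tuple_measure m 0]_t f t = f [tuple].
Proof. by move=> f0 mf; rewrite /= integral_dirac// diracT mul1e. Qed.

Lemma integral_tupleS n (f : n.+1.-tuple T -> \bar R) : (forall t, 0 <= f t) ->
  measurable_fun setT f ->
  \int[tuple_measure m n.+1]_t f t =
  \int[m]_x \int[tuple_measure m n]_t f [tuple of x :: t].
Proof.
move=> f0 mf /=; rewrite /cons_measure.
transitivity (\int[(m \x tuple_measure m n)]_z f (tuple_cons z)).
  rewrite (ge0_integral_pushforward (@measurable_tuple_cons _ _ n))//.
rewrite (@fubini_tonelli1 _ _ _ _ _ _ _ (f \o @tuple_cons _ _ n))//; last first.
  by move=> z; exact: f0.
by apply: measurableT_comp => //; exact: measurable_tuple_cons.
Qed.

Definition tuple_in n (A : set T) : set (n.-tuple T) := [set t | forall i, A (tnth t i)].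

Lemma measurable_tuple_in n A : measurable A -> measurable (@tuple_in n A).
Proof.
move=> mA; rewrite (_ : tuple_in _ = \bigcap_(i in [set: 'I_n]) ((@tnth n T)^~ i @^-1` A)).
  apply: fin_bigcap_measurable => [|i _]; first exact: finite_finset.
  by rewrite -[X in measurable X]setTI; exact: measurable_tnth.
by apply/seteqP; split => [t tA i _|t tA i]; [exact: tA|exact: tA].
Qed.

Lemma tuple_measure_in n A : measurable A ->
  tuple_measure m n (tuple_in A) = (m A) ^+ n.
Proof.
move=> mA; elim: n => [|n IH].
  rewrite /= /dirac indicE mem_set// => -[] //.
rewrite expeS -IH -product_measure1E//; last exact: measurable_tuple_in.
rewrite /= /cons_measure /pushforward; congr ((m \x _)%E _).
apply/seteqP; split => -[x t] /=.
  move=> At; split; first exact: (At ord0).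
  move=> i; have := At (lift ord0 i).
  by rewrite (_ : tnth _ _ = tnth t i)// !(tnth_nth x).
move=> [Ax At] i; case: (unliftP ord0 i) => [j|] ->.
  by rewrite (_ : tnth _ _ = tnth t j)// !(tnth_nth x).
by rewrite (_ : tnth _ _ = x)// (tnth_nth x).
Qed.

End tuple_integral.

Section euclid_measure.
Context {R : realType} {d : nat}.
Local Notation E := (euclid R d).
Local Notation m := (lebesgue_space R d).
Local Open Scope ereal_scope.

Lemma measurable_euclid1 n (x : euclid R n) : measurable [set x].
Proof.
have := @measurable_diag R n.
move=> /(@measurable_xsection _ _ _ _ _ x); congr measurable.
by apply/seteqP; split => y /=; rewrite /xsection/= inE/= => ->.
Qed.

(** A point lies in the hyperplane that fixes its first coordinate, which is null. In dimension zero
    there is no such coordinate, and the single point has mass 1. *)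
Lemma lebesgue_space1 (x : E) : (0 < d)%N -> m [set x] = 0.
Proof.
move: x; rewrite /lebesgue_space; case: d => // n x _.
apply/eqP; rewrite -measure_le0.
pose A : set (measurableTypeR R) := [set tnth x ord0].
have mA : measurable A by exact: measurable_set1.
pose B : set (euclid R n.+1) := (fun t => tnth t ord0) @^-1` A.
have mB : measurable B.
  rewrite -[X in measurable X]setTI.
  exact: (@measurable_tnth _ (measurableTypeR R) n.+1 ord0).
apply: (@le_trans _ _ (tuple_measure (@lebesgue_measure R) n.+1 B)).
  apply: le_measure; rewrite ?inE//.
  - by move: (mB) => _; exact: (@measurable_euclid1 n.+1).
  - by move=> y ->.
rewrite /= /cons_measure /pushforward (_ : _ @^-1` _ = A `*` setT).
  rewrite product_measure1E// [X in X * _](_ : _ = 0) ?mul0e//.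
  exact: lebesgue_measure_set1.
by apply/seteqP; split => [[y t]|[y t] [yA _]] //=; rewrite /B/= ?(tnth_nth y)//=.
Qed.

Definition box (n : nat) : set E :=
  tuple_in (`[(- n%:R)%R, n%:R%R]%classic : set (measurableTypeR R)).

Lemma measurable_box n : measurable (box n).
Proof. by apply: measurable_tuple_in; exact: measurable_itv. Qed.

Lemma box_bounded n : bounded_Borel (box n).
Proof.
split; first exact: measurable_box.
exists n%:R%R => x bx i; have := bx i; rewrite /= in_itv/= => /andP[x1 x2].
by rewrite ler_norml x1.
Qed.

Lemma bounded_region_box L : bounded_region L -> exists n, L `<=` box n.
Proof.
move=> [M LM]; exists (Num.truncn M).+1 => x Lx i /=.
rewrite in_itv/= -ler_norml (le_trans (LM _ Lx i))// ltW//.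
exact: truncnS_gt.
Qed.

Lemma box_lty n : m (box n) < +oo.
Proof.
rewrite /lebesgue_space tuple_measure_in; last exact: measurable_itv.
have [r Ar] : exists r : R, lebesgue_measure
    (`[(- n%:R)%R, n%:R%R]%classic : set (measurableTypeR R)) = r%:E.
  have := @lebesgue_measure_itv R `[(- n%:R)%R, n%:R%R].
  by case: ifPn => _ e; [exists (n%:R - - n%:R)%R|exists 0%R]; exact: e.
by rewrite [X in X ^+ _]Ar -EFin_expe ltry.
Qed.

Lemma box_le n k : (n <= k)%N -> box n `<=` box k.
Proof.
move=> nk x bx i; have := bx i; rewrite /= !in_itv/= -!ler_norml => /le_trans; apply.
by rewrite ler_nat.
Qed.

Lemma box_cover x : exists n, box n x.
Proof.
have [|n] := @bounded_region_box [set x]; last by move=> /(_ x erefl); exists n.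
exists (\sum_(i < d) `|tnth x i|)%R => _ -> i.
by rewrite (bigD1 i)//= lerDl sumr_ge0.
Qed.

Lemma bounded_lty L : bounded_Borel L -> m L < +oo.
Proof.
move=> [mL /bounded_region_box[n Ln]]; apply: le_lt_trans (box_lty n).
by apply: le_measure => //; rewrite inE//; exact: measurable_box.
Qed.

End euclid_measure.

Section npoint.
Context {R : realType} {d : nat}.
Local Notation E := (euclid R d).
Local Notation F := (fconf R d).
Local Notation m := (lebesgue_space R d).
Local Open Scope ereal_scope.

(* [npint n f] is the integral of [f] over unordered configurations of [n]
   labelled points, diagonals included. *)
Definition npint n (f : F -> \bar R) : \bar R :=
  \int[tuple_measure m n]_t f (fconf_of t).

Lemma npint0 f : (forall x, 0 <= f x) -> measurable_fun setT f ->
  npint 0 f = f fset0.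
Proof.
move=> f0 mf; rewrite /npint integral_tuple0//.
  by congr f; apply/fsetP => x; rewrite /fconf_of !inE.
by apply: measurableT_comp => //; exact: measurable_fconf_of.
Qed.

Lemma npintS n f : (forall x, 0 <= f x) -> measurable_fun setT f ->
  npint n.+1 f = \int[m]_x npint n (fun eta => f (x |` eta)%fset).
Proof.
move=> f0 mf; transitivity (\int[m]_x \int[tuple_measure m n]_t
    f (fconf_of [tuple of x :: t])).
  apply: (@integral_tupleS _ _ _ _ n (fun t => f (fconf_of t))) => [t|]; first exact: f0.
  by apply: measurableT_comp mf _; exact: measurable_fconf_of.
by apply: eq_integral => x _; apply: eq_integral => t _; congr f; exact: fconf_of_cons.
Qed.

Section param.
Context dS (S : measurableType dS).

Lemma measurable_npint n (h : S -> F -> \bar R) : (forall s eta, 0 <= h s eta) ->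
  measurable_fun setT (fun z : S * F => h z.1 z.2) ->
  measurable_fun setT (fun s => npint n (h s)).
Proof.
move=> h0 mh.
apply: (@measurable_fun_fubini_tonelli_F _ _ S (n.-tuple E) R (tuple_measure m n)
  (fun z => h z.1 (fconf_of z.2))) => //.
apply: (measurableT_comp mh (g := fun z : S * n.-tuple E => (z.1, fconf_of z.2))).
apply/measurable_fun_pair => //=.
by apply: measurableT_comp => //; exact: measurable_fconf_of.
Qed.

Lemma npint_swap (mu : {sigma_finite_measure set S -> \bar R}) n (h : S -> F -> \bar R) :
  (forall s eta, 0 <= h s eta) ->
  measurable_fun setT (fun z : S * F => h z.1 z.2) ->
  \int[mu]_s npint n (h s) = npint n (fun eta => \int[mu]_s h s eta).
Proof.
move=> h0 mh; rewrite /npint.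
apply: (@fubini_tonelli _ _ S (n.-tuple E) R mu (tuple_measure m n)
  (fun z => h z.1 (fconf_of z.2))) => //.
apply: (measurableT_comp mh (g := fun z : S * n.-tuple E => (z.1, fconf_of z.2))).
apply/measurable_fun_pair => //=.
by apply: measurableT_comp => //; exact: measurable_fconf_of.
Qed.

End param.
End npoint.

Section npint_theory.
Context {R : realType} {d : nat}.
Local Notation E := (euclid R d).
Local Notation F := (fconf R d).
Local Notation m := (lebesgue_space R d).
Local Open Scope ereal_scope.

Lemma npint_ge0 n (f : F -> \bar R) : (forall x, 0 <= f x) -> 0 <= npint n f.
Proof. by move=> f0; apply: integral_ge0. Qed.

Lemma eq_npint n (f g : F -> \bar R) : f =1 g -> npint n f = npint n g.
Proof. by move=> fg; apply: eq_integral => t _; exact: fg. Qed.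

Lemma measurable_comp_fconf_of n (f : F -> \bar R) : measurable_fun setT f ->
  measurable_fun setT (fun t : n.-tuple E => f (fconf_of t)).
Proof. by move=> mf; apply: measurableT_comp => //; exact: measurable_fconf_of. Qed.

Lemma npintD n (f g : F -> \bar R) : (forall x, 0 <= f x) -> (forall x, 0 <= g x) ->
  measurable_fun setT f -> measurable_fun setT g ->
  npint n (fun x => f x + g x) = npint n f + npint n g.
Proof.
move=> f0 g0 mf mg; apply: ge0_integralD => //; exact: measurable_comp_fconf_of.
Qed.

Lemma sum_point_in (x : E) (eta : F) :
  \sum_(y <- eta) (\1_[set x] y : R)%:E = (x \in (eta : {fset E}))%:R%:E.
Proof.
case: (boolP (x \in _)) => xe.
  rewrite (big_fsetD1 x)//= indicE mem_set//= big1_seq ?adde0// => y /=.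
  by rewrite !inE => /andP[yx _]; rewrite indicE memNset//= => /eqP; exact/negP.
rewrite big1_seq// => y /= ye; rewrite indicE memNset//= => yx.
by move: xe; rewrite -yx ye.
Qed.

Lemma integral_in_fconf (d0 : (0 < d)%N) (eta : F) :
  \int[m]_x (x \in (eta : {fset E}))%:R%:E = 0 :> \bar R.
Proof.
transitivity (\int[m]_x \sum_(y <- eta) (\1_[set y] x : R)%:E).
  apply: eq_integral => x _; rewrite -sum_point_in; apply: eq_bigr => y _.
  by rewrite !indicE; congr (_%:R%:E); congr nat_of_bool; apply/idP/idP; rewrite !inE => /= ->.
rewrite ge0_integral_sum//; last first.
  by move=> y; apply: measurable_EFin_indic => //; exact: measurable_euclid1.
rewrite big1// => y _; rewrite integral_indic//; last exact: measurable_euclid1.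
by rewrite setIT; exact: lebesgue_space1.
Qed.

Lemma ae_fresh (d0 : (0 < d)%N) (eta : F) : {ae m, forall x, x \notin (eta : {fset E})}.
Proof.
have mS : measurable [set x | x \in (eta : {fset E})].
  have mf : measurable_fun setT (fun x : E => x \in (eta : {fset E})).
    by apply: (measurable_in_fconf (x := id) (e := fun=> eta)).
  by have := mf measurableT [set true] I; rewrite setTI.
exists [set x | x \in (eta : {fset E})]; split => //; last first.
  by move=> x /= /negP; rewrite negbK.
rewrite -(integral_in_fconf d0 eta) -[LHS]/(m _) -(setIT [set` eta]).
rewrite -integral_indic//; by apply: eq_integral => x _; rewrite indicE mem_setE.
Qed.

(* Almost every point [x] avoids a given finite configuration. *)
Lemma npint_fresh (d0 : (0 < d)%N) n (h g : E -> F -> \bar R) :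
  (forall x eta, 0 <= h x eta) -> (forall x eta, 0 <= g x eta) ->
  measurable_fun setT (fun z : E * F => h z.1 z.2) ->
  measurable_fun setT (fun z : E * F => g z.1 z.2) ->
  (forall x eta, x \notin (eta : {fset E}) -> h x eta = g x eta) ->
  \int[m]_x npint n (h x) = \int[m]_x npint n (g x).
Proof.
move=> h0 g0 mh mg hg; rewrite (npint_swap _ _ h0 mh) (npint_swap _ _ g0 mg); apply: eq_npint => eta.
apply: ge0_ae_eq_integral => //.
- by apply: (measurableT_comp mh (g := fun x => (x, eta))); exact: measurable_fun_pair.
- by apply: (measurableT_comp mg (g := fun x => (x, eta))); exact: measurable_fun_pair.
- have := ae_fresh d0 eta; apply: filterS => x xe _; exact: hg.
Qed.

(** Induction on n: either the first entry occurs in the tail, which is null for each fixed tail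
    because finite sets are null, or the tail itself repeats an entry. *)
Lemma npint_nonuniq (d0 : (0 < d)%N) n :
  tuple_measure m n (~` [set t : n.-tuple E | uniq t]) = 0.
Proof.
have mU k : measurable (~` [set t : k.-tuple E | uniq t]).
  by apply: measurableC; exact: measurable_uniq.
elim: n => [|n IH]; first by rewrite /= /dirac indicE memNset//= => -[].
pose B := [set z : E * n.-tuple E | z.1 \in (fconf_of z.2 : {fset E})].
have mB : measurable B.
  have mf : measurable_fun setT (fun z : E * n.-tuple E => z.1 \in (fconf_of z.2 : {fset E})).
    apply: (measurable_in_fconf (x := fst) (e := fun z : E * n.-tuple E => fconf_of z.2)) => //.
    by apply: measurableT_comp => //; exact: measurable_fconf_of.
  by have := mf measurableT [set true] I; rewrite setTI.
have mV : measurable ([set: E] `*` ~` [set t : n.-tuple E | uniq t]).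
  by apply: measurableX => //; exact: mU.
apply/eqP; rewrite -measure_le0 [X in X <= _]/= /cons_measure /pushforward.
apply: (@le_trans _ _ ((m \x tuple_measure m n) (B `|` (setT `*` ~` [set t : n.-tuple E | uniq t])))).
  apply: le_measure; rewrite ?inE.
  - have := @measurable_tuple_cons _ E n measurableT _ (mU n.+1).
    by rewrite setTI.
  - exact: measurableU.
  move=> [x t] /= /negP; rewrite /B/= negb_and negbK => /orP[xt|/negP ut].
    by left; rewrite /fconf_of !inE.
  by right.
apply: (@le_trans _ _ ((m \x tuple_measure m n) B +
    (m \x tuple_measure m n) (setT `*` ~` [set t : n.-tuple E | uniq t]))).
  exact: measureU2.
rewrite product_measure1E//; last exact: mU.
rewrite IH mule0 adde0.
rewrite -(setIT B) -integral_indic// fubini_tonelli2//; last first.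
  exact: measurable_EFin_indic.
rewrite integral0_eq// => t _; rewrite /fubini_G -(integral_in_fconf d0 (fconf_of t)).
by apply: eq_integral => x _; rewrite indicE /B mem_setE.
Qed.

(** [npoint_measure] sees the distinct tuples only; the others are null, so it is the image of the
    tuple measure under [fconf_of]. *)
Lemma integral_npoint (d0 : (0 < d)%N) n (f : F -> \bar R) :
  (forall x, 0 <= f x) -> measurable_fun setT f ->
  \int[npoint_measure n]_x f x = npint n f.
Proof.
move=> f0 mf.
transitivity (\int[pushforward (tuple_measure m n) (@fconf_of R d n)]_x f x).
  apply: eq_measure_integral; first exact: measurable_fconf_of.
  move=> mff A mA _; rewrite /= /npoint_measure /pushforward.
  have mA' : measurable (@fconf_of R d n @^-1` A).
    by rewrite -[X in measurable X]setTI; exact: measurable_fconf_of.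
  apply/eqP; rewrite eq_le; apply/andP; split.
    by apply: le_measure; rewrite ?inE//; [exact: (mA n)|move=> t [_]].
  rewrite -[leRHS]adde0 -(npint_nonuniq d0 n).
  have mU : measurable (~` [set t : n.-tuple E | uniq t]).
    by apply: measurableC; exact: measurable_uniq.
  apply: le_trans (measureU2 _ _ _) => //; last exact: (mA n).
  apply: le_measure; rewrite ?inE//; first by apply: measurableU => //; exact: (mA n).
  by move=> t At; have [ut|/negP nut] := boolP (uniq t); [left|right].
rewrite (ge0_integral_pushforward (@measurable_fconf_of R d n))//.
Qed.

Lemma integral_lebesgue_poisson (d0 : (0 < d)%N) (f : F -> \bar R) :
  (forall x, 0 <= f x) -> measurable_fun setT f ->
  \int[lebesgue_poisson R d]_x f x = \sum_(n <oo) (n`!%:R^-1)%:E * npint n f.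
Proof.
move=> f0 mf; rewrite /lebesgue_poisson ge0_integral_measure_series//.
apply: eq_eseriesr => n _; rewrite ge0_integral_mscale//=.
by congr (_ * _); exact: integral_npoint.
Qed.

Definition subconf (L : set E) : set F := [set eta | [set` eta] `<=` L].

Lemma measurable_subconf L : measurable L -> measurable (subconf L).
Proof.
move=> mL.
have mC : measurable (~` L) by exact: measurableC.
have mf := measurableT_comp measurable_card_fconf (measurable_frestr mC (@measurable_id _ F setT)).
have := mf measurableT [set 0%N] I; rewrite setTI; congr measurable.
apply/seteqP; split => eta /=.
  move=> /eqP; rewrite cardfs_eq0 => /eqP e0 x /= xe; apply: contrapT => nL.
  have : x \in (frestr (~` L) eta : {fset E}) by rewrite mem_frestr xe; apply/mem_set.
  by rewrite e0 inE.
move=> eL; apply/eqP; rewrite cardfs_eq0; apply/eqP/fsetP => x.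
rewrite /frestr !inE/=; apply/negP => /andP[xe]; rewrite inE/=; apply; exact: eL.
Qed.

Lemma npint_subconf n L : measurable L ->
  npint n (fun eta => (\1_(subconf L) eta : R)%:E) = (m L) ^+ n.
Proof.
move=> mL; rewrite -tuple_measure_in// /npint -[X in _ = _ X]setIT.
rewrite -integral_indic//; last exact: measurable_tuple_in.
apply: eq_integral => t _; rewrite !indicE; congr (_%:R%:E); congr nat_of_bool.
apply/idP/idP; rewrite !inE.
  by move=> h i; apply: h => /=; rewrite /fconf_of !inE mem_tnth.
by move=> h x /=; rewrite /fconf_of !inE => /tnthP[i ->]; exact: h.
Qed.

(** The exhausting sets bound both the region and the number of points, which leaves a finite sum of
    powers of the finite mass of the box. *)
Lemma sigma_finite_lebesgue_poisson : sigma_finite setT (lebesgue_poisson R d).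
Proof.
exists (fun n => subconf (box n) `&` [set eta : F | (#|` eta| <= n)%N]).
  apply/esym/seteqP; split => // eta _.
  have [M bM] : exists M, [set` eta] `<=` box M.
    apply: bounded_region_box.
    exists (\sum_(x <- eta) \sum_(i < d) `|tnth x i|)%R => x /= xe i.
    rewrite (big_fsetD1 x)//= (bigD1 i)//= -addrA lerDl addr_ge0// ?sumr_ge0// => *; rewrite sumr_ge0//.
  exists (maxn M #|` eta|%fset) => //; split; last exact: leq_maxr.
  by apply: subset_trans bM _; apply: box_le; exact: leq_maxl.
move=> n.
have mA : measurable (subconf (box n) `&` [set eta : F | (#|` eta| <= n)%N]).
  apply: measurableI; first by apply: measurable_subconf; exact: measurable_box.
  by have /(_ measurableT [set k | (k <= n)%N] I) := @measurable_card_fconf R d; rewrite setTI.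
split => //.
rewrite /lebesgue_poisson /= /mseries.
apply: (@le_lt_trans _ _ (\sum_(k <oo) (if (k <= n)%N then (k`!%:R^-1)%:E * m (box n) ^+ k else 0))).
  apply: lee_nneseries => k _; first by rewrite mule_ge0// lee_fin.
  rewrite -[leLHS]/(_ * npoint_measure k _); case: ifPn => kn.
    apply: lee_wpmul2l; first by rewrite lee_fin.
    rewrite -npint_subconf; last exact: measurable_box.
    have mU : measurable (@fconf_of R d k @^-1` subconf (box n)).
      rewrite -[X in measurable X]setTI; apply: measurable_fconf_of => //.
      by apply: measurable_subconf; exact: measurable_box.
    rewrite /npoint_measure /npint (_ : \int[_]_t _ = tuple_measure m k (@fconf_of R d k @^-1` subconf (box n))).
      apply: le_measure; rewrite ?inE//; first exact: (mA k).
      by move=> t [_ []].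
    by rewrite -[in RHS](setIT (_ @^-1` _)) -integral_indic.
  suff -> : npoint_measure k (subconf (box n) `&` [set eta : F | (#|` eta| <= n)%N]) = 0 by rewrite mule0.
  rewrite /npoint_measure (_ : unorder _ _ = set0) ?measure0//.
  apply/seteqP; split => // t [/fconf_of_card ut [_ /=]].
  by rewrite ut; exact/negP.
rewrite (nneseries_split 0 n.+1); last by move=> k _; case: ifPn => // _; rewrite mule_ge0 ?lee_fin// expe_ge0.
rewrite [X in _ + X]eseries0 ?adde0; last first.
  by move=> k; rewrite add0n => nk _; rewrite leqNgt nk.
apply: lte_sum_pinfty => k _; case: ifPn => // _.
rewrite lte_mul_pinfty ?lee_fin//.
have := @box_lty R d n; have : 0 <= m (box n) by [].
by case: (m (box n)) => // r _ _; rewrite -EFin_expe ltry.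
Qed.

(* A copy of [lebesgue_poisson] carrying a sigma-finite instance. *)
Definition lpm : set F -> \bar R := lebesgue_poisson R d.
HB.instance Definition _ := Measure.on lpm.
HB.instance Definition _ := Measure_isSigmaFinite.Build _ _ _ lpm
  sigma_finite_lebesgue_poisson.

Lemma integral_lpm (d0 : (0 < d)%N) (f : F -> \bar R) :
  (forall x, 0 <= f x) -> measurable_fun setT f ->
  \int[lpm]_x f x = \sum_(n <oo) (n`!%:R^-1)%:E * npint n f.
Proof. exact: integral_lebesgue_poisson. Qed.

Lemma fsetD1U1 (x z : E) (eta : F) : x \in (eta : {fset E}) -> z \notin (eta : {fset E}) ->
  ((z |` eta) `\ x)%fset = (z |` (eta `\ x))%fset :> F.
Proof.
move=> xe ze; apply/fsetP => y; rewrite !inE; case: (eqVneq y z) => [->|//].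
by rewrite andbT; apply/eqP => zx; move: ze; rewrite zx xe.
Qed.

Section removal_sum.
Context dS (S : measurableType dS).

Lemma measurable_removal_sum (e : S -> F) (h : S -> E -> F -> \bar R) :
  measurable_fun setT e -> (forall s x eta, 0 <= h s x eta) ->
  measurable_fun setT (fun z : S * E * F => h z.1.1 z.1.2 z.2) ->
  measurable_fun setT (fun s => \sum_(x <- e s) h s x (e s `\ x)%fset).
Proof.
move=> me h0 mh.
apply: (measurable_sum_fconf (h := fun s x => h s x (e s `\ x)%fset)) => //.
apply: (measurableT_comp mh (g := fun z : S * E => (z, (e z.1 `\ z.2)%fset : F))).
apply/measurable_fun_pair => //=.
apply: (measurable_fsetD1 (x := snd) (e := fun z : S * E => e z.1)) => //.
exact: measurableT_comp.
Qed.

End removal_sum.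

Lemma measurable_U1 : measurable_fun setT (fun z : E * F => (z.1 |` z.2)%fset : F).
Proof. exact: (measurable_fsetU1 (x := fst) (e := snd)). Qed.

(** Mecke's formula on one level. After the first entry z of the tuple is split off, the sum
    consists of the term of z and of the terms of the other points, with z left in the remainder; z
    avoids the other points almost everywhere. The first contributes once and the second, by
    induction, n times. *)
Lemma mecke_npint (d0 : (0 < d)%N) n (h : E -> F -> \bar R) :
  (forall x eta, 0 <= h x eta) ->
  measurable_fun setT (fun z : E * F => h z.1 z.2) ->
  npint n.+1 (fun eta => \sum_(x <- eta) h x (eta `\ x)%fset) =
  n.+1%:R%:E * \int[m]_x npint n (h x).
Proof.
(* [hz h z] is again a function of a point and a remainder, so the induction hypothesis applies to
   it for each fixed z. *)
move: h; pose hz (h : E -> F -> \bar R) (z x : E) (eta : F) : \bar R := h x ((z |` eta)%fset : F).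
have mhz (h : E -> F -> \bar R) :
    measurable_fun setT (fun z : E * F => h z.1 z.2) ->
    measurable_fun setT (fun z : E * E * F => hz h z.1.1 z.1.2 z.2).
  move=> mh; apply: (measurableT_comp mh (g := fun z : E * E * F => (z.1.2, (z.1.1 |` z.2)%fset : F))).
  apply/measurable_fun_pair => /=; first exact: measurableT_comp.
  apply: (measurable_fsetU1 (x := fun z : E * E * F => z.1.1) (e := snd)) => //.
  exact: measurableT_comp.
have mM (h : E -> F -> \bar R) : (forall x eta, 0 <= h x eta) ->
    measurable_fun setT (fun z : E * F => h z.1 z.2) ->
    measurable_fun setT (fun eta : F => \sum_(x <- eta) h x (eta `\ x)%fset).
  move=> h0 mh; apply: (measurable_removal_sum (S := F) (e := id) (h := fun _ => h)) => //.
  apply: (measurableT_comp mh (g := fun z : F * E * F => (z.1.2, z.2))).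
  by apply/measurable_fun_pair => //=; exact: measurableT_comp.
have mMz (h : E -> F -> \bar R) : (forall x eta, 0 <= h x eta) ->
    measurable_fun setT (fun z : E * F => h z.1 z.2) ->
    measurable_fun setT (fun z : E * F => \sum_(x <- z.2) hz h z.1 x (z.2 `\ x)%fset).
  move=> h0 mh; refine (@measurable_removal_sum _ (E * F)%type snd (fun s x eta => hz h s.1 x eta) _ _ _) => //.
    by move=> s x eta; exact: h0.
  apply: (measurableT_comp (mhz _ mh) (g := fun z : E * F * E * F => (z.1.1.1, z.1.2, z.2))).
  apply/measurable_fun_pair => //=; apply/measurable_fun_pair => /=.
    by apply: measurableT_comp => //; exact: measurableT_comp.
  exact: measurableT_comp.
(* The induction step is isolated so that it serves both level 0, where the sum over the empty
   configuration vanishes, and all higher levels. *)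
suff key k (g : E -> F -> \bar R) : (forall x eta, 0 <= g x eta) ->
    measurable_fun setT (fun z : E * F => g z.1 z.2) ->
    (forall g', (forall x eta, 0 <= g' x eta) ->
      measurable_fun setT (fun z : E * F => g' z.1 z.2) ->
      \int[m]_z npint k (fun eta => \sum_(x <- eta) hz g' z x (eta `\ x)%fset) =
      k%:R%:E * \int[m]_x npint k (g' x)) ->
    npint k.+1 (fun eta => \sum_(x <- eta) g x (eta `\ x)%fset) =
    k.+1%:R%:E * \int[m]_x npint k (g x).
  elim: n => [|n IH] h h0 mh; apply: key => // g g0 mg.
    rewrite mul0e integral0_eq// => z _; rewrite npint0.
    - by rewrite big_seq_fset0.
    - by move=> eta; apply: sume_ge0 => x _; exact: g0.
    - apply: mM => [x eta|]; first exact: g0.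
      apply: (measurableT_comp mg (g := fun y : E * F => (y.1, (z |` y.2)%fset : F))).
      apply/measurable_fun_pair => //=.
      exact: (measurable_fsetU1 (x := fun=> z) (e := snd)).
  transitivity (\int[m]_z (n.+1%:R%:E * \int[m]_x npint n (fun eta => hz g z x eta))).
    apply: eq_integral => z _; apply: IH => [x eta|]; first exact: g0.
    apply: (measurableT_comp mg (g := fun y : E * F => (y.1, (z |` y.2)%fset : F))).
    apply/measurable_fun_pair => //=.
    exact: (measurable_fsetU1 (x := fun=> z) (e := snd)).
  have mN : measurable_fun setT (fun z : E * E => npint n (fun eta => hz g z.1 z.2 eta)).
    refine (@measurable_npint R d _ (E * E)%type n (fun z eta => hz g z.1 z.2 eta) _ _); last exact: mhz.
    by move=> s eta; exact: g0.
  have N0 (z : E * E) : 0 <= npint n (fun eta => hz g z.1 z.2 eta).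
    by apply: npint_ge0 => eta; exact: g0.
  rewrite ge0_integralZl//; first last.
  - move=> z _; apply: integral_ge0 => x _; exact: (N0 (z, x)).
  - exact: (measurable_fun_fubini_tonelli_F _ mN N0).
  congr (_ * _).
  have := fubini_tonelli (m1 := m) (m2 := m) _ mN N0 => /= ->.
  apply: eq_integral => x _; rewrite npintS//.
  by apply: (measurableT_comp mg (g := fun eta : F => (x, eta))); exact: measurable_fun_pair.
move=> g0 mg IH.
have gM (eta : F) : 0 <= \sum_(x <- eta) g x (eta `\ x)%fset.
  by apply: sume_ge0 => x _; exact: g0.
have mg1 x : measurable_fun setT (g x).
  by apply: (measurableT_comp mg (g := fun eta : F => (x, eta))); exact: measurable_fun_pair.
have MZ0 z (eta : F) : 0 <= \sum_(x <- eta) hz g z x (eta `\ x)%fset.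
  by apply: sume_ge0 => x _; exact: g0.
have mMZ z : measurable_fun setT (fun eta : F => \sum_(x <- eta) hz g z x (eta `\ x)%fset).
  by apply: (measurableT_comp (mMz _ g0 mg) (g := fun eta : F => (z, eta))); exact: measurable_fun_pair.
rewrite npintS//; last exact: mM.
rewrite (@npint_fresh d0 k _ (fun z eta => g z eta + \sum_(x <- eta) hz g z x (eta `\ x)%fset)); first last.
- move=> z eta ze; rewrite big_fsetU1//=; congr (g z _ + _).
    by apply/fsetP => y; rewrite !inE; case: (eqVneq y z) => [->|//]; rewrite (negbTE ze).
  by apply: eq_big_seq => x xe; rewrite /hz fsetD1U1.
- apply: emeasurable_funD => //; exact: mMz.
- exact: (measurableT_comp (mM _ g0 mg) measurable_U1).
- by move=> x eta; apply: adde_ge0.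
- by move=> x eta; exact: gM.
transitivity (\int[m]_z (npint k (g z) + npint k (fun eta => \sum_(x <- eta) hz g z x (eta `\ x)%fset))).
  by apply: eq_integral => z _; rewrite npintD.
rewrite ge0_integralD//; first last.
- refine (@measurable_npint R d _ E k (fun z eta => \sum_(x <- eta) hz g z x (eta `\ x)%fset) _ _) => //.
  exact: mMz.
- by move=> z _; apply: npint_ge0.
- exact: measurable_npint.
- by move=> z _; apply: npint_ge0.
rewrite IH// -{1}[\int[m]_x npint k (g x)]mul1e -ge0_muleDl ?lee_fin//.
by congr (_ * _); rewrite -EFinD -natr1 addrC.
Qed.

(** The factor n+1 of the level formula turns 1/(n+1)! into 1/n!, so the two series differ by a
    shift of the index. *)
Lemma mecke (d0 : (0 < d)%N) (h : E -> F -> \bar R) :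
  (forall x eta, 0 <= h x eta) ->
  measurable_fun setT (fun z : E * F => h z.1 z.2) ->
  \int[lpm]_eta (\sum_(x <- eta) h x (eta `\ x)%fset) =
  \int[m]_x \int[lpm]_eta h x eta.
Proof.
move=> h0 mh.
have mM : measurable_fun setT (fun eta : F => \sum_(x <- eta) h x (eta `\ x)%fset).
  apply: (measurable_removal_sum (S := F) (e := id) (h := fun _ => h)) => //.
  apply: (measurableT_comp mh (g := fun z : F * E * F => (z.1.2, z.2))).
  by apply/measurable_fun_pair => //=; exact: measurableT_comp.
have M0 (eta : F) : 0 <= \sum_(x <- eta) h x (eta `\ x)%fset by apply: sume_ge0 => x _; exact: h0.
have mh1 x : measurable_fun setT (h x).
  by apply: (measurableT_comp mh (g := fun eta : F => (x, eta))); exact: measurable_fun_pair.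
rewrite integral_lpm//.
transitivity (\int[m]_x \sum_(n <oo) (n`!%:R^-1)%:E * npint n (h x)); last first.
  by apply: eq_integral => x _; rewrite integral_lpm.
rewrite integral_nneseries//; first last.
- by move=> n x _; rewrite mule_ge0 ?npint_ge0 ?lee_fin.
- by move=> n; apply: measurable_funeM; exact: measurable_npint.
rewrite nneseries_recl//; last by move=> k _; rewrite mule_ge0 ?npint_ge0 ?lee_fin.
rewrite npint0// big_seq_fset0 mule0 add0e.
rewrite -(nneseries_addn 1); last by move=> k; rewrite mule_ge0 ?npint_ge0 ?lee_fin.
apply: eq_eseriesr => n _; rewrite addn1 mecke_npint// muleA -EFinM ge0_integralZl//.
- by rewrite factS natrM invfM mulrAC mulVf ?mul1r// pnatr_eq0.
- exact: measurable_npint.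
- by move=> x _; exact: npint_ge0.
Qed.

End npint_theory.

(** * Sums over subsets and Minlos' lemma *)

Section fset_sums.
Context {K : choiceType} {V : nmodType}.
Implicit Types (A : {fset K}) (x : K).

Lemma sum_fpowersetU1 A x (h : {fset K} -> V) : x \notin A ->
  \sum_(B <- fpowerset (x |` A)%fset) h B =
  \sum_(B <- fpowerset A) h B + \sum_(B <- fpowerset A) h (x |` B)%fset.
Proof.
move=> xA; rewrite (perm_big (enum_fset (fpowerset A) ++
    [seq (x |` B)%fset | B <- enum_fset (fpowerset A)])).
  by rewrite big_cat big_map.
have nx B : B \in fpowerset A -> x \notin B.
  by rewrite fpowersetE => /fsubsetP BA; apply: contra xA => /BA.
apply: uniq_perm => //.
  rewrite cat_uniq fset_uniq map_inj_in_uniq ?fset_uniq ?andbT//; last first.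
    move=> B C /nx xB /nx xC /= BC.
    by rewrite -(fsetU1K xB) BC fsetU1K.
  apply/hasPn => _ /mapP[B BA ->]; apply/negP => /nx.
  by rewrite fset1U1.
move=> B; rewrite mem_cat fpowersetE; apply/idP/orP => [BA|].
  have [xB|xB] := boolP (x \in B).
    right; apply/mapP; exists (B `\ x)%fset; last by rewrite fsetD1K.
    rewrite fpowersetE; apply/fsubsetP => y; rewrite !inE => /andP[yx yB].
    by move/fsubsetP : BA => /(_ y yB); rewrite !inE (negbTE yx).
  left; rewrite fpowersetE; apply/fsubsetP => y yB.
  move/fsubsetP : BA => /(_ y yB); rewrite !inE => /predU1P[yx|//].
  by rewrite -yx yB in xB.
case=> [|/mapP[C CA ->]].
  by rewrite fpowersetE => BA; rewrite (fsubset_trans BA)// fsubsetUr.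
by apply: fsetUS; rewrite -fpowersetE.
Qed.

(** Both sides enumerate the pairs (x, B) with x in [A] and B a subset of [A] avoiding x; the subset
    on the left is B with x added. *)
Lemma sum_fpowerset_removal A (g : K -> {fset K} -> V) :
  \sum_(B <- fpowerset A) \sum_(x <- B) g x (B `\ x)%fset =
  \sum_(x <- A) \sum_(B <- fpowerset (A `\ x)%fset) g x B.
Proof.
transitivity (\sum_(B <- fpowerset A) \sum_(x <- A | x \in B) g x (B `\ x)%fset).
  apply: eq_big_seq => B; rewrite fpowersetE => /fsubsetP BA.
  rewrite -[RHS]big_filter; apply: perm_big; apply: uniq_perm => //.
    by rewrite filter_uniq.
  by move=> x; rewrite mem_filter; case: (boolP (x \in B)) => // /BA ->.
rewrite (exchange_big_dep xpredT)//=; apply: eq_big_seq => x xA.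
rewrite -big_filter.
rewrite -(big_map (fun B => (B `\ x)%fset) xpredT (g x)); apply: perm_big.
apply: uniq_perm; rewrite ?fset_uniq//.
  rewrite map_inj_in_uniq; first by rewrite filter_uniq// fset_uniq.
  move=> B C.
  by rewrite !mem_filter => /andP[xB _] /andP[xC _] BC; rewrite -(fsetD1K xB) BC fsetD1K.
move=> B; rewrite fpowersetE; apply/mapP/idP => [[C]|BA].
  rewrite mem_filter fpowersetE => /andP[xC CA] ->; exact: fsetSD.
have /fsubsetP h := BA.
have xB : x \notin B by apply/negP => /h; rewrite !inE eqxx.
exists (x |` B)%fset; last by rewrite fsetU1K.
rewrite mem_filter fset1U1 fpowersetE/=; apply/fsubsetP => y; rewrite !inE.
by move=> /predU1P[->//|/h]; rewrite !inE => /andP[].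
Qed.

End fset_sums.

Section minlos.
Context {R : realType} {d : nat}.
Local Notation E := (euclid R d).
Local Notation F := (fconf R d).
Local Notation m := (lebesgue_space R d).
Local Open Scope ereal_scope.

(** Fixing the size k of the subset lets Minlos' lemma follow from Mecke's formula by induction, one
    point at a time. *)
Definition ksum k (H : F -> F -> \bar R) (eta : F) : \bar R :=
  \sum_(xi <- fpowerset eta | #|` xi|%fset == k) H xi (eta `\` xi)%fset.

Lemma ksum_ge0 k (H : F -> F -> \bar R) (eta : F) : (forall x y, 0 <= H x y) ->
  0 <= ksum k H eta.
Proof. by move=> H0; apply: sume_ge0. Qed.

Lemma ksum0 (H : F -> F -> \bar R) (eta : F) : ksum 0%N H eta = H fset0 eta.
Proof.
rewrite /ksum big_mkcond (big_fsetD1 fset0) ?fpowersetE//=.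
rewrite fsetD0 big1_seq ?adde0// => xi /=; rewrite !inE => /andP[xi0 _].
by case: ifPn => //; rewrite cardfs_eq0 (negbTE xi0).
Qed.

(** A subset of k+1 points arises from each of its points x by adding x to the remaining k points,
    which gives the factor. *)
Lemma ksumS k (H : F -> F -> \bar R) (eta : F) : (forall x y, 0 <= H x y) ->
  k.+1%:R%:E * ksum k.+1 H eta =
  \sum_(x <- eta) ksum k (fun xi zeta => H (x |` xi)%fset zeta) (eta `\ x)%fset.
Proof.
move=> H0.
pose g (x : E) (xi : F) : \bar R := if #|` xi|%fset == k
  then H (x |` xi)%fset ((eta `\ x) `\` xi)%fset else 0.
transitivity (\sum_(x <- eta) \sum_(xi <- fpowerset (eta `\ x)%fset) g x xi); last first.
  by apply: eq_bigr => x _; rewrite /ksum [RHS]big_mkcond.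
rewrite -(sum_fpowerset_removal eta g).
rewrite /ksum ge0_sume_distrr// big_mkcond/=.
apply: eq_bigr => xi _; case: ifPn => [/eqP xik|xik]; last first.
  rewrite big1_seq// => x /= xxi; rewrite /g; case: ifPn => // /eqP xk.
  by move: xik; rewrite (cardfsD1 x) [x \in _]xxi [X in (_ + X)%N]xk add1n eqxx.
rewrite (eq_big_seq (fun=> H xi (eta `\` xi)%fset)).
  by rewrite big_const_seq count_predT -/(#|` xi|)%fset xik iter_addr_0 mule_natl.
move=> x xxi; rewrite /g; move: xik; rewrite (cardfsD1 x xi) xxi add1n => -[->].
rewrite eqxx fsetD1K//; congr H; apply/fsetP => y; rewrite !inE.
by case: (eqVneq y x) => // ->; rewrite xxi.
Qed.

Lemma sum_ksum (H : F -> F -> \bar R) (eta : F) : (forall x y, 0 <= H x y) ->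
  \sum_(xi <- fpowerset eta) H xi (eta `\` xi)%fset = \sum_(k <oo) ksum k H eta.
Proof.
move=> H0; rewrite /ksum.
transitivity (\sum_(k <oo) \sum_(xi <- fpowerset eta)
    (if #|` xi|%fset == k then H xi (eta `\` xi)%fset else 0)); last first.
  by apply: eq_eseriesr => k _; rewrite [RHS]big_mkcond.
rewrite nneseries_sum; last by move=> *; case: ifP.
apply: eq_bigr => xi _; rewrite (@nneseriesD1 R _ #|` xi|%fset xpredT)//; last by move=> *; case: ifP.
rewrite eqxx eseries0 ?adde0// => k _ /=; rewrite eq_sym => /negbTE ->.
by [].
Qed.

Lemma measurable_ksum k dS (S : measurableType dS) (e : S -> F)
    (H : S -> F -> F -> \bar R) :
  measurable_fun setT e -> (forall s x y, 0 <= H s x y) ->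
  measurable_fun setT (fun z : S * F * F => H z.1.1 z.1.2 z.2) ->
  measurable_fun setT (fun s => ksum k (H s) (e s)).
Proof.
elim: k dS S e H => [|k IH] dS S e H me H0 mH.
  under eq_fun do rewrite ksum0.
  apply: (measurableT_comp mH (g := fun s => (s, fset0 : F, e s))).
  by apply/measurable_fun_pair => //=; exact/measurable_fun_pair.
have -> : (fun s => ksum k.+1 (H s) (e s)) = (fun s => (k.+1%:R^-1)%:E *
    \sum_(x <- e s) ksum k (fun xi zeta => H s (x |` xi)%fset zeta) (e s `\ x)%fset).
  apply/funext => s; rewrite -ksumS// muleA -EFinM mulVf ?mul1e//.
apply: measurable_funeM.
refine (@measurable_removal_sum R d _ S e
  (fun s x eta => ksum k (fun xi zeta => H s (x |` xi)%fset zeta) eta) _ _ _) => //.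
  by move=> s x eta; apply: ksum_ge0.
refine (IH _ (S * E * F)%type snd (fun z xi zeta => H z.1.1 (z.1.2 |` xi)%fset zeta) _ _ _) => //.
apply: (measurableT_comp mH (g := fun z : S * E * F * F * F => (z.1.1.1.1, (z.1.1.1.2 |` z.1.2)%fset : F, z.2))).
apply/measurable_fun_pair => //=; apply/measurable_fun_pair => /=.
  by do 3 apply: measurableT_comp => //.
refine (@measurable_fsetU1 R d _ (S * E * F * F * F)%type (fun z => z.1.1.1.2) (fun z => z.1.2) _ _).
  by do 3 apply: measurableT_comp => //.
exact: measurableT_comp.
Qed.

Lemma measurable_fpowerset_sum dS (S : measurableType dS) (e : S -> F)
    (H : S -> F -> F -> \bar R) :
  measurable_fun setT e -> (forall s x y, 0 <= H s x y) ->
  measurable_fun setT (fun z : S * F * F => H z.1.1 z.1.2 z.2) ->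
  measurable_fun setT (fun s => \sum_(xi <- fpowerset (e s)) H s xi (e s `\` xi)%fset).
Proof.
move=> me H0 mH; under eq_fun do rewrite sum_ksum//.
apply: ge0_emeasurable_sum => [k s _ _|k _]; first exact: ksum_ge0.
exact: measurable_ksum.
Qed.

(** Mecke's formula is applied k times; the divisions by [ksumS] accumulate to 1/k!. *)
Lemma integral_ksum (d0 : (0 < d)%N) k (H : F -> F -> \bar R) :
  (forall x y, 0 <= H x y) ->
  measurable_fun setT (fun z : F * F => H z.1 z.2) ->
  \int[@lpm R d]_eta ksum k H eta =
  (k`!%:R^-1)%:E * npint k (fun xi => \int[@lpm R d]_eta H xi eta).
Proof.
elim: k H => [|k IH] H H0 mH.
  rewrite fact0 invr1 mul1e npint0.
  - by apply: eq_integral => eta _; rewrite ksum0.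
  - by move=> xi; apply: integral_ge0.
  - exact: (measurable_fun_fubini_tonelli_F (m2 := @lpm R d) _ mH (fun z => H0 z.1 z.2)).
pose Hx (x : E) (xi zeta : F) := H (x |` xi)%fset zeta.
have mHx : measurable_fun setT (fun z : E * F * F => Hx z.1.1 z.1.2 z.2).
  apply: (measurableT_comp mH (g := fun z : E * F * F => ((z.1.1 |` z.1.2)%fset : F, z.2))).
  apply/measurable_fun_pair => //=.
  refine (@measurable_fsetU1 R d _ (E * F * F)%type (fun z => z.1.1) (fun z => z.1.2) _ _).
    exact: measurableT_comp.
  exact: measurableT_comp.
have mHx1 x : measurable_fun setT (fun z : F * F => Hx x z.1 z.2).
  apply: (measurableT_comp mHx (g := fun z : F * F => (x, z.1, z.2))).
  by apply/measurable_fun_pair => //=; exact/measurable_fun_pair.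
have mk : measurable_fun setT (fun z : E * F => ksum k (Hx z.1) z.2).
  refine (@measurable_ksum k _ (E * F)%type snd (fun z => Hx z.1) _ _ _) => //.
    by move=> s x y; exact: H0.
  apply: (measurableT_comp mHx (g := fun z : E * F * F * F => (z.1.1.1, z.1.2, z.2))).
  apply/measurable_fun_pair => //=; apply/measurable_fun_pair => /=.
    by do 2 apply: measurableT_comp => //.
  exact: measurableT_comp.
transitivity ((k.+1%:R^-1)%:E * \int[@lpm R d]_eta
    \sum_(x <- eta) ksum k (Hx x) (eta `\ x)%fset).
  rewrite -ge0_integralZl//; first last.
  - by move=> eta _; apply: sume_ge0 => x _; apply: ksum_ge0 => *; exact: H0.
  - refine (@measurable_removal_sum R d _ F id (fun _ x eta => ksum k (Hx x) eta) _ _ _) => //.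
      by move=> *; apply: ksum_ge0 => *; exact: H0.
    apply: (measurableT_comp mk (g := fun z : F * E * F => (z.1.2, z.2))).
    by apply/measurable_fun_pair => //=; exact: measurableT_comp.
  apply: eq_integral => eta _; rewrite -ksumS// muleA -EFinM mulVf ?mul1e//.
rewrite (mecke d0 (h := fun x => ksum k (Hx x)))//; last first.
  by move=> *; apply: ksum_ge0 => *; exact: H0.
transitivity ((k.+1%:R^-1)%:E * \int[m]_x ((k`!%:R^-1)%:E *
    npint k (fun xi => \int[@lpm R d]_eta Hx x xi eta))).
  congr (_ * _); apply: eq_integral => x _; apply: IH => // *; exact: H0.
have mi : measurable_fun setT (fun xi => \int[@lpm R d]_eta H xi eta).
  exact: (measurable_fun_fubini_tonelli_F (m2 := @lpm R d) _ mH (fun z => H0 z.1 z.2)).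
have i0 xi : 0 <= \int[@lpm R d]_eta H xi eta by apply: integral_ge0.
rewrite ge0_integralZl//; first last.
- by move=> x _; apply: npint_ge0 => xi; exact: i0.
- refine (@measurable_npint R d _ E k (fun x xi => \int[@lpm R d]_eta H (x |` xi)%fset eta) _ _) => //.
  exact: (measurableT_comp mi (@measurable_U1 R d)).
by rewrite (@npintS R d k (fun xi => \int[@lpm R d]_eta H xi eta))// muleA -EFinM -invfM -natrM -factS.
Qed.

(** Under the Lebesgue-Poisson measure the two parts of a decomposed configuration become
    independent variables. The sum is sorted by the size of the first part, and [integral_ksum]
    supplies the levels of the outer integral. *)
Lemma minlos (d0 : (0 < d)%N) (H : F -> F -> \bar R) :
  (forall x y, 0 <= H x y) ->
  measurable_fun setT (fun z : F * F => H z.1 z.2) ->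
  \int[@lpm R d]_eta (\sum_(xi <- fpowerset eta) H xi (eta `\` xi)%fset) =
  \int[@lpm R d]_xi \int[@lpm R d]_eta H xi eta.
Proof.
move=> H0 mH; under eq_integral do rewrite sum_ksum//.
rewrite integral_nneseries//; first last.
- by move=> k eta _; exact: ksum_ge0.
- move=> k; refine (@measurable_ksum k _ F id (fun _ => H) _ _ _) => //.
  apply: (measurableT_comp mH (g := fun z : F * F * F => (z.1.2, z.2))).
  by apply/measurable_fun_pair => //=; exact: measurableT_comp.
rewrite [RHS]integral_lpm//.
- by apply: eq_eseriesr => k _; rewrite integral_ksum.
- by move=> xi; apply: integral_ge0.
- exact: (measurable_fun_fubini_tonelli_F (m2 := @lpm R d) _ mH (fun z => H0 z.1 z.2)).
Qed.

End minlos.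

(** * Sums over pairs and the seminorms of X_n *)

Section product_measure.
Context d1 d2 (T1 : measurableType d1) (T2 : measurableType d2) (R : realType).
Variables (m1 : {sigma_finite_measure set T1 -> \bar R})
  (m2 : {sigma_finite_measure set T2 -> \bar R}).

(* A copy of the product measure carrying a sigma-finite instance. *)
Definition prodm : set (T1 * T2) -> \bar R := (m1 \x m2)%E.

HB.instance Definition _ := Measure.on prodm.
HB.instance Definition _ := Measure_isSigmaFinite.Build _ _ _ prodm
  (product_sigma_finite m1 m2).

Local Open Scope ereal_scope.

Lemma prodm_int12 (f : T1 * T2 -> \bar R) : measurable_fun setT f ->
  (forall x, 0 <= f x) ->
  \int[prodm]_z f z = \int[m1]_x \int[m2]_y f (x, y).
Proof. exact: fubini_tonelli1. Qed.

Lemma prodm_int21 (f : T1 * T2 -> \bar R) : measurable_fun setT f ->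
  (forall x, 0 <= f x) ->
  \int[prodm]_z f z = \int[m2]_y \int[m1]_x f (x, y).
Proof. exact: fubini_tonelli2. Qed.

End product_measure.

Section pairs.
Context {R : realType} {d : nat}.
Local Notation E := (euclid R d).
Local Notation F := (fconf R d).
Local Notation m := (lebesgue_space R d).
Local Notation mm := (prodm m m).
Local Notation lp := (@lpm R d).
Local Open Scope ereal_scope.

(** Pairs are ordered, so that Mecke's formula can be applied twice; the generator compensates the
    double count by its factor 1/2. The second argument of h is what remains after the removal. *)
Definition pair_sum (h : E * E -> F -> \bar R) (eta : F) : \bar R :=
  \sum_(x1 <- eta) \sum_(x2 <- (eta `\ x1)%fset) h (x1, x2) (eta `\ x1 `\ x2)%fset.

Lemma pair_sum_ge0 (h : E * E -> F -> \bar R) eta : (forall x xi, 0 <= h x xi) ->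
  0 <= pair_sum h eta.
Proof. by move=> h0; apply: sume_ge0 => x _; apply: sume_ge0. Qed.

Lemma measurable_pair_sum dS (S : measurableType dS) (e : S -> F)
    (h : S -> E * E -> F -> \bar R) :
  measurable_fun setT e -> (forall s x xi, 0 <= h s x xi) ->
  measurable_fun setT (fun z : S * (E * E) * F => h z.1.1 z.1.2 z.2) ->
  measurable_fun setT (fun s => pair_sum (h s) (e s)).
Proof.
move=> me h0 mh.
refine (@measurable_removal_sum R d _ S e
  (fun s x1 zeta => \sum_(x2 <- zeta) h s (x1, x2) (zeta `\ x2)%fset) _ _ _) => //.
  by move=> *; apply: sume_ge0.
refine (@measurable_removal_sum R d _ (S * E * F)%type snd
  (fun z x2 zeta => h z.1.1 (z.1.2, x2) zeta) _ _ _) => //.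
apply: (measurableT_comp mh (g := fun z : S * E * F * E * F => (z.1.1.1.1, (z.1.1.1.2, z.1.2), z.2))).
apply/measurable_fun_pair => //=; apply/measurable_fun_pair => /=.
  by do 3 apply: measurableT_comp => //.
apply/measurable_fun_pair => /=; last exact: measurableT_comp.
by do 3 apply: measurableT_comp => //.
Qed.

Lemma measurable_pair_sum1 (h : E * E -> F -> \bar R) :
  (forall x xi, 0 <= h x xi) ->
  measurable_fun setT (fun z : E * E * F => h z.1 z.2) ->
  measurable_fun setT (pair_sum h).
Proof.
move=> h0 mh; refine (@measurable_pair_sum _ F id (fun _ => h) _ _ _) => //.
apply: (measurableT_comp mh (g := fun z : F * (E * E) * F => (z.1.2, z.2))).
by apply/measurable_fun_pair => //=; exact: measurableT_comp.
Qed.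

Lemma mecke2 (d0 : (0 < d)%N) (h : E * E -> F -> \bar R) :
  (forall x xi, 0 <= h x xi) ->
  measurable_fun setT (fun z : E * E * F => h z.1 z.2) ->
  \int[lp]_eta pair_sum h eta = \int[mm]_x \int[lp]_xi h x xi.
Proof.
move=> h0 mh.
have mh1 x1 : measurable_fun setT (fun z : E * F => h (x1, z.1) z.2).
  apply: (measurableT_comp mh (g := fun z : E * F => ((x1, z.1), z.2))).
  by apply/measurable_fun_pair => //=; exact/measurable_fun_pair.
rewrite (mecke d0 (h := fun x1 zeta => \sum_(x2 <- zeta) h (x1, x2) (zeta `\ x2)%fset)); first last.
- refine (@measurable_removal_sum R d _ (E * F)%type snd (fun z x2 zeta => h (z.1, x2) zeta) _ _ _) => //.
  apply: (measurableT_comp mh (g := fun z : E * F * E * F => ((z.1.1.1, z.1.2), z.2))).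
  apply/measurable_fun_pair => //=; apply/measurable_fun_pair => /=.
    by do 2 apply: measurableT_comp => //.
  exact: measurableT_comp.
- by move=> *; apply: sume_ge0.
have mi : measurable_fun setT (fun x : E * E => \int[lp]_xi h x xi).
  exact: (measurable_fun_fubini_tonelli_F (m2 := lp) _ mh (fun z => h0 z.1 z.2)).
rewrite (prodm_int12 _ _ mi); last by move=> x; apply: integral_ge0.
apply: eq_integral => x1 _.
by rewrite (mecke d0 (h := fun x2 => h (x1, x2))).
Qed.

(** A term is at most a sum of nonnegative terms; this passes finiteness or vanishing of [pair_sum]
    on to each pair. *)
Lemma pair_sum_eq0 (h : E * E -> F -> \bar R) eta x1 x2 :
  (forall x xi, 0 <= h x xi) ->
  x1 \in (eta : {fset E}) -> x2 \in (eta `\ x1)%fset ->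
  h (x1, x2) (eta `\ x1 `\ x2)%fset <= pair_sum h eta.
Proof.
move=> h0 x1e x2e; rewrite /pair_sum (big_fsetD1 x1)//= (big_fsetD1 x2)//=.
rewrite -addeA leeDl// adde_ge0//; first by apply: sume_ge0.
by apply: sume_ge0 => x _; apply: sume_ge0.
Qed.

Definition lev (n : nat) (eta : F) : \bar R := (#|` eta|%fset == n)%:R%:E.

Lemma lev_ge0 n eta : 0 <= lev n eta.
Proof. by rewrite lee_fin. Qed.

Lemma measurable_lev n : measurable_fun setT (lev n).
Proof.
have -> : lev n = (fun eta => (\1_[set eta : F | #|` eta|%fset = n] eta : R)%:E).
  by apply/funext => eta; rewrite /lev indicE; congr (_%:R%:E); congr nat_of_bool;
    apply/idP/idP; rewrite inE/= => /eqP.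
apply: measurable_EFin_indic => //.
by have /(_ measurableT [set n] I) := @measurable_card_fconf R d; rewrite setTI.
Qed.

Lemma ae_lev (P : F -> Prop) :
  (forall n, {ae lp, forall eta, #|` eta|%fset = n -> P eta}) -> {ae lp, forall eta, P eta}.
Proof.
by move=> /ae_foralln; apply: filterS => eta h; exact: (h _ erefl).
Qed.

(** Only integrals on a single level are finite. A pair taken from n points leaves n-2, so the sum
    restricted to remainders of that size is integrable, hence finite almost everywhere, and on n
    points it is the full sum. *)
Lemma ae_pair_lty (d0 : (0 < d)%N) (h : E * E -> F -> \bar R) :
  (forall x xi, 0 <= h x xi) ->
  measurable_fun setT (fun z : E * E * F => h z.1 z.2) ->
  (forall n, \int[mm]_x \int[lp]_xi (lev n xi * h x xi) < +oo) ->
  {ae lp, forall eta, pair_sum h eta < +oo}.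
Proof.
move=> h0 mh hoo; apply: ae_lev => n.
have ml k : measurable_fun setT (fun z : E * E * F => lev k z.2 * h z.1 z.2).
  apply: emeasurable_funM => //; apply: measurableT_comp => //; exact: measurable_lev.
have mp k : measurable_fun setT (pair_sum (fun x xi => lev k xi * h x xi)).
  by apply: measurable_pair_sum1 => // x xi; rewrite mule_ge0// lev_ge0.
have l0 k x xi : 0 <= lev k xi * h x xi by rewrite mule_ge0// lev_ge0.
have : lp.-integrable setT (pair_sum (fun x xi => lev n.-2 xi * h x xi)).
  apply/integrableP; split => //.
  rewrite (eq_integral (pair_sum (fun x xi => lev n.-2 xi * h x xi))).
    by rewrite mecke2.
  by move=> eta _; rewrite gee0_abs// pair_sum_ge0.
move=> /(integrable_ae measurableT); apply: filterS => eta /(_ I) + en.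
rewrite ge0_fin_numE; last by apply: pair_sum_ge0 => *; rewrite mule_ge0// lev_ge0.
congr (_ < _); rewrite /pair_sum.
apply: eq_big_seq => x1 x1e; apply: eq_big_seq => x2 x2e.
rewrite /lev; have := cardfsD1 x1 eta; rewrite x1e en.
have := cardfsD1 x2 (eta `\ x1)%fset; rewrite x2e => -> ->.
by rewrite !add1n eqxx mul1e.
Qed.

Lemma ae_pair_eq0 (d0 : (0 < d)%N) (h : E * E -> F -> \bar R) :
  (forall x xi, 0 <= h x xi) ->
  measurable_fun setT (fun z : E * E * F => h z.1 z.2) ->
  \int[mm]_x \int[lp]_xi h x xi = 0 ->
  {ae lp, forall eta, pair_sum h eta = 0}.
Proof.
move=> h0 mh; rewrite -mecke2// => i0.
have mp := measurable_pair_sum1 h0 mh.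
have := (ae_eq_integral_abs lp measurableT mp).1.
have -> : \int[lp]_x `|pair_sum h x| = 0.
  by rewrite -[RHS]i0; apply: eq_integral => eta _; rewrite gee0_abs// pair_sum_ge0.
by move=> /(_ erefl); apply: filterS => eta /(_ I).
Qed.

End pairs.

Section norms.
Context {R : realType} {d : nat}.
Local Notation E := (euclid R d).
Local Notation F := (fconf R d).
Local Notation m := (lebesgue_space R d).
Local Notation mm := (prodm m m).
Local Notation lp := (@lpm R d).
Local Open Scope ereal_scope.

Lemma lev_pair_sum k (h : E * E -> F -> \bar R) (eta : F) :
  (forall x xi, 0 <= h x xi) ->
  lev k.+2 eta * pair_sum h eta = pair_sum (fun x xi => lev k xi * h x xi) eta.
Proof.
move=> h0; rewrite /pair_sum ge0_sume_distrr; last by move=> *; apply: sume_ge0.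
apply: eq_big_seq => x1 x1e; rewrite ge0_sume_distrr//.
apply: eq_big_seq => x2 x2e; congr (_ * _); rewrite /lev.
by rewrite (cardfsD1 x1 eta) x1e (cardfsD1 x2 (eta `\ x1)%fset) x2e !add1n !eqSS.
Qed.

Lemma lev_sum1 k (h : E -> F -> \bar R) (eta : F) :
  (forall x xi, 0 <= h x xi) ->
  lev k.+1 eta * (\sum_(x <- eta) h x (eta `\ x)%fset) =
  \sum_(x <- eta) lev k (eta `\ x)%fset * h x (eta `\ x)%fset.
Proof.
move=> h0; rewrite ge0_sume_distrr//; apply: eq_big_seq => x xe; congr (_ * _).
by rewrite /lev (cardfsD1 x eta) xe add1n eqSS.
Qed.

(** The norm of the n-point component in X_n divided by n!, which is the weight of that level in the
    Lebesgue-Poisson measure; [Xnorm_nrm] makes this precise. *)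
Definition nrm n (G : F -> R) : \bar R := \int[lp]_eta (lev n eta * `|G eta|%:E).

Lemma nrm_ge0 n G : 0 <= nrm n G.
Proof. by apply: integral_ge0 => eta _; rewrite mule_ge0 ?lev_ge0// lee_fin. Qed.

Definition conf_cons2 (y : E * E) (xi : F) : F := (y.1 |` (y.2 |` xi))%fset.

Lemma measurable_conf_cons2 : measurable_fun setT (fun z : E * E * F => conf_cons2 z.1 z.2).
Proof.
refine (@measurable_fsetU1 R d _ (E * E * F)%type (fun z => z.1.1) (fun z => (z.1.2 |` z.2)%fset) _ _).
  exact: measurableT_comp.
refine (@measurable_fsetU1 R d _ (E * E * F)%type (fun z => z.1.2) (fun z => z.2) _ _).
  exact: measurableT_comp.
exact: measurable_snd.
Qed.

Lemma conf_cons2K (x1 x2 : E) (eta : F) : x1 \in (eta : {fset E}) ->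
  x2 \in (eta `\ x1)%fset -> conf_cons2 (x1, x2) (eta `\ x1 `\ x2)%fset = eta.
Proof. by move=> x1e x2e; rewrite /conf_cons2/= fsetD1K// fsetD1K. Qed.

Variable G : F -> R.
Hypothesis mG : measurable_fun setT G.

Let mGE : measurable_fun setT (fun eta => `|G eta|%:E).
Proof. by apply/measurable_EFinP; exact: measurableT_comp. Qed.

Lemma measurable_norm_cons2 :
  measurable_fun setT (fun z : E * E * F => `|G (conf_cons2 z.1 z.2)|%:E).
Proof. exact: (measurableT_comp mGE measurable_conf_cons2). Qed.

Lemma measurable_norm_cons1 :
  measurable_fun setT (fun z : E * F => `|G (z.1 |` z.2)%fset|%:E).
Proof. exact: (measurableT_comp mGE (@measurable_U1 R d)). Qed.

(** Mecke's formula read backwards: a configuration of k+1 points is obtained once from each of its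
    points. *)
Lemma integral_lev_cons1 (d0 : (0 < d)%N) k :
  \int[m]_x \int[lp]_xi (lev k xi * `|G (x |` xi)%fset|%:E) = k.+1%:R%:E * nrm k.+1 G.
Proof.
rewrite -(mecke d0 (h := fun x xi => lev k xi * `|G (x |` xi)%fset|%:E)); first last.
- apply: emeasurable_funM measurable_norm_cons1.
  by apply: measurableT_comp => //; exact: measurable_lev.
- by move=> *; rewrite mule_ge0 ?lev_ge0 ?lee_fin.
rewrite /nrm -ge0_integralZl//; first last.
- by move=> eta _; rewrite mule_ge0 ?lev_ge0 ?lee_fin.
- by apply: emeasurable_funM mGE; exact: measurable_lev.
apply: eq_integral => eta _.
rewrite -(lev_sum1 k (h := fun x xi => `|G (x |` xi)%fset|%:E)); last by move=> *; rewrite lee_fin.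
rewrite (eq_big_seq (fun=> `|G eta|%:E)); last by move=> x xe; rewrite /= fsetD1K.
rewrite sumEFin big_const_seq count_predT iter_addr_0 /lev.
case: eqP => [->|]; last by rewrite !mul0e mule0.
by rewrite !mul1e -EFinM mulr_natl.
Qed.

Variable c : E -> E -> E -> E -> R.
Hypothesis jr : jump_rate c.

Definition cE (x y : E * E) : \bar R := (c x.1 x.2 y.1 y.2)%:E.

Lemma cE_ge0 x y : 0 <= cE x y.
Proof. by rewrite lee_fin; have [+ _ _ _] := jr; apply. Qed.

Lemma measurable_cE : measurable_fun setT (fun z : E * E * (E * E) => cE z.1 z.2).
Proof. by apply/measurable_EFinP; have [_ + _ _] := jr. Qed.

Lemma a1_ge0 x : 0 <= a1 c x. Proof. by apply: integral_ge0 => y _; exact: cE_ge0. Qed.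
Lemma a2_ge0 x : 0 <= a2 c x. Proof. by apply: integral_ge0 => y _; exact: (cE_ge0 y x). Qed.

Lemma measurable_a1 : measurable_fun setT (a1 c).
Proof.
refine (@measurable_fun_fubini_tonelli_F _ _ (E * E)%type (E * E)%type R mm (fun z => cE z.1 z.2) measurable_cE _) => z.
exact: cE_ge0.
Qed.

Lemma measurable_a2 : measurable_fun setT (a2 c).
Proof.
refine (@measurable_fun_fubini_tonelli_G _ _ (E * E)%type (E * E)%type R mm (fun z => cE z.1 z.2) measurable_cE _) => z.
exact: cE_ge0.
Qed.

Lemma a1C x1 x2 : a1 c (x1, x2) = a1 c (x2, x1).
Proof. by apply: eq_integral => y _; have [_ _ + _] := jr => ->. Qed.

(* Exchanging the arrival points with the departure points turns the gain term
   into the rate [a2]. *)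
Lemma integral_gain_swap (d0 : (0 < d)%N) k (g : E * E -> F -> \bar R) :
  (forall y xi, 0 <= g y xi) ->
  measurable_fun setT (fun z : E * E * F => g z.1 z.2) ->
  \int[lp]_eta (lev k.+2 eta *
    pair_sum (fun x xi => \int[mm]_y (cE x y * g y xi)) eta) =
  \int[mm]_y (a2 c y * \int[lp]_xi (lev k xi * g y xi)).
Proof.
move=> g0 mg.
have cg0 x y xi : 0 <= cE x y * g y xi by rewrite mule_ge0 ?cE_ge0.
have mcg : measurable_fun setT (fun z : E * E * F * (E * E) => cE z.1.1 z.2 * g z.2 z.1.2).
  apply: emeasurable_funM.
    apply: (measurableT_comp measurable_cE (g := fun z : E * E * F * (E * E) => (z.1.1, z.2))).
    by apply/measurable_fun_pair => //=; exact: measurableT_comp.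
  apply: (measurableT_comp mg (g := fun z : E * E * F * (E * E) => (z.2, z.1.2))).
  by apply/measurable_fun_pair => //=; exact: measurableT_comp.
have mi : measurable_fun setT (fun z : E * E * F => \int[mm]_y (cE z.1 y * g y z.2)).
  refine (@measurable_fun_fubini_tonelli_F _ _ (E * E * F)%type (E * E)%type R mm (fun z => cE z.1.1 z.2 * g z.2 z.1.2) mcg _) => z.
  exact: cg0.
have ml : measurable_fun setT (fun z : E * E * F => lev k z.2 * \int[mm]_y (cE z.1 y * g y z.2)).
  by apply: emeasurable_funM mi; apply: measurableT_comp => //; exact: measurable_lev.
have i0 x xi : 0 <= \int[mm]_y (cE x y * g y xi) by apply: integral_ge0.
transitivity (\int[lp]_eta pair_sum (fun x xi => lev k xi * \int[mm]_y (cE x y * g y xi)) eta).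
  by apply: eq_integral => eta _; rewrite lev_pair_sum.
rewrite (mecke2 d0)//; last by move=> *; rewrite mule_ge0 ?lev_ge0.
have mlg : measurable_fun setT (fun z : E * E * F => lev k z.2 * g z.1 z.2).
  by apply: emeasurable_funM => //; apply: measurableT_comp => //; exact: measurable_lev.
have mlgy y : measurable_fun setT (fun xi => lev k xi * g y xi).
  by apply: (measurableT_comp mlg (g := fun xi : F => (y, xi))); exact: measurable_fun_pair.
have mlI : measurable_fun setT (fun y => \int[lp]_xi (lev k xi * g y xi)).
  by apply: (measurable_fun_fubini_tonelli_F (m2 := lp) _ mlg) => z; rewrite mule_ge0 ?lev_ge0.
have lI0 y : 0 <= \int[lp]_xi (lev k xi * g y xi).
  by apply: integral_ge0 => xi _; rewrite mule_ge0 ?lev_ge0.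
transitivity (\int[mm]_x \int[mm]_y (cE x y * \int[lp]_xi (lev k xi * g y xi))).
  apply: eq_integral => x _.
  transitivity (\int[lp]_xi \int[mm]_y (cE x y * (lev k xi * g y xi))).
    apply: eq_integral => xi _; rewrite -ge0_integralZl ?lev_ge0//.
    - by apply: eq_integral => y _; rewrite muleCA.
    - apply: (measurableT_comp mcg (g := fun y => (x, xi, y))).
      exact: measurable_fun_pair.
  have mz : measurable_fun setT (fun z : F * (E * E) => cE x z.2 * (lev k z.1 * g z.2 z.1)).
    apply: emeasurable_funM.
      apply: (measurableT_comp measurable_cE (g := fun z : F * (E * E) => (x, z.2))).
      exact/measurable_fun_pair.
    apply: (measurableT_comp mlg (g := fun z : F * (E * E) => (z.2, z.1))).
    exact/measurable_fun_pair.
  rewrite (fubini_tonelli (m1 := lp) (m2 := mm) _ mz)/=; last first.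
    by move=> z; rewrite !mule_ge0 ?cE_ge0 ?lev_ge0.
  apply: eq_integral => y _; rewrite ge0_integralZl ?cE_ge0//.
  by move=> xi _; rewrite mule_ge0 ?lev_ge0.
have mz : measurable_fun setT (fun z : E * E * (E * E) => cE z.1 z.2 * \int[lp]_xi (lev k xi * g z.2 xi)).
  by apply: emeasurable_funM; [exact: measurable_cE|exact: (measurableT_comp mlI measurable_snd)].
rewrite (fubini_tonelli (m1 := mm) (m2 := mm) _ mz)/=; last first.
  by move=> z; rewrite mule_ge0 ?cE_ge0.
apply: eq_integral => y _; rewrite ge0_integralZr//.
- apply: (measurableT_comp measurable_cE (g := fun x => (x, y))).
  exact: measurable_fun_pair.
- by move=> x _; exact: cE_ge0.
Qed.

(** Once departure and arrival are exchanged, Mecke's formula turns the arrivals back into a pair of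
    points of eta. The gain becomes a multiplication by the total of [a2], which can be compared
    with the loss rate. *)
Lemma integral_gain2 (d0 : (0 < d)%N) k :
  \int[lp]_eta (lev k.+2 eta *
    pair_sum (fun x xi => \int[mm]_y (cE x y * `|G (conf_cons2 y xi)|%:E)) eta) =
  \int[lp]_eta (lev k.+2 eta * (pair_sum (fun x _ => a2 c x) eta * `|G eta|%:E)).
Proof.
rewrite (integral_gain_swap d0 k (g := fun y xi => `|G (conf_cons2 y xi)|%:E)); first last.
- exact: measurable_norm_cons2.
- by move=> *; rewrite lee_fin.
pose h (y : E * E) (xi : F) := a2 c y * (lev k xi * `|G (conf_cons2 y xi)|%:E).
have h0 y xi : 0 <= h y xi by rewrite /h !mule_ge0 ?a2_ge0 ?lev_ge0 ?lee_fin.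
have ml : measurable_fun setT (fun z : E * E * F => lev k z.2 * `|G (conf_cons2 z.1 z.2)|%:E).
  apply: emeasurable_funM measurable_norm_cons2.
  by apply: measurableT_comp => //; exact: measurable_lev.
have mh : measurable_fun setT (fun z : E * E * F => h z.1 z.2).
  by apply: emeasurable_funM ml; apply: measurableT_comp => //; exact: measurable_a2.
transitivity (\int[mm]_y \int[lp]_xi h y xi).
  apply: eq_integral => y _; rewrite ge0_integralZl ?a2_ge0//.
  - apply: (measurableT_comp ml (g := fun xi : F => (y, xi))); exact: measurable_fun_pair.
  - by move=> xi _; rewrite mule_ge0 ?lev_ge0 ?lee_fin.
rewrite -(mecke2 d0 h0 mh); apply: eq_integral => eta _.
transitivity (pair_sum (fun x xi => lev k xi * (a2 c x * `|G (conf_cons2 x xi)|%:E)) eta).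
  by apply: eq_bigr => x1 _; apply: eq_bigr => x2 _; rewrite /h muleCA.
rewrite -lev_pair_sum; last by move=> *; rewrite mule_ge0 ?a2_ge0 ?lee_fin.
congr (_ * _); rewrite /pair_sum muleC ge0_sume_distrr; last first.
  by move=> *; apply: sume_ge0 => *; exact: a2_ge0.
apply: eq_big_seq => x1 x1e; rewrite ge0_sume_distrr; last by move=> *; exact: a2_ge0.
by apply: eq_big_seq => x2 x2e; rewrite conf_cons2K// muleC.
Qed.

(** The factor u sees only the first point, so a bound on the integral of a over the second point
    suffices. This is where [c3] and [c4] enter. *)
Lemma integral_slice_le (a : E * E -> \bar R) (u : E -> \bar R) (C : \bar R) :
  (forall x, 0 <= a x) -> measurable_fun setT a ->
  (forall x, 0 <= u x) -> measurable_fun setT u ->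
  {ae m, forall x1, \int[m]_x2 a (x1, x2) <= C} ->
  0 <= C ->
  \int[mm]_x (a x * u x.1) <= C * \int[m]_x u x.
Proof.
move=> a0 ma u0 mu aC C0.
have mau : measurable_fun setT (fun x : E * E => a x * u x.1).
  by apply: emeasurable_funM => //; exact: measurableT_comp.
rewrite (prodm_int12 _ _ mau); last by move=> x; rewrite mule_ge0.
have mF : measurable_fun setT (fun x1 => \int[m]_x2 a (x1, x2)).
  exact: (measurable_fun_fubini_tonelli_F (m2 := m) _ ma a0).
have ma1 x1 : measurable_fun setT (fun x2 => a (x1, x2)).
  by apply: (measurableT_comp ma (g := fun x2 => (x1, x2))); exact: measurable_fun_pair.
rewrite (eq_integral (fun x1 => (\int[m]_x2 a (x1, x2)) * u x1)); last first.
  by move=> x1 _; rewrite /= ge0_integralZr.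
rewrite -ge0_integralZl//.
apply: ae_ge0_le_integral => //.
- by move=> x _; rewrite mule_ge0// integral_ge0.
- exact: emeasurable_funM.
- by move=> x _; rewrite mule_ge0.
- exact: measurable_funeM.
- by apply: filterS aC => x h _; apply: lee_wpmul2r.
Qed.

(** On a null space the essential supremum is -oo, hence the hypothesis on the total mass. *)
Lemma ess_sup_ge0 d' (T : measurableType d') (mu : {measure set T -> \bar R}) (f : T -> \bar R) :
  mu setT != 0 -> (forall x, 0 <= f x) -> 0 <= ess_sup mu f.
Proof.
by move=> mu0 f0; apply: ess_sup_gee; [rewrite lt0e mu0/=|apply/aeW => x; exact: f0].
Qed.

Lemma integral_gain1 (d0 : (0 < d)%N) k : 0 <= c4 c ->
  \int[lp]_eta (lev k.+2 eta *
    pair_sum (fun x xi => \int[mm]_y (cE x y * `|G (y.1 |` xi)%fset|%:E)) eta) <=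
  c4 c * (k.+1%:R%:E * nrm k.+1 G).
Proof.
move=> c40.
have mg : measurable_fun setT (fun z : E * E * F => `|G (z.1.1 |` z.2)%fset|%:E).
  apply: (measurableT_comp measurable_norm_cons1 (g := fun z : E * E * F => (z.1.1, z.2))).
  by apply/measurable_fun_pair => //=; exact: measurableT_comp.
rewrite (integral_gain_swap d0 k (g := fun y xi => `|G (y.1 |` xi)%fset|%:E))//.
rewrite -integral_lev_cons1//.
apply: (integral_slice_le (a := a2 c) (u := fun x => \int[lp]_xi (lev k xi * `|G (x |` xi)%fset|%:E))) => //.
- exact: a2_ge0.
- exact: measurable_a2.
- by move=> x; apply: integral_ge0 => *; rewrite mule_ge0 ?lev_ge0 ?lee_fin.
- apply: (measurable_fun_fubini_tonelli_F (m2 := lp)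
    (fun z : E * F => lev k z.2 * `|G (z.1 |` z.2)%fset|%:E)).
    apply: emeasurable_funM measurable_norm_cons1.
    by apply: measurableT_comp => //; exact: measurable_lev.
  by move=> z; rewrite mule_ge0 ?lev_ge0 ?lee_fin.
- exact: ess_sup_ge.
Qed.

Lemma integral_loss1 (d0 : (0 < d)%N) k : 0 <= c3 c ->
  \int[lp]_eta (lev k.+2 eta *
    pair_sum (fun x xi => a1 c x * `|G (x.2 |` xi)%fset|%:E) eta) <=
  c3 c * (k.+1%:R%:E * nrm k.+1 G).
Proof.
move=> c30.
have h0 (x : E * E) xi : 0 <= a1 c x * `|G (x.2 |` xi)%fset|%:E.
  by rewrite mule_ge0 ?a1_ge0 ?lee_fin.
rewrite (eq_integral (pair_sum (fun x xi => lev k xi * (a1 c x * `|G (x.2 |` xi)%fset|%:E)))); last first.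
  by move=> eta _; rewrite lev_pair_sum.
have mg : measurable_fun setT (fun z : E * E * F => lev k z.2 * `|G (z.1.2 |` z.2)%fset|%:E).
  apply: emeasurable_funM; first by apply: measurableT_comp => //; exact: measurable_lev.
  apply: (measurableT_comp measurable_norm_cons1 (g := fun z : E * E * F => (z.1.2, z.2))).
  by apply/measurable_fun_pair => //=; exact: measurableT_comp.
rewrite (mecke2 d0); first last.
- have -> : (fun z : E * E * F => lev k z.2 * (a1 c z.1 * `|G (z.1.2 |` z.2)%fset|%:E)) =
      (fun z => a1 c z.1 * (lev k z.2 * `|G (z.1.2 |` z.2)%fset|%:E)).
    by apply/funext => z; rewrite muleCA.
  by apply: emeasurable_funM mg; apply: measurableT_comp => //; exact: measurable_a1.
- by move=> *; rewrite mule_ge0 ?lev_ge0.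
have mu : measurable_fun setT (fun x => \int[lp]_xi (lev k xi * `|G (x |` xi)%fset|%:E)).
  apply: (measurable_fun_fubini_tonelli_F (m2 := lp)
    (fun z : E * F => lev k z.2 * `|G (z.1 |` z.2)%fset|%:E)).
    apply: emeasurable_funM measurable_norm_cons1.
    by apply: measurableT_comp => //; exact: measurable_lev.
  by move=> z; rewrite mule_ge0 ?lev_ge0 ?lee_fin.
have u0 x : 0 <= \int[lp]_xi (lev k xi * `|G (x |` xi)%fset|%:E).
  by apply: integral_ge0 => *; rewrite mule_ge0 ?lev_ge0 ?lee_fin.
rewrite (eq_integral (fun x : E * E => a1 c x * \int[lp]_xi (lev k xi * `|G (x.2 |` xi)%fset|%:E))); last first.
  move=> x _; rewrite -ge0_integralZl ?a1_ge0//.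
  - by apply: eq_integral => xi _; rewrite muleCA.
  - apply: (measurableT_comp mg (g := fun xi : F => (x, xi))); exact: measurable_fun_pair.
  - by move=> *; rewrite mule_ge0 ?lev_ge0 ?lee_fin.
have mau : measurable_fun setT (fun x : E * E => a1 c x * \int[lp]_xi (lev k xi * `|G (x.2 |` xi)%fset|%:E)).
  by apply: emeasurable_funM; [exact: measurable_a1|exact: (measurableT_comp mu measurable_snd)].
(* The integrand depends on the second point of the pair, whereas [c3] integrates the second point
   out; the symmetry of [a1] exchanges them. *)
rewrite (prodm_int21 _ _ mau); last by move=> x; rewrite mule_ge0 ?a1_ge0.
rewrite -integral_lev_cons1//.
apply: le_trans (integral_slice_le a1_ge0 measurable_a1 u0 mu (ess_sup_ge _ _) c30).
rewrite prodm_int12; first last.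
- by move=> x; rewrite mule_ge0 ?a1_ge0.
- by apply: emeasurable_funM; [exact: measurable_a1|exact: (measurableT_comp mu measurable_fst)].
rewrite le_eqVlt; apply/orP; left; apply/eqP.
by apply: eq_integral => x _; apply: eq_integral => y _ /=; rewrite a1C.
Qed.

End norms.

(** * Measurability of the generator *)

Section measurability.
Context {R : realType}.

(** No integrability is assumed: Tonelli applies to the positive and the negative part, and [fine]
    of their difference is measurable whatever its value. *)
Lemma measurable_Rintegral_param dS (S : measurableType dS) dY (Y : measurableType dY)
    (mu : {sigma_finite_measure set Y -> \bar R}) (f : S -> Y -> R) :
  measurable_fun setT (fun z : S * Y => f z.1 z.2) ->
  measurable_fun setT (fun s => \int[mu]_y f s y).
Proof.
move=> mf.
have mE : measurable_fun setT (fun z : S * Y => (f z.1 z.2)%:E) by exact/measurable_EFinP.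
have mp := measurable_funepos mE; have mn := measurable_funeneg mE.
apply: (@measurableT_comp _ _ _ _ _ _ (@fine R) _ (fun s => (\int[mu]_y (f s y)%:E)%E)).
  exact: fine_measurable.
apply: (eq_measurable_fun (fun s => \int[mu]_y (((fun z : S * Y => (f z.1 z.2)%:E)^\+) (s, y)) -
    \int[mu]_y (((fun z : S * Y => (f z.1 z.2)%:E)^\-) (s, y)))%E).
  move=> s _ /=; rewrite [in RHS]integralE.
  by congr (_ - _)%E; apply: eq_integral => y _; rewrite ?funeposE ?funenegE.
apply: emeasurable_funB.
  by apply: (measurable_fun_fubini_tonelli_F (m2 := mu) _ mp) => z; exact: funepos_ge0.
by apply: (measurable_fun_fubini_tonelli_F (m2 := mu) _ mn) => z; exact: funeneg_ge0.
Qed.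

Context {d : nat}.
Local Notation E := (euclid R d).
Local Notation F := (fconf R d).
Local Notation m := (lebesgue_space R d).
Local Notation mm := (prodm m m).

Lemma measurable_rsum_fconf dS (S : measurableType dS) (e : S -> F) (h : S -> E -> R) :
  measurable_fun setT e -> measurable_fun setT (fun z : S * E => h z.1 z.2) ->
  measurable_fun setT (fun s => \sum_(x <- e s) h s x).
Proof.
move=> me mh.
have mE : measurable_fun setT (fun z : S * E => (h z.1 z.2)%:E) by exact/measurable_EFinP.
have mp := measurable_funepos mE; have mn := measurable_funeneg mE.
have key : measurable_fun setT (fun s => (\sum_(x <- e s) (h s x)%:E)%E).
  apply: (eq_measurable_fun (fun s =>
      \sum_(x <- e s) (((fun z : S * E => (h z.1 z.2)%:E)^\+) (s, x)) -
      \sum_(x <- e s) (((fun z : S * E => (h z.1 z.2)%:E)^\-) (s, x)))%E).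
    move=> s _.
    have -> : (\sum_(x <- e s) (((fun z : S * E => (h z.1 z.2)%:E)^\+) (s, x)))%E =
        (\sum_(x <- e s) Num.max (h s x) 0)%:E.
      by rewrite -sumEFin; apply: eq_bigr => x _; rewrite funeposE/= EFin_max.
    have -> : (\sum_(x <- e s) (((fun z : S * E => (h z.1 z.2)%:E)^\-) (s, x)))%E =
        (\sum_(x <- e s) Num.max (- h s x) 0)%:E.
      by rewrite -sumEFin; apply: eq_bigr => x _; rewrite funenegE/= EFin_max.
    rewrite -EFinB sumEFin; congr EFin; rewrite -sumrB; apply: eq_bigr => x _.
    by rewrite /Num.max; case: ifPn; case: ifPn; rewrite ?oppr_lt0 ?oppr_gt0 => *; lra.
  apply: emeasurable_funB.
    refine (@measurable_sum_fconf R d _ S e (fun s x => ((fun z : S * E => (h z.1 z.2)%:E)^\+)%E (s, x)) _ _ _) => //.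
    apply: (measurableT_comp mp (g := fun z : S * E => (z.1, z.2))).
    exact/measurable_fun_pair.
  refine (@measurable_sum_fconf R d _ S e (fun s x => ((fun z : S * E => (h z.1 z.2)%:E)^\-)%E (s, x)) _ _ _) => //.
  apply: (measurableT_comp mn (g := fun z : S * E => (z.1, z.2))).
  exact/measurable_fun_pair.
apply/measurable_EFinP; apply: eq_measurable_fun key => s _.
by rewrite sumEFin.
Qed.

Variable c : E -> E -> E -> E -> R.
Hypothesis jr : jump_rate c.
Variable G : F -> R.
Hypothesis mG : measurable_fun setT G.

Lemma measurable_rate : measurable_fun setT (fun z : E * E * (E * E) => c z.1.1 z.1.2 z.2.1 z.2.2).
Proof. by have [_ + _ _] := jr. Qed.

Lemma fsetU2 (xi : F) (y1 y2 : E) : (xi `|` [fset y1; y2])%fset = conf_cons2 (y1, y2) xi.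
Proof. by apply/fsetP => z; rewrite !inE orbC -orbA. Qed.

Lemma fsetU1C (xi : F) (y : E) : (xi `|` [fset y])%fset = (y |` xi)%fset.
Proof. by rewrite fsetUC. Qed.

Lemma measurable_L0 : measurable_fun setT (L0 c G).
Proof.
rewrite /L0; apply: measurable_funM => //.
refine (@measurable_rsum_fconf _ F id (fun eta x1 => \sum_(x2 <- (eta `\ x1)%fset)
    \int[mm]_y (c x1 x2 y.1 y.2 *
      (G ((eta `\ x1 `\ x2) `|` [fset y.1; y.2])%fset - G eta))) _ _) => //.
have mD : measurable_fun setT (fun z : F * E => (z.1 `\ z.2)%fset : F).
  exact: (@measurable_fsetD1 R d _ (F * E)%type snd fst).
refine (@measurable_rsum_fconf _ (F * E)%type (fun z => (z.1 `\ z.2)%fset) (fun z x2 =>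
    \int[mm]_y (c z.2 x2 y.1 y.2 *
      (G ((z.1 `\ z.2 `\ x2) `|` [fset y.1; y.2])%fset - G z.1))) _ _) => //.
refine (@measurable_Rintegral_param _ (F * E * E)%type _ (E * E)%type mm (fun z y =>
    c z.1.2 z.2 y.1 y.2 *
      (G ((z.1.1 `\ z.1.2 `\ z.2) `|` [fset y.1; y.2])%fset - G z.1.1)) _).
apply: measurable_funM.
  apply: (measurableT_comp measurable_rate (g := fun z : F * E * E * (E * E) => ((z.1.1.2, z.1.2), z.2))).
  apply/measurable_fun_pair => //=; apply/measurable_fun_pair => /=.
    by do 2 apply: measurableT_comp => //.
  exact: measurableT_comp.
apply: measurable_funB; last first.
  by apply: (measurableT_comp mG); do 2 apply: measurableT_comp => //.
apply: (measurableT_comp mG).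
under eq_fun do rewrite fsetU2.
apply: (measurableT_comp (@measurable_conf_cons2 R d) (g := fun z : F * E * E * (E * E) =>
   ((z.2.1, z.2.2), (z.1.1.1 `\ z.1.1.2 `\ z.1.2)%fset : F))).
apply/measurable_fun_pair => /=.
  by apply/measurable_fun_pair => /=; exact: measurableT_comp.
refine (@measurable_fsetD1 R d _ (F * E * E * (E * E))%type (fun z => z.1.2) (fun z => (z.1.1.1 `\ z.1.1.2)%fset) _ _).
  exact: measurableT_comp.
apply: (measurableT_comp mD (g := fun z : F * E * E * (E * E) => (z.1.1.1, z.1.1.2))).
by apply/measurable_fun_pair => /=; do 2 apply: measurableT_comp => //.
Qed.

Lemma measurable_ctilde : measurable_fun setT (fun z : E * E * E => ctilde c z.1.1 z.1.2 z.2).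
Proof.
refine (@measurable_Rintegral_param _ (E * E * E)%type _ E m (fun z y2 => c z.1.1 z.1.2 z.2 y2) _).
apply: (measurableT_comp measurable_rate (g := fun z : E * E * E * E => (z.1.1, (z.1.2, z.2)))).
apply/measurable_fun_pair => /=; first exact: measurableT_comp.
by apply/measurable_fun_pair => //=; exact: measurableT_comp.
Qed.

Lemma measurable_W : measurable_fun setT (W c G).
Proof.
have mD : measurable_fun setT (fun z : F * E => (z.1 `\ z.2)%fset : F).
  exact: (@measurable_fsetD1 R d _ (F * E)%type snd fst).
refine (@measurable_rsum_fconf _ F id (fun eta x2 => \sum_(x1 <- (eta `\ x2)%fset)
    \int[m]_y1 (ctilde c x1 x2 y1 *
      (G ((eta `\ x1 `\ x2) `|` [fset y1])%fset - G (eta `\ x2)%fset))) _ _) => //.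
refine (@measurable_rsum_fconf _ (F * E)%type (fun z => (z.1 `\ z.2)%fset) (fun z x1 =>
    \int[m]_y1 (ctilde c x1 z.2 y1 *
      (G ((z.1 `\ x1 `\ z.2) `|` [fset y1])%fset - G (z.1 `\ z.2)%fset))) _ _) => //.
refine (@measurable_Rintegral_param _ (F * E * E)%type _ E m (fun z y1 =>
    ctilde c z.2 z.1.2 y1 *
      (G ((z.1.1 `\ z.2 `\ z.1.2) `|` [fset y1])%fset - G (z.1.1 `\ z.1.2)%fset)) _).
apply: measurable_funM.
  apply: (measurableT_comp measurable_ctilde (g := fun z : F * E * E * E => ((z.1.2, z.1.1.2), z.2))).
  apply/measurable_fun_pair => //=; apply/measurable_fun_pair => /=.
    exact: measurableT_comp.
  by do 2 apply: measurableT_comp => //.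
apply: measurable_funB; last first.
  apply: (measurableT_comp mG).
  apply: (measurableT_comp mD (g := fun z : F * E * E * E => (z.1.1.1, z.1.1.2))).
  by apply/measurable_fun_pair => /=; do 2 apply: measurableT_comp => //.
apply: (measurableT_comp mG).
under eq_fun do rewrite fsetU1C.
refine (@measurable_fsetU1 R d _ (F * E * E * E)%type (fun z => z.2)
  (fun z => (z.1.1.1 `\ z.1.2 `\ z.1.1.2)%fset) _ _); first exact: measurable_snd.
refine (@measurable_fsetD1 R d _ (F * E * E * E)%type (fun z => z.1.1.2) (fun z => (z.1.1.1 `\ z.1.2)%fset) _ _).
  by do 2 apply: measurableT_comp => //.
apply: (measurableT_comp mD (g := fun z : F * E * E * E => (z.1.1.1, z.1.2))).
apply/measurable_fun_pair => /=; first by do 2 apply: measurableT_comp => //.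
exact: measurableT_comp.
Qed.

End measurability.

(** * The generator on functions of finite configurations *)

Section generator.
Context {R : realType} {d : nat}.
Local Notation E := (euclid R d).
Local Notation F := (fconf R d).
Local Notation m := (lebesgue_space R d).
Local Notation mm := (prodm m m).
Local Notation lp := (@lpm R d).
Variable c : E -> E -> E -> E -> R.
Hypothesis jr : jump_rate c.
Hypothesis d0 : (0 < d)%N.

(** Mecke's formula for the indicator of a null set of pairs: the integral is the mass of this set
    times the total mass, which is 0 even if the latter is infinite. *)
Lemma ae_pairs (P : E * E -> Prop) : {ae mm, forall x, P x} ->
  {ae lp, forall eta : F, forall x1 x2, x1 \in (eta : {fset E}) ->
    x2 \in (eta `\ x1)%fset -> P (x1, x2)}.
Proof.
move=> [N [mN N0 PN]].
have mI : measurable_fun setT (fun z : E * E * F => (\1_N z.1 : R)%:E).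
  by apply: measurable_EFin_indic.
have I0 (x : E * E) (xi : F) : (0 <= (\1_N x : R)%:E)%E by [].
have := ae_pair_eq0 d0 (h := fun x _ => (\1_N x : R)%:E) I0 mI.
have -> : (\int[mm]_x \int[lp]_xi (\1_N x : R)%:E)%E = 0%E.
  transitivity (\int[mm]_x ((\1_N x : R)%:E * lp setT))%E.
    by apply: eq_integral => x _; rewrite integral_cst.
  rewrite ge0_integralZr//; last exact: measurable_EFin_indic.
  by rewrite integral_indic// setIT [X in (X * _)%E]N0 mul0e.
move=> /(_ erefl); apply: filterS => eta h0 x1 x2 x1e x2e.
apply: contrapT => nP; have Nx : N (x1, x2) by apply: PN.
have := pair_sum_eq0 (h := fun x _ => (\1_N x : R)%:E) I0 x1e x2e.
by rewrite h0 indicE mem_set//= lee_fin ler10.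
Qed.

(* The integrals entering the action of the generator on the pair [x], for the
   remaining configuration [xi], converge. *)
Definition good_pair (G : F -> R) (x : E * E) (xi : F) :=
  [/\ (a1 c x < +oo)%E,
      mm.-integrable setT (fun y => (c x.1 x.2 y.1 y.2 * G (conf_cons2 y xi))%:E) &
      mm.-integrable setT (fun y => (c x.1 x.2 y.1 y.2 * G (y.1 |` xi)%fset)%:E)].

Definition good (G : F -> R) (eta : F) := forall x1 x2, x1 \in (eta : {fset E}) ->
  x2 \in (eta `\ x1)%fset -> good_pair G (x1, x2) (eta `\ x1 `\ x2)%fset.

(** Finite norm on each level, without uniformity in n. The generator preserves this class
    ([locint_gen]), so it can be iterated. *)
Definition locint (G : F -> R) := measurable_fun setT G /\ forall n, (nrm n G < +oo)%E.

(** [gain2] keeps both arrival points and is the gain of [L0]; [gain1] keeps only one and is the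
    gain of [W]. *)
Definition gain2 (G : F -> R) (x : E * E) (xi : F) : R :=
  \int[mm]_y (c x.1 x.2 y.1 y.2 * G (conf_cons2 y xi)).
Definition gain1 (G : F -> R) (x : E * E) (xi : F) : R :=
  \int[mm]_y (c x.1 x.2 y.1 y.2 * G (y.1 |` xi)%fset).
Definition rate (x : E * E) : R := fine (a1 c x).

Lemma rate_ge0 x : 0 <= rate x. Proof. by apply: fine_ge0; exact: a1_ge0. Qed.

Lemma measurable_rate1 x : measurable_fun setT (fun y : E * E => c x.1 x.2 y.1 y.2).
Proof.
apply: (measurableT_comp (measurable_rate jr) (g := fun y => (x, y))).
exact: measurable_fun_pair.
Qed.

Lemma integrable_rate x : (a1 c x < +oo)%E ->
  mm.-integrable setT (fun y => (c x.1 x.2 y.1 y.2)%:E).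
Proof.
move=> ax; apply/integrableP; split; first by apply/measurable_EFinP; exact: measurable_rate1.
apply: le_lt_trans ax; rewrite le_eqVlt; apply/orP; left; apply/eqP.
apply: eq_integral => y _; rewrite gee0_abs// lee_fin.
by have [+ _ _ _] := jr; apply.
Qed.

Lemma integrable_rateZ x (k : R) : (a1 c x < +oo)%E ->
  mm.-integrable setT (fun y => (c x.1 x.2 y.1 y.2 * k)%:E).
Proof.
move=> ax; have := integrableZr measurableT k (integrable_rate ax).
by apply: eq_integrable => // y _; rewrite EFinM.
Qed.

Lemma Rintegral_rateZ x (k : R) : (a1 c x < +oo)%E ->
  \int[mm]_y (c x.1 x.2 y.1 y.2 * k) = rate x * k.
Proof. by move=> ax; rewrite RintegralZr//; exact: integrable_rate. Qed.

Lemma L0E (G : F -> R) (eta : F) : good G eta ->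
  L0 c G eta = 2^-1 * \sum_(x1 <- eta) \sum_(x2 <- (eta `\ x1)%fset)
    (gain2 G (x1, x2) (eta `\ x1 `\ x2)%fset - rate (x1, x2) * G eta).
Proof.
move=> gG; rewrite /L0; congr (_ * _).
apply: eq_big_seq => x1 x1e; apply: eq_big_seq => x2 x2e.
have [ax i2 _] := gG _ _ x1e x2e.
rewrite -(@Rintegral_rateZ (x1, x2))// /gain2 -RintegralB//; last exact: (@integrable_rateZ (x1, x2)).
by apply: eq_Rintegral => y _; rewrite fsetU2 mulrBr; case: y.
Qed.

(** [ctilde] is a real-valued integral and takes the default value 0 where it diverges. Finiteness
    of [a1] excludes this for almost every y1, and Fubini's theorem applies. *)
Lemma ctilde_Rintegral (x : E * E) (k : E -> R) : (a1 c x < +oo)%E ->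
  measurable_fun setT k ->
  mm.-integrable setT (fun y => (c x.1 x.2 y.1 y.2 * k y.1)%:E) ->
  \int[m]_y1 (ctilde c x.1 x.2 y1 * k y1) = \int[mm]_y (c x.1 x.2 y.1 y.2 * k y.1).
Proof.
move=> ax mk ik; rewrite /Rintegral; congr fine.
rewrite -(integral12_prod_meas1 ik).
apply: ae_eq_integral => //.
- apply/measurable_EFinP; apply: measurable_funM => //.
  apply: (measurableT_comp (measurable_ctilde jr) (g := fun y => (x, y))).
  exact: measurable_fun_pair.
- exact: (measurable_fubini_F ik).
have := ae_integrable1 (integrable_rate ax); apply: filterS => y1 iy _.
rewrite /= /fubini_F/= /ctilde.
transitivity ((\int[m]_y2 c x.1 x.2 y1 y2 * k y1)%:E) => //.
rewrite -RintegralZr// /Rintegral fineK//.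
apply: integrable_fin_num => //.
have := integrableZr measurableT (k y1) iy.
by apply: eq_integrable => // y _; rewrite EFinM.
Qed.

Lemma WE (G : F -> R) (eta : F) : measurable_fun setT G -> good G eta ->
  W c G eta = \sum_(x1 <- eta) \sum_(x2 <- (eta `\ x1)%fset)
    (gain1 G (x1, x2) (eta `\ x1 `\ x2)%fset -
     rate (x1, x2) * G (x2 |` (eta `\ x1 `\ x2))%fset).
Proof.
move=> mG gG; rewrite /W.
apply: eq_big_seq => x1 x1e; apply: eq_big_seq => x2 x2e.
have [ax _ i1] := gG _ _ x1e x2e.
(* In [W] the outer variable is the point that stays removed. It is renamed x1 here, and the
   symmetry of c in the departing pair leaves the rate unchanged. *)
have cC y1 : ctilde c x2 x1 y1 = ctilde c x1 x2 y1.
  by apply: eq_Rintegral => y2 _; have [_ _ + _] := jr; apply.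
pose xi : F := (eta `\ x1 `\ x2)%fset; pose k := G (x2 |` xi)%fset.
have mk : measurable_fun setT (fun y1 => G (y1 |` xi)%fset - k).
  apply: measurable_funB => //; apply: (measurableT_comp mG).
  exact: (@measurable_fsetU1 R d _ E id (fun=> xi)).
have i1' : mm.-integrable setT (fun y : E * E =>
    (c x1 x2 y.1 y.2 * (G (y.1 |` xi)%fset - k))%:E).
  have := integrableB measurableT i1 (@integrable_rateZ (x1, x2) k ax).
  by apply: eq_integrable => // y _; rewrite mulrBr EFinB.
transitivity (\int[m]_y1 (ctilde c x1 x2 y1 * (G (y1 |` xi)%fset - k))).
  have exi : (eta `\ x2 `\ x1)%fset = xi :> F.
    by apply/fsetP => z; rewrite !inE andbCA.
  have ek : (eta `\ x1)%fset = (x2 |` xi)%fset :> F by rewrite /xi fsetD1K.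
  apply: eq_Rintegral => y1 _; rewrite cC fsetU1C; congr (_ * (G _ - G _)); last exact: ek.
  by congr fsetU; exact: exi.
rewrite (@ctilde_Rintegral (x1, x2))// -(@Rintegral_rateZ (x1, x2))// /gain1 -RintegralB//.
  by apply: eq_Rintegral => y _; rewrite mulrBr.
exact: (@integrable_rateZ (x1, x2)).
Qed.

Section ae_good.
Hypotheses (c1oo : (c1 c < +oo)%E) (c2oo : (c2 c < +oo)%E)
  (c3oo : (c3 c < +oo)%E) (c4oo : (c4 c < +oo)%E).
Local Open Scope ereal_scope.

Lemma lebesgue_spaceT_neq0 : m setT != 0.
Proof.
pose A : set (measurableTypeR R) := `[0%R, 1%R]%classic.
have mA : measurable A by exact: measurable_itv.
have A1 : lebesgue_measure A = 1%:E.
  by have := @lebesgue_measure_itv R `[0%R, 1%R]; rewrite /= lte_fin ltr01 sube0.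
have m1 : m (tuple_in A) = 1.
  rewrite /lebesgue_space tuple_measure_in// [X in X ^+ _]A1.
  by rewrite -EFin_expe expr1n.
rewrite gt_eqF//; apply: (@lt_le_trans _ _ (m (tuple_in A))).
  by rewrite m1 lte01.
by apply: le_measure; rewrite ?inE//; exact: measurable_tuple_in.
Qed.

Lemma prodm_setT_neq0 : mm setT != 0.
Proof.
rewrite -setXTT [X in X != _](product_measure1E)//.
by rewrite mule_neq0// lebesgue_spaceT_neq0.
Qed.

Lemma c1_ge0 : 0 <= c1 c.
Proof. by apply: (ess_sup_ge0 prodm_setT_neq0); exact: a1_ge0. Qed.
Lemma c2_ge0 : 0 <= c2 c.
Proof. by apply: (ess_sup_ge0 prodm_setT_neq0); exact: a2_ge0. Qed.
Lemma c3_ge0 : 0 <= c3 c.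
Proof.
apply: (ess_sup_ge0 lebesgue_spaceT_neq0) => x1; apply: integral_ge0 => x2 _.
exact: (a1_ge0 jr (x1, x2)).
Qed.
Lemma c4_ge0 : 0 <= c4 c.
Proof.
apply: (ess_sup_ge0 lebesgue_spaceT_neq0) => x1; apply: integral_ge0 => x2 _.
exact: (a2_ge0 jr (x1, x2)).
Qed.

Lemma ae_rate_le : {ae lp, forall eta : F, forall x1 x2, x1 \in (eta : {fset E}) ->
    x2 \in (eta `\ x1)%fset -> a1 c (x1, x2) <= c1 c}.
Proof. by apply: (ae_pairs (P := fun x => a1 c x <= c1 c)); exact: ess_sup_ge. Qed.

Lemma integral_lev_cons2 (G : F -> R) k : measurable_fun setT G ->
  \int[mm]_y \int[lp]_xi (lev k xi * `|G (conf_cons2 y xi)|%:E) =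
  (k.+2 * k.+1)%:R%:E * nrm k.+2 G.
Proof.
move=> mG.
have mGE : measurable_fun setT (fun eta => `|G eta|%:E).
  by apply/measurable_EFinP; exact: measurableT_comp.
rewrite -(mecke2 d0); first last.
- apply: emeasurable_funM (measurable_norm_cons2 mG).
  by apply: measurableT_comp => //; exact: measurable_lev.
- by move=> *; rewrite mule_ge0 ?lev_ge0 ?lee_fin.
rewrite /nrm -ge0_integralZl//; first last.
- by move=> eta _; rewrite mule_ge0 ?lev_ge0 ?lee_fin.
- by apply: emeasurable_funM mGE; exact: measurable_lev.
apply: eq_integral => eta _.
rewrite -lev_pair_sum; last by move=> *; rewrite lee_fin.
rewrite /pair_sum.
under eq_big_seq => x1 x1e.
  under eq_big_seq => x2 x2e do rewrite conf_cons2K//.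
  rewrite sumEFin big_const_seq count_predT iter_addr_0.
  over.
rewrite /lev; case: eqP => [en|]; last by rewrite !mul0e mule0.
under eq_big_seq => x1 x1e.
  have -> : size (eta `\ x1)%fset = k.+1.
    by have := cardfsD1 x1 eta; rewrite x1e en add1n => -[<-].
  over.
by rewrite sumEFin big_const_seq count_predT iter_addr_0 -/(#|` eta|)%fset en !mul1e
  -mulrnA -EFinM mulr_natl mulnC.
Qed.

Lemma measurable_cE_int (g : E * E -> F -> \bar R) : (forall y xi, 0 <= g y xi) ->
  measurable_fun setT (fun z : E * E * F => g z.1 z.2) ->
  measurable_fun setT (fun z : E * E * F => \int[mm]_y (cE c z.1 y * g y z.2)).
Proof.
move=> g0 mg.
refine (@measurable_fun_fubini_tonelli_F _ _ (E * E * F)%type (E * E)%type R mm (fun z => cE c z.1.1 z.2 * g z.2 z.1.2) _ _).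
  apply: emeasurable_funM.
    apply: (measurableT_comp (measurable_cE jr) (g := fun z : E * E * F * (E * E) => (z.1.1, z.2))).
    by apply/measurable_fun_pair => //=; exact: measurableT_comp.
  apply: (measurableT_comp mg (g := fun z : E * E * F * (E * E) => (z.2, z.1.2))).
  by apply/measurable_fun_pair => //=; exact: measurableT_comp.
by move=> z; rewrite mule_ge0 ?cE_ge0.
Qed.

(** The integrals of the absolute values are summed over pairs and integrated on each level.
    Exchanging arrival and departure bounds the first by [c2] and the norm on k+2 points, the second
    by [c4] and the norm on k+1 points. So both sums are finite almost everywhere, and with them the
    integral of every pair; [c1] takes care of [a1]. *)
Lemma ae_good (G : F -> R) : locint G -> {ae lp, forall eta, good G eta}.
Proof.
move=> [mG Goo].
have mGE : measurable_fun setT (fun eta => `|G eta|%:E).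
  by apply/measurable_EFinP; exact: measurableT_comp.
pose h2 (x : E * E) (xi : F) := \int[mm]_y (cE c x y * `|G (conf_cons2 y xi)|%:E).
pose h1 (x : E * E) (xi : F) := \int[mm]_y (cE c x y * `|G (y.1 |` xi)%fset|%:E).
have mg2 : measurable_fun setT (fun z : E * E * F => `|G (conf_cons2 z.1 z.2)|%:E) by exact: measurable_norm_cons2.
have mg1 : measurable_fun setT (fun z : E * E * F => `|G (z.1.1 |` z.2)%fset|%:E).
  apply: (measurableT_comp (measurable_norm_cons1 mG) (g := fun z : E * E * F => (z.1.1, z.2))).
  by apply/measurable_fun_pair => //=; exact: measurableT_comp.
have mh := measurable_cE_int.
have hoo (g : E * E -> F -> \bar R) k : (forall y xi, 0 <= g y xi) ->
    measurable_fun setT (fun z : E * E * F => g z.1 z.2) ->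
    \int[mm]_x \int[lp]_xi (lev k xi * \int[mm]_y (cE c x y * g y xi)) =
    \int[lp]_eta (lev k.+2 eta * pair_sum (fun x xi => \int[mm]_y (cE c x y * g y xi)) eta).
  move=> g0 mg; have i0 x xi : 0 <= \int[mm]_y (cE c x y * g y xi).
    by apply: integral_ge0 => y _; rewrite mule_ge0 ?cE_ge0.
  rewrite -(mecke2 d0); first last.
  - by apply: emeasurable_funM (mh _ g0 mg); apply: measurableT_comp => //; exact: measurable_lev.
  - by move=> *; rewrite mule_ge0 ?lev_ge0.
  by apply: eq_integral => eta _; rewrite lev_pair_sum.
have A2 : {ae lp, forall eta, pair_sum h2 eta < +oo}.
  apply: (ae_pair_lty d0); [|exact: (mh (fun y xi => `|G (conf_cons2 y xi)|%:E))|].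
    by move=> *; apply: integral_ge0 => y _; rewrite mule_ge0 ?cE_ge0 ?lee_fin.
  move=> k; rewrite (hoo (fun y xi => `|G (conf_cons2 y xi)|%:E))//.
  rewrite (integral_gain_swap jr d0 k (g := fun y xi => `|G (conf_cons2 y xi)|%:E))//.
  have ml : measurable_fun setT (fun z : E * E * F => lev k z.2 * `|G (conf_cons2 z.1 z.2)|%:E).
    by apply: emeasurable_funM mg2; apply: measurableT_comp => //; exact: measurable_lev.
  have mi : measurable_fun setT (fun y => \int[lp]_xi (lev k xi * `|G (conf_cons2 y xi)|%:E)).
    apply: (measurable_fun_fubini_tonelli_F (m2 := lp) _ ml) => z.
    by rewrite mule_ge0 ?lev_ge0 ?lee_fin.
  have i0 y : 0 <= \int[lp]_xi (lev k xi * `|G (conf_cons2 y xi)|%:E).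
    by apply: integral_ge0 => *; rewrite mule_ge0 ?lev_ge0 ?lee_fin.
  apply: (@le_lt_trans _ _ (\int[mm]_y (c2 c * \int[lp]_xi (lev k xi * `|G (conf_cons2 y xi)|%:E)))).
    apply: ae_ge0_le_integral => //.
    - by move=> y _; rewrite mule_ge0 ?a2_ge0.
    - by apply: emeasurable_funM => //; exact: measurable_a2.
    - by move=> y _; rewrite mule_ge0 ?c2_ge0.
    - exact: measurable_funeM.
    - have := ess_sup_ge mm (a2 c); apply: filterS => y h _; exact: lee_wpmul2r.
  rewrite ge0_integralZl ?c2_ge0// integral_lev_cons2//.
  by rewrite lte_mul_pinfty ?c2_ge0 ?ge0_fin_numE ?c2_ge0// lte_mul_pinfty ?lee_fin.
have A1 : {ae lp, forall eta, pair_sum h1 eta < +oo}.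
  apply: (ae_pair_lty d0); [|exact: (mh (fun y xi => `|G (y.1 |` xi)%fset|%:E))|].
    by move=> *; apply: integral_ge0 => y _; rewrite mule_ge0 ?cE_ge0 ?lee_fin.
  move=> k; rewrite (hoo (fun y xi => `|G (y.1 |` xi)%fset|%:E))//.
  apply: le_lt_trans (integral_gain1 mG jr d0 k c4_ge0) _.
  by rewrite lte_mul_pinfty ?c4_ge0 ?ge0_fin_numE ?c4_ge0// lte_mul_pinfty ?lee_fin.
apply: filterS3 A2 A1 ae_rate_le => eta e2 e1 er x1 x2 x1e x2e.
have h20 x xi : 0 <= h2 x xi.
  by apply: integral_ge0 => y _; rewrite mule_ge0 ?cE_ge0 ?lee_fin.
have h10 x xi : 0 <= h1 x xi.
  by apply: integral_ge0 => y _; rewrite mule_ge0 ?cE_ge0 ?lee_fin.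
have mc := measurable_rate1 (x1, x2).
split; first exact: le_lt_trans (er _ _ x1e x2e) c1oo.
- apply/integrableP; split.
    apply/measurable_EFinP; apply: measurable_funM => //; apply: (measurableT_comp mG).
    apply: (measurableT_comp (@measurable_conf_cons2 R d) (g := fun y => (y, (eta `\ x1 `\ x2)%fset : F))).
    exact: measurable_fun_pair.
  apply: le_lt_trans e2; apply: le_trans (pair_sum_eq0 h20 x1e x2e).
  rewrite le_eqVlt; apply/orP; left; apply/eqP; apply: eq_integral => y _.
  by rewrite /= normrM EFinM ger0_norm//; have [+ _ _ _] := jr; apply.
- apply/integrableP; split.
    apply/measurable_EFinP; apply: measurable_funM => //; apply: (measurableT_comp mG).
    by refine (@measurable_fsetU1 R d _ (E * E)%type fst (fun=> (eta `\ x1 `\ x2)%fset : F) _ _).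
  apply: le_lt_trans e1; apply: le_trans (pair_sum_eq0 h10 x1e x2e).
  rewrite le_eqVlt; apply/orP; left; apply/eqP; apply: eq_integral => y _.
  by rewrite /= normrM EFinM ger0_norm//; have [+ _ _ _] := jr; apply.
Qed.

End ae_good.
End generator.

(** * Linearity of the generator and pointwise bounds for one Euler step *)

Section generator_bounds.
Context {R : realType} {d : nat}.
Local Notation E := (euclid R d).
Local Notation F := (fconf R d).
Local Notation m := (lebesgue_space R d).
Local Notation mm := (prodm m m).
Local Notation lp := (@lpm R d).
Variable c : E -> E -> E -> E -> R.
Hypothesis jr : jump_rate c.
Hypothesis d0 : (0 < d)%N.
Hypotheses (c1oo : (c1 c < +oo)%E) (c2oo : (c2 c < +oo)%E)
  (c3oo : (c3 c < +oo)%E) (c4oo : (c4 c < +oo)%E).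
Hypothesis a21 : {ae mm, forall x, (a2 c x <= a1 c x)%E}.

Definition gen (G : F -> R) (eta : F) : R := L0 c G eta + W c G eta.

Lemma measurable_gen G : measurable_fun setT G -> measurable_fun setT (gen G).
Proof.
by move=> mG; apply: measurable_funD; [exact: measurable_L0|exact: measurable_W].
Qed.

Lemma genE (G : F -> R) (eta : F) : measurable_fun setT G -> good c G eta ->
  gen G eta = \sum_(x1 <- eta) \sum_(x2 <- (eta `\ x1)%fset)
    (2^-1 * (gain2 c G (x1, x2) (eta `\ x1 `\ x2)%fset - rate c (x1, x2) * G eta) +
     (gain1 c G (x1, x2) (eta `\ x1 `\ x2)%fset -
     rate c (x1, x2) * G (x2 |` (eta `\ x1 `\ x2))%fset)).
Proof.
move=> mG gG; rewrite /gen L0E// WE// mulr_sumr -big_split/=; apply: eq_bigr => x1 _.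
by rewrite mulr_sumr -big_split.
Qed.

Lemma good_lin a (G H : F -> R) eta : good c G eta -> good c H eta ->
  good c (fun eta => a * G eta + H eta) eta.
Proof.
move=> gG gH x1 x2 x1e x2e; have [ax G2 G1] := gG _ _ x1e x2e; have [_ H2 H1] := gH _ _ x1e x2e.
split => //.
- have := integrableD measurableT (integrableZl measurableT a G2) H2.
  by apply: eq_integrable => // y _; rewrite -EFinM -EFinD; congr EFin; rewrite mulrDr mulrCA.
- have := integrableD measurableT (integrableZl measurableT a G1) H1.
  by apply: eq_integrable => // y _; rewrite -EFinM -EFinD; congr EFin; rewrite mulrDr mulrCA.
Qed.

Lemma gain2_lin a (G H : F -> R) x xi : good_pair c G x xi -> good_pair c H x xi ->
  gain2 c (fun eta => a * G eta + H eta) x xi = a * gain2 c G x xi + gain2 c H x xi.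
Proof.
move=> [ax G2 G1] [_ H2 H1]; rewrite /gain2 -RintegralZl// -RintegralD//; last first.
  by have := integrableZl measurableT a G2; apply: eq_integrable => // y _; rewrite EFinM.
by apply: eq_Rintegral => y _; rewrite mulrDr mulrCA.
Qed.

Lemma gain1_lin a (G H : F -> R) x xi : good_pair c G x xi -> good_pair c H x xi ->
  gain1 c (fun eta => a * G eta + H eta) x xi = a * gain1 c G x xi + gain1 c H x xi.
Proof.
move=> [ax G2 G1] [_ H2 H1]; rewrite /gain1 -RintegralZl// -RintegralD//; last first.
  by have := integrableZl measurableT a G1; apply: eq_integrable => // y _; rewrite EFinM.
by apply: eq_Rintegral => y _; rewrite mulrDr mulrCA.
Qed.

(** Linearity is stated at good configurations, since a divergent integral takes a default value
    that does not add up. *)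
Lemma gen_lin a (G H : F -> R) eta :
  measurable_fun setT G -> measurable_fun setT H -> good c G eta -> good c H eta ->
  gen (fun eta => a * G eta + H eta) eta = a * gen G eta + gen H eta.
Proof.
move=> mG mH gG gH; rewrite !genE//; first last.
- exact: good_lin.
- by apply: measurable_funD => //; exact: measurable_funM.
rewrite mulr_sumr -big_split; apply: eq_big_seq => x1 x1e /=.
rewrite mulr_sumr -big_split; apply: eq_big_seq => x2 x2e /=.
rewrite gain2_lin ?gain1_lin; [|exact: gG|exact: gH|exact: gG|exact: gH].
set p := gain2 _ G _ _; set q := gain2 _ H _ _; set r := gain1 _ G _ _.
set s := gain1 _ H _ _; set u := rate _ _.
have -> z w : u * (a * z + w) = a * (u * z) + u * w by rewrite mulrDr mulrCA.
have -> z w : u * (a * z + w) = a * (u * z) + u * w by rewrite mulrDr mulrCA.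
set v := u * G eta; set v' := u * H eta.
set w := u * _; set w' := u * _.
by lra.
Qed.

Lemma le_gain2 (G : F -> R) x xi : good_pair c G x xi ->
  (`|gain2 c G x xi|%:E <= \int[mm]_y (cE c x y * `|G (conf_cons2 y xi)|%:E))%E.
Proof.
move=> [ax G2 G1]; rewrite /gain2 EFin_normr_Rintegral//.
apply: le_trans (le_abse_integral _ _ _) _ => //; first by case/integrableP : G2.
rewrite le_eqVlt; apply/orP; left; apply/eqP; apply: eq_integral => y _.
by rewrite /= normrM EFinM ger0_norm//; have [+ _ _ _] := jr; apply.
Qed.

Lemma le_gain1 (G : F -> R) x xi : good_pair c G x xi ->
  (`|gain1 c G x xi|%:E <= \int[mm]_y (cE c x y * `|G (y.1 |` xi)%fset|%:E))%E.
Proof.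
move=> [ax G2 G1]; rewrite /gain1 EFin_normr_Rintegral//.
apply: le_trans (le_abse_integral _ _ _) _ => //; first by case/integrableP : G1.
rewrite le_eqVlt; apply/orP; left; apply/eqP; apply: eq_integral => y _.
by rewrite /= normrM EFinM ger0_norm//; have [+ _ _ _] := jr; apply.
Qed.

Lemma rateE (x : E * E) : (a1 c x < +oo)%E -> (rate c x)%:E = a1 c x.
Proof. by move=> ax; rewrite /rate fineK// ge0_fin_numE// a1_ge0. Qed.

(** Summed over ordered pairs, this is twice the total jump rate at eta, hence the coefficients s/2
    in the Euler step. *)
Definition trate (eta : F) : R :=
  \sum_(x1 <- eta) \sum_(x2 <- (eta `\ x1)%fset) rate c (x1, x2).

Lemma trate_ge0 eta : 0 <= trate eta.
Proof. by apply: sumr_ge0 => *; apply: sumr_ge0 => *; exact: rate_ge0. Qed.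

Lemma measurable_trate : measurable_fun setT trate.
Proof.
have mr : measurable_fun setT (rate c).
  by apply: measurableT_comp; [exact: fine_measurable|exact: measurable_a1].
have mD : measurable_fun setT (fun z : F * E => (z.1 `\ z.2)%fset : F).
  exact: (@measurable_fsetD1 R d _ (F * E)%type snd fst).
refine (@measurable_rsum_fconf R d _ F id (fun eta x1 => \sum_(x2 <- (eta `\ x1)%fset) rate c (x1, x2)) _ _) => //.
refine (@measurable_rsum_fconf R d _ (F * E)%type (fun z => (z.1 `\ z.2)%fset) (fun z x2 => rate c (z.2, x2)) _ _) => //.
apply: (measurableT_comp mr (g := fun z : F * E * E => (z.1.2, z.2))).
by apply/measurable_fun_pair => //=; exact: measurableT_comp.
Qed.

Definition c1r : R := fine (c1 c).

Lemma c1r_ge0 : 0 <= c1r. Proof. by apply: fine_ge0; exact: c1_ge0. Qed.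

Lemma c1rE : (c1r%:E = c1 c)%E.
Proof. by have c10 := c1_ge0 jr; rewrite /c1r fineK// ge0_fin_numE. Qed.

Lemma ae_trate_le : {ae lp, forall eta, trate eta <= (#|` eta|%fset * #|` eta|%fset)%:R * c1r}.
Proof.
apply: filterS (ae_rate_le c d0) => eta h; rewrite /trate.
apply: (@le_trans _ _ (\sum_(x1 <- eta) (#|` eta|%fset)%:R * c1r)).
  rewrite !big_seq; apply: ler_sum => x1 x1e.
  apply: (@le_trans _ _ (\sum_(x2 <- (eta `\ x1)%fset) c1r)).
    rewrite !big_seq; apply: ler_sum => x2 x2e.
    have := h _ _ x1e x2e; rewrite -c1rE => ac.
    by rewrite -lee_fin rateE//; exact: le_lt_trans ac (ltry _).
  rewrite big_const_seq count_predT iter_addr_0 -[leLHS]mulr_natl.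
  apply: ler_wpM2r; first exact: c1r_ge0.
  by rewrite ler_nat (cardfsD1 x1 eta) leq_addl.
by rewrite big_const_seq count_predT iter_addr_0 -[X in X <= _]mulr_natl mulrA -natrM.
Qed.

Section euler_step.
Variables (G : F -> R) (s : R) (eta : F).
Hypotheses (mG : measurable_fun setT G) (gG : good c G eta) (s0 : 0 <= s)
  (st : s * trate eta <= 1).

Let h2 (x : E * E) (xi : F) := (\int[mm]_y (cE c x y * `|G (conf_cons2 y xi)|%:E))%E.
Let h1 (x : E * E) (xi : F) := (\int[mm]_y (cE c x y * `|G (y.1 |` xi)%fset|%:E))%E.
Let h0 (x : E * E) (xi : F) := (a1 c x * `|G (x.2 |` xi)%fset|%:E)%E.

(** The diagonal contributions are gathered in the coefficient 1 - (s/2) [trate], which the step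
    condition makes nonnegative. It thus survives the absolute value with its loss term, against
    which the gain is later balanced. *)
Lemma euler_step_le : (`|G eta + s * gen G eta|%:E <=
  (1 - s * 2^-1 * trate eta)%:E * `|G eta|%:E + (s * 2^-1)%:E * pair_sum h2 eta +
  s%:E * pair_sum h1 eta + s%:E * pair_sum h0 eta)%E.
Proof.
pose g2 := \sum_(x1 <- eta) \sum_(x2 <- (eta `\ x1)%fset) `|gain2 c G (x1, x2) (eta `\ x1 `\ x2)%fset|.
pose g1 := \sum_(x1 <- eta) \sum_(x2 <- (eta `\ x1)%fset) `|gain1 c G (x1, x2) (eta `\ x1 `\ x2)%fset|.
pose g0 := \sum_(x1 <- eta) \sum_(x2 <- (eta `\ x1)%fset) (rate c (x1, x2) * `|G (x2 |` (eta `\ x1 `\ x2))%fset|).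
have G2 : (g2%:E <= pair_sum h2 eta)%E.
  rewrite /g2 -sumEFin /pair_sum big_seq [leRHS]big_seq; apply: lee_sum => x1 x1e.
  rewrite -sumEFin big_seq [leRHS]big_seq; apply: lee_sum => x2 x2e.
  exact: (le_gain2 (gG x1e x2e)).
have G1 : (g1%:E <= pair_sum h1 eta)%E.
  rewrite /g1 -sumEFin /pair_sum big_seq [leRHS]big_seq; apply: lee_sum => x1 x1e.
  rewrite -sumEFin big_seq [leRHS]big_seq; apply: lee_sum => x2 x2e.
  exact: (le_gain1 (gG x1e x2e)).
have G0 : (g0%:E <= pair_sum h0 eta)%E.
  rewrite /g0 -sumEFin /pair_sum big_seq [leRHS]big_seq; apply: lee_sum => x1 x1e.
  rewrite -sumEFin big_seq [leRHS]big_seq; apply: lee_sum => x2 x2e.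
  by have [ax _ _] := gG x1e x2e; rewrite EFinM rateE.
apply: (@le_trans _ _ ((1 - s * 2^-1 * trate eta)%:E * `|G eta|%:E + (s * 2^-1)%:E * g2%:E +
  s%:E * g1%:E + s%:E * g0%:E)%E); last first.
  by apply: leeD; [apply: leeD; [apply: leeD => //|]|]; apply: lee_wpmul2l; rewrite // lee_fin ?mulr_ge0.
rewrite -!EFinM -!EFinD lee_fin genE//.
have -> : G eta + s * (\sum_(x1 <- eta) \sum_(x2 <- (eta `\ x1)%fset)
    (2^-1 * (gain2 c G (x1, x2) (eta `\ x1 `\ x2)%fset - rate c (x1, x2) * G eta) +
     (gain1 c G (x1, x2) (eta `\ x1 `\ x2)%fset -
     rate c (x1, x2) * G (x2 |` (eta `\ x1 `\ x2))%fset))) =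
  (1 - s * 2^-1 * trate eta) * G eta +
  s * 2^-1 * (\sum_(x1 <- eta) \sum_(x2 <- (eta `\ x1)%fset) gain2 c G (x1, x2) (eta `\ x1 `\ x2)%fset) +
  s * (\sum_(x1 <- eta) \sum_(x2 <- (eta `\ x1)%fset) gain1 c G (x1, x2) (eta `\ x1 `\ x2)%fset) -
  s * (\sum_(x1 <- eta) \sum_(x2 <- (eta `\ x1)%fset) (rate c (x1, x2) * G (x2 |` (eta `\ x1 `\ x2))%fset)).
  have -> : \sum_(x1 <- eta) \sum_(x2 <- (eta `\ x1)%fset)
    (2^-1 * (gain2 c G (x1, x2) (eta `\ x1 `\ x2)%fset - rate c (x1, x2) * G eta) +
     (gain1 c G (x1, x2) (eta `\ x1 `\ x2)%fset -
     rate c (x1, x2) * G (x2 |` (eta `\ x1 `\ x2))%fset)) =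
     2^-1 * ((\sum_(x1 <- eta) \sum_(x2 <- (eta `\ x1)%fset) gain2 c G (x1, x2) (eta `\ x1 `\ x2)%fset) - trate eta * G eta) +
     ((\sum_(x1 <- eta) \sum_(x2 <- (eta `\ x1)%fset) gain1 c G (x1, x2) (eta `\ x1 `\ x2)%fset) -
      \sum_(x1 <- eta) \sum_(x2 <- (eta `\ x1)%fset) (rate c (x1, x2) * G (x2 |` (eta `\ x1 `\ x2))%fset)).
    rewrite /trate mulr_suml -!sumrB mulr_sumr -big_split/=; apply: eq_bigr => x1 _.
    by rewrite mulr_suml -!sumrB mulr_sumr -big_split.
  set P := \sum_(x1 <- eta) _; set Q := \sum_(x1 <- eta) _; set T := \sum_(x1 <- eta) _.
  by lra.
apply: le_trans (ler_normB _ _) _; apply: lerD; last first.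
  rewrite normrM (ger0_norm s0); apply: ler_wpM2l => //.
  apply: le_trans (ler_norm_sum _ _ _) _; apply: ler_sum => x1 _.
  apply: le_trans (ler_norm_sum _ _ _) _; apply: ler_sum => x2 _.
  by rewrite normrM (ger0_norm (rate_ge0 _ _)).
apply: le_trans (ler_normD _ _) _; apply: lerD; last first.
  rewrite normrM (ger0_norm s0); apply: ler_wpM2l => //.
  apply: le_trans (ler_norm_sum _ _ _) _; apply: ler_sum => x1 _.
  exact: ler_norm_sum.
apply: le_trans (ler_normD _ _) _; apply: lerD; last first.
  rewrite normrM ger0_norm ?mulr_ge0//; apply: ler_wpM2l; first by rewrite mulr_ge0.
  apply: le_trans (ler_norm_sum _ _ _) _; apply: ler_sum => x1 _.
  exact: ler_norm_sum.
rewrite normrM ger0_norm// subr_ge0.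
by apply: le_trans st; rewrite -mulrA; apply: ler_wpM2l => //; have := trate_ge0 eta; lra.
Qed.

End euler_step.

End generator_bounds.

(** * The level norms of one Euler step *)

Section contraction.
Context {R : realType} {d : nat}.
Local Notation E := (euclid R d).
Local Notation F := (fconf R d).
Local Notation m := (lebesgue_space R d).
Local Notation mm := (prodm m m).
Local Notation lp := (@lpm R d).

Lemma measurable_lev_norm n (G : F -> R) : measurable_fun setT G ->
  measurable_fun setT (fun eta => lev n eta * `|G eta|%:E)%E.
Proof.
move=> mG; apply: emeasurable_funM; first exact: measurable_lev.
by apply/measurable_EFinP; exact: measurableT_comp.
Qed.

Lemma lev_norm_ge0 n (G : F -> R) eta : (0 <= lev n eta * `|G eta|%:E)%E.
Proof. by rewrite mule_ge0 ?lev_ge0 ?lee_fin. Qed.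

Lemma nrm_le n (G H : F -> R) : measurable_fun setT G -> measurable_fun setT H ->
  {ae lp, forall eta, `|G eta| <= `|H eta|} -> (nrm n G <= nrm n H)%E.
Proof.
move=> mG mH GH; apply: ae_ge0_le_integral => //.
- by move=> eta _; exact: lev_norm_ge0.
- exact: measurable_lev_norm.
- by move=> eta _; exact: lev_norm_ge0.
- exact: measurable_lev_norm.
- by apply: filterS GH => eta GH _; apply: lee_wpmul2l; rewrite ?lev_ge0 ?lee_fin.
Qed.

Lemma nrmZ n a (G : F -> R) : measurable_fun setT G ->
  nrm n (fun eta => a * G eta) = (`|a|%:E * nrm n G)%E.
Proof.
move=> mG; rewrite /nrm -ge0_integralZl//; first last.
- by move=> eta _; exact: lev_norm_ge0.
- exact: measurable_lev_norm.
by apply: eq_integral => eta _; rewrite normrM EFinM muleCA.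
Qed.

Lemma le_nrmD n (G H : F -> R) : measurable_fun setT G -> measurable_fun setT H ->
  (nrm n (fun eta => (G eta + H eta)%R) <= nrm n G + nrm n H)%E.
Proof.
move=> mG mH; rewrite /nrm -ge0_integralD//; first last.
- exact: measurable_lev_norm.
- by move=> eta _; exact: lev_norm_ge0.
- exact: measurable_lev_norm.
- by move=> eta _; exact: lev_norm_ge0.
apply: ge0_le_integral => //.
- by move=> eta _; exact: (lev_norm_ge0 n (fun x => G x + H x)).
- by apply: measurable_lev_norm; exact: measurable_funD.
- by apply: emeasurable_funD; exact: measurable_lev_norm.
- move=> eta _; rewrite /lev; case: eqP => _; last by rewrite !mul0e adde0.
  rewrite !mul1e; change (`|G eta + H eta|%:E <= (`|G eta| + `|H eta|)%:E)%E.
  by rewrite lee_fin ler_normD.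
Qed.

Lemma nrm0_ae (G : F -> R) : measurable_fun setT G ->
  (forall n, nrm n G = 0%E) -> {ae lp, forall eta, G eta = 0}.
Proof.
move=> mG G0; apply: ae_lev => n.
have := (ae_eq_integral_abs lp measurableT (measurable_lev_norm n mG)).1.
have -> : (\int[lp]_x `|(lev n x * `|G x|%:E)| = 0)%E.
  by rewrite -[RHS](G0 n); apply: eq_integral => eta _; rewrite gee0_abs// lev_norm_ge0.
move=> /(_ erefl); apply: filterS => eta /(_ I) /= + en; rewrite /lev en eqxx mul1e.
by move=> -[] /normr0_eq0.
Qed.

Variable c : E -> E -> E -> E -> R.
Hypothesis jr : jump_rate c.
Hypothesis d0 : (0 < d)%N.
Hypotheses (c1oo : (c1 c < +oo)%E) (c2oo : (c2 c < +oo)%E)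
  (c3oo : (c3 c < +oo)%E) (c4oo : (c4 c < +oo)%E).
Hypothesis a21 : {ae mm, forall x, (a2 c x <= a1 c x)%E}.

Lemma locint_lin a (G H : F -> R) : locint G -> locint H ->
  locint (fun eta => a * G eta + H eta).
Proof.
move=> [mG Goo] [mH Hoo]; split.
  by apply: measurable_funD => //; exact: measurable_funM.
move=> n; apply: le_lt_trans (le_nrmD n _ mH) _; first exact: measurable_funM.
by rewrite nrmZ// lte_add_pinfty// lte_mul_pinfty// lee_fin.
Qed.

Lemma gen_small (G : F -> R) eta : (#|` eta|%fset < 2)%N -> gen c G eta = 0.
Proof.
move=> e2; rewrite /gen /L0 /W.
have H x1 x2 : x1 \in (eta : {fset E}) -> x2 \in (eta `\ x1)%fset -> False.
  move=> x1e x2e; move: e2.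
  by rewrite (cardfsD1 x1 eta) x1e (cardfsD1 x2 (eta `\ x1)%fset) x2e.
rewrite big1_seq; last first.
  by move=> x1 /= x1e; rewrite big1_seq// => x2 /= x2e; case: (H _ _ x1e x2e).
rewrite mulr0 add0r big1_seq// => x1 /= x1e.
by rewrite big1_seq// => x2 /= x2e; case: (H _ _ x1e x2e).
Qed.

Lemma B_ge0 : 0 <= B c.
Proof.
exact: (addr_ge0 (fine_ge0 (c3_ge0 jr)) (fine_ge0 (c4_ge0 jr))).
Qed.

Lemma ae_pair_sum_a2 : {ae lp, forall eta : F,
  (pair_sum (fun x _ => a2 c x) eta <= (trate c eta)%:E)%E}.
Proof.
apply: filterS2 (ae_pairs d0 a21) (ae_rate_le c d0) => eta h r.
rewrite /trate -sumEFin /pair_sum big_seq [leRHS]big_seq; apply: lee_sum => x1 x1e.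
rewrite -sumEFin big_seq [leRHS]big_seq; apply: lee_sum => x2 x2e.
rewrite (rateE jr); first exact: h.
by apply: le_lt_trans c1oo; exact: r.
Qed.

Lemma muleDl_fine (a b N : \bar R) (p : R) : (0 <= a)%E -> (0 <= b)%E ->
  (a < +oo)%E -> (b < +oo)%E ->
  (a * (p%:E * N) + b * (p%:E * N) = (p * (fine b + fine a))%:E * N)%E.
Proof.
case: a => [a| |]//; case: b => [b| |]// a0 b0 _ _.
by rewrite -ge0_muleDl// muleA -EFinD -EFinM mulrC [b + a]addrC.
Qed.

(* As [a2 <= a1], the gain of mass from level [n] is compensated by the loss,
   and only the terms coming from [W] at level [n-1] can increase the norm. *)
Lemma nrm_euler_step (G : F -> R) (s : R) n : locint G -> 0 <= s ->
  s * ((n * n)%:R * c1r c) <= 1 ->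
  (nrm n (fun eta => (G eta + s * gen c G eta)%R)
     <= nrm n G + (s * n.-1%:R * B c)%:E * nrm n.-1 G)%E.
Proof.
move=> lG s0 sn; have [mG Goo] := lG.
have mA := measurable_gen jr mG.
have Bge0 : (0 <= (s * n.-1%:R * B c)%:E)%E by rewrite lee_fin !mulr_ge0 ?B_ge0.
have [n2|n2] := ltnP n 2.
  rewrite -[leLHS]adde0; apply: leeD; last by rewrite mule_ge0 ?nrm_ge0.
  rewrite le_eqVlt; apply/orP; left; apply/eqP; apply: eq_integral => eta _.
  rewrite /lev; case: eqP => [en|]; last by rewrite !mul0e.
  by rewrite gen_small ?en// mulr0 addr0.
case: n n2 sn Bge0 => [//|[//|k]] _ sn Bge0.
pose h2 (x : E * E) (xi : F) := (\int[mm]_y (cE c x y * `|G (conf_cons2 y xi)|%:E))%E.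
pose h1 (x : E * E) (xi : F) := (\int[mm]_y (cE c x y * `|G (y.1 |` xi)%fset|%:E))%E.
pose h0 (x : E * E) (xi : F) := (a1 c x * `|G (x.2 |` xi)%fset|%:E)%E.
have h2p x xi : (0 <= h2 x xi)%E.
  by apply: integral_ge0 => y _; rewrite mule_ge0 ?(cE_ge0 jr)// lee_fin.
have h1p x xi : (0 <= h1 x xi)%E.
  by apply: integral_ge0 => y _; rewrite mule_ge0 ?(cE_ge0 jr)// lee_fin.
have h0p x xi : (0 <= h0 x xi)%E by rewrite mule_ge0 ?(a1_ge0 jr)// lee_fin.
have mg1 : measurable_fun setT (fun z : E * E * F => `|G (z.1.1 |` z.2)%fset|%:E).
  apply: (measurableT_comp (measurable_norm_cons1 mG) (g := fun z : E * E * F => (z.1.1, z.2))).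
  by apply/measurable_fun_pair => //=; exact: measurableT_comp.
have mp2 : measurable_fun setT (pair_sum h2).
  apply: measurable_pair_sum1 => //.
  by apply: (measurable_cE_int jr (g := fun y xi => `|G (conf_cons2 y xi)|%:E)) => //; exact: measurable_norm_cons2.
have mp1 : measurable_fun setT (pair_sum h1).
  apply: measurable_pair_sum1 => //.
  exact: (measurable_cE_int jr (g := fun y xi => `|G (y.1 |` xi)%fset|%:E)).
have mp0 : measurable_fun setT (pair_sum h0).
  apply: measurable_pair_sum1 => //; apply: emeasurable_funM.
    exact: (measurableT_comp (measurable_a1 jr) measurable_fst).
  apply: (measurableT_comp (measurable_norm_cons1 mG) (g := fun z : E * E * F => (z.1.2, z.2))).
  by apply/measurable_fun_pair => //=; exact: measurableT_comp.
have ml (n : nat) (g : F -> \bar R) : measurable_fun setT g -> measurable_fun setT (fun eta => lev n eta * g eta)%E.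
  by move=> mg; apply: emeasurable_funM => //; exact: measurable_lev.
have lp0 n (y : \bar R) (eta : F) : (0 <= y)%E -> (0 <= lev n eta * y)%E.
  by move=> y0; rewrite mule_ge0 ?lev_ge0.
(* The diagonal coefficient is nonnegative on this level off a null set; the truncation makes the
   integrand nonnegative everywhere. *)
pose u eta := Num.max 0 (1 - s * 2^-1 * trate c eta).
have u0 eta : 0 <= u eta by rewrite /u le_max lexx.
have mu : measurable_fun setT u.
  apply: measurable_maxr => //; apply: measurable_funB => //.
  by apply: measurable_funM => //; exact: measurable_trate.
have s20 : 0 <= s * 2^-1 by rewrite mulr_ge0.
pose f1 eta := (lev k.+2 eta * ((u eta)%:E * `|G eta|%:E))%E.
have f10 eta : (0 <= f1 eta)%E by apply: lp0; rewrite mule_ge0 ?lee_fin.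
have mGE : measurable_fun setT (fun eta => `|G eta|%:E).
  by apply/measurable_EFinP; exact: measurableT_comp.
have mf1 : measurable_fun setT f1.
  by apply: ml; apply: emeasurable_funM => //; exact/measurable_EFinP.
have ml2 := ml k.+2 _ mp2; have ml1 := ml k.+2 _ mp1; have ml0 := ml k.+2 _ mp0.
have l20 eta : (0 <= lev k.+2 eta * pair_sum h2 eta)%E by apply: lp0; exact: pair_sum_ge0.
have l10 eta : (0 <= lev k.+2 eta * pair_sum h1 eta)%E by apply: lp0; exact: pair_sum_ge0.
have l00 eta : (0 <= lev k.+2 eta * pair_sum h0 eta)%E by apply: lp0; exact: pair_sum_ge0.
pose f2 eta := ((s * 2^-1)%:E * (lev k.+2 eta * pair_sum h2 eta))%E.
pose f3 eta := (s%:E * (lev k.+2 eta * pair_sum h1 eta))%E.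
pose f4 eta := (s%:E * (lev k.+2 eta * pair_sum h0 eta))%E.
have f20 eta : (0 <= f2 eta)%E by rewrite mule_ge0 ?lee_fin.
have f30 eta : (0 <= f3 eta)%E by rewrite mule_ge0 ?lee_fin.
have f40 eta : (0 <= f4 eta)%E by rewrite mule_ge0 ?lee_fin.
have mf2 : measurable_fun setT f2 := measurable_funeM (s * 2^-1)%:E ml2.
have mf3 : measurable_fun setT f3 := measurable_funeM s%:E ml1.
have mf4 : measurable_fun setT f4 := measurable_funeM s%:E ml0.
have f12_0 eta : (0 <= f1 eta + f2 eta)%E by rewrite adde_ge0.
have mf12 : measurable_fun setT (fun eta => f1 eta + f2 eta)%E := emeasurable_funD mf1 mf2.
have f123_0 eta : (0 <= f1 eta + f2 eta + f3 eta)%E by rewrite adde_ge0.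
have mf123 : measurable_fun setT (fun eta => f1 eta + f2 eta + f3 eta)%E := emeasurable_funD mf12 mf3.
have step : (nrm k.+2 (fun eta => (G eta + s * gen c G eta)%R) <=
    \int[lp]_eta (f1 eta + f2 eta + f3 eta + f4 eta))%E.
  apply: ae_ge0_le_integral => //.
  - by move=> eta _; exact: (lev_norm_ge0 k.+2 (fun x => G x + s * gen c G x)).
  - by apply: measurable_lev_norm; apply: measurable_funD => //; exact: measurable_funM.
  - by move=> eta _; rewrite adde_ge0.
  - exact: emeasurable_funD.
  - apply: filterS2 (ae_good jr d0 c1oo c2oo c4oo lG) (ae_trate_le jr d0 c1oo) => eta ge te _.
    have [en|en] := eqVneq (#|` eta|%fset) k.+2; last first.
      rewrite /f1 /f2 /f3 /f4 (_ : lev k.+2 eta = 0%E) ?mul0e ?mule0 ?adde0//.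
      by rewrite /lev (negbTE en).
    have st : s * trate c eta <= 1.
      by apply: le_trans sn; rewrite ler_wpM2l// -en.
    have := euler_step_le jr mG ge s0 st.
    have l1 : lev k.+2 eta = 1%E by rewrite /lev en eqxx.
    rewrite /f1 /f2 /f3 /f4 l1 !mul1e => /le_trans; apply.
    by rewrite !leeD2r// lee_wpmul2r ?lee_fin// /u le_max lexx orbT.
apply: le_trans step _.
rewrite ge0_integralD// ge0_integralD//.
(* The diagonal term and the gain on the same level are together at most the norm of G there,
   because [a2] is at most [a1]. The two terms coming from k+1 points give the summand with [B]. *)
rewrite -addeA; apply: leeD.
  rewrite ge0_integralD// /f2 ge0_integralZl//.
  rewrite [X in (_ + _ * X)%E](integral_gain2 mG jr d0 k).
  have ma2 : measurable_fun setT (fun eta : F => pair_sum (fun x _ => a2 c x) eta).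
    apply: measurable_pair_sum1 => [x xi|]; first exact: (a2_ge0 jr).
    exact: (measurableT_comp (measurable_a2 jr) measurable_fst).
  have a20 eta : (0 <= pair_sum (fun x _ => a2 c x) (eta : F))%E.
    by apply: pair_sum_ge0 => x xi; exact: (a2_ge0 jr).
  have mpa : measurable_fun setT (fun eta => lev k.+2 eta * (pair_sum (fun x _ => a2 c x) eta * `|G eta|%:E))%E.
    by apply: ml; exact: emeasurable_funM.
  have pa0 eta : (0 <= lev k.+2 eta * (pair_sum (fun x _ => a2 c x) eta * `|G eta|%:E))%E.
    by apply: lp0; rewrite mule_ge0 ?lee_fin.
  have mpa2 := measurable_funeM (s * 2^-1)%:E mpa.
  have pa20 eta : (0 <= (s * 2^-1)%:E * (lev k.+2 eta * (pair_sum (fun x _ => a2 c x) eta * `|G eta|%:E)))%E.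
    by rewrite mule_ge0 ?lee_fin.
  rewrite -ge0_integralZl// -ge0_integralD//.
  apply: ae_ge0_le_integral => //.
  - by move=> eta _; rewrite adde_ge0.
  - exact: emeasurable_funD.
  - by move=> eta _; exact: lev_norm_ge0.
  - exact: measurable_lev_norm.
  - apply: filterS2 ae_pair_sum_a2 (ae_trate_le jr d0 c1oo) => eta pe te _.
    have [en|en] := eqVneq (#|` eta|%fset) k.+2; last first.
      by rewrite /f1 (_ : lev k.+2 eta = 0%E) ?mul0e ?mule0 ?adde0// /lev (negbTE en).
    have st : s * trate c eta <= 1.
      by apply: le_trans sn; rewrite ler_wpM2l// -en.
    have l1 : lev k.+2 eta = 1%E by rewrite /lev en eqxx.
    rewrite /f1 l1 !mul1e.
    apply: (@le_trans _ _ ((u eta)%:E * `|G eta|%:E + (s * 2^-1)%:E * ((trate c eta)%:E * `|G eta|%:E))%E).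
      by apply: leeD => //; apply: lee_wpmul2l; rewrite ?lee_fin//; apply: lee_wpmul2r; rewrite ?lee_fin.
    rewrite -!EFinM -EFinD lee_fin mulrA -mulrDl -[leRHS]mul1r ler_wpM2r//.
    have t0 := trate_ge0 jr eta.
    by have := mulr_ge0 s0 t0; rewrite /u; case: (ger0P (1 - s * 2^-1 * trate c eta)) => h; lra.
rewrite /f3 /f4 !ge0_integralZl// -ge0_muleDr ?integral_ge0//.
rewrite /= -mulrA EFinM -muleA; apply: lee_wpmul2l; first by rewrite lee_fin.
apply: le_trans (leeD (integral_gain1 mG jr d0 k (c4_ge0 jr)) (integral_loss1 mG jr d0 k (c3_ge0 jr))) _.
by rewrite (muleDl_fine _ _ (c4_ge0 jr) (c3_ge0 jr) c4oo c3oo).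
Qed.

End contraction.

(** * Exponential power sums *)

Section power_sums.
Context {R : realType}.
Implicit Types (v a : nat -> R) (t T K h : R).

Definition absd T v : \bar R := (\sum_(j <oo) (T ^+ j / j`!%:R * `|v j|)%:E)%E.

(* [limn_esup] keeps the sum measurable in a parameter without a convergence
   hypothesis. *)
Definition psum t v : R :=
  fine (limn_esup (fun N => (\sum_(j < N) t ^+ j / j`!%:R * v j)%:E)).

Lemma absd_term_ge0 T v j : 0 <= T -> (0 <= (T ^+ j / j`!%:R * `|v j|)%:E)%E.
Proof. by move=> T0; rewrite lee_fin !mulr_ge0// ?exprn_ge0 ?invr_ge0. Qed.

Lemma absd_ge0 T v : 0 <= T -> (0 <= absd T v)%E.
Proof. by move=> T0; apply: nneseries_ge0 => j _ _; exact: absd_term_ge0. Qed.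

Lemma le_absd T T' v : 0 <= T -> T <= T' -> (absd T v <= absd T' v)%E.
Proof.
move=> T0 TT'; apply: lee_nneseries => [j _ _|j _]; first exact: absd_term_ge0.
rewrite lee_fin ler_wpM2r// ler_wpM2r ?invr_ge0// lerXn2r ?nnegrE//.
exact: le_trans TT'.
Qed.

Lemma absd_partial T v N : 0 <= T -> (absd T v < +oo)%E ->
  \sum_(j < N) T ^+ j / j`!%:R * `|v j| <= fine (absd T v).
Proof.
move=> T0 Tv; rewrite -lee_fin fineK ?ge0_fin_numE ?absd_ge0// -sumEFin.
have := @nneseries_lim_ge R (fun j => (T ^+ j / j`!%:R * `|v j|)%:E) xpredT 0 N.
by rewrite big_mkord; apply => j _ _; exact: absd_term_ge0.
Qed.

Lemma dominated_partial a T K v N : 0 <= T -> 0 <= K ->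
  (forall j, `|a j| <= K * (T ^+ j / j`!%:R)) -> (absd T v < +oo)%E ->
  \sum_(j < N) `|a j * v j| <= K * fine (absd T v).
Proof.
move=> T0 K0 aT Tv; apply: le_trans (ler_wpM2l K0 (absd_partial N T0 Tv)).
rewrite mulr_sumr; apply: ler_sum => j _.
by rewrite normrM mulrA ler_wpM2r.
Qed.

Lemma dominated_series_cvg a T K v : 0 <= T -> 0 <= K ->
  (forall j, `|a j| <= K * (T ^+ j / j`!%:R)) -> (absd T v < +oo)%E ->
  cvgn (fun N => \sum_(j < N) a j * v j).
Proof.
move=> T0 K0 aT Tv.
have -> : (fun N => \sum_(j < N) a j * v j) = series (fun j => a j * v j).
  by apply/funext => N; rewrite /series/= big_mkord.
apply: normed_cvg; apply: nondecreasing_is_cvgn.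
  apply/nondecreasing_seqP => N /=; by rewrite /series/= big_nat_recr//= lerDl.
exists (K * fine (absd T v)) => _ [N _ <-] /=; rewrite /series/= big_mkord.
exact: dominated_partial.
Qed.

Lemma dominated_le a T K v l : 0 <= T -> 0 <= K ->
  (forall j, `|a j| <= K * (T ^+ j / j`!%:R)) -> (absd T v < +oo)%E ->
  (\sum_(j < N) a j * v j) @[N --> \oo] --> l -> `|l| <= K * fine (absd T v).
Proof.
move=> T0 K0 aT Tv /cvg_norm al; rewrite -(cvg_lim _ al)//.
apply: limr_le; first by apply/cvg_ex; exists `|l|.
apply: nearW => N; apply: le_trans (ler_norm_sum _ _ _) _.
exact: dominated_partial.
Qed.

Lemma psum_cvg t v : (absd `|t| v < +oo)%E ->
  (\sum_(j < N) t ^+ j / j`!%:R * v j) @[N --> \oo] --> psum t v.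
Proof.
move=> tv.
have cv : cvgn (fun N => \sum_(j < N) t ^+ j / j`!%:R * v j).
  apply: (@dominated_series_cvg (fun j => t ^+ j / j`!%:R) `|t| 1) => // j.
  by rewrite mul1r normrM normrX normfV normr_nat.
rewrite (_ : psum t v = limn (fun N => \sum_(j < N) t ^+ j / j`!%:R * v j))//.
rewrite /psum (_ : limn_esup _ = (limn (fun N => \sum_(j < N) t ^+ j / j`!%:R * v j))%:E)//.
by apply: (cvg_limn_einf_sup _).2; apply: cvg_EFin => //; exact: nearW.
Qed.

Lemma psum0 v : psum 0 v = v 0%N.
Proof.
rewrite /psum (_ : limn_esup _ = (v 0%N)%:E)//.
apply: (cvg_limn_einf_sup _).2; rewrite -(cvg_shiftS _).
rewrite (_ : [sequence _]_n = fun=> (v 0%N)%:E); first exact: cvg_cst.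
apply/funext => N /=; congr EFin; rewrite big_ord_recl/= expr0 fact0 divr1 mul1r big1 ?addr0// => j _.
by rewrite /bump/= add1n expr0n/= !mul0r.
Qed.

(** The remainder is h^2 times a polynomial in h with nonnegative coefficients. For |h| at most 1
    its modulus is bounded by its value at h = 1, which is the factor on the right. *)
Lemma expr_taylor2 t h j : 0 <= t -> `|h| <= 1 ->
  `|(t + h) ^+ j - t ^+ j - h * (j%:R * t ^+ j.-1)| <=
  h ^+ 2 * ((1 + t) ^+ j - t ^+ j - j%:R * t ^+ j.-1).
Proof.
move=> t0 h1; elim: j => [|[|j] IH] /=.
- by rewrite !expr0 !mul0r mulr0 !subr0 subrr normr0 mulr0.
- rewrite !expr1 expr0 !mulr1 (_ : t + h - t - h = 0); last by lra.
  by rewrite normr0 (_ : 1 + t - t - 1 = 0) ?mulr0//; lra.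
rewrite /= in IH.
have -> : (t + h) ^+ j.+2 - t ^+ j.+2 - h * (j.+2%:R * t ^+ j.+1) =
    (t + h) * ((t + h) ^+ j.+1 - t ^+ j.+1 - h * (j.+1%:R * t ^+ j)) +
    h ^+ 2 * (j.+1%:R * t ^+ j).
  by rewrite (exprS (t + h) j.+1) !(exprS t) expr2 -[j.+2%:R]natr1; lra.
have -> : (1 + t) ^+ j.+2 - t ^+ j.+2 - j.+2%:R * t ^+ j.+1 =
    (1 + t) * ((1 + t) ^+ j.+1 - t ^+ j.+1 - j.+1%:R * t ^+ j) + j.+1%:R * t ^+ j.
  by rewrite (exprS (1 + t) j.+1) !(exprS t) -[j.+2%:R]natr1; lra.
rewrite [leRHS]mulrDr; apply: le_trans (ler_normD _ _) _; apply: lerD; last first.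
  by rewrite ger0_norm// mulr_ge0 ?sqr_ge0// mulr_ge0// exprn_ge0.
rewrite normrM [leRHS]mulrCA; apply: ler_pM => //.
by apply: le_trans (ler_normD _ _) _; rewrite ger0_norm// addrC lerD2r.
Qed.

Definition dcoef t (j : nat) : R := if j is i.+1 then t ^+ i / i`!%:R else 0.

Lemma dcoefE t j : dcoef t j = j%:R * t ^+ j.-1 / j`!%:R.
Proof.
case: j => [|j]; first by rewrite /= !mul0r.
by rewrite /= factS natrM invfM mulrACA divff ?mul1r// pnatr_eq0.
Qed.

(** The Taylor remainder of the j-th coefficient is at most h^2 (1 + t)^j / j!, so the remainders
    sum to h^2 times the dominating series at 1 + t. *)
Lemma psum_deriv t h v : 0 <= t -> `|h| <= 1 -> (absd (1 + t) v < +oo)%E ->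
  `|psum (t + h) v - psum t v - h * psum t (fun j => v j.+1)| <=
  h ^+ 2 * fine (absd (1 + t) v).
Proof.
move=> t0 h1 tv.
have t1 : 0 <= 1 + t by rewrite addr_ge0.
have fac j : 0 <= j`!%:R^-1 :> R by rewrite invr_ge0.
have th : `|t + h| <= 1 + t.
  by apply: le_trans (ler_normD _ _) _; rewrite ger0_norm// addrC lerD2r.
have c1 := psum_cvg (le_lt_trans (le_absd v (normr_ge0 _) th) tv).
have c2 : (\sum_(j < N) t ^+ j / j`!%:R * v j) @[N --> \oo] --> psum t v.
  apply: psum_cvg; apply: le_lt_trans tv; apply: le_absd => //.
  by rewrite ger0_norm// lerDr.
have bern j : j%:R * t ^+ j.-1 <= (1 + t) ^+ j.
  have := @expr_taylor2 t 1 j t0; rewrite normr1 lexx => /(_ isT) /(le_trans (normr_ge0 _)).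
  by rewrite expr1n mul1r; have := exprn_ge0 j t0; lra.
have tv' : (absd `|t| (fun j => v j.+1) < +oo)%E.
  rewrite ger0_norm//; apply: le_lt_trans tv.
  rewrite {2}/absd nneseries_recl//; last by move=> j _; exact: absd_term_ge0.
  rewrite -[leLHS]add0e; apply: leeD; first exact: absd_term_ge0.
  rewrite -(nneseries_addn 1); last by move=> j; exact: absd_term_ge0.
  apply: lee_nneseries => [j _ _|j _]; first exact: (@absd_term_ge0 t (fun j => v j.+1) j).
  rewrite addn1 lee_fin ler_wpM2r//.
  by have := dcoefE t j.+1 => /= ->; rewrite ler_wpM2r.
have c3 : (\sum_(j < N) dcoef t j * v j) @[N --> \oo] --> psum t (fun j => v j.+1).
  rewrite -(cvg_shiftS _); have := psum_cvg tv'.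
  rewrite (_ : (fun N => \sum_(j < N) t ^+ j / j`!%:R * v j.+1) =
    [sequence \sum_(j < n.+1) dcoef t j * v j]_n)//.
  by apply/funext => N; rewrite /= big_ord_recl/= mul0r add0r.
apply: (@dominated_le (fun j => (t + h) ^+ j / j`!%:R - t ^+ j / j`!%:R - h * dcoef t j) (1 + t)) => //.
- exact: sqr_ge0.
- move=> j; rewrite dcoefE [h * _]mulrA -!mulrBl normrM (ger0_norm (fac j)) [leRHS]mulrA ler_wpM2r//.
  apply: le_trans (expr_taylor2 j t0 h1) _; rewrite ler_wpM2l ?sqr_ge0//.
  by rewrite -addrA -opprD gerBl addr_ge0 ?mulr_ge0 ?exprn_ge0.
- rewrite (_ : (fun N => _) = (fun N => (\sum_(j < N) (t + h) ^+ j / j`!%:R * v j) -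
     (\sum_(j < N) t ^+ j / j`!%:R * v j) - h * (\sum_(j < N) dcoef t j * v j))).
    by apply: cvgB; [exact: cvgB|apply: cvgM => //; exact: cvg_cst].
  apply/funext => N; rewrite mulr_sumr -!sumrB; apply: eq_bigr => j _.
  by rewrite !mulrBl mulrA.
Qed.

(** For j at least N the power t^j = 2^-j (2t)^j is at most 2^-N (2t)^j; hence the dominating series
    at twice the time. *)
Lemma psum_tail t v N : 0 <= t -> (absd (2 * t) v < +oo)%E ->
  `|psum t v - \sum_(j < N) t ^+ j / j`!%:R * v j| <= 2^-1 ^+ N * fine (absd (2 * t) v).
Proof.
move=> t0 tv.
have fac j : 0 <= j`!%:R^-1 :> R by rewrite invr_ge0.
have t2 : 0 <= 2 * t by rewrite mulr_ge0.
have c2 : (\sum_(j < M) t ^+ j / j`!%:R * v j) @[M --> \oo] --> psum t v.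
  apply: psum_cvg; apply: le_lt_trans tv; apply: le_absd => //.
  by rewrite ger0_norm//; lra.
apply: (@dominated_le (fun j => if (j < N)%N then 0 else t ^+ j / j`!%:R) (2 * t)) => //.
- move=> j; case: ltnP => [_|Nj].
    by rewrite normr0 !mulr_ge0 ?exprn_ge0.
  rewrite ger0_norm ?mulr_ge0 ?exprn_ge0// mulrA ler_wpM2r// exprMn mulrA.
  rewrite -[leLHS]mul1r ler_wpM2r ?exprn_ge0//.
  rewrite exprVn mulrC ler_pdivlMr ?exprn_gt0// mul1r ler_eXn2l//.
  by rewrite ltr1n.
- have : (\sum_(j < M) t ^+ j / j`!%:R * v j - \sum_(j < N) t ^+ j / j`!%:R * v j) @[M --> \oo]
     --> psum t v - \sum_(j < N) t ^+ j / j`!%:R * v j.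
    by apply: cvgB => //; exact: cvg_cst.
  apply: cvg_trans; apply: near_eq_cvg; exists N => // M /= NM.
  rewrite -(big_mkord xpredT (fun j => t ^+ j / j`!%:R * v j)) (big_cat_nat (n := N))//=.
  rewrite -(big_mkord xpredT (fun j => t ^+ j / j`!%:R * v j)) addrAC subrr add0r.
  rewrite -(big_mkord xpredT (fun j => (if (j < N)%N then 0 else t ^+ j / j`!%:R) * v j)).
  rewrite [RHS](big_cat_nat (n := N))//= [X in _ = X + _](_ : _ = 0) ?add0r; last first.
    by rewrite big_nat_cond big1// => j /andP[/andP[_ ->]] _; rewrite mul0r.
  by apply: eq_big_nat => j /andP[Nj _]; rewrite ltnNge Nj.
Qed.

(** The quotient is the product of the factors 1 - i/N for i < j. It is at least one minus the sum
    of the i/N, and that sum is at most j^2/N. *)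
Lemma ffact_ratio N j : (0 < N)%N ->
  (1 - (j * j)%:R / N%:R <= (N ^_ j)%:R / N%:R ^+ j :> R) /\
  ((N ^_ j)%:R / N%:R ^+ j <= 1 :> R).
Proof.
move=> N0; have N0' : 0 < N%:R :> R by rewrite ltr0n.
elim: j => [|j [l u]]; first by rewrite ffactn0 expr0 divr1 mul0n mul0r subr0 lexx.
have -> : (N ^_ j.+1)%:R / N%:R ^+ j.+1 = (N ^_ j)%:R / N%:R ^+ j * ((N - j)%:R / N%:R) :> R.
  by rewrite ffactnSr natrM exprSr invfM mulrACA.
set p := (N ^_ j)%:R / N%:R ^+ j in l u *.
have p0 : 0 <= p by rewrite divr_ge0// exprn_ge0.
have q0 : 0 <= (N - j)%:R / N%:R :> R by rewrite divr_ge0.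
have q1 : (N - j)%:R / N%:R <= 1 :> R by rewrite ler_pdivrMr// mul1r ler_nat leq_subr.
have q2 : 1 - j%:R / N%:R <= (N - j)%:R / N%:R :> R.
  rewrite -{1}(divff (lt0r_neq0 N0')) -mulrBl ler_wpM2r ?invr_ge0 ?(ltW N0')//.
  by rewrite lerBlDr -natrD ler_nat addnC -leq_subLR.
split; last by rewrite -[leRHS]mulr1 ler_pM.
have q3 : p * (1 - j%:R / N%:R) <= p * ((N - j)%:R / N%:R) by rewrite ler_wpM2l.
apply: le_trans q3; rewrite mulrBr mulr1.
have : p * (j%:R / N%:R) <= j%:R / N%:R.
  by rewrite -[leRHS]mul1r ler_wpM2r// divr_ge0.
move=> q4; apply: le_trans (lerB l q4).
rewrite -addrA lerD2l -opprD lerN2 -mulrDl ler_wpM2r ?invr_ge0 ?(ltW N0')//.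
by rewrite -natrD ler_nat mulSn mulnS addnC leq_addl.
Qed.

(** A coefficientwise comparison of (1 + t/N)^N with the exponential series. The relative error of
    the j-th coefficient is at most j^2/N, and j < 2^j absorbs j^2 into 4^j; hence the dominating
    series at 4t. *)
Lemma psum_euler t v N : (0 < N)%N -> 0 <= t -> (absd (4 * t) v < +oo)%E ->
  `|\sum_(j < N.+1) 'C(N, j)%:R * (t / N%:R) ^+ j * v j - psum t v| <=
  N%:R^-1 * fine (absd (4 * t) v).
Proof.
move=> N0 t0 tv.
have fac j : 0 <= j`!%:R^-1 :> R by rewrite invr_ge0.
have t4 : 0 <= 4 * t by rewrite mulr_ge0.
have N0' : 0 < N%:R :> R by rewrite ltr0n.
have c2 : (\sum_(j < M) t ^+ j / j`!%:R * v j) @[M --> \oo] --> psum t v.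
  apply: psum_cvg; apply: le_lt_trans tv; apply: le_absd => //.
  by rewrite ger0_norm//; lra.
apply: (@dominated_le (fun j => 'C(N, j)%:R * (t / N%:R) ^+ j - t ^+ j / j`!%:R) (4 * t)) => //.
- move=> j.
  have aux (C f n u : R) : f != 0 -> C * (u * n) = C * f * n * (u * f^-1).
    move=> f0; have -> : C * f * n * (u * f^-1) = f * f^-1 * (C * (u * n)) by lra.
    by rewrite divff ?mul1r.
  have [l u] := ffact_ratio j N0.
  have -> : 'C(N, j)%:R * (t / N%:R) ^+ j = ((N ^_ j)%:R / N%:R ^+ j) * (t ^+ j / j`!%:R) :> R.
    by rewrite -bin_ffact natrM expr_div_n; apply: aux; rewrite pnatr_eq0 -lt0n fact_gt0.
  have s0 : 0 <= t ^+ j / j`!%:R by rewrite mulr_ge0 ?exprn_ge0.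
  rewrite -[X in _ - X]mul1r -mulrBl normrM (ger0_norm s0) exprMn -mulrA [leRHS]mulrA.
  rewrite ler_wpM2r// ler0_norm ?subr_le0// opprB.
  apply: (@le_trans _ _ ((j * j)%:R / N%:R)); first by lra.
  rewrite mulrC ler_wpM2l ?invr_ge0 ?(ltW N0')// -natrX ler_nat.
  by rewrite (_ : 4 = 2 * 2)%N// expnMn leq_mul// ltnW// ltn_expl.
- have : (\sum_(j < N.+1) 'C(N, j)%:R * (t / N%:R) ^+ j * v j - \sum_(j < M) t ^+ j / j`!%:R * v j) @[M --> \oo]
     --> \sum_(j < N.+1) 'C(N, j)%:R * (t / N%:R) ^+ j * v j - psum t v.
    by apply: cvgB => //; exact: cvg_cst.
  apply: cvg_trans; apply: near_eq_cvg; exists N.+1 => // M /= NM.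
  under [RHS]eq_bigr do rewrite mulrBl.
  rewrite sumrB; congr (_ - _).
  rewrite -(big_mkord xpredT (fun j => 'C(N, j)%:R * (t / N%:R) ^+ j * v j)).
  rewrite -(big_mkord xpredT (fun j => 'C(N, j)%:R * (t / N%:R) ^+ j * v j)).
  rewrite [RHS](big_cat_nat (n := N.+1))//= [X in _ = _ + X](_ : _ = 0) ?addr0//.
  by rewrite big_nat_cond big1// => j /andP[/andP[Nj _] _]; rewrite bin_small// !mul0r.
Qed.

End power_sums.

(** * The evolution V(t) *)

Section semigroup.
Context {R : realType} {d : nat}.
Local Notation E := (euclid R d).
Local Notation F := (fconf R d).
Local Notation m := (lebesgue_space R d).
Local Notation mm := (prodm m m).
Local Notation lp := (@lpm R d).
Variable c : E -> E -> E -> E -> R.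
Hypothesis jr : jump_rate c.
Hypothesis d0 : (0 < d)%N.
Hypotheses (c1oo : (c1 c < +oo)%E) (c2oo : (c2 c < +oo)%E)
  (c3oo : (c3 c < +oo)%E) (c4oo : (c4 c < +oo)%E).
Hypothesis a21 : {ae mm, forall x, (a2 c x <= a1 c x)%E}.

Local Notation rn n G := (fine (nrm n G)).

Lemma rn_ge0 n (G : F -> R) : 0 <= rn n G.
Proof. by apply: fine_ge0; exact: nrm_ge0. Qed.

Lemma rnE n (G : F -> R) : locint G -> (rn n G)%:E = nrm n G.
Proof. by move=> [_ Goo]; rewrite fineK// ge0_fin_numE// nrm_ge0. Qed.

Lemma le_rn n (G H : F -> R) : locint G -> locint H ->
  {ae lp, forall eta, `|G eta| <= `|H eta|} -> rn n G <= rn n H.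
Proof.
move=> lG lH GH; rewrite -lee_fin (rnE n lG) (rnE n lH).
by apply: nrm_le => //; [case: lG|case: lH].
Qed.

Lemma rn_lin n a (G H : F -> R) : locint G -> locint H ->
  rn n (fun eta => a * G eta + H eta) <= `|a| * rn n G + rn n H.
Proof.
move=> lG lH; rewrite -lee_fin (rnE n (locint_lin a lG lH)) EFinD EFinM (rnE n lG) (rnE n lH).
have [mG _] := lG; have [mH _] := lH.
apply: le_trans (le_nrmD n _ mH) _; first exact: measurable_funM.
by rewrite nrmZ.
Qed.

Lemma ae_locint (G H : F -> R) : measurable_fun setT G -> locint H ->
  {ae lp, forall eta, `|G eta| <= `|H eta|} -> locint G.
Proof.
move=> mG [mH Hoo] GH; split => // n.
by apply: le_lt_trans (Hoo n); exact: nrm_le.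
Qed.

(** The constant of [nrm_gen]. The first summand is 2q, where 1/q is an admissible Euler step on n
    points; the second comes from the lower level. The added 1 keeps q positive even if [c1] is
    0. *)
Definition gq (n : nat) : R := 2 * ((n * n)%:R * c1r c + 1) + n%:R * B c.

Lemma gq_ge0 n : 0 <= gq n.
Proof.
by rewrite addr_ge0 ?mulr_ge0 ?(B_ge0 jr)// addr_ge0// mulr_ge0// (c1r_ge0 jr).
Qed.

Lemma le_gq k n : (k <= n)%N -> gq k <= gq n.
Proof.
move=> kn; rewrite lerD//; last by rewrite ler_wpM2r ?(B_ge0 jr)// ler_nat.
by rewrite ler_wpM2l// lerD2r ler_wpM2r ?(c1r_ge0 jr)// ler_nat leq_mul.
Qed.

(** The estimate for the Euler step contains one for the generator: with an admissible step 1/q, the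
    generator applied to G is q times the difference between the step and G. *)
Lemma nrm_gen (G : F -> R) n : locint G ->
  (nrm n (gen c G) <= (gq n * (rn n G + rn n.-1 G))%:E)%E.
Proof.
move=> lG; have [mG Goo] := lG; have mA := measurable_gen jr mG.
pose q := (n * n)%:R * c1r c + 1.
have q0 : 0 < q by rewrite ltr_wpDl// mulr_ge0// (c1r_ge0 jr).
have sq : q^-1 * ((n * n)%:R * c1r c) <= 1.
  by rewrite mulrC ler_pdivrMr// mul1r /q lerDl.
have q0' : 0 <= q^-1 by rewrite invr_ge0 ltW.
have := nrm_euler_step jr d0 c1oo c2oo c3oo c4oo a21 lG q0' sq.
set H := (fun eta => G eta + q^-1 * gen c G eta) => HE.
have mH : measurable_fun setT H by apply: measurable_funD => //; exact: measurable_funM.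
have -> : nrm n (gen c G) = nrm n (fun eta => q * (H eta + (-1) * G eta)).
  rewrite /nrm; apply: eq_integral => eta _; congr (_ * `|_|%:E)%E.
  by rewrite /H addrAC mulN1r subrr add0r mulVKf// gt_eqF.
have mNG : measurable_fun setT (fun eta => (-1) * G eta) by exact: measurable_funM.
rewrite nrmZ; last exact: measurable_funD.
rewrite (ger0_norm (ltW q0)).
apply: (@le_trans _ _ (q%:E * ((rn n G + q^-1 * n.-1%:R * B c * rn n.-1 G) + rn n G)%:E)%E).
  apply: lee_wpmul2l; first by rewrite lee_fin ltW.
  apply: le_trans (le_nrmD n mH mNG) _.
  rewrite nrmZ// normrN1 mul1e -(rnE n lG).
  rewrite EFinD; apply: leeD => //; apply: le_trans HE _.
  by rewrite -(rnE n lG) -(rnE n.-1 lG).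
have qK : q * q^-1 = 1 by rewrite divff// gt_eqF.
rewrite -EFinM lee_fin.
have -> : q * (rn n G + q^-1 * n.-1%:R * B c * rn n.-1 G + rn n G) =
    2 * (q * rn n G) + (q * q^-1) * (n.-1%:R * B c * rn n.-1 G) by lra.
rewrite qK mul1r.
have r1 := rn_ge0 n G; have r2 := rn_ge0 n.-1 G.
have h1 : n.-1%:R * B c <= n%:R * B c by rewrite ler_wpM2r ?(B_ge0 jr)// ler_nat leq_pred.
have h2 : n.-1%:R * B c * rn n.-1 G <= n%:R * B c * rn n.-1 G by rewrite ler_wpM2r.
have h3 : 0 <= n%:R * B c * rn n G by rewrite !mulr_ge0 ?(B_ge0 jr).
have h4 : 0 <= q * rn n.-1 G by rewrite mulr_ge0// ltW.
by rewrite /gq -/q; lra.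
Qed.

Lemma locint_gen (G : F -> R) : locint G -> locint (gen c G).
Proof.
move=> lG; have [mG _] := lG; split; first exact: measurable_gen.
by move=> n; apply: le_lt_trans (nrm_gen n lG) _; exact: ltry.
Qed.

Definition orb (G : F -> R) (eta : F) (j : nat) : R := iter j (gen c) G eta.

Lemma locint_iter (G : F -> R) j : locint G -> locint (iter j (gen c) G).
Proof. by move=> lG; elim: j => //= j IH; exact: locint_gen. Qed.

(** The bound on a level involves this level and the one below, so all levels up to n are treated
    together with the largest constant [gq n]; the two terms account for the factor 2. *)
Lemma rn_iter (G : F -> R) n j k : locint G -> (k <= n)%N ->
  rn k (iter j (gen c) G) <= (2 * gq n) ^+ j * \sum_(i < n.+1) rn i G.
Proof.
move=> lG; elim: j k => [|j IH] k kn.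
  rewrite expr0 mul1r/= (bigD1 (Ordinal (kn : (k < n.+1)%N)))//= lerDl.
  by apply: sumr_ge0 => i _; exact: rn_ge0.
rewrite iterS -lee_fin (rnE k (locint_gen (locint_iter j lG))).
apply: le_trans (nrm_gen k (locint_iter j lG)) _; rewrite lee_fin exprS -mulrA.
set X := (_ ^+ j * _) in IH *.
have h : rn k (iter j (gen c) G) + rn k.-1 (iter j (gen c) G) <= 2 * X.
  by rewrite mulr2n mulrDl mul1r lerD ?IH//; exact: leq_trans (leq_pred _) kn.
rewrite (mulrC 2) -mulrA; apply: ler_pM => //; [exact: gq_ge0| |exact: le_gq].
by rewrite addr_ge0// rn_ge0.
Qed.

Lemma gen_ae_lin a (G H : F -> R) : locint G -> locint H ->
  {ae lp, forall eta, gen c (fun eta => a * G eta + H eta) eta = a * gen c G eta + gen c H eta}.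
Proof.
move=> lG lH; have [mG _] := lG; have [mH _] := lH.
apply: filterS2 (ae_good jr d0 c1oo c2oo c4oo lG) (ae_good jr d0 c1oo c2oo c4oo lH) => eta gG gH.
by rewrite gen_lin.
Qed.

(** At a single configuration the generator may see values of G on a null set. Its norms, however,
    vanish with those of G. *)
Lemma gen_ae0 (G : F -> R) : measurable_fun setT G ->
  {ae lp, forall eta, G eta = 0} -> {ae lp, forall eta, gen c G eta = 0}.
Proof.
move=> mG G0.
have n0 n : nrm n G = 0%E.
  apply/eqP; rewrite eq_le nrm_ge0 andbT.
  apply: (@le_trans _ _ (nrm n (fun=> 0))).
    by apply: nrm_le => //; apply: filterS G0 => eta ->.
  by rewrite /nrm integral0_eq// => eta _; rewrite normr0 mule0.
have lG : locint G by split => // n; rewrite n0.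
apply: nrm0_ae; first exact: measurable_gen.
move=> n; apply/eqP; rewrite eq_le nrm_ge0 andbT.
by apply: le_trans (nrm_gen n lG) _; rewrite !n0/= addr0 mulr0.
Qed.

Lemma gen_ae_eq (G H : F -> R) : locint G -> locint H ->
  {ae lp, forall eta, G eta = H eta} -> {ae lp, forall eta, gen c G eta = gen c H eta}.
Proof.
move=> lG lH GH; have lD := locint_lin (-1) lG lH; have [mD _] := lD.
have D0 : {ae lp, forall eta, -1 * G eta + H eta = 0}.
  by apply: filterS GH => eta ->; rewrite mulN1r addNr.
apply: filterS2 (gen_ae_lin (-1) lG lH) (gen_ae0 mD D0) => eta -> /eqP.
by rewrite mulN1r addrC subr_eq0 => /eqP.
Qed.

Lemma locint0 : locint (fun _ : F => 0 : R).
Proof.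
split => // n; rewrite /nrm (_ : (\int[_]__ _ = 0)%E)//.
by rewrite integral0_eq// => eta _; rewrite normr0 mule0.
Qed.

Lemma locint_sum (a : nat -> R) (u : nat -> F -> R) N : (forall j, locint (u j)) ->
  locint (fun eta => \sum_(j < N) a j * u j eta).
Proof.
move=> lu; elim: N => [|N IH].
  by under eq_fun do rewrite big_ord0; exact: locint0.
under eq_fun do rewrite big_ord_recr/= addrC.
exact: locint_lin.
Qed.

Lemma gen_ae_sum (a : nat -> R) (u : nat -> F -> R) N : (forall j, locint (u j)) ->
  {ae lp, forall eta, gen c (fun eta => \sum_(j < N) a j * u j eta) eta =
    \sum_(j < N) a j * gen c (u j) eta}.
Proof.
move=> lu; elim: N => [|N IH].
  have -> : (fun eta : F => \sum_(j < 0) a j * u j eta) = (fun=> 0).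
    by apply/funext => eta; rewrite big_ord0.
  have [m0 _] := locint0; have h : {ae lp, forall eta, (fun _ : F => 0 : R) eta = 0} by apply: aeW.
  by apply: filterS (gen_ae0 m0 h) => eta ->; rewrite big_ord0.
have -> : (fun eta : F => \sum_(j < N.+1) a j * u j eta) =
    (fun eta => a N * u N eta + \sum_(j < N) a j * u j eta).
  by apply/funext => eta; rewrite big_ord_recr/= addrC.
apply: filterS2 IH (gen_ae_lin (a N) (lu N) (locint_sum a N lu)) => eta h ->.
by rewrite h big_ord_recr/= addrC.
Qed.

(** The series of absolute values along the orbit: a single function, integrable on each level, that
    dominates all expansions in time. *)
Definition orbd T (G : F -> R) (eta : F) : R := fine (absd T (orb G eta)).

(** V(t) as the exponential series of the generator, summed separately at each configuration. *)
Definition semig (t : R) (G : F -> R) (eta : F) : R := psum t (orb G eta).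

Section orbit.
Variable G : F -> R.
Hypothesis lG : locint G.

Lemma measurable_absd T : 0 <= T -> measurable_fun setT (fun eta : F => absd T (orb G eta)).
Proof.
move=> T0.
refine (@ge0_emeasurable_sum _ F R setT (fun j eta => (T ^+ j / j`!%:R * `|orb G eta j|)%:E) xpredT _ _).
  by move=> j eta _ _; exact: absd_term_ge0.
move=> j _; apply/measurable_EFinP; apply: measurable_funM => //.
by apply: measurableT_comp => //; have [] := locint_iter j lG.
Qed.

(** By [rn_iter] the norms of the iterates grow at most geometrically on a fixed level, so the
    integrated series is bounded by the exponential series at M = 2T [gq n]. *)
Lemma integral_absd T n : 0 <= T ->
  (\int[lp]_eta (lev n eta * absd T (orb G eta)) < +oo)%E.
Proof.
move=> T0.
have t0 j : 0 <= T ^+ j / j`!%:R by rewrite mulr_ge0 ?exprn_ge0 ?invr_ge0.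
pose u j eta := ((T ^+ j / j`!%:R)%:E * (lev n eta * `|orb G eta j|%:E))%E.
have u0 j eta : (0 <= u j eta)%E by rewrite mule_ge0 ?lee_fin// mule_ge0 ?lev_ge0 ?lee_fin.
have mu j : measurable_fun setT (u j).
  by apply: measurable_funeM; apply: measurable_lev_norm; have [] := locint_iter j lG.
have -> : (\int[lp]_eta (lev n eta * absd T (orb G eta)) = \int[lp]_eta \sum_(j <oo) u j eta)%E.
  apply: eq_integral => eta _; rewrite /absd /lev -nneseriesZl.
    by apply: eq_eseriesr => j _; rewrite /u muleCA EFinM.
  by move=> j _; exact: absd_term_ge0.
rewrite integral_nneseries//.
pose S := \sum_(i < n.+1) rn i G.
have S0 : 0 <= S by apply: sumr_ge0 => i _; exact: rn_ge0.
pose M := T * (2 * gq n).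
have M0 : 0 <= M by rewrite !mulr_ge0// gq_ge0.
apply: (@le_lt_trans _ _ (\sum_(j <oo) (S * exp_coeff M j)%:E)%E).
  apply: lee_nneseries => [j _ _|j _]; first exact: integral_ge0.
  rewrite /u ge0_integralZl ?lee_fin//; first last.
  - by move=> eta _; rewrite mule_ge0 ?lev_ge0 ?lee_fin.
  - by apply: measurable_lev_norm; have [] := locint_iter j lG.
  rewrite [X in (_ * X)%E](_ : _ = (rn n (iter j (gen c) G))%:E); last first.
    by rewrite (rnE n (locint_iter j lG)).
  rewrite -EFinM lee_fin /exp_coeff/= /M exprMn.
  have := rn_iter j lG (leqnn n); rewrite -/S => /(ler_wpM2l (t0 j)) /le_trans; apply.
  by rewrite le_eqVlt; apply/orP; left; apply/eqP; lra.
apply: (@le_lt_trans _ _ (S * expR M)%:E); last exact: ltry.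
apply: lime_le.
  apply: is_cvg_nneseries => j _ _; rewrite lee_fin mulr_ge0//; exact: exp_coeff_ge0.
apply: nearW => N; rewrite sumEFin lee_fin -mulr_sumr ler_wpM2l//.
rewrite /expR; apply: nondecreasing_cvgn_le; last exact: is_cvg_series_exp_coeff.
apply/nondecreasing_seqP => k /=; rewrite /series/= [leRHS]big_nat_recr//= lerDl.
exact: exp_coeff_ge0.
Qed.

Lemma ae_absd T : 0 <= T -> {ae lp, forall eta, (absd T (orb G eta) < +oo)%E}.
Proof.
move=> T0; apply: ae_lev => n.
have p0 eta : (0 <= lev n eta * absd T (orb G eta))%E by rewrite mule_ge0 ?lev_ge0 ?absd_ge0.
have : lp.-integrable setT (fun eta => (lev n eta * absd T (orb G eta))%E).
  apply/integrableP; split.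
    by apply: emeasurable_funM; [exact: measurable_lev|exact: measurable_absd].
  under eq_integral do rewrite gee0_abs//.
  exact: integral_absd.
move=> /(integrable_ae measurableT); apply: filterS => eta /(_ I) + en.
by rewrite /lev en eqxx mul1e ge0_fin_numE// absd_ge0.
Qed.

Lemma locint_orbd T : 0 <= T -> locint (orbd T G).
Proof.
move=> T0; have mo : measurable_fun setT (orbd T G).
  by apply: measurableT_comp; [exact: fine_measurable|exact: measurable_absd].
split => // n; apply: le_lt_trans (integral_absd n T0).
apply: ae_ge0_le_integral => //.
- by move=> eta _; exact: lev_norm_ge0.
- exact: measurable_lev_norm.
- by move=> eta _; rewrite mule_ge0 ?lev_ge0 ?absd_ge0.
- by apply: emeasurable_funM; [exact: measurable_lev|exact: measurable_absd].
- apply: filterS (ae_absd T0) => eta h _; apply: lee_wpmul2l; first exact: lev_ge0.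
  by rewrite /orbd ger0_norm ?fine_ge0 ?absd_ge0// fineK// ge0_fin_numE// absd_ge0.
Qed.

Lemma orbd_ge0 T eta : 0 <= T -> 0 <= orbd T G eta.
Proof. by move=> T0; rewrite fine_ge0// absd_ge0. Qed.

Lemma measurable_psum_orb t i :
  measurable_fun setT (fun eta => psum t (fun j => orb G eta (j + i)%N)).
Proof.
apply: measurableT_comp; first exact: fine_measurable.
apply: measurable_fun_limn_esup => N; apply/measurable_EFinP.
apply: measurable_sum => j; apply: measurable_funM => //.
by have [] := locint_iter (j + i) lG.
Qed.

Lemma measurable_semig t : measurable_fun setT (semig t G).
Proof.
by have := @measurable_psum_orb t 0; rewrite /semig; under eq_fun => eta do
  under (eq_fun (T := nat)) => j do rewrite addn0.
Qed.

Lemma locint_semig t : 0 <= t -> locint (semig t G).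
Proof.
move=> t0; have t2 : 0 <= 2 * t by rewrite mulr_ge0.
apply: ae_locint (measurable_semig t) (locint_orbd t2) _.
apply: filterS (ae_absd t2) => eta h.
have := psum_tail 0 t0 h; rewrite big_ord0 subr0 expr0 mul1r => /le_trans; apply.
exact: ler_norm.
Qed.

End orbit.

Lemma orb_gen (G : F -> R) eta j : orb (gen c G) eta j = orb G eta j.+1.
Proof. by rewrite /orb iterSr. Qed.

(** For partial sums this is linearity. The remainders are dominated by 2^-N times [orbd], both on
    level n and on level n-1, which the generator also sees. The norm of the difference is then at
    most 2^-N K for every N, hence 0. *)
Lemma gen_semig (G : F -> R) t : locint G -> 0 <= t ->
  {ae lp, forall eta, gen c (semig t G) eta = semig t (gen c G) eta}.
Proof.
move=> lG t0; have lA := locint_gen lG; have t2 : 0 <= 2 * t by rewrite mulr_ge0.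
have lV := locint_semig lG t0; have lVA := locint_semig lA t0.
have lgV := locint_gen lV; have lD := locint_lin (-1) lVA lgV.
suff D0 n : nrm n (fun eta => -1 * semig t (gen c G) eta + gen c (semig t G) eta) = 0%E.
  have [mD _] := lD; apply: filterS (nrm0_ae mD D0) => eta /eqP.
  by rewrite mulN1r addrC subr_eq0 => /eqP.
rewrite -(rnE n lD); congr EFin; apply/eqP; rewrite eq_le rn_ge0 andbT.
pose K := gq n * (rn n (orbd (2 * t) G) + rn n.-1 (orbd (2 * t) G)) + rn n (orbd (2 * t) (gen c G)).
have lo := locint_orbd lG t2; have loA := locint_orbd lA t2.
have K0 : 0 <= K by rewrite addr_ge0 ?mulr_ge0 ?gq_ge0 ?addr_ge0 ?rn_ge0.
have step N : rn n (fun eta => -1 * semig t (gen c G) eta + gen c (semig t G) eta) <= 2^-1 ^+ N * K.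
  have p0 : 0 <= 2^-1 ^+ N :> R by rewrite exprn_ge0.
  pose S H eta := \sum_(j < N) t ^+ j / j`!%:R * orb H eta j.
  have lS H : locint H -> locint (S H).
    by move=> lH; apply: (locint_sum (fun j => t ^+ j / j`!%:R) N) => j; exact: locint_iter.
  have lT H : locint H -> 0 <= t -> locint (fun eta => -1 * S H eta + semig t H eta).
    by move=> lH _; apply: locint_lin; [exact: lS|exact: locint_semig].
  have tail H k : locint H -> rn k (fun eta => -1 * S H eta + semig t H eta) <=
      2^-1 ^+ N * rn k (orbd (2 * t) H).
    move=> lH; have loH := locint_orbd lH t2; have := @nrmZ R d k (2^-1 ^+ N) (orbd (2 * t) H) loH.1.
    rewrite (ger0_norm p0) -(rnE k loH) => /(congr1 fine) /= <-.
    apply: le_rn; [exact: lT| |].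
      have := locint_lin (2^-1 ^+ N) loH locint0.
      by under eq_fun do rewrite addr0.
    apply: filterS (ae_absd lH t2) => eta h; rewrite mulN1r addrC.
    rewrite [leRHS]ger0_norm ?mulr_ge0 ?orbd_ge0//; exact: psum_tail.
  have h1 : {ae lp, forall eta, gen c (S G) eta = S (gen c G) eta}.
    apply: filterS (gen_ae_sum (fun j => t ^+ j / j`!%:R) N (fun j => locint_iter j lG)) => eta ->.
    by apply: eq_bigr => j _; rewrite orb_gen.
  have h2 : {ae lp, forall eta, gen c (fun eta => -1 * S G eta + semig t G eta) eta =
      -1 * gen c (S G) eta + gen c (semig t G) eta} by apply: gen_ae_lin => //; exact: lS.
  have l1 := locint_gen (lT _ lG t0).
  apply: (@le_trans _ _ (rn n (fun eta => -1 * (-1 * S (gen c G) eta + semig t (gen c G) eta) +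
      gen c (fun eta => -1 * S G eta + semig t G eta) eta))).
    apply: (le_rn n lD (locint_lin (-1) (lT _ lA t0) l1)).
    by apply: filterS2 h1 h2 => eta e1 ->; rewrite e1 le_eqVlt; apply/orP; left; apply/eqP; congr `|_|; lra.
  apply: le_trans (rn_lin n (-1) (lT _ lA t0) l1) _.
  rewrite normrN1 mul1r /K mulrDr addrC; apply: lerD; last exact: tail.
  rewrite -lee_fin (rnE n l1); apply: le_trans (nrm_gen n (lT _ lG t0)) _.
  rewrite lee_fin mulrCA ler_wpM2l ?gq_ge0// mulrDr.
  by apply: lerD; exact: tail.
apply/ler_addgt0Pl => e e0; rewrite addr0.
have cv : (fun N => 2^-1 ^+ N * K) @ \oo --> 0.
  rewrite -[X in _ --> X](mul0r K); apply: cvgM; last exact: cvg_cst.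
  by apply: cvg_expr; rewrite ger0_norm//; lra.
have [N _ /(_ N (leqnn N)) /=] := (cvgr0Pnorm_le _).1 cv _ e0.
rewrite ger0_norm; last by rewrite mulr_ge0// exprn_ge0.
exact: le_trans (step N).
Qed.

End semigroup.

(** * Level decomposition of the weighted spaces *)

Section level_decomposition.
Context {R : realType} {d : nat}.
Local Notation E := (euclid R d).
Local Notation F := (fconf R d).
Local Notation m := (lebesgue_space R d).
Local Notation lp := (@lpm R d).
Hypothesis d0 : (0 < d)%N.

Lemma sum_lev (h : nat -> \bar R) (eta : F) : (forall n, (0 <= h n)%E) ->
  (\sum_(n <oo) lev n eta * h n = h #|` eta|%fset)%E.
Proof.
move=> h0; rewrite (@nneseriesD1 R _ #|` eta|%fset xpredT)//; last first.
  by move=> n _; rewrite mule_ge0 ?lev_ge0.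
rewrite /lev eqxx mul1e eseries0 ?adde0// => n _ /=.
by rewrite eq_sym => /negbTE ->; rewrite mul0e.
Qed.

Lemma npint_lev n k (f : F -> \bar R) : (forall x, (0 <= f x)%E) -> measurable_fun setT f ->
  npint k (fun eta => lev n eta * f eta)%E = if k == n then npint n f else 0%E.
Proof.
move=> f0 mf.
have mlf : measurable_fun setT (fun eta => lev n eta * f eta)%E.
  by apply: emeasurable_funM => //; exact: measurable_lev.
have ae_uniq : {ae tuple_measure m k, forall t : k.-tuple E, uniq t}.
  exists (~` [set t : k.-tuple E | uniq t]); split.
  - by apply: measurableC; exact: measurable_uniq.
  - exact: npint_nonuniq.
  - by move=> t /= h; exact: h.
have mof (g : F -> \bar R) : measurable_fun setT g -> measurable_fun setT (fun t : k.-tuple E => g (fconf_of t)).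
  by move=> mg; apply: measurableT_comp => //; exact: measurable_fconf_of.
have card_of (t : k.-tuple E) : uniq t -> #|` fconf_of t|%fset = k.
  by move=> ut; rewrite card_fseq undup_id// size_tuple.
have [kn|kn] := eqVneq k n.
  subst k; apply: ae_eq_integral => //; [exact: (mof _ mlf)|exact: (mof _ mf)|].
  by apply: filterS ae_uniq => t ut _; rewrite /lev card_of// eqxx mul1e.
rewrite -[RHS](@integral0 _ _ R (tuple_measure m k) setT).
apply: ae_eq_integral => //; first exact: (mof _ mlf).
by apply: filterS ae_uniq => t ut _; rewrite /lev card_of// (negbTE kn) mul0e.
Qed.

Lemma Xnorm_nrm n (G : F -> R) : measurable_fun setT G ->
  Xnorm n G = (n`!%:R%:E * nrm n G)%E.
Proof.
move=> mG; have mGE : measurable_fun setT (fun eta => `|G eta|%:E).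
  by apply/measurable_EFinP; exact: measurableT_comp.
rewrite /nrm integral_lpm//; first last.
- exact: measurable_lev_norm.
- by move=> eta; exact: lev_norm_ge0.
have Ge0 : forall eta, (0 <= `|G eta|%:E)%E by move=> eta; rewrite lee_fin.
rewrite (@nneseriesD1 R _ n xpredT)//; last first.
  move=> k _; apply: mule_ge0; first by rewrite lee_fin invr_ge0.
  by apply: integral_ge0 => t _; exact: lev_norm_ge0.
rewrite eseries0; last first.
  by move=> k _ /= /negbTE kn; rewrite (npint_lev n k Ge0)// kn mule0.
rewrite adde0 (npint_lev n n Ge0)// eqxx muleA -EFinM divff ?mul1e//.
Qed.

Lemma integral_level_weight (C : R) (G : F -> R) : 0 <= C -> measurable_fun setT G ->
  (\int[lp]_eta `|G eta * C ^+ #|` eta|%fset|%:E = \sum_(n <oo) (C ^+ n)%:E * nrm n G)%E.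
Proof.
move=> C0 mG.
transitivity (\int[lp]_eta \sum_(n <oo) ((C ^+ n)%:E * (lev n eta * `|G eta|%:E)))%E.
  apply: eq_integral => eta _.
  have -> : (\sum_(n <oo) ((C ^+ n)%:E * (lev n eta * `|G eta|%:E)) =
      \sum_(n <oo) lev n eta * ((C ^+ n)%:E * `|G eta|%:E))%E.
    by apply: eq_eseriesr => n _; rewrite muleCA.
  rewrite sum_lev; last by move=> n; rewrite mule_ge0 ?lee_fin ?exprn_ge0.
  by rewrite normrM [X in (_ * X)%R]ger0_norm ?exprn_ge0// EFinM muleC.
rewrite integral_nneseries//; first last.
- by move=> n eta _; rewrite mule_ge0 ?lev_norm_ge0// lee_fin exprn_ge0.
- by move=> n; apply: measurable_funeM; exact: measurable_lev_norm.
apply: eq_eseriesr => n _; rewrite ge0_integralZl ?lee_fin ?exprn_ge0//.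
- exact: measurable_lev_norm.
- by move=> eta _; exact: lev_norm_ge0.
Qed.

Lemma measurable_weight (C : R) : measurable_fun setT (fun eta : F => C ^+ #|` eta|%fset).
Proof.
have mn : measurable_fun setT (fun n : nat => C ^+ n) by [].
exact: (measurableT_comp mn (@measurable_card_fconf R d)).
Qed.

Lemma L_spaceP (C : R) (G : F -> R) : 0 < C -> L_space C G <->
  measurable_fun setT G /\ (\sum_(n <oo) (C ^+ n)%:E * nrm n G < +oo)%E.
Proof.
move=> C0; rewrite /L_space; split.
  move=> /Lfun1_integrable/integrableP[/measurable_EFinP mGC Goo].
  have mG : measurable_fun setT G.
    have -> : G = (fun eta => (G eta * C ^+ #|` eta|%fset) * (C^-1) ^+ #|` eta|%fset).
      apply/funext => eta; rewrite -mulrA -exprMn divff ?gt_eqF// expr1n mulr1//.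
    by apply: measurable_funM => //; exact: measurable_weight.
  by split => //; rewrite -integral_level_weight ?ltW.
move=> [mG Goo]; apply/Lfun1_integrable/integrableP; split.
  by apply/measurable_EFinP; apply: measurable_funM => //; exact: measurable_weight.
by move: Goo; rewrite -integral_level_weight ?ltW.
Qed.

Lemma L_space_locint (C : R) (G : F -> R) : 0 < C -> L_space C G -> locint G.
Proof.
move=> C0 /(L_spaceP _ C0)[mG Goo]; split => // n.
have t0 k : (0 <= (C ^+ k)%:E * nrm k G)%E by rewrite mule_ge0 ?nrm_ge0// lee_fin exprn_ge0// ltW.
have : ((C ^+ n)%:E * nrm n G < +oo)%E.
  apply: le_lt_trans Goo; rewrite (@nneseriesD1 R _ n xpredT)//.
  by rewrite leeDl// nneseries_ge0.
have Cn : 0 < C ^+ n by rewrite exprn_gt0.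
rewrite !ltey; apply: contraNN => /eqP ->.
by rewrite mulry gtr0_sg// mul1e.
Qed.

End level_decomposition.

(** * Euler products, the weighted bound and the solution property *)

Section solution.
Context {R : realType} {d : nat}.
Local Notation E := (euclid R d).
Local Notation F := (fconf R d).
Local Notation m := (lebesgue_space R d).
Local Notation mm := (prodm m m).
Local Notation lp := (@lpm R d).
Variable c : E -> E -> E -> E -> R.
Hypothesis jr : jump_rate c.
Hypothesis d0 : (0 < d)%N.
Hypotheses (c1oo : (c1 c < +oo)%E) (c2oo : (c2 c < +oo)%E)
  (c3oo : (c3 c < +oo)%E) (c4oo : (c4 c < +oo)%E).
Hypothesis a21 : {ae mm, forall x, (a2 c x <= a1 c x)%E}.
Local Notation rn n G := (fine (nrm n G)).

Definition euler s N (G : F -> R) : F -> R :=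
  iter N (fun H eta => H eta + s * gen c H eta) G.

Lemma locint_euler_step s (G : F -> R) : locint G -> locint (fun eta => G eta + s * gen c G eta).
Proof.
move=> lG; have := locint_lin s (locint_gen jr d0 c1oo c2oo c3oo c4oo a21 lG) lG.
by congr locint; apply/funext => eta; rewrite addrC.
Qed.

Lemma locint_euler s N (G : F -> R) : locint G -> locint (euler s N G).
Proof. by move=> lG; elim: N => //= N IH; exact: locint_euler_step. Qed.

Lemma binomial_step s (v : nat -> R) N :
  \sum_(j < N.+1) 'C(N, j)%:R * s ^+ j * v j +
    s * \sum_(j < N.+1) 'C(N, j)%:R * s ^+ j * v j.+1 =
  \sum_(j < N.+2) 'C(N.+1, j)%:R * s ^+ j * v j.
Proof.
rewrite [RHS]big_ord_recl/= bin0 expr0.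
have -> : \sum_(i < N.+1) 'C(N.+1, bump 0 i)%:R * s ^+ bump 0 i * v (bump 0 i) =
  \sum_(i < N.+1) 'C(N, i.+1)%:R * s ^+ i.+1 * v i.+1 +
  s * \sum_(i < N.+1) 'C(N, i)%:R * s ^+ i * v i.+1.
  rewrite mulr_sumr -big_split; apply: eq_bigr => i _ /=.
  rewrite /bump/= add1n binS natrD exprS; lra.
rewrite addrA; congr (_ + _).
by rewrite [in RHS]big_ord_recr/= bin_small// !mul0r addr0 [LHS]big_ord_recl/= bin0 expr0.
Qed.

(** Pascal's rule ([binomial_step]) with the generator in the role of the shift; each step uses
    linearity off a null set. *)
Lemma euler_binomial s N (G : F -> R) : locint G ->
  {ae lp, forall eta, euler s N G eta = \sum_(j < N.+1) 'C(N, j)%:R * s ^+ j * orb c G eta j}.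
Proof.
move=> lG; elim: N => [|N IH].
  by apply: aeW => eta; rewrite big_ord1 bin0 expr0 !mul1r.
have lI j := locint_iter jr d0 c1oo c2oo c3oo c4oo a21 j lG.
have lS := locint_sum (fun j => 'C(N, j)%:R * s ^+ j) N.+1 lI.
have h1 := gen_ae_sum jr d0 c1oo c2oo c3oo c4oo a21 (fun j => 'C(N, j)%:R * s ^+ j) N.+1 lI.
have h2 := gen_ae_eq jr d0 c1oo c2oo c3oo c4oo a21 (locint_euler s N lG) lS IH.
apply: filterS3 IH h1 h2 => eta e1 e2 e3; rewrite /= e1 e3 e2.
exact: (binomial_step s (orb c G eta) N).
Qed.

Lemma bernoulli_ineq (x : R) n : 0 <= x -> 1 + n%:R * x <= (1 + x) ^+ n.
Proof.
move=> x0; elim: n => [|n IH]; first by rewrite mul0r addr0 expr0.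
rewrite exprS; apply: (@le_trans _ _ ((1 + x) * (1 + n%:R * x))).
  rewrite -natr1; have : 0 <= n%:R * (x * x) :> R by rewrite !mulr_ge0.
  by lra.
by rewrite ler_wpM2l// addr_ge0.
Qed.

(** Reindexing the terms from the lower level gives the weight r^n (1 + n s B r), and Bernoulli's
    inequality bounds it by the n-th power of r(1 + sBr). The sum may stop at any J, because a level
    receives mass only from itself and from the level below. *)
Lemma rn_euler_step s (r : R) J (G : F -> R) : locint G -> 0 <= s -> 0 <= r ->
  s * ((J * J)%:R * c1r c) <= 1 ->
  \sum_(n < J.+1) r ^+ n * rn n (fun eta => G eta + s * gen c G eta) <=
  \sum_(n < J.+1) (r * (1 + s * B c * r)) ^+ n * rn n G.
Proof.
move=> lG s0 r0 sJ; have B0 := B_ge0 jr.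
have u0 n : 0 <= rn n G by exact: rn_ge0.
apply: (@le_trans _ _ (\sum_(n < J.+1) r ^+ n * (rn n G + s * n.-1%:R * B c * rn n.-1 G))).
  apply: ler_sum => n _; rewrite ler_wpM2l ?exprn_ge0//.
  rewrite -lee_fin (rnE n (locint_euler_step s lG)) EFinD EFinM (rnE n lG) (rnE n.-1 lG).
  apply: (nrm_euler_step jr) => //.
  apply: le_trans sJ; rewrite ler_wpM2l// ler_wpM2r ?(c1r_ge0 jr)// ler_nat.
  by have := ltn_ord n; rewrite ltnS => nJ; exact: leq_mul.
apply: (@le_trans _ _ (\sum_(n < J.+1) r ^+ n * (1 + n%:R * (s * B c * r)) * rn n G)); last first.
  apply: ler_sum => n _; rewrite ler_wpM2r// exprMn ler_wpM2l ?exprn_ge0//.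
  by apply: bernoulli_ineq; rewrite !mulr_ge0.
under eq_bigr do rewrite mulrDr.
under [leRHS]eq_bigr do rewrite mulrDr mulr1 mulrDl.
rewrite !big_split/= lerD2l.
rewrite [leLHS]big_ord_recl/= !(mulr0n, mulr0, mul0r) add0r [leRHS]big_ord_recr/=.
apply: (@le_trans _ _ (\sum_(i < J) r ^+ i * (i%:R * (s * B c * r)) * rn i G)); last first.
  by rewrite lerDl !mulr_ge0 ?exprn_ge0.
apply: ler_sum => i _; rewrite /bump/= add1n/= exprS.
by rewrite le_eqVlt; apply/orP; left; apply/eqP; lra.
Qed.

(** A discrete form of r' = B r^2, whose solution grows from C/(1 + BCt) to C in time t. One step
    turns the bound C/(1 + N s q C) into the bound with N - 1 in place of N. *)
Lemma iter_radius s (q C r : R) N : 0 <= q -> 0 <= s -> 0 < C -> 0 <= r ->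
  r <= C / (1 + N%:R * (s * q * C)) ->
  0 <= iter N (fun r => r * (1 + s * q * r)) r <= C.
Proof.
move=> q0 s0 C0; elim: N r => [|N IH] r r0; first by rewrite mul0r addr0 divr1 => ->; rewrite r0.
rewrite iterSr => rC; set b := s * q in rC IH *.
have b0 : 0 <= b by rewrite mulr_ge0.
have e0 : 0 <= b * C by rewrite mulr_ge0// ltW.
apply: IH; first by rewrite mulr_ge0// addr_ge0// mulr_ge0.
move: rC; rewrite -natr1; set a := 1 + N%:R * (b * C).
have a0 : 0 < a by rewrite ltr_wpDr// mulr_ge0.
have -> : 1 + (N%:R + 1) * (b * C) = a + b * C by rewrite /a; lra.
set e := b * C in e0 a a0 *; have ae0 : 0 < a + e by rewrite ltr_wpDr.
rewrite !ler_pdivlMr// => rC.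
have h1 : b * (r * (a + e)) <= b * C by rewrite ler_wpM2l.
rewrite -/e in h1.
have h2 : (a + e) * (1 + b * r) <= a + e + e by lra.
have h3 : (r * (a + e)) * ((a + e) * (1 + b * r)) <= C * (a + e + e).
  by apply: ler_pM => //; rewrite mulr_ge0// ?(ltW ae0)// addr_ge0// mulr_ge0.
have h4 : 0 <= e * e by rewrite mulr_ge0.
rewrite -(ler_pM2r (mulr_gt0 ae0 ae0)).
have -> : r * (1 + b * r) * a * ((a + e) * (a + e)) = r * (a + e) * ((a + e) * (1 + b * r)) * a by lra.
apply: le_trans (ler_wpM2r (ltW a0) h3) _.
rewrite -mulrA ler_wpM2l ?(ltW C0)//; lra.
Qed.

Lemma rn_euler s (C r : R) J N (G : F -> R) : locint G -> 0 <= s -> 0 < C -> 0 <= r ->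
  s * ((J * J)%:R * c1r c) <= 1 -> r <= C / (1 + N%:R * (s * B c * C)) ->
  \sum_(n < J.+1) r ^+ n * rn n (euler s N G) <= \sum_(n < J.+1) C ^+ n * rn n G.
Proof.
move=> lG s0 C0 r0 sJ rC; have B0 := B_ge0 jr.
pose f r := r * (1 + s * B c * r).
apply: (@le_trans _ _ (\sum_(n < J.+1) (iter N f r) ^+ n * rn n G)); last first.
  have /andP[h1 h2] := iter_radius B0 s0 C0 r0 rC.
  apply: ler_sum => n _; rewrite ler_wpM2r ?rn_ge0// lerXn2r// nnegrE//.
  exact: ltW.
elim: N r r0 {rC} => [//|N IH] r r0.
rewrite [euler _ _ _]/= iterSr.
apply: le_trans (rn_euler_step (locint_euler s N lG) s0 r0 sJ) _.
by apply: IH; rewrite mulr_ge0// addr_ge0// !mulr_ge0.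
Qed.

(** With N Euler steps of size t/N the admissible radius is [rho c t C] for every N, and the Euler
    products approach [semig] with an error of at most [orbd] divided by N. As J is fixed, the step
    condition holds for all large N. *)
Lemma rn_semig_le (C t : R) J (G : F -> R) : locint G -> 0 < C -> 0 <= t ->
  \sum_(n < J.+1) rho c t C ^+ n * rn n (semig c t G) <= \sum_(n < J.+1) C ^+ n * rn n G.
Proof.
move=> lG C0 t0; have B0 := B_ge0 jr; have c10 := c1r_ge0 jr.
have t4 : 0 <= 4 * t by rewrite mulr_ge0.
have lo := locint_orbd jr d0 c1oo c2oo c3oo c4oo a21 lG t4.
have lV := locint_semig jr d0 c1oo c2oo c3oo c4oo a21 lG t0.
have den : 0 < 1 + B c * C * t by rewrite ltr_wpDr// !mulr_ge0// ltW.
set r := rho c t C; have r0 : 0 <= r by rewrite /r /rho divr_ge0 ?ltW.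
pose K := \sum_(n < J.+1) r ^+ n * rn n (orbd c (4 * t) G).
have K0 : 0 <= K by apply: sumr_ge0 => n _; rewrite mulr_ge0 ?rn_ge0// exprn_ge0.
have step N : t * ((J * J)%:R * c1r c) <= N.+1%:R ->
    \sum_(n < J.+1) r ^+ n * rn n (semig c t G) <=
    \sum_(n < J.+1) C ^+ n * rn n G + N.+1%:R^-1 * K.
  move=> tN; have N0 : 0 < N.+1%:R :> R by rewrite ltr0n.
  have s0 : 0 <= t / N.+1%:R by rewrite divr_ge0.
  have sJ : t / N.+1%:R * ((J * J)%:R * c1r c) <= 1 by rewrite mulrAC ler_pdivrMr// mul1r.
  have rC : r <= C / (1 + N.+1%:R * (t / N.+1%:R * B c * C)).
    rewrite /r /rho (_ : N.+1%:R * (t / N.+1%:R * B c * C) = B c * C * t)//.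
    move: N.+1%:R N0 => u u0; rewrite !mulrA [u * t]mulrC mulfK ?gt_eqF//.
    by rewrite mulrAC mulrC mulrA mulrAC.
  apply: le_trans (lerD (rn_euler lG s0 C0 r0 sJ rC) (lexx _)).
  rewrite /K mulr_sumr -big_split/=; apply: ler_sum => n _.
  rewrite mulrCA -mulrDr ler_wpM2l ?exprn_ge0//.
  have Ninv : 0 <= N.+1%:R^-1 :> R by rewrite invr_ge0 ltW.
  have lE := locint_euler (t / N.+1%:R) N.+1 lG.
  pose D eta := N.+1%:R^-1 * orbd c (4 * t) G eta + 0.
  have lD : locint D := locint_lin N.+1%:R^-1 lo locint0.
  pose D' eta := 1 * D eta + `|euler (t / N.+1%:R) N.+1 G eta|.
  have lE' : locint (fun eta => `|euler (t / N.+1%:R) N.+1 G eta|).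
    have [mE _] := lE; apply: ae_locint _ lE _; first exact: measurableT_comp.
    by apply: aeW => eta; rewrite normr_id.
  have lD' : locint D' := locint_lin 1 lD lE'.
  apply: (@le_trans _ _ (rn n D')).
    apply: le_rn => //.
    apply: filterS2 (euler_binomial (t / N.+1%:R) N.+1 lG) (ae_absd jr d0 c1oo c2oo c3oo c4oo a21 lG t4) => eta e1 e2.
    have := psum_euler (ltn0Sn N) t0 e2; rewrite -e1 => h.
    have o0 : 0 <= orbd c (4 * t) G eta by exact: orbd_ge0.
    rewrite /D' /D mul1r addr0 [leRHS]ger0_norm; last by rewrite addr_ge0// mulr_ge0.
    rewrite -lerBlDr; apply: le_trans h; rewrite distrC.
    exact: lerB_dist.
  apply: le_trans (rn_lin n 1 lD lE') _; rewrite normr1 mul1r addrC; apply: lerD.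
    by apply: le_rn => //; apply: aeW => eta; rewrite normr_id.
  apply: le_trans (rn_lin n N.+1%:R^-1 lo locint0) _.
  rewrite ger0_norm// (_ : rn n (fun=> 0) = 0) ?addr0//.
  by rewrite /nrm integral0_eq// => eta _; rewrite normr0 mule0.
apply/ler_addgt0Pr => e e0.
have [N1 hN1] : exists N, K / e <= N.+1%:R.
  by exists (Num.truncn (K / e)); apply/ltW; exact: truncnS_gt.
have [N2 hN2] : exists N, t * ((J * J)%:R * c1r c) <= N.+1%:R.
  by exists (Num.truncn (t * ((J * J)%:R * c1r c))); apply/ltW; exact: truncnS_gt.
have l2 : t * ((J * J)%:R * c1r c) <= (N1 + N2).+1%:R.
  by apply: le_trans hN2 _; rewrite ler_nat ltnS leq_addl.
apply: le_trans (step _ l2) _; rewrite lerD2l.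
rewrite mulrC ler_pdivrMr ?ltr0n// -ler_pdivrMl//.
by rewrite mulrC; apply: le_trans hN1 _; rewrite ler_nat ltnS leq_addr.
Qed.

Lemma L_space_semig (C t : R) (G : F -> R) : 0 < C -> 0 <= t -> L_space C G ->
  L_space (rho c t C) (semig c t G).
Proof.
move=> C0 t0 GC; have lG := L_space_locint C0 GC; have B0 := B_ge0 jr.
have den : 0 < 1 + B c * C * t by rewrite ltr_wpDr// !mulr_ge0// ltW.
have r0 : 0 < rho c t C by rewrite /rho divr_gt0.
have lV := locint_semig jr d0 c1oo c2oo c3oo c4oo a21 lG t0.
apply/(L_spaceP _ r0); split; first by case: lV.
have [_ Goo] := (L_spaceP G C0).1 GC.
apply: le_lt_trans Goo; apply: lime_le.
  by apply: is_cvg_nneseries => n _ _; rewrite mule_ge0 ?nrm_ge0// lee_fin exprn_ge0// ltW.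
apply: nearW => J.
apply: (@le_trans _ _ (\sum_(0 <= n < J.+1) (rho c t C ^+ n)%:E * nrm n (semig c t G))%E).
  rewrite [leRHS]big_nat_recr//= leeDl// mule_ge0 ?nrm_ge0// lee_fin exprn_ge0//.
  exact: ltW.
apply: (@le_trans _ _ (\sum_(0 <= n < J.+1) (C ^+ n)%:E * nrm n G)%E); last first.
  by apply: nneseries_lim_ge => n _ _; rewrite mule_ge0 ?nrm_ge0// lee_fin exprn_ge0// ltW.
rewrite !big_mkord.
under eq_bigr do rewrite -(rnE _ lV) -EFinM.
under [leRHS]eq_bigr do rewrite -(rnE _ lG) -EFinM.
by rewrite !sumEFin lee_fin; exact: rn_semig_le.
Qed.

(** Supplies a concrete solution to which the duality in [evolution] applies. The difference
    quotient deviates from the generator by at most |h| times [orbd c (1 + t) G], which has finite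
    norm on every level. *)
Lemma semig_solution (C : R) (G : F -> R) : 0 < C -> L_space C G ->
  solution c C G (fun t => semig c t G).
Proof.
move=> C0 GC; have lG := L_space_locint C0 GC; split.
- by move=> t t0; exact: L_space_semig.
- by apply: (aeW lp) => eta; rewrite /semig psum0.
move=> t n t0; have t1 : 0 <= 1 + t by rewrite addr_ge0.
have lo := locint_orbd jr d0 c1oo c2oo c3oo c4oo a21 lG t1.
have mV u := measurable_semig jr d0 c1oo c2oo c3oo c4oo a21 lG u.
pose X h eta := (semig c (t + h) G eta - semig c t G eta) / h - (L0 c (semig c t G) eta + W c (semig c t G) eta).
have mX h : measurable_fun setT (X h).
  apply: measurable_funB; last exact: (measurable_gen jr (mV t)).
  by apply: measurable_funM => //; exact: measurable_funB.
pose K := n`!%:R * rn n (orbd c (1 + t) G).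
have K0 : 0 <= K by rewrite mulr_ge0// rn_ge0.
have bound h : h != 0 -> `|h| <= 1 -> (Xnorm n (X h) <= (`|h| * K)%:E)%E.
  move=> h0 h1; rewrite Xnorm_nrm//.
  apply: (@le_trans _ _ (n`!%:R%:E * nrm n (fun eta => h * orbd c (1 + t) G eta)%R)%E).
    apply: lee_wpmul2l; first by rewrite lee_fin.
    apply: nrm_le => //; first by case: lo => mo _; exact: measurable_funM.
    apply: filterS2 (gen_semig jr d0 c1oo c2oo c3oo c4oo a21 lG t0) (ae_absd jr d0 c1oo c2oo c3oo c4oo a21 lG t1) => eta e1 e2.
    have := psum_deriv t0 h1 e2; rewrite /X.
    have -> : L0 c (semig c t G) eta + W c (semig c t G) eta = psum t (fun j => orb c G eta j.+1).
      rewrite -[LHS]/(gen c (semig c t G) eta) e1 /semig; congr psum.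
      by apply/funext => j; rewrite orb_gen.
    rewrite -/(semig c t G eta) -/(semig c (t + h) G eta) -/(orbd c (1 + t) G eta) => e3.
    rewrite normrM [X in _ <= _ * X]ger0_norm ?orbd_ge0//.
    have hp : 0 < `|h| by rewrite normr_gt0.
    rewrite -(ler_pM2l hp) -normrM mulrBr mulrCA divff// mulr1.
    by rewrite [leRHS]mulrA -expr2 real_normK ?num_real.
  case: lo => mo oo; rewrite nrmZ// -(rnE n (conj mo oo)) -!EFinM lee_fin /K.
  by rewrite mulrCA.
apply: (@squeeze_cvge _ _ _ _ (fun=> 0%E) _ (fun h => (`|h| * K)%:E)).
- have h1 := @dnbhs0_le R R 1 ltr01; have h2 := @nbhs_dnbhs_neq R 0.
  have P : \forall h \near 0^', (0%R <= Xnorm n (X h) <= (`|h| * K)%:E)%E.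
    apply: filterS2 h1 h2 => h h1 h2; rewrite bound// andbT.
    by apply: integral_ge0 => x _; rewrite lee_fin.
  by rewrite /within/=; apply: filterS P => h + _.
- exact: cvg_cst.
apply: cvg_within_filter; apply: cvg_EFin; first exact: nearW.
rewrite -[X in _ --> X](mul0r K); apply: cvgM; last exact: cvg_cst.
rewrite -[X in _ --> X](normr0 R); apply: cvg_norm; exact: nbhs_dnbhs.
Qed.

End solution.

(** * Positivity of the K-transform along V(t) *)

Section pair_sum_swap.
Context {K : choiceType} {V : nmodType}.

Lemma sum_fset_neq (A : {fset K}) x (f : K -> V) : x \in A ->
  \sum_(y <- (A `\ x)%fset) f y = \sum_(y <- A) if y == x then 0 else f y.
Proof.
move=> xA; rewrite [RHS](big_fsetD1 x)//= eqxx add0r.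
by apply: eq_big_seq => y; rewrite !inE => /andP[/negbTE ->].
Qed.

Lemma sum_pair_swap (A : {fset K}) (f : K -> K -> V) :
  \sum_(x <- A) \sum_(y <- (A `\ x)%fset) f x y =
  \sum_(x <- A) \sum_(y <- (A `\ x)%fset) f y x.
Proof.
transitivity (\sum_(x <- A) \sum_(y <- A) if y == x then 0 else f x y).
  by apply: eq_big_seq => x xA; rewrite sum_fset_neq.
rewrite exchange_big/=; apply: eq_big_seq => y yA; rewrite sum_fset_neq//.
by apply: eq_bigr => x _; rewrite eq_sym.
Qed.

End pair_sum_swap.

Section swap_integral.
Context {d1} {T : measurableType d1} {R : realType}.
Variable mu : {sigma_finite_measure set T -> \bar R}.

Lemma integral_prodm_swap (f : T * T -> \bar R) : measurable_fun setT f ->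
  (forall y, (0 <= f y)%E) ->
  (\int[prodm mu mu]_y f (y.2, y.1) = \int[prodm mu mu]_y f y)%E.
Proof.
move=> mf f0; rewrite prodm_int12//; last first.
  by apply: measurableT_comp mf _; exact: measurable_fun_pair.
by rewrite [RHS]prodm_int21.
Qed.

Lemma Rintegral_prodm_swap (f : T * T -> R) : measurable_fun setT f ->
  \int[prodm mu mu]_y f (y.2, y.1) = \int[prodm mu mu]_y f y.
Proof.
move=> mf; rewrite /Rintegral integralE [in RHS]integralE.
have mfE : measurable_fun setT (EFin \o f) by exact/measurable_EFinP.
rewrite -(integral_prodm_swap (f := ((EFin \o f)^\+)%E))//; last exact: measurable_funepos.
rewrite -(integral_prodm_swap (f := ((EFin \o f)^\-)%E))//; last exact: measurable_funeneg.
congr (fine (_ - _)); apply: eq_integral => y _; first by rewrite !funeposE.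
by rewrite !funenegE.
Qed.

End swap_integral.

Section positivity.
Context {R : realType} {d : nat}.
Local Notation E := (euclid R d).
Local Notation F := (fconf R d).
Local Notation m := (lebesgue_space R d).
Local Notation mm := (prodm m m).
Local Notation lp := (@lpm R d).
Hypothesis d0 : (0 < d)%N.

Definition Kf (G : F -> R) (gam : F) : R := \sum_(xi <- fpowerset gam) G xi.

(** By Minlos' lemma, the number of subsets lying in a null set integrates to the mass of this set
    times the total mass, that is, to 0. *)
Lemma null_powerset (P : F -> Prop) : {ae lp, forall eta, P eta} ->
  {ae lp, forall gam : F, forall xi : F, (xi `<=` gam)%fset -> P xi}.
Proof.
move=> [N [mN N0 PN]].
have mI : measurable_fun setT (fun z : F * F => (\1_N z.1 : R)%:E).
  by apply: measurable_EFin_indic.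
have I0 (x y : F) : (0 <= (\1_N x : R)%:E)%E by [].
pose H (g : F) := (\sum_(xi <- fpowerset g) (\1_N xi : R)%:E)%E.
have H0 g : (0 <= H g)%E by apply: sume_ge0.
have mH : measurable_fun setT H.
  refine (@measurable_fpowerset_sum R d _ F id (fun _ xi _ => (\1_N xi : R)%:E) _ _ _) => //.
  apply: (measurableT_comp mI (g := fun z : F * F * F => (z.1.2, z.2))).
  by apply/measurable_fun_pair => //=; exact: measurableT_comp.
have : (\int[lp]_g H g = 0)%E.
  rewrite (minlos d0 (H := fun xi _ => (\1_N xi : R)%:E))//.
  transitivity (\int[lp]_xi ((\1_N xi : R)%:E * lp setT))%E.
    by apply: eq_integral => x _; rewrite integral_cst.
  rewrite ge0_integralZr//; last exact: measurable_EFin_indic.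
  by rewrite integral_indic// setIT [X in (X * _)%E]N0 mul0e.
move=> i0; have := (ae_eq_integral_abs lp measurableT mH).1.
have -> : (\int[lp]_x `|H x| = 0)%E.
  by rewrite -i0; apply: eq_integral => g _; rewrite gee0_abs.
move=> /(_ erefl); apply: filterS => g /(_ I) h xi xig.
apply: contrapT => nP; have Nx : N xi by apply: PN.
have : ((\1_N xi : R)%:E <= H g)%E.
  rewrite /H (big_fsetD1 xi)/=; last by rewrite fpowersetE.
  by rewrite leeDl// sume_ge0.
by rewrite h indicE mem_set//= lee_fin ler10.
Qed.

(** The indicator of a null set, integrated over arrivals and remainders, is by Mecke's formula a
    sum over pairs of points of configurations in that set, hence 0. The integral over arrivals thus
    vanishes for almost every remainder and, by Mecke's formula again, for the remainder of every
    pair. *)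
Lemma null_cons2 (P : F -> Prop) : {ae lp, forall eta, P eta} ->
  {ae lp, forall gam : F, forall x1 x2, x1 \in (gam : {fset E}) ->
    x2 \in (gam `\ x1)%fset ->
    {ae mm, forall y, P (conf_cons2 y (gam `\ x1 `\ x2)%fset)}}.
Proof.
move=> [N [mN N0 PN]].
have mI : measurable_fun setT (fun z : E * E * F => (\1_N (conf_cons2 z.1 z.2) : R)%:E).
  by apply: measurable_EFin_indic => //; exact: measurable_conf_cons2.
pose h (_ : E * E) (xi : F) := (\int[mm]_y (\1_N (conf_cons2 y xi) : R)%:E)%E.
have h0 x xi : (0 <= h x xi)%E by exact: integral_ge0.
have mh1 : measurable_fun setT (fun xi : F => \int[mm]_y (\1_N (conf_cons2 y xi) : R)%:E)%E.
  by refine (@measurable_fun_fubini_tonelli_G _ _ (E * E)%type F R mm (fun z => (\1_N (conf_cons2 z.1 z.2) : R)%:E) _ _).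
have mh : measurable_fun setT (fun z : E * E * F => h z.1 z.2).
  exact: (measurableT_comp mh1 measurable_snd).
have i0 : (\int[mm]_y \int[lp]_xi (\1_N (conf_cons2 y xi) : R)%:E = 0)%E.
  rewrite -(mecke2 d0 (h := fun y xi => (\1_N (conf_cons2 y xi) : R)%:E))//.
  rewrite -[RHS](@integral0 _ _ R lp setT); apply: ae_eq_integral => //.
    by apply: measurable_pair_sum1.
  have aN : {ae lp, forall eta, ~ N eta} by exists N; split => // x /contrapT.
  apply: filterS aN => eta nN _; rewrite /pair_sum big1_seq// => x1 /= x1e.
  by rewrite big1_seq// => x2 /= x2e; rewrite conf_cons2K// indicE memNset.
have := ae_pair_eq0 d0 h0 mh.
have -> : (\int[mm]_x \int[lp]_xi h x xi = 0)%E.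
  rewrite integral0_eq// => x _; rewrite /h -[RHS]i0.
  by rewrite -(@fubini_tonelli _ _ (E * E)%type F R mm lp (fun z => (\1_N (conf_cons2 z.1 z.2) : R)%:E)).
move=> /(_ erefl); apply: filterS => g hg x1 x2 x1g x2g.
have hx : h (x1, x2) (g `\ x1 `\ x2)%fset = 0%E.
  by apply/eqP; rewrite eq_le h0 andbT -hg; exact: pair_sum_eq0.
have my : measurable_fun setT (fun y => (\1_N (conf_cons2 y (g `\ x1 `\ x2)%fset) : R)%:E).
  apply: (measurableT_comp mI (g := fun y => (y, (g `\ x1 `\ x2)%fset : F))).
  exact: measurable_fun_pair.
have := (ae_eq_integral_abs mm measurableT my).1.
have -> : (\int[mm]_y `|(\1_N (conf_cons2 y (g `\ x1 `\ x2)%fset) : R)%:E| = 0)%E.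
  by rewrite -[RHS]hx; apply: eq_integral => y _; rewrite gee0_abs.
move=> /(_ erefl); apply: filterS => y /(_ I) h1; apply: contrapT => nP.
have Ny : N (conf_cons2 y (g `\ x1 `\ x2)%fset) by apply: PN.
by move: h1; rewrite indicE mem_set// => -[] /eqP; rewrite oner_eq0.
Qed.

Lemma ae_fresh2 (eta : F) : {ae mm, forall y : E * E,
  [/\ y.1 \notin (eta : {fset E}), y.2 \notin (eta : {fset E}) & y.1 != y.2]}.
Proof.
pose A := [set y : E * E | ~~ (y.1 \in (y.2 |` eta)%fset) && ~~ (y.2 \in (eta : {fset E}))].
have m1 : measurable_fun setT (fun y : E * E => y.1 \in (y.2 |` eta)%fset).
  apply: (measurable_in_fconf (x := fst) (e := fun y : E * E => (y.2 |` eta)%fset : F)) => //.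
  by refine (@measurable_fsetU1 R d _ (E * E)%type snd (fun=> eta) _ _).
have m2 : measurable_fun setT (fun y : E * E => y.2 \in (eta : {fset E})).
  exact: (measurable_in_fconf (x := snd) (e := fun=> eta)).
have mA : measurable A.
  have := measurable_and (measurable_neg m1) (measurable_neg m2).
  by move=> /(_ measurableT [set true] I); rewrite setTI; congr measurable; apply/seteqP; split.
have mI : measurable_fun setT (fun y => (\1_(~` A) y : R)%:E).
  by apply: measurable_EFin_indic => //; exact: measurableC.
have : (\int[mm]_y (\1_(~` A) y : R)%:E = 0)%E.
  rewrite prodm_int21//; rewrite -[RHS](@integral0 _ _ R m setT).
  apply: ae_eq_integral => //.
    by refine (@measurable_fun_fubini_tonelli_G _ _ E E R m (fun z => (\1_(~` A) z : R)%:E) _ _).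
  apply: filterS (ae_fresh d0 eta) => y2 y2e _.
  rewrite -[RHS](@integral0 _ _ R m setT); apply: ae_eq_integral => //.
    by apply: (measurableT_comp mI (g := fun x => (x, y2))); exact: measurable_fun_pair.
  apply: filterS (ae_fresh d0 (y2 |` eta)%fset) => y1 y1e _.
  by rewrite indicE memNset//= /A/= y1e y2e => /(_ isT).
move=> i0; have := (ae_eq_integral_abs mm measurableT mI).1.
have -> : (\int[mm]_x `|(\1_(~` A) x : R)%:E| = 0)%E.
  by rewrite -i0; apply: eq_integral => y _; rewrite gee0_abs.
move=> /(_ erefl); apply: filterS => y /(_ I) h.
have : A y.
  apply: contrapT => nA; move: h; rewrite indicE mem_set// => -[] /eqP.
  by rewrite oner_eq0.
rewrite /A/= !inE negb_or => /andP[/andP[y12 y1] y2]; split => //.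
Qed.

(** Subsets are sorted by their trace on the two added points. *)
Lemma Kf_cons2 (G : F -> R) (y : E * E) (Z : F) :
  y.1 \notin (Z : {fset E}) -> y.2 \notin (Z : {fset E}) -> y.1 != y.2 ->
  Kf G (conf_cons2 y Z) =
  \sum_(zeta <- fpowerset Z) (G zeta + G (y.2 |` zeta)%fset + G (y.1 |` zeta)%fset
     + G (conf_cons2 y zeta)).
Proof.
move=> y1 y2 y12; rewrite /Kf /conf_cons2.
rewrite (sum_fpowersetU1 (A := (y.2 |` Z)%fset)); last by rewrite !inE negb_or y12.
rewrite (sum_fpowersetU1 (A := Z) (x := y.2) G)//.
rewrite (sum_fpowersetU1 (A := Z) (x := y.2) (fun B => G (y.1 |` B)%fset))//.
by rewrite !big_split/= -!addrA.
Qed.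

Variable c : E -> E -> E -> E -> R.
Hypothesis jr : jump_rate c.
Hypotheses (c1oo : (c1 c < +oo)%E) (c2oo : (c2 c < +oo)%E)
  (c3oo : (c3 c < +oo)%E) (c4oo : (c4 c < +oo)%E).
Hypothesis a21 : {ae mm, forall x, (a2 c x <= a1 c x)%E}.

Section Kf_gen.
Variables (G : F -> R) (gam : F).
Hypothesis mG : measurable_fun setT G.
Hypothesis gG : forall xi : F, (xi `<=` gam)%fset -> good c G xi.

(* [y] ranges over the arrival points; for almost every [y] this is
   [c x y * Kf G (conf_cons2 y Z)]. *)
Definition Kf_integrand (x : E * E) (Z : F) (y : E * E) : R :=
  \sum_(zeta <- fpowerset Z) (c x.1 x.2 y.1 y.2 * G zeta + c x.1 x.2 y.1 y.2 * G (y.2 |` zeta)%fset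
    + c x.1 x.2 y.1 y.2 * G (y.1 |` zeta)%fset + c x.1 x.2 y.1 y.2 * G (conf_cons2 y zeta)).

(** Goodness concerns a pair and the rest of the configuration; zeta with the pair added is a subset
    of gam whose rest is zeta. *)
Lemma good_pair_sub x1 x2 (zeta : F) : x1 \in (gam : {fset E}) -> x2 \in (gam `\ x1)%fset ->
  (zeta `<=` gam `\ x1 `\ x2)%fset -> good_pair c G (x1, x2) zeta.
Proof.
move=> x1g x2g zg.
have x2z : x2 \notin (zeta : {fset E}).
  by apply/negP => /(fsubsetP zg); rewrite !inE eqxx.
have x1z : x1 \notin (zeta : {fset E}).
  by apply/negP => /(fsubsetP zg); rewrite !inE eqxx andbF.
have x12 : x1 != x2 by move: x2g; rewrite !inE eq_sym => /andP[].
have sub : (conf_cons2 (x1, x2) zeta `<=` gam)%fset.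
  rewrite /conf_cons2/= !fsubUset !fsub1set x1g (fsubsetP (fsubD1set _ _) _ x2g)/=.
  by apply: fsubset_trans zg _; apply: fsubset_trans (fsubD1set _ _) (fsubD1set _ _).
have x1c : x1 \in (conf_cons2 (x1, x2) zeta : {fset E}) by rewrite !inE eqxx.
have e1 : (conf_cons2 (x1, x2) zeta `\ x1)%fset = (x2 |` zeta)%fset.
  by rewrite /conf_cons2/= fsetU1K// !inE negb_or x12.
have x2c : x2 \in (conf_cons2 (x1, x2) zeta `\ x1)%fset by rewrite e1 !inE eqxx.
have := gG sub x1c x2c; rewrite e1 fsetU1K//.
Qed.

Lemma swap_integrable x (zeta : F) : good_pair c G x zeta ->
  mm.-integrable setT (fun y => (c x.1 x.2 y.1 y.2 * G (y.2 |` zeta)%fset)%:E).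
Proof.
move=> [ax _ /integrableP[/measurable_EFinP mi ioo]].
have mi' : measurable_fun setT (fun y : E * E => c x.1 x.2 y.1 y.2 * G (y.2 |` zeta)%fset).
  rewrite (_ : (fun y => _) = (fun y : E * E => (fun y : E * E => c x.1 x.2 y.1 y.2 * G (y.1 |` zeta)%fset) (y.2, y.1))).
    by apply: (measurableT_comp mi); exact: measurable_fun_pair.
  by apply/funext => y /=; have [_ _ _ ->] := jr.
apply/integrableP; split; first exact/measurable_EFinP.
apply: le_lt_trans ioo; rewrite -integral_prodm_swap; first last.
- by move=> y; rewrite abse_ge0.
- by apply: measurableT_comp => //; exact/measurable_EFinP.
rewrite le_eqVlt; apply/orP; left; apply/eqP; apply: eq_integral => y _ /=.
by have [_ _ _ ->] := jr.
Qed.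

Lemma gain1_swap x (zeta : F) : good_pair c G x zeta ->
  \int[mm]_y (c x.1 x.2 y.1 y.2 * G (y.2 |` zeta)%fset) = gain1 c G x zeta.
Proof.
move=> [ax _ /integrableP[/measurable_EFinP mi _]].
rewrite /gain1 -[RHS]Rintegral_prodm_swap//; apply: eq_Rintegral => y _ /=.
by have [_ _ _ ->] := jr.
Qed.

Lemma Kf_integrand_term x (zeta : F) : good_pair c G x zeta ->
  mm.-integrable setT (fun y => (c x.1 x.2 y.1 y.2 * G zeta + c x.1 x.2 y.1 y.2 * G (y.2 |` zeta)%fset
    + c x.1 x.2 y.1 y.2 * G (y.1 |` zeta)%fset + c x.1 x.2 y.1 y.2 * G (conf_cons2 y zeta))%:E) /\
  \int[mm]_y (c x.1 x.2 y.1 y.2 * G zeta + c x.1 x.2 y.1 y.2 * G (y.2 |` zeta)%fset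
    + c x.1 x.2 y.1 y.2 * G (y.1 |` zeta)%fset + c x.1 x.2 y.1 y.2 * G (conf_cons2 y zeta)) =
  rate c x * G zeta + 2 * gain1 c G x zeta + gain2 c G x zeta.
Proof.
move=> gp; have [ax i2 i1] := gp; have isw := swap_integrable gp.
have i0 := integrable_rateZ jr (G zeta) ax.
have i01 := integrableD measurableT i0 isw.
have i012 := integrableD measurableT i01 i1.
have i0123 := integrableD measurableT i012 i2.
split; first exact: i0123.
rewrite (RintegralD _ i012 i2)// (RintegralD _ i01 i1)// (RintegralD _ i0 isw)//.
rewrite Rintegral_rateZ// gain1_swap// -/(gain1 c G x zeta) -/(gain2 c G x zeta); lra.
Qed.

Lemma Kf_integrandE x1 x2 : x1 \in (gam : {fset E}) -> x2 \in (gam `\ x1)%fset ->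
  \int[mm]_y Kf_integrand (x1, x2) (gam `\ x1 `\ x2)%fset y =
  \sum_(zeta <- fpowerset (gam `\ x1 `\ x2)%fset)
    (rate c (x1, x2) * G zeta + 2 * gain1 c G (x1, x2) zeta + gain2 c G (x1, x2) zeta).
Proof.
move=> x1g x2g; rewrite /Kf_integrand.
have : forall zeta, zeta \in (fpowerset (gam `\ x1 `\ x2)%fset : seq {fset E}) -> good_pair c G (x1, x2) zeta.
  by move=> zeta; rewrite fpowersetE => h; exact: good_pair_sub.
elim: (fpowerset _ : seq {fset E}) => [|z s IH] gs.
  by under eq_Rintegral do rewrite big_nil; rewrite big_nil /Rintegral integral0.
have [iz ez] := Kf_integrand_term (gs _ (mem_head _ _)).
have gs' : forall zeta, zeta \in s -> good_pair c G (x1, x2) zeta.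
  by move=> zeta zs; apply: gs; rewrite inE zs orbT.
have iss : mm.-integrable setT (fun y => (\sum_(zeta <- s) (c x1 x2 y.1 y.2 * G zeta + c x1 x2 y.1 y.2 * G (y.2 |` zeta)%fset
    + c x1 x2 y.1 y.2 * G (y.1 |` zeta)%fset + c x1 x2 y.1 y.2 * G (conf_cons2 y zeta)))%:E).
  elim: s gs' {gs IH} => [|w s IH] gs.
    by under eq_fun do rewrite big_nil; exact: integrable0.
  under eq_fun do rewrite big_cons EFinD.
  apply: integrableD => //; first by have [] := Kf_integrand_term (gs _ (mem_head _ _)).
  by apply: IH => zeta zs; apply: gs; rewrite inE zs orbT.
under eq_Rintegral do rewrite big_cons.
by rewrite (RintegralD _ iz iss)// big_cons -IH// ez.
Qed.

(** The relation between the generators before and after the K-transform, at a finite configuration.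
    All sums are rearranged over a departing pair and a subset zeta of the other points. Subsets
    with one arrival point occur twice, equally by the symmetry of c in y1 and y2, and the factor
    1/2 leaves one [gain1]. *)
Lemma Kf_gen : Kf (gen c G) gam =
  2^-1 * (\sum_(x1 <- gam) \sum_(x2 <- (gam `\ x1)%fset)
    \int[mm]_y Kf_integrand (x1, x2) (gam `\ x1 `\ x2)%fset y) - 2^-1 * trate c gam * Kf G gam.
Proof.
pose phi x (zeta : F) := 2^-1 * (gain2 c G x zeta - rate c x * G (conf_cons2 x zeta)) +
     (gain1 c G x zeta - rate c x * G (x.2 |` zeta)%fset).
have -> : Kf (gen c G) gam = \sum_(x1 <- gam) \sum_(x2 <- (gam `\ x1)%fset)
    \sum_(zeta <- fpowerset (gam `\ x1 `\ x2)%fset) phi (x1, x2) zeta.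
  transitivity (\sum_(xi <- fpowerset gam) \sum_(x1 <- (xi : F)) \sum_(x2 <- (xi `\ x1)%fset)
     phi (x1, x2) (xi `\ x1 `\ x2)%fset).
    apply: eq_big_seq => xi; rewrite fpowersetE => xig; rewrite genE//; last exact: gG.
    apply: eq_big_seq => x1 x1x; apply: eq_big_seq => x2 x2x.
    by rewrite /phi conf_cons2K.
  rewrite (sum_fpowerset_removal gam (fun x1 xi => \sum_(x2 <- (xi : F)) phi (x1, x2) (xi `\ x2)%fset)).
  apply: eq_bigr => x1 _.
  by rewrite (sum_fpowerset_removal (gam `\ x1)%fset (fun x2 xi => phi (x1, x2) xi)).
pose S1 (x : E) (Z : F) := \sum_(zeta <- fpowerset Z) G (x |` zeta)%fset.
rewrite -[2^-1 * trate c gam * _]mulrA.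
(* A subset meeting the pair in one point contains x1 or x2. Exchanging the pair, with [a1]
   symmetric, shows that both kinds give the same total, hence the factor 2. *)
have -> : trate c gam * Kf G gam = \sum_(x1 <- gam) \sum_(x2 <- (gam `\ x1)%fset)
    \sum_(zeta <- fpowerset (gam `\ x1 `\ x2)%fset)
      (rate c (x1, x2) * (G zeta + 2 * G (x2 |` zeta)%fset + G (conf_cons2 (x1, x2) zeta))).
  transitivity (\sum_(x1 <- gam) \sum_(x2 <- (gam `\ x1)%fset)
     (rate c (x1, x2) * \sum_(zeta <- fpowerset (gam `\ x1 `\ x2)%fset)
         (G zeta + G (x2 |` zeta)%fset + G (conf_cons2 (x1, x2) zeta)) +
      rate c (x1, x2) * S1 x1 (gam `\ x1 `\ x2)%fset)).
    rewrite /trate mulr_suml; apply: eq_big_seq => x1 x1g.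
    rewrite mulr_suml; apply: eq_big_seq => x2 x2g; rewrite -mulrDr; congr (_ * _).
    rewrite -{1}(conf_cons2K x1g x2g) Kf_cons2; first last.
    - by move: x2g; rewrite !inE eq_sym => /andP[].
    - by rewrite !inE eqxx.
    - by rewrite !inE eqxx andbF.
    by rewrite /S1 -big_split/=; apply: eq_bigr => zeta _; lra.
  under eq_bigr do rewrite big_split.
  rewrite big_split/=.
  have -> : \sum_(x1 <- gam) \sum_(x2 <- (gam `\ x1)%fset) rate c (x1, x2) * S1 x1 (gam `\ x1 `\ x2)%fset =
     \sum_(x1 <- gam) \sum_(x2 <- (gam `\ x1)%fset) rate c (x1, x2) * S1 x2 (gam `\ x1 `\ x2)%fset.
    rewrite sum_pair_swap; apply: eq_bigr => x1 _; apply: eq_bigr => x2 _.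
    by rewrite /rate (a1C jr) fsetDDl fsetUC -fsetDDl.
  rewrite -big_split/=; apply: eq_bigr => x1 _; rewrite -big_split/=; apply: eq_bigr => x2 _.
  rewrite -mulrDr /S1 -big_split mulr_sumr/=; apply: eq_bigr => zeta _; congr (_ * _); lra.
have -> : \sum_(x1 <- gam) \sum_(x2 <- (gam `\ x1)%fset)
    \int[mm]_y Kf_integrand (x1, x2) (gam `\ x1 `\ x2)%fset y =
  \sum_(x1 <- gam) \sum_(x2 <- (gam `\ x1)%fset) \sum_(zeta <- fpowerset (gam `\ x1 `\ x2)%fset)
    (rate c (x1, x2) * G zeta + 2 * gain1 c G (x1, x2) zeta + gain2 c G (x1, x2) zeta).
  by apply: eq_big_seq => x1 x1g; apply: eq_big_seq => x2 x2g; exact: Kf_integrandE.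
rewrite !mulr_sumr -sumrB; apply: eq_big_seq => x1 x1g.
rewrite !mulr_sumr -sumrB; apply: eq_big_seq => x2 x2g.
rewrite !mulr_sumr -sumrB; apply: eq_bigr => zeta _; rewrite /phi/=.
set r := rate _ _; set g := G zeta; set g1 := G (x2 |` zeta)%fset; set g2 := G (conf_cons2 _ _).
lra.
Qed.

End Kf_gen.

Lemma KfD (G H : F -> R) s gam :
  Kf (fun eta => G eta + s * H eta) gam = Kf G gam + s * Kf H gam.
Proof. by rewrite /Kf big_split mulr_sumr. Qed.

Lemma Rintegral_ae_ge0 (f : E * E -> R) : measurable_fun setT f ->
  {ae mm, forall y, 0 <= f y} -> 0 <= \int[mm]_y f y.
Proof.
move=> mf f0; rewrite /Rintegral (_ : (\int[mm]_y (f y)%:E = \int[mm]_y `|f y|%:E)%E).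
  by rewrite fine_ge0// integral_ge0// => y _; rewrite lee_fin.
apply: ae_eq_integral => //; [exact/measurable_EFinP| |].
  by apply/measurable_EFinP; exact: measurableT_comp.
by apply: filterS f0 => y f0 _; rewrite ger0_norm.
Qed.

Lemma card_cons2_le (gam : F) x1 x2 (y : E * E) : x1 \in (gam : {fset E}) ->
  x2 \in (gam `\ x1)%fset ->
  (#|` conf_cons2 y (gam `\ x1 `\ x2)|%fset <= #|` gam|%fset)%N.
Proof.
move=> x1g x2g; rewrite (cardfsD1 x1 gam) x1g (cardfsD1 x2 (gam `\ x1)%fset) x2g addnA.
by rewrite /conf_cons2 !cardfsU1 addnA leq_add2r leq_add// leq_b1.
Qed.

(** The K-transform of the step is that of G at gam with coefficient 1 - (s/2) [trate], plus
    integrals of the K-transform of G over configurations after one jump. The latter have no more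
    points than gam, so the sign on at most n points is preserved. *)
Lemma Kf_euler_step_ge0 (G : F -> R) s n : locint G -> 0 <= s ->
  s * ((n * n)%:R * c1r c) <= 1 ->
  {ae lp, forall gam : F, (#|` gam|%fset <= n)%N -> 0 <= Kf G gam} ->
  {ae lp, forall gam : F, (#|` gam|%fset <= n)%N ->
    0 <= Kf (fun eta => G eta + s * gen c G eta) gam}.
Proof.
move=> lG s0 sn K0; have [mG _] := lG.
have h1 := null_powerset (ae_good jr d0 c1oo c2oo c4oo lG).
have h2 := null_cons2 K0; have h3 := ae_trate_le jr d0 c1oo.
have h23 : {ae lp, forall gam : F, (forall x1 x2, x1 \in (gam : {fset E}) ->
    x2 \in (gam `\ x1)%fset -> {ae mm, forall y,
    (#|` conf_cons2 y (gam `\ x1 `\ x2)%fset|%fset <= n)%N ->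
    0 <= Kf G (conf_cons2 y (gam `\ x1 `\ x2)%fset)}) /\
    trate c gam <= (#|` gam|%fset * #|` gam|%fset)%:R * c1r c}.
  by apply: filterS2 h2 h3 => gam k2 tr; split.
apply: filterS3 K0 h1 h23 => gam k0 gG [k2 tr] gn.
rewrite KfD Kf_gen//.
set I2 := \sum_(x1 <- gam) _.
have I20 : 0 <= I2.
  rewrite /I2 big_seq; apply: sumr_ge0 => x1 x1g; rewrite big_seq; apply: sumr_ge0 => x2 x2g.
  apply: Rintegral_ae_ge0.
    apply: measurable_sum => zeta.
    pose mc := measurable_rate1 jr (x1, x2).
    have mU (f : E * E -> E) : measurable_fun setT f -> measurable_fun setT (fun y => G (f y |` zeta)%fset).
      by move=> mf; apply: (measurableT_comp mG); refine (@measurable_fsetU1 R d _ (E * E)%type f (fun=> zeta) _ _).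
    apply: measurable_funD; [apply: measurable_funD; [apply: measurable_funD|]|]; apply: measurable_funM => //.
    - exact: mU measurable_snd.
    - exact: mU measurable_fst.
    - apply: (measurableT_comp mG).
      apply: (measurableT_comp (@measurable_conf_cons2 R d) (g := fun y => (y, zeta : F))).
      exact: measurable_fun_pair.
  apply: filterS2 (ae_fresh2 (gam `\ x1 `\ x2)%fset) (k2 _ _ x1g x2g) => y [y1 y2 y12] ky.
  rewrite (_ : Kf_integrand _ _ _ _ = c x1 x2 y.1 y.2 * Kf G (conf_cons2 y (gam `\ x1 `\ x2)%fset)).
    apply: mulr_ge0; first by have [+ _ _ _] := jr; apply.
    by apply: ky; exact: leq_trans (card_cons2_le y x1g x2g) gn.
  by rewrite Kf_cons2// mulr_sumr; apply: eq_bigr => zeta _; rewrite !mulrDr.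
have st : s * trate c gam <= 1.
  apply: le_trans sn; rewrite ler_wpM2l//; apply: le_trans tr _.
  by rewrite ler_wpM2r ?(c1r_ge0 jr)// ler_nat leq_mul.
have -> : Kf G gam + s * (2^-1 * I2 - 2^-1 * trate c gam * Kf G gam) =
  (1 - 2^-1 * (s * trate c gam)) * Kf G gam + s * 2^-1 * I2 by lra.
have t0 := trate_ge0 jr gam; have st0 := mulr_ge0 s0 t0.
apply: addr_ge0; apply: mulr_ge0; [by lra|exact: k0|by rewrite mulr_ge0|by []].
Qed.

Lemma Kf_euler_ge0 (G : F -> R) s n N : locint G -> 0 <= s ->
  s * ((n * n)%:R * c1r c) <= 1 ->
  {ae lp, forall gam : F, 0 <= Kf G gam} ->
  {ae lp, forall gam : F, (#|` gam|%fset <= n)%N -> 0 <= Kf (euler c s N G) gam}.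
Proof.
move=> lG s0 sn K0; elim: N => [|N IH].
  by apply: filterS K0 => gam ->.
apply: Kf_euler_step_ge0 => //; exact: (locint_euler jr d0).
Qed.

(** The K-transform at gam is a finite sum over subsets, so the error of the Euler products is at
    most D/N there. The step condition depends on the number of points of gam and holds from some N
    on. *)
Lemma Kf_semig_ge0 (G : F -> R) t : locint G -> 0 <= t ->
  {ae lp, forall gam : F, 0 <= Kf G gam} ->
  {ae lp, forall gam : F, 0 <= Kf (semig c t G) gam}.
Proof.
move=> lG t0 K0; have t4 : 0 <= 4 * t by rewrite mulr_ge0.
have h1 : {ae lp, forall gam : F, forall N, t / N.+1%:R * ((#|` gam|%fset * #|` gam|%fset)%:R * c1r c) <= 1 ->
    0 <= Kf (euler c (t / N.+1%:R) N.+1 G) gam}.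
  have : {ae lp, forall gam : F, forall n N, t / N.+1%:R * ((n * n)%:R * c1r c) <= 1 ->
      (#|` gam|%fset <= n)%N -> 0 <= Kf (euler c (t / N.+1%:R) N.+1 G) gam}.
    apply/ae_foralln => n; apply/ae_foralln => N.
    have [tn|tn] := leP (t / N.+1%:R * ((n * n)%:R * c1r c)) 1; last exact: aeW.
    have s0 : 0 <= t / N.+1%:R by rewrite divr_ge0.
    by apply: filterS (Kf_euler_ge0 N.+1 lG s0 tn K0) => gam h _; exact: h.
  by apply: filterS => gam h N tN; apply: h tN _.
have h2 : {ae lp, forall gam : F, forall xi : F, (xi `<=` gam)%fset -> forall N,
    euler c (t / N.+1%:R) N.+1 G xi = \sum_(j < N.+2) 'C(N.+1, j)%:R * (t / N.+1%:R) ^+ j * orb c G xi j}.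
  by apply: null_powerset; apply/ae_foralln => N; exact: (euler_binomial jr d0).
have h3 := null_powerset (ae_absd jr d0 c1oo c2oo c3oo c4oo a21 lG t4).
apply: filterS3 h1 h2 h3 => gam k0 eE aoo.
pose D := \sum_(xi <- fpowerset gam) orbd c (4 * t) G xi.
have D0 : 0 <= D by apply: sumr_ge0 => xi _; exact: orbd_ge0.
have step N : t / N.+1%:R * ((#|` gam|%fset * #|` gam|%fset)%:R * c1r c) <= 1 ->
    - (N.+1%:R^-1 * D) <= Kf (semig c t G) gam.
  move=> /k0 kN; apply: (@le_trans _ _ (Kf (euler c (t / N.+1%:R) N.+1 G) gam - N.+1%:R^-1 * D)).
    by rewrite -[leLHS]add0r lerD2r.
  rewrite /Kf /D mulr_sumr -sumrB big_seq [leRHS]big_seq; apply: ler_sum => xi.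
  rewrite fpowersetE => xig; rewrite eE// lerBlDr -lerBlDl.
  apply: le_trans (ler_norm _) _.
  exact: (psum_euler (ltn0Sn N) t0 (aoo _ xig)).
set q := (#|` gam|%fset * #|` gam|%fset)%:R * c1r c in step.
have q0 : 0 <= q by rewrite mulr_ge0// (c1r_ge0 jr).
apply/ler_addgt0Pr => e e0.
have [N1 hN1] : exists N, D / e <= N.+1%:R.
  by exists (Num.truncn (D / e)); apply/ltW; exact: truncnS_gt.
have [N2 hN2] : exists N, t * q <= N.+1%:R.
  by exists (Num.truncn (t * q)); apply/ltW; exact: truncnS_gt.
have N0 : 0 < (N1 + N2).+1%:R :> R by rewrite ltr0n.
have /step : t / (N1 + N2).+1%:R * q <= 1.
  rewrite mulrAC ler_pdivrMr// mul1r; apply: le_trans hN2 _.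
  by rewrite ler_nat ltnS leq_addl.
rewrite -lerBlDr sub0r; apply: le_trans; rewrite lerN2 mulrC ler_pdivrMr//.
rewrite -ler_pdivrMl// mulrC; apply: le_trans hN1 _.
by rewrite ler_nat ltnS leq_addr.
Qed.

End positivity.

(** * The inverse K-transform *)

Section inverse_K.
Context {R : realType} {d : nat}.
Local Notation E := (euclid R d).
Local Notation F := (fconf R d).
Local Notation m := (lebesgue_space R d).
Local Notation lp := (@lpm R d).

Lemma fconf_ind (P : F -> Prop) : P fset0 ->
  (forall x (A : F), x \notin (A : {fset E}) -> P A -> P (x |` A)%fset) -> forall A, P A.
Proof.
move=> P0 PU A; have [n] := ubnP #|` A|%fset; elim: n A => // n IH A.
have [->//|/fset0Pn[x xA]] := eqVneq (A : {fset E}) fset0.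
rewrite (cardfsD1 x A) xA ltnS add1n => cA.
by rewrite -(fsetD1K xA); apply: PU; [rewrite !inE eqxx|exact: IH].
Qed.

(** Moebius inversion over the subsets of eta; the inverse of [Kf] by [Kf_Ki] and [Ki_Kf]. *)
Definition Ki (f : F -> R) (eta : F) : R :=
  \sum_(xi <- fpowerset eta) (-1) ^+ #|` (eta `\` xi)|%fset * f xi.

Lemma KiU1 (f : F -> R) x (A : F) : x \notin (A : {fset E}) ->
  Ki f (x |` A)%fset = Ki (fun B => f (x |` B)%fset) A - Ki f A.
Proof.
move=> xA; rewrite /Ki (sum_fpowersetU1 (fun B => (-1) ^+ #|` ((x |` A) `\` B)|%fset * f B) xA).
rewrite addrC -sumrN; congr (_ + _); apply: eq_big_seq => B; rewrite fpowersetE => BA.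
  have xB : x \notin B by apply: contra xA; exact: (fsubsetP BA).
  congr ((-1) ^+ _ * _); rewrite fsetDUl fsetDUr fsetDv fset0I fset0U.
  by congr (#|` _|%fset); apply/fsetP => z; rewrite !inE; case: eqP => [->|]; rewrite ?(negbTE xA) ?andbF//= andbC; case: (z \in A); rewrite ?andbT ?andbF ?andbb.
have xB : x \notin B by apply: contra xA; exact: (fsubsetP BA).
rewrite -mulNr; congr (_ * _).
have -> : ((x |` A) `\` B)%fset = (x |` (A `\` B))%fset.
  by apply/fsetP => z; rewrite !inE; case: eqP => [->|]//=; rewrite xB.
by rewrite cardfsU1 !inE (negbTE xA) andbF add1n exprS mulN1r.
Qed.

Lemma Kf_Ki (f : F -> R) gam : Kf (Ki f) gam = f gam.
Proof.
elim/fconf_ind: gam f => [|x A xA IH] f.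
  by rewrite /Kf /Ki fpowerset0 !big_seq_fset1 fpowerset0 big_seq_fset1 fsetDv cardfs0 expr0 mul1r.
rewrite /Kf (sum_fpowersetU1 _ xA) -big_split/=.
rewrite -[RHS](IH (fun B => f (x |` B)%fset)); apply: eq_big_seq => B; rewrite fpowersetE => BA.
have xB : x \notin B by apply: contra xA; exact: (fsubsetP BA).
by rewrite KiU1// addrC subrK.
Qed.

Lemma normr_Ki (f : F -> R) (K a : R) eta : 1 <= a -> 0 <= K ->
  (forall eta, `|f eta| <= K * a ^+ #|` eta|%fset) ->
  `|Ki f eta| <= K * (2 * a) ^+ #|` eta|%fset.
Proof.
move=> a1 K0 fK; apply: le_trans (ler_norm_sum _ _ _) _.
apply: (@le_trans _ _ (\sum_(xi <- fpowerset eta) K * a ^+ #|` eta|%fset)).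
  rewrite !big_seq; apply: ler_sum => xi; rewrite fpowersetE => xie.
  rewrite normrM normrX normrN1 expr1n mul1r; apply: le_trans (fK _) _.
  by rewrite ler_wpM2l// ler_weXn2l// fsubset_leq_card.
rewrite big_const_seq count_predT iter_addr_0 card_fpowerset exprMn -[leLHS]mulr_natl natrX.
by rewrite mulrCA.
Qed.

(** Inclusion-exclusion: the alternating sum over subsets of the points in D cancels unless there
    are no such points. *)
Lemma alternating_sum (D : set E) (eta : F) :
  \sum_(xi <- fpowerset eta) (\1_(subconf D) xi : R) * (-1) ^+ #|` (eta `\` xi)|%fset =
  \1_(subconf (~` D)) eta * (-1) ^+ #|` eta|%fset.
Proof.
transitivity (Ki (\1_(subconf D)) eta); first by apply: eq_bigr => xi _; rewrite mulrC.
suff H : forall f : F -> R, (forall A, f A = \1_(subconf D) A) -> Ki f eta = \1_(subconf (~` D)) eta * (-1) ^+ #|` eta|%fset by exact: H.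
elim/fconf_ind: eta => [|x A xA IH] f fE.
  rewrite /Ki fpowerset0 big_seq_fset1 fsetDv cardfs0 expr0 mul1r mulr1 fE.
  by rewrite !indicE !mem_set// => y /=; rewrite inE.
rewrite KiU1// (IH f fE).
have [Dx|nDx] := pselect (D x).
  rewrite (IH (fun B => f (x |` B)%fset)) ?subrr.
    rewrite indicE memNset ?mul0r// => /(_ x); apply => //=; first by rewrite !inE eqxx.
  move=> B; rewrite fE !indicE; congr (_%:R); congr nat_of_bool.
  apply/idP/idP; rewrite !inE/= => h y /=; first by move=> yB; apply: h; rewrite /= !inE yB orbT.
  by rewrite !inE => /orP[/eqP -> //|yB]; exact: h.
rewrite (_ : Ki (fun B => f (x |` B)%fset) A = 0); last first.
  rewrite /Ki big1// => B _; rewrite fE indicE memNset ?mulr0// => /(_ x); apply: contra_not nDx.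
  by apply; rewrite /= !inE eqxx.
rewrite sub0r cardfsU1 xA add1n exprS mulrCA mulN1r; congr (- (_ * _)).
rewrite !indicE; congr (_%:R); congr nat_of_bool.
apply/idP/idP; rewrite !inE/= => h y /=; last by move=> yB; apply: h; rewrite /= !inE yB orbT.
by rewrite !inE => /orP[/eqP -> //|yB]; exact: h.
Qed.

Lemma measurable_powerset_Rsum (H : F -> F -> R) :
  measurable_fun setT (fun z : F * F => H z.1 z.2) ->
  measurable_fun setT (fun eta : F => \sum_(xi <- fpowerset eta) H xi (eta `\` xi)%fset).
Proof.
move=> mH.
pose Hp xi zeta := Num.max (H xi zeta) 0; pose Hn xi zeta := Num.max (- H xi zeta) 0.
have mHs (h : F -> F -> R) : (forall x y, 0 <= h x y) -> measurable_fun setT (fun z : F * F => h z.1 z.2) ->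
    measurable_fun setT (fun eta : F => \sum_(xi <- fpowerset eta) h xi (eta `\` xi)%fset).
  move=> h0 mh; apply/measurable_EFinP.
  rewrite (_ : EFin \o _ = (fun eta : F => \sum_(xi <- fpowerset eta) (h xi (eta `\` xi)%fset)%:E)%E); last first.
    by apply/funext => eta; rewrite /= sumEFin.
  refine (@measurable_fpowerset_sum R d _ F id (fun _ x y => (h x y)%:E) _ _ _) => //.
  apply/measurable_EFinP; apply: (measurableT_comp mh (g := fun z : F * F * F => (z.1.2, z.2))).
  by apply/measurable_fun_pair => //=; exact: measurableT_comp.
have E0 x : x = Num.max x 0 - Num.max (- x) 0 :> R.
  by case: (ger0P x) => x0; [rewrite max_r ?oppr_le0 ?subr0|rewrite max_l ?oppr_ge0 ?(ltW x0) ?sub0r ?opprK].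
rewrite (_ : (fun eta => _) = (fun eta : F => \sum_(xi <- fpowerset eta) Hp xi (eta `\` xi)%fset -
    \sum_(xi <- fpowerset eta) Hn xi (eta `\` xi)%fset)).
  apply: measurable_funB; apply: mHs => [x y|]; rewrite ?le_max ?lexx ?orbT//.
    exact: measurable_maxr.
  by apply: measurable_maxr => //; exact: measurableT_comp.
by apply/funext => eta; rewrite -sumrB; apply: eq_bigr => xi _; exact: E0.
Qed.

Lemma measurable_Kf (G : F -> R) : measurable_fun setT G -> measurable_fun setT (Kf G).
Proof.
move=> mG; apply: (measurable_powerset_Rsum (H := fun xi _ => G xi)).
exact: (measurableT_comp mG measurable_fst).
Qed.

Lemma measurable_sgn : measurable_fun setT (fun eta : F => (-1) ^+ #|` eta|%fset : R).
Proof. exact: measurable_weight. Qed.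

Lemma measurable_Ki (f : F -> R) : measurable_fun setT f -> measurable_fun setT (Ki f).
Proof.
move=> mf; apply: (measurable_powerset_Rsum (H := fun xi zeta => (-1) ^+ #|` zeta|%fset * f xi)).
apply: measurable_funM; first exact: (measurableT_comp measurable_sgn measurable_snd).
exact: (measurableT_comp mf measurable_fst).
Qed.

Hypothesis d0 : (0 < d)%N.

Section minlos_int.
Variable f : F * F -> R.
Hypothesis fi : (prodm lp lp).-integrable setT (EFin \o f).

Let mf : measurable_fun setT f.
Proof. by have /integrableP[/measurable_EFinP] := fi. Qed.

Let Sf (g : F * F -> R) (eta : F) : R := \sum_(xi <- fpowerset eta) g (xi, (eta `\` xi)%fset).

Let mSf (g : F * F -> R) : measurable_fun setT g -> measurable_fun setT (Sf g).
Proof.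
move=> mg; apply: (measurable_powerset_Rsum (H := fun xi zeta => g (xi, zeta))).
by rewrite (_ : (fun z => _) = g)//; apply/funext => -[].
Qed.

Let minlosE (g : F * F -> R) : measurable_fun setT g -> (forall z, 0 <= g z) ->
  (\int[lp]_eta (Sf g eta)%:E = \int[prodm lp lp]_z (g z)%:E)%E.
Proof.
move=> mg g0; rewrite prodm_int12//.
  rewrite -(minlos d0 (H := fun xi zeta => (g (xi, zeta))%:E)).
  - by apply: eq_integral => eta _; rewrite /Sf sumEFin.
  - by move=> *; rewrite lee_fin.
  - by rewrite (_ : (fun z => _) = EFin \o g); [exact/measurable_EFinP|apply/funext => -[]].
exact/measurable_EFinP.
Qed.

Lemma minlos_Rintegral : \int[lp]_eta Sf f eta = \int[prodm lp lp]_z f z.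
Proof.
pose p z := Num.max (f z) 0; pose n z := Num.max (- f z) 0.
have p0 z : 0 <= p z by rewrite le_max lexx orbT.
have n0 z : 0 <= n z by rewrite le_max lexx orbT.
have mp : measurable_fun setT p by exact: measurable_maxr.
have mn : measurable_fun setT n by apply: measurable_maxr => //; exact: measurableT_comp.
have fE z : f z = p z - n z.
  rewrite /p /n; case: (ger0P (f z)) => x0; first by rewrite max_r ?oppr_le0// subr0.
  by rewrite max_l ?oppr_ge0 ?(ltW x0)// sub0r opprK.
have ip : (prodm lp lp).-integrable setT (EFin \o p).
  apply: le_integrable fi => //; first exact/measurable_EFinP.
  move=> z _; rewrite lee_fin ger0_norm// /p ge_max ler_norm normr_ge0//.
have inn : (prodm lp lp).-integrable setT (EFin \o n).
  apply: le_integrable fi => //; first exact/measurable_EFinP.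
  by move=> z _; rewrite lee_fin ger0_norm// /n ge_max -(normrN (f z)) ler_norm normr_ge0.
have sub (g : F * F -> R) : (prodm lp lp).-integrable setT (EFin \o g) -> (forall z, 0 <= g z) ->
    measurable_fun setT g -> lp.-integrable setT (EFin \o Sf g) /\ \int[lp]_eta Sf g eta = \int[prodm lp lp]_z g z.
  move=> gi g0 mg; have e := minlosE mg g0; split; last by rewrite /Rintegral e.
  apply/integrableP; split; first by apply/measurable_EFinP; exact: mSf.
  under eq_integral => eta _ do rewrite gee0_abs ?lee_fin ?sumr_ge0//.
  rewrite [X in (X < _)%E]e; have /integrableP[_] := gi; apply: le_lt_trans.
  by rewrite le_eqVlt; apply/orP; left; apply/eqP; apply: eq_integral => z _; rewrite /= ger0_norm.
have [isp ep] := sub p ip p0 mp; have [isn en] := sub n inn n0 mn.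
transitivity (\int[lp]_eta (Sf p eta - Sf n eta)).
  by apply: eq_Rintegral => eta _; rewrite /Sf -sumrB; apply: eq_bigr => xi _; rewrite fE.
by rewrite RintegralB// ep en -RintegralB//; apply: eq_Rintegral => z _; rewrite -fE.
Qed.

Lemma Rintegral_prod : \int[prodm lp lp]_z f z = \int[lp]_x \int[lp]_y f (x, y).
Proof.
rewrite /Rintegral -(integral12_prod_meas1 fi); congr fine.
apply: ae_eq_integral => //.
- exact: (measurable_fubini_F fi).
- have h := measurable_fubini_F fi.
  by apply/measurable_EFinP; apply: measurableT_comp h; exact: fine_measurable.
have := ae_integrable1 fi; apply: filterS => x ix _.
by rewrite fineK//; exact: integrable_fin_num.
Qed.

End minlos_int.

Lemma nrm_subconf (L : set E) n : measurable L -> (m L < +oo)%E ->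
  nrm n (\1_(subconf L) : F -> R) = (fine (m L) ^+ n / n`!%:R)%:E.
Proof.
move=> mL Loo; have mI : measurable_fun setT (\1_(subconf L) : F -> R).
  by apply: measurable_indic; exact: measurable_subconf.
have := Xnorm_nrm d0 n mI; rewrite /Xnorm -[LHS]/(npint n (fun eta => `|\1_(subconf L) eta : R|%:E)).
rewrite (_ : (fun eta => _) = (fun eta => (\1_(subconf L) eta : R)%:E)); last first.
  by apply/funext => eta; rewrite ger0_norm.
rewrite npint_subconf// -[X in (X ^+ n)%E]fineK ?ge0_fin_numE// -EFin_expe => e.
have f0 : n`!%:R != 0 :> R by rewrite pnatr_eq0 -lt0n fact_gt0.
have : ((n`!%:R^-1)%:E * (fine (m L) ^+ n)%:E = (n`!%:R^-1)%:E * (n`!%:R%:E * nrm n (\1_(subconf L) : F -> R)))%E by rewrite e.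
by rewrite muleA -!EFinM mulVf// mul1e mulrC => <-.
Qed.

(** On n points the region has mass m(L)^n / n!, so the weights a^n produce an exponential
    series. *)
Lemma integral_expcard (L : set E) (a : R) : 0 <= a -> measurable L -> (m L < +oo)%E ->
  (\int[lp]_eta (\1_(subconf L) eta * a ^+ #|` eta|%fset)%:E = (expR (a * fine (m L)))%:E)%E.
Proof.
move=> a0 mL Loo; have mI : measurable_fun setT (\1_(subconf L) : F -> R).
  by apply: measurable_indic; exact: measurable_subconf.
have I0 (eta : F) : 0 <= \1_(subconf L) eta :> R by [].
transitivity (\int[lp]_eta `|\1_(subconf L) eta * a ^+ #|` eta|%fset|%:E)%E.
  by apply: eq_integral => eta _; rewrite ger0_norm// mulr_ge0// exprn_ge0.
rewrite integral_level_weight//.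
have v0 : 0 <= fine (m L) by rewrite fine_ge0.
transitivity (\sum_(n <oo) (exp_coeff (a * fine (m L)) n)%:E)%E.
  by apply: eq_eseriesr => n _; rewrite (nrm_subconf n mL Loo) -EFinM /exp_coeff/= exprMn mulrA.
apply/cvg_lim => //; rewrite (_ : (fun n => _) = EFin \o series (exp_coeff (a * fine (m L)))).
  by apply: cvg_EFin; [exact: nearW|exact: is_cvg_series_exp_coeff].
by apply/funext => n; rewrite /= sumEFin.
Qed.

End inverse_K.

(** * Local densities of a correlation functional *)

Section local_densities.
Context {R : realType} {d : nat}.
Local Notation E := (euclid R d).
Local Notation F := (fconf R d).
Local Notation m := (lebesgue_space R d).
Local Notation lp := (@lpm R d).
Hypothesis d0 : (0 < d)%N.

Lemma fsetU_subr (xi eta : F) : (xi `<=` eta)%fset -> (xi `|` eta)%fset = eta.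
Proof. by move=> h; apply/fsetP => x; rewrite inE orb_idl//; exact: (fsubsetP h). Qed.

Definition isub (L : set E) (eta : F) : R := \1_(subconf L) eta.

Lemma isub_ge0 L eta : 0 <= isub L eta. Proof. by []. Qed.

Lemma isub_le1 L eta : isub L eta <= 1.
Proof. by rewrite /isub indicE; case: (_ \in _). Qed.

Lemma isubE1 L eta : subconf L eta -> isub L eta = 1.
Proof. by move=> Le; rewrite /isub indicE mem_set. Qed.

Lemma isubE0 L eta : ~ subconf L eta -> isub L eta = 0.
Proof. by move=> Le; rewrite /isub indicE memNset. Qed.

Lemma measurable_isub L : measurable L -> measurable_fun setT (isub L).
Proof. by move=> mL; apply: measurable_indic; exact: measurable_subconf. Qed.

Lemma isubU L (xi zeta : F) : isub L (xi `|` zeta)%fset = isub L xi * isub L zeta.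
Proof.
have [Lx|nLx] := pselect (subconf L xi); last first.
  rewrite (isubE0 nLx) mul0r isubE0// => h; apply: nLx => x xx; apply: h => /=.
  by rewrite inE; apply/orP; left.
rewrite (isubE1 Lx) mul1r.
have [Lz|nLz] := pselect (subconf L zeta); last first.
  rewrite (isubE0 nLz) isubE0// => h; apply: nLz => x xx; apply: h => /=.
  by rewrite inE; apply/orP; right.
rewrite (isubE1 Lz) isubE1// => x /=; rewrite inE => /orP[]; [exact: Lx|exact: Lz].
Qed.

Lemma isubI L L' (xi : F) : isub (L `&` L') xi = isub L xi * isub L' xi.
Proof.
have [Lx|nLx] := pselect (subconf L xi); last first.
  by rewrite (isubE0 nLx) mul0r isubE0// => h; apply: nLx => x /h[].
rewrite (isubE1 Lx) mul1r.
have [Lz|nLz] := pselect (subconf L' xi).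
  by rewrite (isubE1 Lz) isubE1// => x xx; split; [exact: Lx|exact: Lz].
by rewrite (isubE0 nLz) isubE0// => h; apply: nLz => x /h[].
Qed.

(** The standard integrable majorant. The base a absorbs the exponential bound on k and the 2^n
    subsets entering K-transforms and their inverses. *)
Definition ecard (L : set E) (a : R) (eta : F) : R := isub L eta * a ^+ #|` eta|%fset.

Lemma ecard_ge0 L a eta : 0 <= a -> 0 <= ecard L a eta.
Proof. by move=> a0; rewrite mulr_ge0// exprn_ge0. Qed.

Lemma measurable_ecard L a : measurable L -> measurable_fun setT (ecard L a).
Proof. by move=> mL; apply: measurable_funM; [exact: measurable_isub|exact: measurable_weight]. Qed.

Lemma integrable_ecard L a : 0 <= a -> measurable L -> (m L < +oo)%E ->
  lp.-integrable setT (EFin \o ecard L a).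
Proof.
move=> a0 mL Loo; apply/integrableP; split; first by apply/measurable_EFinP; exact: measurable_ecard.
under eq_integral => eta _ do rewrite gee0_abs ?lee_fin ?ecard_ge0//.
by rewrite [X in (X < _)%E](integral_expcard d0 a0 mL Loo) ltry.
Qed.

Lemma Rintegral_ecard L a : 0 <= a -> measurable L -> (m L < +oo)%E ->
  \int[lp]_eta ecard L a eta = expR (a * fine (m L)).
Proof. by move=> a0 mL Loo; rewrite /Rintegral [X in fine X](integral_expcard d0 a0 mL Loo). Qed.

Lemma integrable_dominated (f : F -> R) L a K : 0 <= a -> 0 <= K -> measurable L -> (m L < +oo)%E ->
  measurable_fun setT f -> (forall eta, `|f eta| <= K * ecard L a eta) ->
  lp.-integrable setT (EFin \o f) /\ `|\int[lp]_eta f eta| <= K * expR (a * fine (m L)).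
Proof.
move=> a0 K0 mL Loo mf fK.
have ie := integrable_ecard a0 mL Loo.
have ig : lp.-integrable setT (EFin \o (fun eta => K * ecard L a eta)).
  have := integrableZl measurableT K ie.
  by apply: eq_integrable => // eta _; rewrite /= EFinM.
have fi : lp.-integrable setT (EFin \o f).
  apply: le_integrable ig => //; first exact/measurable_EFinP.
  move=> eta _; rewrite lee_fin; apply: le_trans (fK eta) _.
  exact: ler_norm.
split=> //; apply: le_trans (le_normr_Rintegral measurableT fi) _.
apply: (@le_trans _ _ (\int[lp]_eta (K * ecard L a eta))).
  apply: le_Rintegral => //.
  have /integrableP[_ foo] := fi; apply/integrableP; split.
    by apply/measurable_EFinP; exact: measurableT_comp.
  by under eq_integral => eta _ do rewrite /= normr_id.
by rewrite RintegralZl// Rintegral_ecard.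
Qed.

Lemma prodm_integrable_dominated (f : F * F -> R) L L' a b K : 0 <= a -> 0 <= b -> 0 <= K ->
  measurable L -> (m L < +oo)%E -> measurable L' -> (m L' < +oo)%E ->
  measurable_fun setT f -> (forall z, `|f z| <= K * (ecard L a z.1 * ecard L' b z.2)) ->
  (prodm lp lp).-integrable setT (EFin \o f).
Proof.
move=> a0 b0 K0 mL Loo mL' L'oo mf fK.
have me1 := measurable_ecard a mL; have me2 := measurable_ecard b mL'.
apply/integrableP; split; first exact/measurable_EFinP.
apply: (@le_lt_trans _ _ (\int[prodm lp lp]_z (K * (ecard L a z.1 * ecard L' b z.2))%:E)%E).
  apply: ge0_le_integral => //.
  - by apply/measurable_EFinP; exact: measurableT_comp.
  - apply/measurable_EFinP; apply: measurable_funM => //; apply: measurable_funM.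
      exact: (measurableT_comp me1 measurable_fst).
    exact: (measurableT_comp me2 measurable_snd).
  - by move=> z _; rewrite lee_fin.
rewrite prodm_int12; first last.
- by move=> z; rewrite lee_fin; apply: mulr_ge0 => //; apply: mulr_ge0; exact: ecard_ge0.
- apply/measurable_EFinP; apply: measurable_funM => //; apply: measurable_funM.
    exact: (measurableT_comp me1 measurable_fst).
  exact: (measurableT_comp me2 measurable_snd).
under eq_integral => x _.
  under eq_integral => y _ do rewrite /= mulrA EFinM.
  have c0 := mulr_ge0 K0 (ecard_ge0 L x a0).
  rewrite ge0_integralZl ?lee_fin//; first last.
  - by move=> y _; rewrite lee_fin ecard_ge0.
  - exact/measurable_EFinP.
  rewrite [X in (_ * X)%E](integral_expcard d0 b0 mL' L'oo) mulrC EFinM -muleA -EFinM mulrC.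
  over.
have c1 : 0 <= K * expR (b * fine (m L')) by rewrite mulr_ge0// expR_ge0.
under eq_integral do rewrite /= EFinM.
rewrite ge0_integralZl ?lee_fin//; first last.
- by move=> y _; rewrite lee_fin ecard_ge0.
- exact/measurable_EFinP.
by rewrite [X in (_ * X)%E](integral_expcard d0 a0 mL Loo) -EFinM ltry.
Qed.

(** Only the decomposition of eta along L meets the condition; all other terms are 0. *)
Lemma sum_split_region (L L' : set E) (V : nmodType) (h : F -> F -> V) (eta : F) :
  \sum_(xi <- fpowerset eta) (if `[< subconf L xi /\ subconf (L' `\` L) (eta `\` xi)%fset >]
     then h xi (eta `\` xi)%fset else 0) =
  if `[< subconf (L `|` L') eta >] then h (frestr L eta) (eta `\` frestr L eta)%fset else 0.
Proof.
have sub : (frestr L eta `<=` eta)%fset.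
  by apply/fsubsetP => x; rewrite [x \in _]mem_frestr => /andP[].
rewrite (big_fsetD1 (frestr L eta))/=; last by rewrite fpowersetE.
rewrite [X in _ + X]big1_seq ?addr0 => [|xi /=].
  congr (if _ then _ else _); apply: asbool_equiv_eq; split.
    move=> [h1 h2] x xe; have [xL|xL] := pselect (L x); first by left.
    by right; have [] := h2 x _ => //; rewrite /= inE xe andbT [x \in _]mem_frestr xe/= memNset.
  move=> h1; split => x /=; first by rewrite [x \in _]mem_frestr => /andP[_]; rewrite inE.
  rewrite inE [x \in frestr _ _]mem_frestr => /andP[/nandP[]].
    by move=> /negP h2 xe; case: h2.
  move=> nL xe; have [Lx|L'x] := h1 x xe; first by move: nL; rewrite mem_set.
  by split => // Lx; move: nL; rewrite mem_set.
rewrite !inE => /andP[xin]; rewrite fpowersetE => xie; case: asboolP => // -[h1 h2].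
move/eqP: xin; case; apply/fsetP => x.
rewrite [x \in frestr _ _]mem_frestr; apply/idP/andP => [xx|[xe]].
  by split; [exact: (fsubsetP xie)|apply/mem_set; exact: h1].
by rewrite inE => Lx; apply: contrapT => /negP nx; have [] := h2 x _ => //; rewrite /= inE nx.
Qed.

(** The Lebesgue-Poisson measure on L' is a product over L and the rest of L': Minlos' lemma,
    applied to a sum with at most one nonzero term. *)
Lemma integral_split_region (L L' : set E) (h : F -> \bar R) : measurable L -> measurable L' ->
  L `<=` L' -> (forall eta, (0 <= h eta)%E) -> measurable_fun setT h ->
  (\int[lp]_eta ((isub L' eta)%:E * h eta) =
   \int[lp]_xi ((isub L xi)%:E * \int[lp]_zeta ((isub (L' `\` L) zeta)%:E * h (xi `|` zeta)%fset)))%E.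
Proof.
move=> mL mL' LL' h0 mh.
have mD : measurable (L' `\` L) by exact: measurableD.
pose H (xi zeta : F) := ((isub L xi)%:E * ((isub (L' `\` L) zeta)%:E * h (xi `|` zeta)%fset))%E.
have H0 x y : (0 <= H x y)%E by rewrite !mule_ge0 ?lee_fin.
have mU : measurable_fun setT (fun z : F * F => (z.1 `|` z.2)%fset : F).
  by refine (@measurable_fsetU R d _ (F * F)%type fst snd _ _).
have mH : measurable_fun setT (fun z : F * F => H z.1 z.2).
  apply: emeasurable_funM.
    by apply/measurable_EFinP; exact: (measurableT_comp (measurable_isub mL) measurable_fst).
  apply: emeasurable_funM; last exact: (measurableT_comp mh mU).
  by apply/measurable_EFinP; exact: (measurableT_comp (measurable_isub mD) measurable_snd).
transitivity (\int[lp]_eta (\sum_(xi <- fpowerset eta) H xi (eta `\` xi)%fset))%E.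
  apply: eq_integral => eta _.
  transitivity (\sum_(xi <- fpowerset eta) (if `[< subconf L xi /\ subconf (L' `\` L) (eta `\` xi)%fset >]
     then h eta else 0))%E; last first.
    apply: eq_big_seq => xi; rewrite fpowersetE => xie; rewrite /H fsetUDl fsetDv fsetD0.
    have -> : (xi `|` eta)%fset = eta by exact: fsetU_subr.
    case: asboolP => [[h1 h2]|]; first by rewrite (isubE1 h1) (isubE1 h2) !mul1e.
    have [h1|h1] := pselect (subconf L xi); last by rewrite (isubE0 h1) mul0e.
    have [h2|h2] := pselect (subconf (L' `\` L) (eta `\` xi)%fset); last by rewrite (isubE0 h2) mul0e mule0.
    by case.
  rewrite (sum_split_region L L' (fun _ _ => h eta) eta).
  have -> : L `|` L' = L' by apply/seteqP; split => x; [case=> //; exact: LL'|right].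
  by case: asboolP => h1; [rewrite (isubE1 h1) mul1e|rewrite (isubE0 h1) mul0e].
rewrite (minlos d0 H0 mH); apply: eq_integral => xi _; rewrite /H ge0_integralZl ?lee_fin//; first last.
- by move=> zeta _; rewrite mule_ge0 ?lee_fin.
- apply: emeasurable_funM; first by apply/measurable_EFinP; exact: measurable_isub.
  apply: (measurableT_comp mh); refine (@measurable_fsetU R d _ F (fun=> xi) id _ _) => //.
Qed.

Section dens.
Variables (k : F -> R) (M C : R).
Hypotheses (mk : measurable_fun setT k) (M0 : 0 <= M) (C1 : 1 <= C).
Hypothesis kM : forall eta, `|k eta| <= M * C ^+ #|` eta|%fset.

(* If [k] is the correlation functional of a measure, this is the density of its
   projection to [L].  The formula makes sense for every [eta], so that the
   densities are consistent everywhere and not only almost everywhere. *)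
Definition dens (L : set E) (eta : F) : R :=
  \int[lp]_zeta (isub L zeta * (-1) ^+ #|` zeta|%fset * k (eta `|` zeta)%fset).

Let C0 : 0 <= C. Proof. by rewrite (le_trans _ C1). Qed.

Let ek : forall eta : F, 0 <= M * C ^+ #|` eta|%fset.
Proof. by move=> eta; rewrite mulr_ge0// exprn_ge0. Qed.

Lemma k_union_le (eta zeta : F) :
  `|k (eta `|` zeta)%fset| <= M * C ^+ #|` eta|%fset * C ^+ #|` zeta|%fset.
Proof.
apply: le_trans (kM _) _; rewrite -mulrA ler_wpM2l// -exprD ler_weXn2l//.
by rewrite cardfsU leq_subr.
Qed.

Lemma measurable_k_union : measurable_fun setT (fun z : F * F => k (z.1 `|` z.2)%fset).
Proof.
by apply: (measurableT_comp mk); refine (@measurable_fsetU R d _ (F * F)%type fst snd _ _).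
Qed.

Lemma measurable_dens_integrand L (eta : F) : measurable L ->
  measurable_fun setT (fun zeta : F => isub L zeta * (-1) ^+ #|` zeta|%fset * k (eta `|` zeta)%fset).
Proof.
move=> mL; apply: measurable_funM.
  by apply: measurable_funM; [exact: measurable_isub|exact: measurable_sgn].
apply: (measurableT_comp measurable_k_union (g := fun zeta => (eta, zeta))).
exact: measurable_fun_pair.
Qed.

Lemma dens_integrand_le L (eta zeta : F) :
  `|isub L zeta * (-1) ^+ #|` zeta|%fset * k (eta `|` zeta)%fset| <=
  M * C ^+ #|` eta|%fset * ecard L C zeta.
Proof.
rewrite !normrM normrX normrN1 expr1n mulr1 ger0_norm// /ecard [leRHS]mulrCA.
by rewrite ler_wpM2l//; exact: k_union_le.
Qed.

Lemma integrable_dens L (eta : F) : measurable L -> (m L < +oo)%E ->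
  lp.-integrable setT (EFin \o (fun zeta : F => isub L zeta * (-1) ^+ #|` zeta|%fset * k (eta `|` zeta)%fset)).
Proof.
move=> mL Loo.
by have [] := integrable_dominated C0 (ek eta) mL Loo (measurable_dens_integrand eta mL) (dens_integrand_le L eta).
Qed.

Lemma dens_le L eta : measurable L -> (m L < +oo)%E ->
  `|dens L eta| <= M * expR (C * fine (m L)) * C ^+ #|` eta|%fset.
Proof.
move=> mL Loo.
have [_] := integrable_dominated C0 (ek eta) mL Loo (measurable_dens_integrand eta mL) (dens_integrand_le L eta).
by rewrite mulrAC.
Qed.

Lemma measurable_dens L : measurable L -> measurable_fun setT (dens L).
Proof.
move=> mL.
refine (@measurable_Rintegral_param R _ F _ F lp (fun eta zeta => isub L zeta * (-1) ^+ #|` zeta|%fset * k (eta `|` zeta)%fset) _).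
apply: measurable_funM; last exact: measurable_k_union.
apply: measurable_funM.
  exact: (measurableT_comp (measurable_isub mL) measurable_snd).
exact: (measurableT_comp measurable_sgn measurable_snd).
Qed.

(** Minlos' lemma makes the subset in [Ki f] and its complement independent, and the integral over
    the complement is the one in [dens]. For an indicator f this shows [dens k L] as a density dual
    to the inverse K-transform. *)
Lemma dens_formula L (f : F -> R) (K a : R) : measurable L -> (m L < +oo)%E ->
  measurable_fun setT f -> 0 <= K -> 1 <= a -> (forall eta, `|f eta| <= K * a ^+ #|` eta|%fset) ->
  \int[lp]_eta (isub L eta * Ki f eta * k eta) = \int[lp]_xi (isub L xi * f xi * dens L xi).
Proof.
move=> mL Loo mf K0 a1 fK; have a0 : 0 <= a by rewrite (le_trans _ a1).
have mI := measurable_isub mL.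
pose g (z : F * F) := isub L z.1 * f z.1 * (isub L z.2 * (-1) ^+ #|` z.2|%fset * k (z.1 `|` z.2)%fset).
have mg : measurable_fun setT g.
  apply: measurable_funM.
    by apply: measurable_funM; [exact: (measurableT_comp mI measurable_fst)|exact: (measurableT_comp mf measurable_fst)].
  apply: measurable_funM; last exact: measurable_k_union.
  apply: measurable_funM; [exact: (measurableT_comp mI measurable_snd)|].
  exact: (measurableT_comp measurable_sgn measurable_snd).
have gi : (prodm lp lp).-integrable setT (EFin \o g).
  apply: (@prodm_integrable_dominated g L L (a * C) C (K * M)) => //; [by rewrite mulr_ge0|by rewrite mulr_ge0|].
  move=> [x y] /=; rewrite /g/= normrM normrM ger0_norm//.
  apply: (@le_trans _ _ (isub L x * (K * a ^+ #|` x|%fset) * (M * C ^+ #|` x|%fset * ecard L C y))).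
    by apply: ler_pM => //; [rewrite mulr_ge0|rewrite ler_wpM2l|exact: dens_integrand_le].
  rewrite /ecard exprMn; set u := isub L x; set v := isub L y.
  set p := a ^+ _; set q := C ^+ #|` x|%fset; set r := C ^+ #|` y|%fset.
  by rewrite le_eqVlt; apply/orP; left; apply/eqP; lra.
transitivity (\int[lp]_eta \sum_(xi <- fpowerset eta) g (xi, (eta `\` xi)%fset)).
  apply: eq_Rintegral => eta _; rewrite /Ki mulr_sumr mulr_suml; apply: eq_big_seq => xi.
  rewrite fpowersetE => xie; rewrite /g/= fsetUDl fsetDv fsetD0.
  have xU : (xi `|` eta)%fset = eta by exact: fsetU_subr.
  have -> : isub L eta = isub L xi * isub L (eta `\` xi)%fset.
    by rewrite -isubU fsetUDl fsetDv fsetD0 xU.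
  by rewrite xU; set s := (-1) ^+ _; lra.
rewrite (minlos_Rintegral d0 gi) (Rintegral_prod gi).
apply: eq_Rintegral => xi _; rewrite /g/= RintegralZl//; exact: integrable_dens.
Qed.

(** Minlos' lemma merges xi and the variable of [dens] into one configuration omega. A point of
    omega outside L may come from either, with opposite signs, so by [alternating_sum] only omega
    inside L remains. *)
Lemma dens_consistent L L' (eta : F) : measurable L -> measurable L' -> (m L' < +oo)%E -> L `<=` L' ->
  dens L eta = \int[lp]_xi (isub (L' `\` L) xi * dens L' (eta `|` xi)%fset).
Proof.
move=> mL mL' L'oo LL'.
have mD : measurable (L' `\` L) by exact: measurableD.
have Doo : (m (L' `\` L) < +oo)%E.
  by apply: le_lt_trans L'oo; apply: le_measure; rewrite ?inE//; exact: subIsetl.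
pose g (z : F * F) := isub (L' `\` L) z.1 *
  (isub L' z.2 * (-1) ^+ #|` z.2|%fset * k ((eta `|` z.1) `|` z.2)%fset).
have mg : measurable_fun setT g.
  apply: measurable_funM; first exact: (measurableT_comp (measurable_isub mD) measurable_fst).
  apply: measurable_funM; last first.
    apply: (measurableT_comp measurable_k_union (g := fun z : F * F => ((eta `|` z.1)%fset : F, z.2))).
    apply/measurable_fun_pair => //=.
    by refine (@measurable_fsetU R d _ (F * F)%type (fun=> eta) fst _ _).
  apply: measurable_funM; [exact: (measurableT_comp (measurable_isub mL') measurable_snd)|].
  exact: (measurableT_comp measurable_sgn measurable_snd).
have gi : (prodm lp lp).-integrable setT (EFin \o g).
  apply: (@prodm_integrable_dominated g (L' `\` L) L' C C (M * C ^+ #|` eta|%fset)) => //.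
  move=> [x y] /=; rewrite /g/= normrM ger0_norm//.
  apply: (@le_trans _ _ (isub (L' `\` L) x * (M * C ^+ #|` eta|%fset * C ^+ #|` x|%fset * ecard L' C y))).
    rewrite ler_wpM2l//; apply: le_trans (dens_integrand_le L' _ y) _.
    rewrite ler_wpM2r ?ecard_ge0// -mulrA ler_wpM2l// -exprD ler_weXn2l//.
    by rewrite cardfsU leq_subr.
  rewrite /ecard; set u := isub _ x; set v := isub L' y.
  by rewrite le_eqVlt; apply/orP; left; apply/eqP; lra.
transitivity (\int[lp]_omega \sum_(xi <- fpowerset omega) g (xi, (omega `\` xi)%fset)).
  apply: eq_Rintegral => omega _.
  transitivity (isub L' omega * (\sum_(xi <- fpowerset omega) isub (L' `\` L) xi * (-1) ^+ #|` (omega `\` xi)|%fset) * k (eta `|` omega)%fset).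
    rewrite alternating_sum mulrA -/(isub _ _) -isubI.
    congr (isub _ _ * _ * _).
    apply/seteqP; split=> x /=; first by move=> Lx; split; [exact: LL'|case].
    by move=> [L'x nx]; apply: contrapT => nL; apply: nx.
  rewrite mulr_sumr mulr_suml; apply: eq_big_seq => xi.
  rewrite fpowersetE => xie; rewrite /g/= -fsetUA fsetUDl fsetDv fsetD0.
  have xU : (xi `|` omega)%fset = omega by exact: fsetU_subr.
  have -> : isub L' omega = isub L' xi * isub L' (omega `\` xi)%fset.
    by rewrite -isubU fsetUDl fsetDv fsetD0 xU.
  have -> : isub (L' `\` L) xi = isub L' xi * isub (L' `\` L) xi.
    by rewrite -isubI; congr isub; apply/seteqP; split => x /=; [case=> ? ?; split|case].
  have idem : isub L' xi * isub L' xi = isub L' xi.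
    by rewrite -isubI setIid.
  rewrite xU; set a := isub L' xi in idem *; set b := isub L' _; set s := (-1) ^+ _.
  set u := isub (L' `\` L) xi; set q := k _.
  have -> : a * b * (a * u * s) * q = (a * a) * (b * u * s * q) by lra.
  by rewrite idem; lra.
rewrite (minlos_Rintegral d0 gi) (Rintegral_prod gi).
apply: eq_Rintegral => xi _; rewrite /g/= RintegralZl//; exact: integrable_dens.
Qed.

End dens.
End local_densities.

(** * Measures with a given correlation functional *)

Section density.
Import HBNNSimple.
Context {dT} {T : measurableType dT} {R : realType}.
Variables (mu nu : {measure set T -> \bar R}) (g : T -> \bar R).
Hypotheses (mg : measurable_fun setT g) (g0 : forall x, (0 <= g x)%E)
  (gfin : forall x, g x \is a fin_num).
Hypothesis nuE : forall A, measurable A -> nu A = (\int[mu]_(x in A) g x)%E.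
Local Open Scope ereal_scope.

Lemma integral_density (f : T -> \bar R) : (forall x, 0 <= f x) -> measurable_fun setT f ->
  \int[nu]_x f x = \int[mu]_x (f x * g x).
Proof.
move=> f0 mf; pose h n : T -> R := nnsfun_approx measurableT mf n.
have h0 n x : (0 <= h n x)%R by exact: fun_ge0.
have mh n : measurable_fun setT (h n) by exact: measurable_funPT.
have hf x : (EFin \o h ^~ x) n @[n --> \oo] --> f x by exact: cvg_nnsfun_approx.
have ndh x n k : (n <= k)%N -> (h n x <= h k x)%R by move=> nk; exact/lefP/nd_nnsfun_approx.
have simple n : \int[nu]_x (h n x)%:E = \int[mu]_x ((h n x)%:E * g x).
  pose A y := h n @^-1` [set y].
  have mA y : measurable (A y) by rewrite -[A y]setTI; exact: mh.
  have ySum (lam : {measure set T -> \bar R}) (q : T -> \bar R) : measurable_fun setT q -> (forall x, 0 <= q x) ->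
      \int[lam]_x ((h n x)%:E * q x) = \sum_(y \in range (h n)) (y%:E * \int[lam]_(x in A y) q x).
    move=> mq q0.
    have t0 y x : 0 <= (y * \1_(A y) x)%:E * q x.
      have [xA|xA] := pselect (A y x); last by rewrite indicE memNset// mulr0 mul0e.
      by rewrite mule_ge0// lee_fin -xA mulr_ge0.
    transitivity (\int[lam]_x \sum_(y \in range (h n)) ((y * \1_(A y) x)%:E * q x)).
      apply: eq_integral => x _; rewrite {1}/h fimfunE -fsumEFin// ge0_mule_fsuml// => y.
      have [xA|xA] := pselect (A y x); last by rewrite indicE memNset// mulr0.
      by rewrite lee_fin -xA mulr_ge0.
    rewrite ge0_integral_fsum//; first last.
    - move=> y; apply: emeasurable_funM => //; apply/measurable_EFinP.
      by apply: measurable_funM => //; exact: measurable_indic.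
    apply: eq_fsbigr => y /[!inE] -[x _ <-].
    transitivity (\int[lam]_z ((h n x)%:E * ((\1_(A (h n x)) z)%:E * q z))).
      by apply: eq_integral => z _; rewrite EFinM muleA.
    rewrite ge0_integralZl ?lee_fin//; first last.
    - by move=> z _; rewrite mule_ge0 ?lee_fin.
    - by apply: emeasurable_funM => //; apply/measurable_EFinP; exact: measurable_indic.
    congr (_ * _); rewrite [RHS]integral_mkcond; apply: eq_integral => z _.
    by rewrite patchE indicE; case: (z \in _); rewrite ?mul1e ?mul0e.
  rewrite ySum// (_ : \int[nu]_x _ = \int[nu]_x ((h n x)%:E * cst 1 x)); last first.
    by apply: eq_integral => x _; rewrite mule1.
  rewrite (ySum nu (cst 1))//; apply: eq_fsbigr => y _; congr (_ * _).
  by rewrite integral_cst// mul1e nuE.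
transitivity (limn (fun n => \int[nu]_x (h n x)%:E)).
  rewrite -monotone_convergence//.
  - by apply: eq_integral => x _; apply/esym; apply: cvg_lim => //; exact: hf.
  - by move=> n; exact/measurable_EFinP.
  - by move=> n x _; rewrite lee_fin.
  - by move=> x _ n k nk; rewrite lee_fin ndh.
under eq_fun do rewrite simple.
rewrite -monotone_convergence//.
- apply: eq_integral => x _; apply/cvg_lim => //.
  by apply: cvgeZr; [exact: gfin|exact: hf].
- by move=> n; apply: emeasurable_funM => //; exact/measurable_EFinP.
- by move=> n x _; rewrite mule_ge0 ?lee_fin.
- by move=> x _ n k nk; apply: lee_wpmul2r => //; rewrite lee_fin ndh.
Qed.

(** On the set where k is negative, the measure is both nonnegative and the integral of a negative
    function. *)
Lemma density_ae_ge0 (k : T -> R) : measurable_fun setT k ->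
  (forall A, measurable A -> nu A = \int[mu]_(x in A) (k x)%:E) ->
  {ae mu, forall x, (0 <= k x)%R}.
Proof.
move=> mk nukE; pose A := [set x | (k x < 0)%R].
have mA : measurable A.
  rewrite (_ : A = k @^-1` `]-oo, 0%R[); last by apply/seteqP; split => x /=; rewrite in_itv.
  by rewrite -[X in measurable X]setTI; apply: mk => //; exact: measurable_itv.
have mkA : measurable_fun A (fun x => (k x)%:E) by apply/measurable_EFinP; exact: measurable_funTS.
have iA : \int[mu]_(x in A) `|(k x)%:E| = 0.
  apply/eqP; rewrite eq_le integral_ge0// andbT.
  have e : \int[mu]_(x in A) (k x)%:E = - \int[mu]_(x in A) `|(k x)%:E|.
    rewrite -integral_ge0N; last by move=> x _; exact: abse_ge0.
    by apply: eq_integral => x /[!inE] xA; rewrite /= ltr0_norm//= opprK.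
  by have : 0 <= nu A by []; rewrite nukE// e oppe_ge0.
have := (ae_eq_integral_abs mu mA mkA).1 iA; apply: filterS => x kx.
by rewrite leNgt; apply/negP => xA; have := kx xA => -[] k0; move: xA; rewrite k0 ltxx.
Qed.

End density.

Section correlation_side.
Context {R : realType} {d : nat}.
Local Notation E := (euclid R d).
Local Notation F := (fconf R d).
Local Notation m := (lebesgue_space R d).
Local Notation lp := (@lpm R d).
Hypothesis d0 : (0 < d)%N.

(** The trace on a region as a finite configuration. It is meaningful for bounded L, where local
    finiteness makes the intersection finite; otherwise [fset_set] may return its default. *)
Definition confr (L : set E) (g : conf R d) : F := fset_set (g `&` L).

Lemma mem_confr L g x : bounded_Borel L -> (x \in (confr L g : {fset E})) = (x \in g `&` L).
Proof. by move=> [_ bL]; rewrite /confr in_fset_set//; exact: points_locally_finite. Qed.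

Lemma subconf_confr L g : bounded_Borel L -> subconf L (confr L g).
Proof. by move=> bL x /=; rewrite [_ \in _]mem_confr// inE => -[]. Qed.

Lemma measurable_count_in (L : set E) : bounded_Borel L -> measurable_fun setT (@count_in R d L).
Proof.
move=> bL _ Y _; rewrite setTI.
have -> : count_in L @^-1` Y = \bigcup_(n in Y) [set g | count_in L g = n].
  by apply/seteqP; split => g /=; [move=> Yg; exists (count_in L g)|move=> [n Yn ->]].
rewrite bigcup_mkcond; apply: bigcupT_measurable => n; case: ifP => // _.
by apply: sub_sigma_algebra; exists L => //; exists n.
Qed.

Lemma bounded_BorelI (L A : set E) : bounded_Borel L -> measurable A -> bounded_Borel (L `&` A).
Proof.
by move=> [mL [M LM]] mA; split; [exact: measurableI|exists M => x [+ _]; exact: LM].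
Qed.

Lemma cmeas_frestr (eta : F) (D : set E) : cmeas eta D = (#|` frestr D eta|%fset)%:R%:E.
Proof.
rewrite cmeasE; transitivity (\sum_(x <- frestr D eta) (1 : \bar R))%E; last first.
  by rewrite sumEFin big_const_seq count_predT iter_addr_0.
transitivity (\sum_(x <- eta | x \in D) (1 : \bar R))%E.
  by rewrite [RHS]big_mkcond; apply: eq_bigr => x _; rewrite indicE; case: (x \in D).
rewrite -big_filter; apply: perm_big; apply: uniq_perm => //; first by rewrite filter_uniq.
by move=> x; rewrite mem_filter [RHS]mem_frestr andbC.
Qed.

Lemma count_confr L (A : set E) g : bounded_Borel L -> measurable A ->
  cmeas (confr L g) A = (count_in (L `&` A) g)%:R%:E.
Proof.
move=> bL mA; rewrite cmeas_frestr; congr (_%:R%:E); congr (#|` _|%fset).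
apply/fsetP => x; rewrite [LHS]mem_frestr mem_confr// [RHS]mem_confr; last exact: bounded_BorelI.
by rewrite !in_setI andbA.
Qed.

Lemma measurable_confr L : bounded_Borel L -> measurable_fun setT (confr L).
Proof.
move=> bL; apply: measurable_fconf => A mA.
have mc := measurable_count_in (bounded_BorelI bL mA).
apply: (eq_measurable_fun (fun g => (count_in (L `&` A) g)%:R%:E)).
  by move=> g _; rewrite count_confr.
apply/measurable_EFinP.
exact: (measurableT_comp (f := fun n : nat => n%:R : R) _ mc).
Qed.

Lemma card_confr L g : #|` confr L g|%fset = count_in L g.
Proof. by []. Qed.

Lemma Ktransform_Kf (G : F -> R) L g : bounded_Borel L -> (forall eta, ~ subconf L eta -> G eta = 0) ->
  Ktransform G g = Kf G (confr L g).
Proof.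
move=> bL G0; rewrite /Ktransform /Kf.
rewrite (fsbig_seq _ G (fset_uniq (fpowerset (confr L g)))); apply/esym/fsbig_widen.
  move=> xi /=; rewrite fpowersetE => /fsubsetP h x /= /h.
  by rewrite [_ \in _]mem_confr// inE => -[].
move=> xi [/= xg nx]; apply: G0 => xL; apply: nx; rewrite fpowersetE; apply/fsubsetP => x xx.
by rewrite [_ \in _]mem_confr//; apply/mem_set; split; [exact: xg|exact: xL].
Qed.

Lemma Kf_subconf (G : F -> R) L (gam : F) : subconf L gam ->
  Kf (fun eta => isub L eta * G eta) gam = Kf G gam.
Proof.
move=> gL; apply: eq_big_seq => xi; rewrite fpowersetE => /fsubsetP xg.
by rewrite isubE1 ?mul1r// => x /= /xg; exact: gL.
Qed.

Section functional.
Variables (nu : probability (conf R d) R) (rho : {measure set (fconf R d) -> \bar R}) (k : F -> R).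
Hypotheses (crho : is_correlation_measure nu rho) (mk : measurable_fun setT k)
  (rhoE : forall A, measurable A -> rho A = (\int[lp]_(eta in A) (k eta)%:E)%E).

Lemma correlation_ge0 : {ae lp, forall eta, 0 <= k eta}.
Proof. by have h := @density_ae_ge0 _ F R lp rho k mk rhoE; exact: h. Qed.

(** [k] is nonnegative only almost everywhere; the absolute value gives a version with this sign at
    every configuration. *)
Lemma integral_rho (G : F -> R) : measurable_fun setT G -> (forall eta, 0 <= G eta) ->
  (\int[rho]_eta (G eta)%:E = \int[lp]_eta (G eta * `|k eta|)%:E)%E.
Proof.
move=> mG G0; rewrite (@integral_density _ F R lp rho (fun eta => `|k eta|%:E))//.
- by apply/measurable_EFinP; exact: measurableT_comp.
- move=> A mA; rewrite rhoE//; apply: ae_eq_integral => //.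
  + by apply/measurable_EFinP; exact: measurable_funTS.
  + by apply/measurable_EFinP; apply: measurable_funTS; exact: measurableT_comp.
  + by apply: filterS correlation_ge0 => eta k0 _; rewrite ger0_norm.
- exact/measurable_EFinP.
Qed.

(** The correlation identity is given on [Bbs] only. G is truncated in value and in the number of
    points, and both sides increase to their limits. *)
Lemma integral_Kf_ge0 L (G : F -> R) : bounded_Borel L -> measurable_fun setT G ->
  (forall eta, 0 <= G eta) ->
  (\int[nu]_g (Kf G (confr L g))%:E = \int[lp]_eta (isub L eta * G eta * `|k eta|)%:E)%E.
Proof.
move=> bL mG G0; have [mL _] := bL; have mI := measurable_isub mL.
pose GN (n : nat) eta := isub L eta * (Num.min (G eta) n%:R * (#|` eta|%fset <= n)%N%:R).
have GN0 n eta : 0 <= GN n eta by rewrite !mulr_ge0// le_min G0 ler0n.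
have GNnd eta n n' : (n <= n')%N -> GN n eta <= GN n' eta.
  move=> nn'; rewrite /GN ler_wpM2l//; apply: ler_pM => //.
  - by rewrite le_min G0 ler0n.
  - by rewrite le_min !ge_min lexx/= ler_nat nn' orbT.
  - by rewrite ler_nat; case: (leqP #|` eta|%fset n) => // h; rewrite (leq_trans h nn').
have mc n : measurable_fun setT (fun eta : F => (#|` eta|%fset <= n)%N%:R : R).
  exact: (measurableT_comp (f := fun j : nat => (j <= n)%N%:R : R) _ (@measurable_card_fconf R d)).
have mGN n : measurable_fun setT (GN n).
  by apply: measurable_funM => //; apply: measurable_funM => //; exact: measurable_minr.
have GNcvg eta : \forall n \near \oo, GN n eta = isub L eta * G eta.
  have [N hN] : exists N, G eta <= N%:R by exists (Num.truncn (G eta)).+1; apply/ltW; exact: truncnS_gt.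
  exists (maxn N #|` eta|%fset) => // n /= nN; rewrite /GN.
  have h1 : G eta <= n%:R by apply: le_trans hN _; rewrite ler_nat (leq_trans (leq_maxl _ _) nN).
  by rewrite min_l// (leq_trans (leq_maxr _ _) nN) mulr1.
have GNB n : Bbs (GN n).
  split => //.
    exists n%:R => eta; rewrite ger0_norm// /GN.
    apply: (@le_trans _ _ (Num.min (G eta) n%:R)); last by rewrite ge_min lexx orbT.
    have h : 0 <= Num.min (G eta) n%:R by rewrite le_min G0 ler0n.
    rewrite mulrCA ler_piMr// -[leRHS]mulr1; apply: ler_pM => //; first exact: isub_le1.
    by case: (_ <= _)%N.
  exists n, L; split => // eta neta; rewrite /GN.
  have [Le|Le] := pselect (subconf L eta); last by rewrite isubE0// mul0r.
  by case: leqP => [cn|_]; [case: neta|rewrite mulr0 mulr0].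
have step n : (\int[nu]_g (Kf (GN n) (confr L g))%:E = \int[lp]_eta (GN n eta * `|k eta|)%:E)%E.
  rewrite -integral_rho// -crho//; apply: eq_integral => g _.
  by rewrite (Ktransform_Kf _ bL)// => eta h; rewrite /GN isubE0// mul0r.
have mKf n : measurable_fun setT (fun g => Kf (GN n) (confr L g)).
  exact: (measurableT_comp (measurable_Kf (mGN n)) (measurable_confr bL)).
have Kf0 n g : 0 <= Kf (GN n) g by apply: sumr_ge0 => xi _; exact: GN0.
transitivity (limn (fun n => \int[nu]_g (Kf (GN n) (confr L g))%:E)%E).
  rewrite -monotone_convergence//; first last.
  - by move=> g _ n n' nn'; rewrite lee_fin; apply: ler_sum => xi _; exact: GNnd.
  - by move=> n g _; rewrite lee_fin.
  - by move=> n; exact/measurable_EFinP.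
  apply: eq_integral => g _; apply/esym/cvg_lim => //; apply: cvg_near_cst.
  have hg : subconf L (confr L g) by exact: subconf_confr.
  rewrite -(Kf_subconf G hg) /Kf.
  elim: (fpowerset _ : seq F) => [|xi s IH].
    by apply: nearW => n; rewrite !big_nil.
  apply: filterS2 (GNcvg xi) IH => n e1 [e2].
  by rewrite !big_cons e1 e2.
under eq_fun do rewrite step.
rewrite -monotone_convergence//; first last.
- by move=> g _ n n' nn'; rewrite lee_fin ler_wpM2r//; exact: GNnd.
- by move=> n g _; rewrite lee_fin mulr_ge0.
- move=> n; apply/measurable_EFinP; apply: measurable_funM => //; exact: measurableT_comp.
apply: eq_integral => eta _; apply/cvg_lim => //; apply: cvg_near_cst.
by apply: filterS (GNcvg eta) => n ->.
Qed.

Lemma integral_Kf L (G : F -> R) : bounded_Borel L -> measurable_fun setT G ->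
  lp.-integrable setT (fun eta => (isub L eta * G eta * k eta)%:E) ->
  nu.-integrable setT (fun g => (Kf G (confr L g))%:E) /\
  \int[nu]_g Kf G (confr L g) = \int[lp]_eta (isub L eta * G eta * k eta).
Proof.
move=> bL mG iG; have [mL _] := bL; have mI := measurable_isub mL.
pose p eta := Num.max (G eta) 0; pose n eta := Num.max (- G eta) 0.
have p0 eta : 0 <= p eta by rewrite le_max lexx orbT.
have n0 eta : 0 <= n eta by rewrite le_max lexx orbT.
have mp : measurable_fun setT p by exact: measurable_maxr.
have mn : measurable_fun setT n by apply: measurable_maxr => //; exact: measurableT_comp.
have GE eta : G eta = p eta - n eta.
  rewrite /p /n; case: (ger0P (G eta)) => x0; first by rewrite max_r ?oppr_le0// subr0.
  by rewrite max_l ?oppr_ge0 ?(ltW x0)// sub0r opprK.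
have pG eta : p eta <= `|G eta| by rewrite /p ge_max ler_norm normr_ge0.
have nG eta : n eta <= `|G eta| by rewrite /n ge_max -(normrN (G eta)) ler_norm normr_ge0.
have sub (q : F -> R) : measurable_fun setT q -> (forall eta, 0 <= q eta) -> (forall eta, q eta <= `|G eta|) ->
    [/\ lp.-integrable setT (fun eta => (isub L eta * q eta * k eta)%:E),
      nu.-integrable setT (fun g => (Kf q (confr L g))%:E) &
      \int[nu]_g Kf q (confr L g) = \int[lp]_eta (isub L eta * q eta * k eta)].
  move=> mq q0 qG.
  have iq : lp.-integrable setT (fun eta => (isub L eta * q eta * k eta)%:E).
    apply: le_integrable iG => //.
      by apply/measurable_EFinP; apply: measurable_funM => //; exact: measurable_funM.
    move=> eta _; rewrite lee_fin !normrM !ler_wpM2r// ler_wpM2l//.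
    by rewrite [leLHS]ger0_norm.
  have e := integral_Kf_ge0 bL mq q0.
  have e2 : (\int[lp]_eta (isub L eta * q eta * `|k eta|)%:E = \int[lp]_eta (isub L eta * q eta * k eta)%:E)%E.
    apply: ae_eq_integral => //.
    - apply/measurable_EFinP; apply: measurable_funM; first exact: measurable_funM.
      exact: measurableT_comp.
    - by apply/measurable_EFinP; apply: measurable_funM => //; exact: measurable_funM.
    - by apply: filterS correlation_ge0 => eta k0 _; rewrite ger0_norm.
  have Kf0 g : 0 <= Kf q g by exact: sumr_ge0.
  split => //; last by rewrite /Rintegral e e2.
  apply/integrableP; split.
    by apply/measurable_EFinP; exact: (measurableT_comp (measurable_Kf mq) (measurable_confr bL)).
  under eq_integral do rewrite gee0_abs ?lee_fin//.
  rewrite e e2; apply: integrable_lty => //.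
have [ip kp ep] := sub p mp p0 pG; have [inn kn en] := sub n mn n0 nG.
have KE g : Kf G (confr L g) = Kf p (confr L g) - Kf n (confr L g).
  by rewrite /Kf -sumrB; apply: eq_bigr => xi _; exact: GE.
split.
  have := integrableB measurableT kp kn; apply: eq_integrable => // g _.
  by rewrite KE EFinB.
transitivity (\int[nu]_g (Kf p (confr L g) - Kf n (confr L g))).
  by apply: eq_Rintegral => g _; rewrite KE.
rewrite RintegralB// ep en -RintegralB//; apply: eq_Rintegral => eta _.
by rewrite GE mulrBr mulrBl.
Qed.

Variables (M C : R).
Hypotheses (M0 : 0 <= M) (C1 : 1 <= C)
  (kM : {ae lp, forall eta, `|k eta| <= M * C ^+ #|` eta|%fset}).

Lemma integrable_exp_bounded L (f : F -> R) (K a : R) : bounded_Borel L -> measurable_fun setT f ->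
  0 <= K -> 0 <= a -> (forall eta, `|f eta| <= K * a ^+ #|` eta|%fset) ->
  lp.-integrable setT (fun eta => (isub L eta * f eta * k eta)%:E).
Proof.
move=> bL mf K0 a0 fK; have [mL _] := bL; have mI := measurable_isub mL.
have Loo := bounded_lty bL; have C0 : 0 <= C by rewrite (le_trans _ C1).
have aC0 : 0 <= a * C by rewrite mulr_ge0.
apply/integrableP; split.
  by apply/measurable_EFinP; apply: measurable_funM => //; exact: measurable_funM.
apply: (@le_lt_trans _ _ (\int[lp]_eta ((K * M)%:E * (ecard L (a * C) eta)%:E))%E).
  apply: ae_ge0_le_integral => //.
  - apply/measurable_EFinP; apply: measurableT_comp => //.
    by apply: measurable_funM => //; exact: measurable_funM.
  - by move=> eta _; rewrite -EFinM lee_fin !mulr_ge0// exprn_ge0.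
  - by apply: measurable_funeM; apply/measurable_EFinP; exact: measurable_ecard.
  - apply: filterS kM => eta h _; rewrite -EFinM lee_fin !normrM ger0_norm//.
    apply: (@le_trans _ _ (isub L eta * (K * a ^+ #|` eta|%fset) * (M * C ^+ #|` eta|%fset))).
      by apply: ler_pM => //; rewrite ?mulr_ge0// ler_wpM2l.
    rewrite /ecard exprMn; set u := isub L eta; set v := a ^+ _; set w := C ^+ _.
    by rewrite le_eqVlt; apply/orP; left; apply/eqP; lra.
rewrite ge0_integralZl ?lee_fin ?mulr_ge0//; first last.
- by move=> eta _; rewrite lee_fin ecard_ge0.
- by apply/measurable_EFinP; exact: measurable_ecard.
by rewrite [X in (_ * X)%E](integral_expcard d0 aC0 mL Loo) -EFinM ltry.
Qed.

(** For G = [Ki f] the K-transform is f again, and the factor 2^n of the inversion stays integrable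
    because k is exponentially bounded. The law of the trace on L is thereby a function of k. *)
Lemma integral_confr L (f : F -> R) (K a : R) : bounded_Borel L -> measurable_fun setT f ->
  0 <= K -> 1 <= a -> (forall eta, `|f eta| <= K * a ^+ #|` eta|%fset) ->
  nu.-integrable setT (fun g => (f (confr L g))%:E) /\
  \int[nu]_g f (confr L g) = \int[lp]_eta (isub L eta * Ki f eta * k eta).
Proof.
move=> bL mf K0 a1 fK; have mKi := measurable_Ki mf.
have a20 : 0 <= 2 * a by rewrite mulr_ge0// (le_trans _ a1).
have iK := integrable_exp_bounded bL mKi K0 a20 (fun eta => normr_Ki eta a1 K0 fK).
have [h1 h2] := integral_Kf bL mKi iK; split.
  by apply: eq_integrable h1 => // g _; rewrite Kf_Ki.
by rewrite -h2; apply: eq_Rintegral => g _; rewrite Kf_Ki.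
Qed.

(** [Ki] of the indicator of A involves only subsets lying in A, and almost every configuration has
    none. *)
Lemma confr_null L (A : set F) : bounded_Borel L -> measurable A -> lp A = 0%E ->
  nu (confr L @^-1` A) = 0%E.
Proof.
move=> bL mA A0.
have mI : measurable_fun setT (\1_A : F -> R) by exact: measurable_indic.
have I1 eta : `|\1_A eta : R| <= 1 * 1 ^+ #|` eta|%fset.
  by rewrite expr1n mulr1 indicE; case: (_ \in _); rewrite ?normr1 ?normr0.
have [ii e] := integral_confr bL mI ler01 (lexx 1) I1.
have nA : {ae lp, forall eta, ~ A eta} by exists A; split => // x /contrapT.
have i0 : \int[lp]_eta (isub L eta * Ki (\1_A) eta * k eta) = 0.
  rewrite /Rintegral -[RHS](_ : fine (\int[lp]_eta 0)%E = 0); last by rewrite integral0.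
  congr fine; apply: ae_eq_integral => //.
    apply/measurable_EFinP; apply: measurable_funM => //; apply: measurable_funM.
      by apply: measurable_isub; case: bL.
    exact: measurable_Ki.
  apply: filterS (null_powerset d0 nA) => eta h _.
  rewrite /Ki big1_seq ?mulr0 ?mul0r// => xi /=; rewrite fpowersetE => /h nx.
  by rewrite indicE memNset// mulr0.
have mA' : measurable (confr L @^-1` A).
  by rewrite -[X in measurable X]setTI; exact: measurable_confr.
have := e; rewrite i0 /Rintegral.
have -> : (\int[nu]_g (\1_A (confr L g))%:E = nu (confr L @^-1` A))%E.
  by rewrite -[X in nu X]setIT -integral_indic.
move=> h; rewrite -[LHS]fineK ?h// fin_num_measure//.
Qed.

Lemma ae_confr L (P : F -> Prop) : bounded_Borel L -> {ae lp, forall eta, P eta} ->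
  {ae nu, forall g, P (confr L g)}.
Proof.
move=> bL [N [mN N0 PN]]; exists (confr L @^-1` N); split.
- by rewrite -[X in measurable X]setTI; exact: measurable_confr.
- exact: confr_null.
- by move=> g /= nP; exact: PN.
Qed.

(** V is not confined to a bounded region. On a box, the pairing is the nu-integral of the
    K-transform at the trace, which is nonnegative by [ae_confr]; dominated convergence along the
    boxes gives the whole pairing. *)
Lemma pairing_Kf_ge0 (V : F -> R) : measurable_fun setT V ->
  lp.-integrable setT (fun eta => (V eta * k eta)%:E) ->
  {ae lp, forall gam, 0 <= Kf V gam} -> 0 <= pairing V k.
Proof.
move=> mV iV KV.
have mIb n := measurable_isub (@measurable_box R d n).
have step n : (0 <= \int[lp]_eta (isub (box n) eta * V eta * k eta)%:E)%E.
  have bB := @box_bounded R d n.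
  have ib : lp.-integrable setT (fun eta => (isub (box n) eta * V eta * k eta)%:E).
    apply: le_integrable iV => //.
      by apply/measurable_EFinP; apply: measurable_funM => //; exact: measurable_funM.
    move=> eta _; rewrite lee_fin !normrM -mulrA [X in X * _]ger0_norm//.
    by rewrite ler_piMl ?mulr_ge0// isub_le1.
  have [_ e] := integral_Kf bB mV ib.
  rewrite -(fineK (integrable_fin_num measurableT ib)) lee_fin -[leRHS]e.
  rewrite /Rintegral (_ : (\int[nu]_g (Kf V (confr (box n) g))%:E = \int[nu]_g `|Kf V (confr (box n) g)|%:E)%E).
    by rewrite fine_ge0// integral_ge0// => g _; rewrite lee_fin.
  have mKV := measurableT_comp (measurable_Kf mV) (measurable_confr bB).
  apply: ae_eq_integral => //; [exact/measurable_EFinP| |].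
    by apply/measurable_EFinP; exact: measurableT_comp.
  by apply: filterS (ae_confr bB KV) => g h _; rewrite ger0_norm.
have cv : ((\int[lp]_eta (isub (box n) eta * V eta * k eta)%:E)%E @[n --> \oo] -->
    \int[lp]_eta (V eta * k eta)%:E)%E.
  apply: (@lebesgue_integral_dominated_convergence.dominated_cvg _ _ _ _ _ measurableT _ _ (fun eta => `|V eta * k eta|%:E)) => //.
  - by move=> n; apply/measurable_EFinP; apply: measurable_funM => //; exact: measurable_funM.
  - move=> eta _; apply: cvg_near_cst.
    have [N hN] : exists N, subconf (box N) eta.
      elim/(@fconf_ind R d): eta => [|x A _ [N hN]]; first by exists 0%N => x /=; rewrite inE.
      have [K xK] := box_cover x; exists (maxn N K) => y /=; rewrite !inE => /orP[/eqP ->|yA].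
        exact: box_le (leq_maxr _ _) _ xK.
      exact: box_le (leq_maxl _ _) _ (hN y yA).
    exists N => // n /= Nn; rewrite isubE1 ?mul1r// => x /hN.
    exact: box_le.
  - exact: (integrable_abse iV).
  - by move=> n eta _; rewrite lee_fin -mulrA normrM ger0_norm// ler_piMl// isub_le1.
rewrite /pairing /Rintegral; apply: fine_ge0.
rewrite -(cvg_lim _ cv)//; apply: lime_ge; last exact: nearW.
by apply/cvg_ex; eexists; exact: cv.
Qed.

End functional.
End correlation_side.

Lemma integral_abse_npos {dT} {T : measurableType dT} {R : realType}
    (mu : {measure set T -> \bar R}) (f : T -> R) : (forall x, f x <= 0) ->
  (\int[mu]_x `|(f x)%:E| = - \int[mu]_x (f x)%:E)%E.
Proof.
move=> f0; rewrite -[LHS]oppeK; congr (- _)%E.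
rewrite -integral_ge0N; last by move=> x _; exact: abse_ge0.
by apply: eq_integral => x _; rewrite /= ler0_norm//= opprK.
Qed.

(** * The evolved correlation functional *)

Section dual_bounds.
Context {R : realType} {d : nat}.
Local Notation E := (euclid R d).
Local Notation F := (fconf R d).
Local Notation m := (lebesgue_space R d).
Local Notation lp := (@lpm R d).
Hypothesis d0 : (0 < d)%N.

(** Subsets reaching outside L drop out. For G = [Ki] of an indicator the right side is an
    indicator, so such cut-off functions are admissible in the positivity test. *)
Lemma Kf_isub (G : F -> R) (L : set E) gam :
  Kf (fun eta => isub L eta * G eta) gam = Kf G (frestr L gam).
Proof.
have sub : (frestr L gam `<=` gam)%fset.
  by apply/fsubsetP => x; rewrite [x \in _]mem_frestr => /andP[].
rewrite /Kf [LHS](bigID (fun xi : F => (xi `<=` frestr L gam)%fset))/= [X in _ + X]big1_seq ?addr0; last first.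
  move=> xi /andP[nx]; rewrite fpowersetE => /fsubsetP xg.
  rewrite isubE0 ?mul0r// => xL; move/negP: nx; apply; apply/fsubsetP => x xx.
  by rewrite [x \in _]mem_frestr xg//=; apply/mem_set; exact: xL.
rewrite -big_filter.
have -> : \sum_(xi <- [seq xi <- fpowerset gam | (xi `<=` frestr L gam)%fset]) isub L xi * G xi =
    \sum_(xi <- fpowerset (frestr L gam)) isub L xi * G xi.
  apply: perm_big; apply: uniq_perm; [by rewrite filter_uniq ?fset_uniq|exact: fset_uniq|].
  move=> xi; rewrite mem_filter !fpowersetE; apply: andb_idr => h; exact: fsubset_trans h sub.
apply: eq_big_seq => xi; rewrite fpowersetE => /fsubsetP xr.
rewrite isubE1 ?mul1r// => x /= /xr; rewrite [x \in _]mem_frestr => /andP[_].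
by rewrite inE.
Qed.

(** The empty configuration alone has mass 1. Positivity matters because the norm behind [K_space]
    is an essential supremum only on a space of positive mass. *)
Lemma lp_setT_gt0 : (0 < lp setT)%E.
Proof.
apply: (@lt_le_trans _ _ (\int[lp]_eta (lev 0 eta))%E); last first.
  rewrite -[leRHS]mul1e -integral_cst//; apply: ge0_le_integral => //.
  - by move=> eta _; exact: lev_ge0.
  - exact: measurable_lev.
  - by move=> eta _; rewrite /lev lee_fin; case: eqP.
rewrite integral_lpm//; first last.
- exact: measurable_lev.
- by move=> eta; exact: lev_ge0.
rewrite (@nneseriesD1 R _ 0%N xpredT)//; last first.
  move=> n _; rewrite mule_ge0 ?lee_fin ?invr_ge0//.
  by apply: integral_ge0 => *; exact: lev_ge0.
rewrite fact0 invr1 mul1e npint0; first last.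
- exact: measurable_lev.
- by move=> eta; exact: lev_ge0.
rewrite {1}/lev cardfs0 eqxx; apply: (@lt_le_trans _ _ 1%E) => //.
rewrite leeDl// nneseries_ge0// => n _ _; rewrite mule_ge0 ?lee_fin ?invr_ge0//.
by apply: integral_ge0 => *; exact: lev_ge0.
Qed.

Lemma K_space_bound (C : R) (k : F -> R) : 0 < C -> K_space C k ->
  measurable_fun setT k /\
  exists2 M, 0 <= M & {ae lp, forall eta, `|k eta| <= M * C ^+ #|` eta|%fset}.
Proof.
move=> C0 kK; have /andP[] := kK; rewrite !inE/= => mkC fin.
have mk : measurable_fun setT k.
  have -> : k = (fun eta => (k eta * C ^- #|` eta|%fset) * C ^+ #|` eta|%fset).
    by apply/funext => eta; rewrite mulfVK// expf_eq0 gt_eqF// andbF.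
  by apply: measurable_funM => //; exact: measurable_weight.
split => //; move: fin; rewrite /finite_norm unlock/=.
rewrite [X in if X then _ else _]lp_setT_gt0 => fin.
pose S := ess_sup lp (fun eta => `|(k eta * C ^- #|` eta|%fset)%:E|%E).
have Soo : (S < +oo)%E by exact: fin.
have S0 : (0 <= S)%E.
  apply: (ess_sup_ge0 (mu := lp)); first by rewrite gt_eqF// lp_setT_gt0.
  by move=> eta; exact: abse_ge0.
exists (fine S); first exact: fine_ge0.
have := @ess_sup_ge _ _ _ lp (fun eta => `|(k eta * C ^- #|` eta|%fset)%:E|%E).
apply: filterS => eta; rewrite -/S -[leRHS]fineK ?ge0_fin_numE// lee_fin normrM.
by rewrite [X in _ * X]ger0_norm ?invr_ge0 ?exprn_ge0 ?(ltW C0)// ler_pdivrMr// exprn_gt0.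
Qed.

Lemma integrable_pairing (C M : R) (G k : F -> R) : 0 < C -> 0 <= M -> L_space C G ->
  measurable_fun setT k -> {ae lp, forall eta, `|k eta| <= M * C ^+ #|` eta|%fset} ->
  lp.-integrable setT (fun eta => (G eta * k eta)%:E).
Proof.
move=> C0 M0 GC mk kM; have [mG _] := (L_spaceP G C0).1 GC.
have iG : lp.-integrable setT (fun eta => (M * (G eta * C ^+ #|` eta|%fset))%:E).
  have := GC; rewrite /L_space => /Lfun1_integrable /(integrableZl measurableT M).
  by apply: eq_integrable => // eta _; rewrite EFinM.
have mGk : measurable_fun setT (fun eta => (G eta * k eta)%:E).
  by apply/measurable_EFinP; exact: measurable_funM.
have /integrableP[mGC fin] := iG; apply/integrableP; split => //.
apply: le_lt_trans fin; apply: ae_ge0_le_integral => //.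
- exact: measurableT_comp.
- exact: measurableT_comp.
- apply: filterS kM => eta h _; rewrite lee_fin !normrM (ger0_norm M0).
  rewrite [X in _ <= _ * (_ * X)]ger0_norm ?exprn_ge0 ?(ltW C0)//.
  by rewrite mulrCA ler_wpM2l.
Qed.

End dual_bounds.

Section evolved.
Context {R : realType} {d : nat}.
Local Notation E := (euclid R d).
Local Notation F := (fconf R d).
Local Notation m := (lebesgue_space R d).
Local Notation mm := (prodm m m).
Local Notation lp := (@lpm R d).
Hypothesis d0 : (0 < d)%N.
Variable c : E -> E -> E -> E -> R.
Hypothesis jr : jump_rate c.
Hypotheses (c1oo : (c1 c < +oo)%E) (c2oo : (c2 c < +oo)%E)
  (c3oo : (c3 c < +oo)%E) (c4oo : (c4 c < +oo)%E).
Hypothesis a21 : {ae mm, forall x, (a2 c x <= a1 c x)%E}.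
Variables (C0 : R) (mu : probability (conf R d) R) (kmu : F -> R) (k : R -> F -> R).
Hypotheses (C00 : 0 < C0) (kmuK : K_space C0 kmu) (evol : evolution c C0 kmu k).
Variable rhomu : {measure set (fconf R d) -> \bar R}.
Hypotheses (crho : is_correlation_measure mu rhomu)
  (rhoE : forall A, measurable A -> rhomu A = (\int[lp]_(eta in A) (kmu eta)%:E)%E).
Variable t : R.
Hypotheses (t0 : 0 < t) (tT : (t%:E < lifetime c C0)%E).

Local Notation Ctt := (Ct c C0 t).

Lemma lifetime_gt0 : 0 < 1 - B c * C0 * t.
Proof.
have B0 := B_ge0 jr.
move: tT; rewrite /lifetime; case: eqP => [-> _|/eqP Bn]; first by rewrite !mul0r subr0.
have Bp : 0 < B c by rewrite lt_neqAle eq_sym Bn.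
by rewrite lte_fin ltr_pdivlMr ?mulr_gt0// mulrC subr_gt0.
Qed.

Lemma Ct_gt0 : 0 < Ctt. Proof. by rewrite /Ct divr_gt0// lifetime_gt0. Qed.

Lemma rho_Ct : rho c t Ctt = C0.
Proof.
have l0 := lifetime_gt0; rewrite /rho /Ct.
have -> : 1 + B c * (C0 / (1 - B c * C0 * t)) * t = (1 - B c * C0 * t)^-1.
  have lu : (1 - B c * C0 * t) / (1 - B c * C0 * t) = 1 by rewrite divff// gt_eqF.
  by rewrite -{1}lu; lra.
by rewrite invrK mulfVK// gt_eqF.
Qed.

Let kt_space : K_space Ctt (k t). Proof. by have [] := evol t0 tT. Qed.

(** [evolution] speaks of every solution, in particular of [semig]; by [rho_Ct] the radius reached
    at time t is [C0], where [kmu] lives. *)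
Lemma evolved_pairing (G : F -> R) : L_space Ctt G ->
  pairing G (k t) = pairing (semig c t G) kmu /\ L_space C0 (semig c t G).
Proof.
move=> GC; have [_ ev] := evol t0 tT; split.
  exact: (ev G (fun s => semig c s G) GC (semig_solution jr d0 c1oo c2oo c3oo c4oo a21 Ct_gt0 GC)).
rewrite -rho_Ct; apply: (L_space_semig jr) => //; [exact: Ct_gt0|exact: ltW].
Qed.

Lemma evolved_pairing_ge0 (G : F -> R) : L_space Ctt G ->
  {ae lp, forall gam, 0 <= Kf G gam} -> 0 <= pairing G (k t).
Proof.
move=> GC KG; have [-> VC] := evolved_pairing GC.
have lG := L_space_locint Ct_gt0 GC.
have [mk [M M0 kM]] := K_space_bound d0 C00 kmuK.
have [mV _] := (L_spaceP (semig c t G) C00).1 VC.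
pose C1 := Num.max C0 1.
have kM1 : {ae lp, forall eta, `|kmu eta| <= M * C1 ^+ #|` eta|%fset}.
  apply: filterS kM => eta /le_trans; apply; rewrite ler_wpM2l// lerXn2r ?nnegrE ?(ltW C00)//.
    by rewrite le_max ltW.
  by rewrite le_max lexx.
have C11 : 1 <= C1 by rewrite le_max lexx orbT.
apply: (pairing_Kf_ge0 d0 crho mk rhoE M0 C11 kM1 mV).
  exact: (integrable_pairing C00 M0 VC mk kM).
exact: (Kf_semig_ge0 d0 jr c1oo c2oo c3oo c4oo a21 lG (ltW t0) KG).
Qed.

(** Its K-transform is 1 and the generator annihilates it, so it carries the normalization of mu
    over to the densities. *)
Definition vac : F -> R := \1_[set fset0].

Lemma vacE (eta : F) : vac eta = (eta == fset0 :> {fset E})%:R.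
Proof.
rewrite /vac indicE; congr (_%:R); congr nat_of_bool; apply/idP/eqP; rewrite inE//=.
Qed.

Lemma gen_vac eta : gen c vac eta = 0.
Proof.
have V0 (A : F) x : x \in (A : {fset E}) -> vac A = 0.
  by move=> xA; rewrite vacE; case: eqP => // A0; move: xA; rewrite A0.
have z (dT : measure_display) (X : measurableType dT) (nu : {measure set X -> \bar R}) (f : X -> R) :
    (forall y, f y = 0) -> \int[nu]_y f y = 0.
  by move=> f0; rewrite /Rintegral integral0_eq// => y _; rewrite f0.
rewrite /gen /L0 /W big1_seq ?mulr0 ?add0r => [|x1 /= x1e]; last first.
  rewrite big1_seq// => x2 /= x2e; apply: z => // y.
  rewrite (V0 _ y.1); last by rewrite !inE eqxx !orbT.
  by rewrite (V0 eta x1)// subrr mulr0.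
rewrite big1_seq// => x2 /= x2e; rewrite big1_seq// => x1 /= x1e; apply: z => // y.
rewrite (V0 _ y); last by rewrite !inE eqxx !orbT.
by rewrite (V0 _ x1)// subrr mulr0.
Qed.

Lemma gen0 eta : gen c (fun=> 0) eta = 0.
Proof.
rewrite /gen /L0 /W big1 ?mulr0 ?add0r => [|x1 _].
  rewrite big1// => x1 _; rewrite big1// => x2 _.
  by rewrite /Rintegral integral0_eq// => y _; rewrite ?subrr ?oppr0 mulr0.
rewrite big1// => x2 _.
by rewrite /Rintegral integral0_eq// => y _; rewrite ?subrr ?oppr0 mulr0.
Qed.

Lemma semig_vac s : semig c s vac = vac.
Proof.
have o' j : iter j.+1 (gen c) vac = (fun=> 0).
  by elim: j => [|j IH]; apply/funext => eta; rewrite iterS ?IH ?gen_vac ?gen0.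
have o j eta : orb c vac eta j.+1 = 0 by rewrite /orb o'.
apply/funext => eta; rewrite /semig /psum (_ : limn_esup _ = (vac eta)%:E)//.
apply: (cvg_limn_einf_sup _).2; rewrite -(cvg_shiftS _).
rewrite (_ : [sequence _]_n = fun=> (vac eta)%:E); first exact: cvg_cst.
apply/funext => N; congr EFin; rewrite big_ord_recl [X in _ + X]big1 => [|j _].
  by rewrite addr0 expr0 fact0 divr1 mul1r.
by rewrite lift0 o mulr0.
Qed.

Lemma measurable_vac : measurable_fun setT vac.
Proof.
apply: measurable_indic; rewrite (_ : [set fset0] = (fun eta : F => #|` eta|%fset) @^-1` [set 0%N]).
  by rewrite -[X in measurable X]setTI; exact: (@measurable_card_fconf R d measurableT [set 0%N] I).
by apply/seteqP; split => eta /=; [move=> ->; exact: cardfs0|move=> /eqP; rewrite cardfs_eq0 => /eqP].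
Qed.

Lemma vac_isub (L : set E) eta : isub L eta * vac eta = vac eta.
Proof.
rewrite vacE; case: eqP => [->|_]; last by rewrite mulr0.
by rewrite isubE1 ?mul1r// => x /=; rewrite inE.
Qed.

Lemma L_space_ecard (L : set E) (C a K : R) (G : F -> R) : bounded_Borel L -> 0 < C -> 0 <= a -> 0 <= K ->
  measurable_fun setT G -> (forall eta, `|G eta| <= K * ecard L a eta) -> L_space C G.
Proof.
move=> bL C1 a0 K0 mG GK; apply/Lfun1_integrable.
have [mL _] := bL; have Loo := bounded_lty bL.
have [] // := @integrable_dominated R d d0 (fun eta => G eta * C ^+ #|` eta|%fset) L (a * C) K _ K0 mL Loo.
- by rewrite mulr_ge0// ltW.
- by apply: measurable_funM => //; exact: measurable_weight.
move=> eta; rewrite normrM [X in _ * X]ger0_norm ?exprn_ge0 ?(ltW C1)//.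
by rewrite /ecard exprMn !mulrA ler_wpM2r ?exprn_ge0 ?(ltW C1)// -mulrA; exact: GK.
Qed.

(** The evolution fixes [vac], and its pairing with [kmu] is the integral of the constant 1 under
    the probability mu. *)
Lemma evolved_vac : pairing vac (k t) = 1.
Proof.
have vL : L_space Ctt vac.
  apply: (@L_space_ecard (box 0) Ctt 1 1) => //; [exact: box_bounded|exact: Ct_gt0|exact: measurable_vac|].
  move=> eta; rewrite mul1r -(vac_isub (box 0)) /ecard expr1n mulr1.
  rewrite normrM ger0_norm// vacE ler_piMr//; case: eqP => _; by rewrite ?normr1 ?normr0.
have [-> _] := evolved_pairing vL; rewrite semig_vac.
have vBbs : Bbs vac.
  split; first exact: measurable_vac.
    by exists 1 => eta; rewrite vacE; case: eqP; rewrite ?normr1 ?normr0.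
  exists 0%N, (box 0); split; first exact: box_bounded.
  move=> eta neta; rewrite vacE; case: eqP => // e0; case: neta; rewrite e0 cardfs0.
  by split => // x /=; rewrite inE.
have mk : measurable_fun setT kmu by have [] := K_space_bound d0 C00 kmuK.
have K1 g : Ktransform vac g = 1.
  rewrite (@Ktransform_Kf R d vac (box 0) g (@box_bounded R d 0)); last first.
    move=> eta h; rewrite vacE; case: eqP => // e0; case: h; rewrite e0 => x /=.
    by rewrite inE.
  rewrite /Kf (big_fsetD1 fset0)/=; last by rewrite fpowersetE fsub0set.
  rewrite vacE eqxx big1_seq ?addr0// => xi /=; rewrite !inE => /andP[xi0 _].
  by rewrite vacE (negbTE xi0).
have := crho vBbs; under eq_integral do rewrite K1.
rewrite (_ : (\int[mu]__ 1 = 1)%E); last by rewrite integral_cst// mul1e; exact: probability_setT.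
move=> e.
have mv : measurable [set fset0 : F].
  rewrite (_ : [set fset0] = (fun eta : F => #|` eta|%fset) @^-1` [set 0%N]).
    by rewrite -[X in measurable X]setTI; exact: (@measurable_card_fconf R d measurableT [set 0%N] I).
  by apply/seteqP; split => eta /=; [move=> ->; exact: cardfs0|move=> /eqP; rewrite cardfs_eq0 => /eqP].
rewrite integral_indic// setIT rhoE// in e.
rewrite /pairing /Rintegral -[RHS]/(fine 1%E) e; congr fine.
rewrite [RHS]integral_mkcond; apply: eq_integral => eta _.
by rewrite patchE /vac indicE; case: ifPn => h; rewrite ?mul1r ?mul0r.
Qed.

(** A nonnegative function has a nonnegative K-transform and can be tested against [k t]. The test
    function is the indicator of the set where [k t] is negative, cut to a box so as to lie in
    [L_space]. *)
Lemma evolved_ge0 : {ae lp, forall eta, 0 <= k t eta}.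
Proof.
have [mk [M M0 kM]] := K_space_bound d0 Ct_gt0 kt_space.
pose A := [set eta | k t eta < 0].
have mA : measurable A.
  rewrite (_ : A = k t @^-1` `]-oo, 0%R[); last by apply/seteqP; split => x /=; rewrite in_itv.
  by rewrite -[X in measurable X]setTI; apply: mk => //; exact: measurable_itv.
suff h n : {ae lp, forall eta, isub (box n) eta * \1_A eta * k t eta = 0}.
  move/ae_foralln : h; apply: filterS => eta h; rewrite leNgt; apply/negP => k0.
  have [N hN] : exists N, subconf (box N) eta.
    elim/(@fconf_ind R d): {h k0} eta => [|x B _ [N hN]]; first by exists 0%N => x /=; rewrite inE.
    have [K xK] := box_cover x; exists (maxn N K) => y /=; rewrite !inE => /orP[/eqP ->|yA].
      exact: box_le (leq_maxr _ _) _ xK.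
    exact: box_le (leq_maxl _ _) _ (hN y yA).
  have := h N; rewrite (isubE1 hN) indicE mem_set// !mul1r => e.
  by move: k0; rewrite e ltxx.
pose G eta := isub (box n) eta * \1_A eta.
have mI := measurable_isub (@measurable_box R d n).
have mG : measurable_fun setT G by apply: measurable_funM => //; exact: measurable_indic.
have G0 eta : 0 <= G eta by rewrite mulr_ge0.
have GL : L_space Ctt G.
  apply: (@L_space_ecard (box n) Ctt 1 1) => //; [exact: box_bounded|exact: Ct_gt0|].
  by move=> eta; rewrite mul1r /ecard expr1n mulr1 (ger0_norm (G0 eta)) /G ler_piMr.
have p0 := evolved_pairing_ge0 GL (aeW lp (fun gam => sumr_ge0 _ (fun xi _ => G0 xi))).
have ig := integrable_pairing Ct_gt0 M0 GL mk kM.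
have mGk : measurable_fun setT (fun eta => (G eta * k t eta)%:E).
  by apply/measurable_EFinP; exact: measurable_funM.
have npos eta : G eta * k t eta <= 0.
  rewrite /G indicE; have [kA|kA] := boolP (eta \in A); last by rewrite mulr0 mul0r.
  by rewrite mulr1 mulr_ge0_le0//; move: kA; rewrite inE => /ltW.
have := (ae_eq_integral_abs lp measurableT mGk).1.
have -> : (\int[lp]_x `|(G x * k t x)%:E| = 0)%E.
  apply/eqP; rewrite eq_le integral_ge0// andbT.
  rewrite (integral_abse_npos lp npos) oppe_le0 -(fineK (integrable_fin_num measurableT ig)) lee_fin.
  exact: p0.
by move=> /(_ erefl); apply: filterS => eta /(_ I) [].
Qed.

Section clipped.
Variables (M C : R) (kc : F -> R).
Hypotheses (M0 : 0 <= M) (C1 : 1 <= C) (mkc : measurable_fun setT kc)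
  (kcM : forall eta, `|kc eta| <= M * C ^+ #|` eta|%fset)
  (kcE : {ae lp, forall eta, kc eta = k t eta}).

Lemma pairing_isub_Ki L (f : F -> R) : bounded_Borel L -> measurable_fun setT f ->
  (forall eta, `|f eta| <= 1) ->
  L_space Ctt (fun eta => isub L eta * Ki f eta) /\
  pairing (fun eta => isub L eta * Ki f eta) (k t) = \int[lp]_xi (isub L xi * f xi * dens kc L xi).
Proof.
move=> bL mf f1; have [mL _] := bL; have Loo := bounded_lty bL.
have [mk [M' M'0 kM']] := K_space_bound d0 Ct_gt0 kt_space.
have f1' eta : `|f eta| <= 1 * 1 ^+ #|` eta|%fset by rewrite expr1n mulr1.
have mG : measurable_fun setT (fun eta => isub L eta * Ki f eta).
  by apply: measurable_funM; [exact: measurable_isub|exact: measurable_Ki].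
have GL : L_space Ctt (fun eta => isub L eta * Ki f eta).
  apply: (@L_space_ecard L Ctt 2 1) => //; first exact: Ct_gt0.
  move=> eta; rewrite mul1r /ecard normrM ger0_norm// ler_wpM2l//.
  by have := normr_Ki eta (lexx 1) ler01 f1'; rewrite mul1r mulr1.
split => //; rewrite -(dens_formula d0 mkc M0 C1 kcM mL Loo mf ler01 (lexx 1) f1').
rewrite /pairing /Rintegral; congr fine; apply: ae_eq_integral => //.
- by apply/measurable_EFinP; exact: measurable_funM.
- by apply/measurable_EFinP; exact: measurable_funM.
- by apply: filterS kcE => eta ->.
Qed.

(** The test function is [isub L] times [Ki] of the indicator of A, where A is the set of negative
    density. Its K-transform indicates that the trace on L lies in A. *)
Lemma dens_ae_ge0 L : bounded_Borel L -> {ae lp, forall eta, 0 <= isub L eta * dens kc L eta}.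
Proof.
move=> bL; have [mL _] := bL; have Loo := bounded_lty bL.
have mI := measurable_isub mL; have md := measurable_dens mkc mL.
have md' : measurable_fun setT (fun eta => isub L eta * dens kc L eta) by exact: measurable_funM.
pose A := [set eta | isub L eta * dens kc L eta < 0].
have mA : measurable A.
  rewrite (_ : A = (fun eta => isub L eta * dens kc L eta) @^-1` `]-oo, 0%R[); last first.
    by apply/seteqP; split => x /=; rewrite in_itv.
  by rewrite -[X in measurable X]setTI; apply: md' => //; exact: measurable_itv.
have mIA : measurable_fun setT (\1_A : F -> R) by exact: measurable_indic.
have I1 eta : `|\1_A eta : R| <= 1 by rewrite indicE; case: (_ \in _); rewrite ?normr1 ?normr0.
have [GL e] := pairing_isub_Ki bL mIA I1.
have : 0 <= pairing (fun eta => isub L eta * Ki (\1_A) eta) (k t).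
  apply: evolved_pairing_ge0 => //; apply: (aeW lp) => gam.
  by have -> := Kf_isub (Ki (\1_A)) L gam; rewrite Kf_Ki.
rewrite e => p0.
have C0' : 0 <= C by rewrite (le_trans _ C1).
pose h eta := isub L eta * \1_A eta * dens kc L eta.
have mh : measurable_fun setT h by apply: measurable_funM => //; exact: measurable_funM.
have K0 : 0 <= M * expR (C * fine (m L)) by rewrite mulr_ge0// expR_ge0.
have [ih _] : lp.-integrable setT (EFin \o h) /\ `|\int[lp]_eta h eta| <= M * expR (C * fine (m L)) * expR (C * fine (m L)).
  apply: (integrable_dominated d0 C0' K0 mL Loo mh) => eta.
  rewrite /h !normrM ger0_norm// /ecard [leRHS]mulrCA -mulrA ler_wpM2l//.
  rewrite -[leRHS]mul1r ler_pM//; exact: dens_le.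
have npos eta : h eta <= 0.
  rewrite /h; have [kA|kA] := pselect (A eta); last by rewrite indicE memNset// mulr0 mul0r.
  by rewrite indicE mem_set// mulr1; exact: ltW.
have mhE : measurable_fun setT (fun eta => (h eta)%:E) by exact/measurable_EFinP.
have := (ae_eq_integral_abs lp measurableT mhE).1.
have -> : (\int[lp]_x `|(h x)%:E| = 0)%E.
  apply/eqP; rewrite eq_le integral_ge0// andbT.
  by rewrite (integral_abse_npos lp npos) oppe_le0 -(fineK (integrable_fin_num measurableT ih)) lee_fin.
move=> /(_ erefl); apply: filterS => eta /(_ I) [h0].
rewrite leNgt; apply/negP => hA; move: h0; rewrite /h indicE mem_set// mulr1 => h0.
by move: hA; rewrite h0 ltxx.
Qed.

(** For f = 1 the inverse K-transform is [vac], so the total mass is the pairing of [vac] with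
    [k t]. *)
Lemma dens_total L : bounded_Borel L -> \int[lp]_eta (isub L eta * dens kc L eta) = 1.
Proof.
move=> bL.
have m1 : measurable_fun setT (cst 1 : F -> R) by [].
have b1 eta : `|(cst 1 : F -> R) eta| <= 1 by rewrite normr1.
have [_ e] := pairing_isub_Ki bL m1 b1.
rewrite -[RHS]evolved_vac -[LHS](_ : \int[lp]_xi (isub L xi * cst 1 xi * dens kc L xi) = _); last first.
  by apply: eq_Rintegral => xi _; rewrite mulr1.
rewrite -e; congr pairing; apply/funext => eta; rewrite -[RHS](vac_isub L); congr (_ * _).
have := @alternating_sum R d setT eta.
rewrite (_ : \sum_(xi <- fpowerset eta) _ = Ki (cst 1) eta); last first.
  by apply: eq_bigr => xi _; rewrite indicE mem_set// mul1r /cst mulr1.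
move=> ->; rewrite vacE indicE; case: eqP => [->|e0].
  by rewrite cardfs0 expr0 mulr1 mem_set// => x /=; rewrite inE.
have /fset0Pn[x xe] : eta != fset0 :> {fset E} by exact/eqP.
by rewrite memNset ?mul0r// => /(_ x xe) /=.
Qed.

End clipped.
End evolved.

(** * The projective limit *)

Section projective_limit.
Context {R : realType} {d : nat}.
Local Notation E := (euclid R d).
Local Notation F := (fconf R d).
Local Notation m := (lebesgue_space R d).
Local Notation lp := (@lpm R d).
Hypothesis d0 : (0 < d)%N.

Lemma measurable_fconfU dS (S : measurableType dS) (e f : S -> F) :
  measurable_fun setT e -> measurable_fun setT f ->
  measurable_fun setT (fun s => (e s `|` f s)%fset : F).
Proof. exact: measurable_fsetU. Qed.

Lemma Rintegral_split_region (L L' : set E) (phi : F -> F -> R) (K a : R) :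
  measurable L -> measurable L' -> (m L' < +oo)%E -> L `<=` L' -> 0 <= K -> 0 <= a ->
  measurable_fun setT (fun z : F * F => phi z.1 z.2) ->
  (forall x y, `|phi x y| <= K * (a ^+ #|` x|%fset * a ^+ #|` y|%fset)) ->
  \int[lp]_om (isub L' om * phi (frestr L om) (om `\` frestr L om)%fset) =
  \int[lp]_xi (isub L xi * \int[lp]_zeta (isub (L' `\` L) zeta * phi xi zeta)).
Proof.
move=> mL mL' Loo' LL' K0 a0 mphi phiK.
have mD : measurable (L' `\` L) by exact: measurableD.
have Loo : (m L < +oo)%E by apply: le_lt_trans Loo'; apply: le_measure; rewrite ?inE.
have Doo : (m (L' `\` L) < +oo)%E.
  by apply: le_lt_trans Loo'; apply: le_measure; rewrite ?inE//; exact: subIsetl.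
pose f (z : F * F) := isub L z.1 * (isub (L' `\` L) z.2 * phi z.1 z.2).
have mf : measurable_fun setT f.
  apply: measurable_funM; first exact: (measurableT_comp (measurable_isub mL) measurable_fst).
  apply: measurable_funM => //; exact: (measurableT_comp (measurable_isub mD) measurable_snd).
have fi : (prodm lp lp).-integrable setT (EFin \o f).
  apply: (@prodm_integrable_dominated R d d0 f L (L' `\` L) a a K) => // -[x y] /=.
  rewrite /f/= !normrM (ger0_norm (isub_ge0 _ _)) [X in _ * (X * _)]ger0_norm//.
  apply: (@le_trans _ _ (isub L x * (isub (L' `\` L) y * (K * (a ^+ #|` x|%fset * a ^+ #|` y|%fset))))).
    by rewrite ler_wpM2l// ler_wpM2l.
  rewrite /ecard; set u := isub L x; set v := isub _ y; set p := a ^+ _; set q := a ^+ _.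
  by rewrite le_eqVlt; apply/orP; left; apply/eqP; lra.
transitivity (\int[lp]_om \sum_(xi <- fpowerset om) f (xi, (om `\` xi)%fset)).
  apply: eq_Rintegral => om _.
  transitivity (\sum_(xi <- fpowerset om) (if `[< subconf L xi /\ subconf (L' `\` L) (om `\` xi)%fset >]
     then phi xi (om `\` xi)%fset else 0)).
    rewrite (sum_split_region L L' phi om).
    have -> : L `|` L' = L' by apply/seteqP; split => x; [case=> //; exact: LL'|right].
    by case: asboolP => h1; [rewrite (isubE1 h1) mul1r|rewrite (isubE0 h1) mul0r].
  apply: eq_bigr => xi _; rewrite /f/=.
  case: asboolP => [[h1 h2]|]; first by rewrite (isubE1 h1) (isubE1 h2) !mul1r.
  have [h1|h1] := pselect (subconf L xi); last by rewrite (isubE0 h1) mul0r.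
  have [h2|h2] := pselect (subconf (L' `\` L) (om `\` xi)%fset); last by rewrite (isubE0 h2) mul0r mulr0.
  by case.
rewrite (minlos_Rintegral d0 fi) (Rintegral_prod fi).
apply: eq_Rintegral => xi _; rewrite /f/= RintegralZl//.
have [] // := @integrable_dominated R d d0 (fun zeta => isub (L' `\` L) zeta * phi xi zeta)
  (L' `\` L) a (K * a ^+ #|` xi|%fset) a0 _ mD Doo.
- by rewrite mulr_ge0// exprn_ge0.
- apply: measurable_funM; first exact: measurable_isub.
  by apply: (measurableT_comp mphi (g := fun zeta => (xi, zeta))); exact: measurable_fun_pair.
- move=> eta; rewrite normrM (ger0_norm (isub_ge0 _ _)) /ecard [leRHS]mulrCA -mulrA.
  by rewrite ler_wpM2l.
Qed.

Lemma isub_set0 (eta : F) : isub set0 eta = (eta == fset0 :> {fset E})%:R.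
Proof.
case: eqP => [->|/eqP/fset0Pn[x xe]]; first by rewrite isubE1// => x /=; rewrite inE.
by rewrite isubE0// => /(_ x xe).
Qed.

(** Over the empty region the Lebesgue-Poisson measure is the unit mass at the empty
    configuration. *)
Lemma Rintegral_isub_set0 (f : F -> R) : measurable_fun setT f ->
  \int[lp]_om (isub set0 om * f om) = f fset0.
Proof.
move=> mf.
have e : forall om, isub set0 om * f om = f fset0 * isub set0 om.
  by move=> om; rewrite mulrC isub_set0; case: eqP => [->//|_]; rewrite !mulr0.
transitivity (\int[lp]_om (f fset0 * isub set0 om)); first by apply: eq_Rintegral => om _; exact: e.
have m0 : m set0 = 0%E by exact: measure0.
have mI : measurable (set0 : set E) by [].
have m0oo : (m set0 < +oo)%E by rewrite m0.
have ie := integrable_ecard d0 (@ler01 R) mI m0oo.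
have ec : ecard set0 1 = isub set0 :> (F -> R).
  by apply/funext => om; rewrite /ecard expr1n mulr1.
rewrite RintegralZl//; last by rewrite -ec.
by rewrite -ec Rintegral_ecard// m0 mulr0 expR0 mulr1.
Qed.

Variables (k : F -> R) (M C : R).
Hypotheses (mk : measurable_fun setT k) (M0 : 0 <= M) (C1 : 1 <= C)
  (kM : forall eta, `|k eta| <= M * C ^+ #|` eta|%fset).
Hypothesis dens_ge0 : forall L, bounded_Borel L ->
  {ae lp, forall eta, 0 <= isub L eta * dens k L eta}.

Let C0 : 0 <= C. Proof. by rewrite (le_trans _ C1). Qed.

Section chain.
Variables (L : nat -> set E) (A : nat -> set F).
Hypotheses (bL : forall n, bounded_Borel (L n)) (L0 : L 0%N = set0)
  (Lnd : forall n n', (n <= n')%N -> L n `<=` L n')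
  (Lcov : forall D : set E, bounded_region D -> exists n, D `<=` L n)
  (mA : forall n, measurable (A n))
  (Adec : forall n (eta : F), subconf (L n.+1) eta -> A n.+1 eta -> A n (frestr (L n) eta)).

Let g n := dens k (L n).
Let mL n : measurable (L n). Proof. by have [] := bL n. Qed.
Let Loo n : (m (L n) < +oo)%E. Proof. exact: bounded_lty. Qed.
Let mD n i : measurable (L n `\` L i). Proof. exact: measurableD. Qed.
Let Doo n i : (m (L n `\` L i) < +oo)%E.
Proof. by apply: le_lt_trans (Loo n); apply: le_measure; rewrite ?inE//; exact: subIsetl. Qed.
Let mg n : measurable_fun setT (g n). Proof. exact: measurable_dens. Qed.
Let Kn n := M * expR (C * fine (m (L n))).
Let Kn0 n : 0 <= Kn n. Proof. by rewrite mulr_ge0// expR_ge0. Qed.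

Let gK n (eta om : F) : `|g n (eta `|` om)%fset| <= Kn n * C ^+ #|` eta|%fset * C ^+ #|` om|%fset.
Proof.
apply: le_trans (dens_le d0 mk M0 C1 kM _ (mL n) (Loo n)) _.
rewrite -/(Kn n) -mulrA; apply: ler_wpM2l; first exact: Kn0.
by rewrite -exprD ler_weXn2l// cardfsU leq_subr.
Qed.

Let f n (eta : F) := \1_(A n) eta * g n eta.

Let mf n : measurable_fun setT (f n).
Proof. by apply: measurable_funM => //; exact: measurable_indic. Qed.

Let fK n (eta om : F) : `|f n (eta `|` om)%fset| <= Kn n * C ^+ #|` eta|%fset * C ^+ #|` om|%fset.
Proof.
rewrite /f normrM -[leRHS]mul1r; apply: ler_pM; [exact: normr_ge0|exact: normr_ge0| |exact: gK].
by rewrite indicE; case: (_ \in _); rewrite ?normr1 ?normr0.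
Qed.

(* The mass of the event [A n], given that the points in [L i] form [eta]. *)
Let hh i n (eta : F) := \int[lp]_om (isub (L n `\` L i) om * f n (eta `|` om)%fset).

(* Almost every extension of [eta], at every later stage, has nonnegative
   density. *)
Let good_at i (eta : F) := forall n, (i <= n)%N ->
  {ae lp, forall om, 0 <= isub (L n `\` L i) om * g n (eta `|` om)%fset}.

Let hh_ge0 i n eta : (i <= n)%N -> good_at i eta -> 0 <= hh i n eta.
Proof.
move=> ni ge; have iF : measurable_fun setT (fun om : F => isub (L n `\` L i) om * f n (eta `|` om)%fset).
  apply: measurable_funM; first exact: measurable_isub.
  by apply: (measurableT_comp (mf n)); exact: (measurable_fconfU (e := fun=> eta)).
rewrite /hh /Rintegral (_ : (\int[lp]_om (isub (L n `\` L i) om * f n (eta `|` om)%fset)%:E =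
   \int[lp]_om `|isub (L n `\` L i) om * f n (eta `|` om)%fset|%:E)%E).
  by rewrite fine_ge0// integral_ge0// => y _; rewrite lee_fin.
apply: ae_eq_integral => //; [exact/measurable_EFinP| |].
  by apply/measurable_EFinP; exact: measurableT_comp.
apply: filterS (ge n ni) => om g0 _; rewrite ger0_norm//.
by rewrite /f mulrCA mulr_ge0.
Qed.

(** By consistency, the mass at stage n is also an integral against the density of stage n+1. There
    the event of stage n+1 implies that of stage n ([Adec]), and [good_at] gives the density its
    sign. *)
Let hh_dec i n eta : (i <= n)%N -> subconf (L i) eta -> good_at i eta ->
  hh i n.+1 eta <= hh i n eta.
Proof.
move=> ni eL ge.
have LD : L n `\` L i `<=` L n.+1 `\` L i by move=> x [Lx nx]; split => //; exact: Lnd Lx.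
pose phi (xi zeta : F) := \1_(A n) (eta `|` xi)%fset * g n.+1 ((eta `|` xi) `|` zeta)%fset.
have mphi : measurable_fun setT (fun z : F * F => phi z.1 z.2).
  have mU : measurable_fun setT (fun z : F * F => (eta `|` z.1)%fset : F).
    by apply: (measurable_fconfU (e := fun=> eta)) => //; exact: measurable_fst.
  apply: measurable_funM.
    by apply: (measurableT_comp _ mU); exact: measurable_indic.
  by apply: (measurableT_comp (mg n.+1)); apply: measurable_fconfU => //; exact: measurable_snd.
have phiK (xi zeta : F) : `|phi xi zeta| <= (Kn n.+1 * C ^+ #|` eta|%fset) * (C ^+ #|` xi|%fset * C ^+ #|` zeta|%fset).
  rewrite /phi normrM -[leRHS]mul1r; apply: ler_pM => //.
    by rewrite indicE; case: (_ \in _); rewrite ?normr1 ?normr0.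
  apply: le_trans (gK _ _ _) _; rewrite mulrA ler_wpM2r ?exprn_ge0// -mulrA; apply: ler_wpM2l; first exact: Kn0.
  by rewrite -exprD ler_weXn2l// cardfsU leq_subr.
have K0 : 0 <= Kn n.+1 * C ^+ #|` eta|%fset by rewrite mulr_ge0// exprn_ge0.
have := Rintegral_split_region (mD n i) (mD n.+1 i) (Doo n.+1 i) LD K0 C0 mphi phiK.
have -> : \int[lp]_xi (isub (L n `\` L i) xi *
   \int[lp]_zeta (isub ((L n.+1 `\` L i) `\` (L n `\` L i)) zeta * phi xi zeta)) = hh i n eta.
  apply: eq_Rintegral => xi _; congr (_ * _).
  have -> : (L n.+1 `\` L i) `\` (L n `\` L i) = L n.+1 `\` L n.
    apply/seteqP; split => x /=; first by move=> [[x1 x2] x3]; split => // Lx; apply: x3.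
    by move=> [x1 x2]; split; [split => // Lx; apply: x2; exact: Lnd Lx|case].
  rewrite /f /g (dens_consistent d0 mk M0 C1 kM (eta `|` xi)%fset (mL n) (mL n.+1) (Loo n.+1) (Lnd (leqnSn n))).
  rewrite -RintegralZl//; last first.
    have [] // := @integrable_dominated R d d0 (fun zeta => isub (L n.+1 `\` L n) zeta * g n.+1 ((eta `|` xi) `|` zeta)%fset)
      (L n.+1 `\` L n) C (Kn n.+1 * C ^+ #|` (eta `|` xi)|%fset) C0 _ (mD _ _) (Doo _ _).
    - by rewrite mulr_ge0// exprn_ge0.
    - apply: measurable_funM; first exact: measurable_isub.
      by apply: (measurableT_comp (mg n.+1)); exact: (measurable_fconfU (e := fun=> (eta `|` xi)%fset)).
    - move=> z; rewrite normrM (ger0_norm (isub_ge0 _ _)) /ecard [leRHS]mulrCA ler_wpM2l//.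
  by apply: eq_Rintegral => zeta _; rewrite /phi mulrCA.
move=> <-.
have iB (q : F -> R) : measurable_fun setT q -> (forall om, `|q om| <= Kn n.+1 * C ^+ #|` eta|%fset * C ^+ #|` om|%fset) ->
    lp.-integrable setT (EFin \o (fun om => isub (L n.+1 `\` L i) om * q om)).
  move=> mq qK; have [] // := @integrable_dominated R d d0 (fun om => isub (L n.+1 `\` L i) om * q om)
      (L n.+1 `\` L i) C (Kn n.+1 * C ^+ #|` eta|%fset) C0 K0 (mD _ _) (Doo _ _).
    by apply: measurable_funM => //; exact: measurable_isub.
  by move=> z; rewrite normrM (ger0_norm (isub_ge0 _ _)) /ecard [leRHS]mulrCA ler_wpM2l.
have mr : measurable_fun setT (fun om : F => frestr (L n `\` L i) om).
  exact: (measurable_frestr (mD n i) (@measurable_id _ F setT)).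
have mq2 : measurable_fun setT (fun om : F => \1_(A n) (eta `|` frestr (L n `\` L i) om)%fset * g n.+1 (eta `|` om)%fset).
  apply: measurable_funM.
    apply: (measurableT_comp (f := \1_(A n) : F -> R)); first exact: measurable_indic.
    exact: (measurable_fconfU (e := fun=> eta)).
  by apply: (measurableT_comp (mg n.+1)); exact: (measurable_fconfU (e := fun=> eta)).
have phiE (om : F) : phi (frestr (L n `\` L i) om) (om `\` frestr (L n `\` L i) om)%fset =
    \1_(A n) (eta `|` frestr (L n `\` L i) om)%fset * g n.+1 (eta `|` om)%fset.
  rewrite /phi; congr (_ * g _ _); rewrite -fsetUA; congr fsetU.
  rewrite fsetUDl fsetDv fsetD0; apply: fsetU_subr.
  by apply/fsubsetP => x; rewrite [x \in _]mem_frestr => /andP[].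
under [leRHS]eq_Rintegral do rewrite phiE.
have i1 := iB (fun om => f n.+1 (eta `|` om)%fset).
have i2 := iB _ mq2.
have {}i1 : lp.-integrable setT (EFin \o (fun om => isub (L n.+1 `\` L i) om * f n.+1 (eta `|` om)%fset)).
  apply: i1; last by move=> om; exact: fK.
  by apply: (measurableT_comp (mf n.+1)); exact: (measurable_fconfU (e := fun=> eta)).
have {}i2 : lp.-integrable setT (EFin \o (fun om => isub (L n.+1 `\` L i) om *
    (\1_(A n) (eta `|` frestr (L n `\` L i) om)%fset * g n.+1 (eta `|` om)%fset))).
  apply: i2 => om; rewrite normrM -[leRHS]mul1r; apply: ler_pM => //.
  by rewrite indicE; case: (_ \in _); rewrite ?normr1 ?normr0.
rewrite -subr_ge0 -RintegralB// /Rintegral.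
have mi1 := measurable_int _ i1; have mi2 := measurable_int _ i2.
set q := fun om : F => (_ - _)%:E.
have mq : measurable_fun setT q.
  apply/measurable_EFinP; apply: measurable_funB; [exact/measurable_EFinP|exact/measurable_EFinP].
rewrite (_ : (\int[lp]_om q om = \int[lp]_om `|q om|)%E).
  by rewrite fine_ge0// integral_ge0.
apply: ae_eq_integral => //; first exact: measurableT_comp.
apply: filterS (ge n.+1 (leq_trans ni (leqnSn n))) => om g0 _.
rewrite gee0_abs// /q lee_fin subr_ge0 /f mulrCA [leRHS]mulrCA.
have [h|h] := pselect (subconf (L n.+1 `\` L i) om); last by rewrite (isubE0 h) !mul0r !mulr0.
rewrite ler_wpM2r// !indicE ler_nat.
have [h2|//] := boolP (_ \in A n.+1).
rewrite mem_set//; move: h2; rewrite inE => /Adec h3.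
(* As eta lies in [L i] and om avoids it, the trace of their union on [L n] is eta together with the
   part of om in [L n] minus [L i]; this is the argument of the event at stage n. *)
have := h3; rewrite (_ : frestr (L n) _ = (eta `|` frestr (L n `\` L i) om)%fset); last first.
  apply/fsetP => x; rewrite [LHS]mem_frestr !in_fsetU [x \in frestr _ om]mem_frestr.
  apply/andP/orP => [[/orP[xe|xo] xL]|[xe|/andP[xo]]].
  - by left.
  - by right; rewrite xo; apply/mem_set; split; [move: xL; rewrite inE|have [] := h _ xo].
  - by split; [rewrite xe|apply/mem_set; apply: Lnd ni _ _; exact: eL].
  - by rewrite inE => -[Lx _]; split; [rewrite xo orbT|exact/mem_set].
apply => x /=; rewrite inE => /orP[xe|xo]; last by have [] := h _ xo.
exact: (Lnd (leq_trans ni (leqnSn n)) (eL _ xe)).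
Qed.

Let hh_tower i n eta : (i < n)%N ->
  hh i n eta = \int[lp]_xi (isub (L i.+1 `\` L i) xi * hh i.+1 n (eta `|` xi)%fset).
Proof.
move=> ni.
have LD : L i.+1 `\` L i `<=` L n `\` L i by move=> x [Lx nx]; split => //; exact: Lnd ni _ Lx.
pose phi (xi zeta : F) := f n ((eta `|` xi) `|` zeta)%fset.
have mphi : measurable_fun setT (fun z : F * F => phi z.1 z.2).
  apply: (measurableT_comp (mf n)); apply: measurable_fconfU; last exact: measurable_snd.
  by apply: (measurable_fconfU (e := fun=> eta)) => //; exact: measurable_fst.
have phiK (xi zeta : F) : `|phi xi zeta| <= (Kn n * C ^+ #|` eta|%fset) * (C ^+ #|` xi|%fset * C ^+ #|` zeta|%fset).
  apply: le_trans (fK _ _ _) _; rewrite mulrA ler_wpM2r ?exprn_ge0// -mulrA; apply: ler_wpM2l; first exact: Kn0.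
  by rewrite -exprD ler_weXn2l// cardfsU leq_subr.
have K0 : 0 <= Kn n * C ^+ #|` eta|%fset by rewrite mulr_ge0// exprn_ge0.
have := Rintegral_split_region (mD i.+1 i) (mD n i) (Doo n i) LD K0 C0 mphi phiK.
have -> : (L n `\` L i) `\` (L i.+1 `\` L i) = L n `\` L i.+1.
  apply/seteqP; split => x /=; first by move=> [[x1 x2] x3]; split => // Lx; apply: x3.
  by move=> [x1 x2]; split; [split => // Lx; apply: x2; exact: Lnd Lx|case].
move=> <-; apply: eq_Rintegral => om _; congr (_ * f _ _); rewrite -fsetUA; congr fsetU.
apply/esym; rewrite fsetUDl fsetDv fsetD0; apply: fsetU_subr.
by apply/fsubsetP => x; rewrite [x \in _]mem_frestr => /andP[].
Qed.

(** The exceptional null set of eta at stage n is split along the next layer; almost all of its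
    sections are null. *)
Let good_next i eta : good_at i eta ->
  {ae lp, forall xi, subconf (L i.+1 `\` L i) xi -> good_at i.+1 (eta `|` xi)%fset}.
Proof.
move=> ge.
suff h n : (i < n)%N -> {ae lp, forall xi, subconf (L i.+1 `\` L i) xi ->
    {ae lp, forall om, 0 <= isub (L n `\` L i.+1) om * g n ((eta `|` xi) `|` om)%fset}}.
  have : {ae lp, forall xi, forall n, (i < n)%N -> subconf (L i.+1 `\` L i) xi ->
    {ae lp, forall om, 0 <= isub (L n `\` L i.+1) om * g n ((eta `|` xi) `|` om)%fset}}.
    apply/ae_foralln => n; have [ni|ni] := boolP (i < n)%N.
      by apply: filterS (h n ni) => xi hx _; exact: hx.
    by apply: aeW => xi.
  by apply: filterS => xi hx xL n ni; exact: hx.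
move=> ni.
have LD : L i.+1 `\` L i `<=` L n `\` L i by move=> x [Lx nx]; split => //; exact: Lnd ni _ Lx.
have DE : (L n `\` L i) `\` (L i.+1 `\` L i) = L n `\` L i.+1.
  apply/seteqP; split => x /=; first by move=> [[x1 x2] x3]; split => // Lx; apply: x3.
  by move=> [x1 x2]; split; [split => // Lx; apply: x2; exact: Lnd Lx|case].
have [N [mN N0 NP]] := ge n (ltnW ni).
have mI : measurable_fun setT (fun om : F => (\1_N om : R)%:E) by apply: measurable_EFin_indic.
have I0 (om : F) : (0 <= (\1_N om : R)%:E)%E by rewrite lee_fin.
have := integral_split_region d0 (mD i.+1 i) (mD n i) LD (h := fun om => (\1_N om : R)%:E) I0 mI.
have -> : (\int[lp]_eta ((isub (L n `\` L i) eta)%:E * (\1_N eta : R)%:E) = 0)%E.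
  rewrite -[RHS](@integral0 _ _ R lp setT); apply: ae_eq_integral => //.
    by apply: emeasurable_funM => //; apply/measurable_EFinP; exact: measurable_isub.
  have aN : {ae lp, forall eta, ~ N eta} by exists N; split => // x /contrapT.
  by apply: filterS aN => om nN _; rewrite indicE memNset// mule0.
rewrite DE; set J := fun xi : F => (\int[lp]_zeta ((isub (L n `\` L i.+1) zeta)%:E * (\1_N (xi `|` zeta)%fset : R)%:E))%E => e.
have mJ2 : measurable_fun setT (fun z : F * F => ((isub (L n `\` L i.+1) z.2)%:E * (\1_N (z.1 `|` z.2)%fset : R)%:E)%E).
  apply: emeasurable_funM.
    by apply/measurable_EFinP; exact: (measurableT_comp (measurable_isub (mD n i.+1)) measurable_snd).
  apply: measurable_EFin_indic => //; apply: measurable_fconfU; [exact: measurable_fst|exact: measurable_snd].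
have mJ : measurable_fun setT J.
  refine (@measurable_fun_fubini_tonelli_F _ _ F F R lp (fun z => ((isub (L n `\` L i.+1) z.2)%:E * (\1_N (z.1 `|` z.2)%fset : R)%:E)%E) _ _).
    exact: mJ2.
  by move=> z; rewrite mule_ge0 ?lee_fin.
have J0 xi : (0 <= J xi)%E by apply: integral_ge0 => y _; rewrite mule_ge0 ?lee_fin.
have mJ' : measurable_fun setT (fun xi => (isub (L i.+1 `\` L i) xi)%:E * J xi)%E.
  by apply: emeasurable_funM => //; apply/measurable_EFinP; exact: measurable_isub.
have := (ae_eq_integral_abs lp measurableT mJ').1.
have -> : (\int[lp]_x `|((isub (L i.+1 `\` L i) x)%:E * J x)| = 0)%E.
  by rewrite [RHS]e; apply: eq_integral => xi _; rewrite gee0_abs// mule_ge0 ?lee_fin.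
move=> /(_ erefl); apply: filterS => xi /(_ I) h xL.
move: h; rewrite /= (isubE1 xL) mul1e => Jx.
have mjx : measurable_fun setT (fun zeta => (isub (L n `\` L i.+1) zeta)%:E * (\1_N (xi `|` zeta)%fset : R)%:E)%E.
  by apply: (measurableT_comp mJ2 (g := fun zeta => (xi, zeta))); exact: measurable_fun_pair.
have := (ae_eq_integral_abs lp measurableT mjx).1.
have -> : (\int[lp]_x `|((isub (L n `\` L i.+1) x)%:E * (\1_N (xi `|` x)%fset : R)%:E)| = 0)%E.
  by rewrite -[RHS]Jx; apply: eq_integral => z _; rewrite gee0_abs// mule_ge0 ?lee_fin.
move=> /(_ erefl); apply: filterS => om /(_ I) h.
have [oL|oL] := pselect (subconf (L n `\` L i.+1) om); last by rewrite (isubE0 oL) mul0r.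
have nN : ~ N (xi `|` om)%fset.
  move=> Nx; move: h; rewrite /= (isubE1 oL) mul1e indicE mem_set// => -[] /eqP.
  by rewrite oner_eq0.
have s : subconf (L n `\` L i) (xi `|` om)%fset.
  move=> x /=; rewrite inE => /orP[/xL[Lx nL]|/oL[Lx nL]]; split => //; first exact: Lnd ni _ Lx.
  by move=> Lix; apply: nL; exact: Lnd (leqnSn i) _ Lix.
have := contra_notP (NP (xi `|` om)%fset) nN.
by rewrite /= (isubE1 s) (isubE1 oL) !mul1r fsetUA.
Qed.

Let hh_diag i eta : hh i i eta = f i eta.
Proof.
rewrite /hh setDv Rintegral_isub_set0 ?fsetU0//.
by apply: (measurableT_comp (mf i)); exact: (measurable_fconfU (e := fun=> eta)).
Qed.

Let hh_dec_le i n n' eta : (i <= n)%N -> (n <= n')%N -> subconf (L i) eta -> good_at i eta ->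
  hh i n' eta <= hh i n eta.
Proof.
move=> ni nn' eL ge; rewrite -(subnK nn'); elim: (n' - n)%N => [|j IH]; first by rewrite add0n.
rewrite addSn; apply: le_trans IH; apply: hh_dec => //.
by rewrite (leq_trans ni)// leq_addl.
Qed.

Let measurable_hh i n eta : measurable_fun setT (fun xi : F => hh i n (eta `|` xi)%fset).
Proof.
refine (@measurable_Rintegral_param R _ F _ F lp (fun xi om => isub (L n `\` L i) om * f n ((eta `|` xi) `|` om)%fset) _).
apply: measurable_funM; first exact: (measurableT_comp (measurable_isub (mD n i)) measurable_snd).
apply: (measurableT_comp (mf n)); apply: measurable_fconfU; last exact: measurable_snd.
by apply: (measurable_fconfU (e := fun=> eta)) => //; exact: measurable_fst.
Qed.

(* The points [eta] found so far in [L i] can be extended at every later stage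
   with a mass bounded away from [0]. *)
Let live i (eta : F) := [/\ subconf (L i) eta, good_at i eta &
  exists2 e : R, 0 < e & forall n, (i <= n)%N -> e <= hh i n eta].

(** Were no extension live, the masses [hh i.+1 n] would decrease to 0 for almost every choice of
    points in the next layer. They are dominated by an integrable bound on their value at n = i+1,
    so by [hh_tower] the mass [hh i n] would tend to 0 as well, against its lower bound e. *)
Let live_next i eta : live i eta -> exists2 eta', live i.+1 eta' & frestr (L i) eta' = eta.
Proof.
move=> [eL ge [e e0 he]]; apply: contrapT => no.
have D1 := mD i.+1 i; have D1oo := Doo i.+1 i.
have small : {ae lp, forall xi, subconf (L i.+1 `\` L i) xi ->
    [/\ subconf (L i.+1) (eta `|` xi)%fset, good_at i.+1 (eta `|` xi)%fset &
      forall r : R, 0 < r -> exists2 n, (i < n)%N & hh i.+1 n (eta `|` xi)%fset < r]}.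
  apply: filterS (good_next ge) => xi gxi xL; have gx := gxi xL.
  have sx : subconf (L i.+1) (eta `|` xi)%fset.
    move=> x /=; rewrite inE => /orP[/eL|/xL[]//]; exact: Lnd.
  split=> // r r0; apply: contrapT => nr; apply: no; exists (eta `|` xi)%fset.
    split => //; exists r => // n ni; rewrite leNgt; apply/negP => h.
    by apply: nr; exists n.
  apply/fsetP => x; rewrite [LHS]mem_frestr in_fsetU.
  apply/andP/idP => [[/orP[//|xx]]|xe]; last by split; [rewrite xe|apply/mem_set; exact: eL].
  by rewrite inE => Lx; have [] := xL x xx.
pose u n (xi : F) := isub (L i.+1 `\` L i) xi * hh i.+1 (n + i.+1)%N (eta `|` xi)%fset.
have mu n : measurable_fun setT (u n) by apply: measurable_funM; [exact: measurable_isub|exact: measurable_hh].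
have cvu : {ae lp, forall xi, (u n xi)%:E @[n --> \oo] --> (0 : R)%:E}.
  apply: filterS small => xi h; apply: cvg_EFin; first exact: nearW.
  have [xL|xL] := pselect (subconf (L i.+1 `\` L i) xi); last first.
    rewrite (_ : _ \o _ = fun=> 0); first exact: cvg_cst.
    by apply/funext => n /=; rewrite /u (isubE0 xL) mul0r.
  have [sx gx hs] := h xL; apply/cvgrPdist_lt => r r0.
  have [N iN hN] := hs r r0; exists N => // n /= nN.
  rewrite sub0r normrN /u (isubE1 xL) mul1r ger0_norm; last by apply: hh_ge0 => //; rewrite leq_addl.
  by apply: le_lt_trans hN; apply: hh_dec_le => //; rewrite (leq_trans nN)// leq_addr.
have K0 : 0 <= Kn i.+1 * C ^+ #|` eta|%fset by rewrite mulr_ge0// exprn_ge0.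
have dom : {ae lp, forall xi, forall n, `|u n xi| <= Kn i.+1 * C ^+ #|` eta|%fset * ecard (L i.+1 `\` L i) C xi}.
  apply: filterS small => xi h n; rewrite /u /ecard.
  have [xL|xL] := pselect (subconf (L i.+1 `\` L i) xi); last first.
    by rewrite (isubE0 xL) !mul0r normr0 mulr0.
  have [sx gx _] := h xL; rewrite (isubE1 xL) !mul1r ger0_norm; last by apply: hh_ge0 => //; rewrite leq_addl.
  apply: le_trans (hh_dec_le (leqnn _) (leq_addl n _) sx gx) _.
  rewrite hh_diag; apply: le_trans (ler_norm _) _; exact: fK.
have iD : lp.-integrable setT (EFin \o (fun xi => Kn i.+1 * C ^+ #|` eta|%fset * ecard (L i.+1 `\` L i) C xi)).
  have := integrableZl measurableT (Kn i.+1 * C ^+ #|` eta|%fset) (integrable_ecard d0 C0 D1 D1oo).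
  by apply: eq_integrable => // xi _; rewrite /= EFinM.
have mE n : measurable_fun setT (fun xi => (u n xi)%:E) by exact/measurable_EFinP.
have m0 : measurable_fun setT (fun _ : F => (0 : R)%:E) by [].
have c1 : {ae lp, forall xi, setT xi -> (u n xi)%:E @[n --> \oo] --> (0 : R)%:E}.
  by apply: filterS cvu => xi h _.
have c2 : {ae lp, forall (xi : F) (n : nat), setT xi -> (`|(u n xi)%:E| <= (Kn i.+1 * C ^+ #|` eta|%fset * ecard (L i.+1 `\` L i) C xi)%R%:E)%E}.
  by apply: filterS dom => xi h n _; rewrite lee_fin.
have [_ _] := @dominated_convergence _ _ _ lp _ measurableT (fun n xi => (u n xi)%:E) (fun _ => 0%:E) _ mE m0 c1 iD c2.
rewrite integral0 => /fine_cvg cv.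
have : ((fine \o (fun n => \int[lp]_xi (u n xi)%:E)%E) n @[n --> \oo] --> (0 : R)) by exact: cv.
move=> /cvgrPdist_lt/(_ e e0)[N _ /(_ N (leqnn N))] /=.
rewrite sub0r normrN => h.
have := he (N + i.+1)%N (leq_trans (leqnSn i) (leq_addl _ _)).
rewrite hh_tower ?leq_addl// => h2.
by move: (lt_le_trans (le_lt_trans (ler_norm _) h) h2); rewrite ltxx.
Qed.

(** Plays the role of compactness in the extension theorem. Live traces are extended step by step
    from the empty one. Their union is locally finite, since a bounded region lies in some [L n],
    where the trace no longer changes. A live trace belongs to the event of its stage because its
    mass is positive. *)
Lemma chain_point (e : R) : 0 < e ->
  (forall n, e <= \int[lp]_om (isub (L n) om * (\1_(A n) om * dens k (L n) om))) ->
  exists gam : conf R d, forall n, A n (confr (L n) gam).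
Proof.
move=> e0 he.
(* Stage 0 is the empty region: the only trace is empty, and [good_at] reduces to the sign of the
   densities. *)
have live0 : live 0%N fset0.
  split; first by move=> x /=; rewrite inE.
    by move=> n _; apply: filterS (dens_ge0 (bL n)) => om; rewrite L0 setD0 fset0U.
  exists e => // n _; rewrite /hh L0 setD0.
  by under eq_Rintegral do rewrite fset0U; exact: he.
have /choice[nxt hn] : forall z : nat * F, exists eta', live z.1 z.2 ->
    live z.1.+1 eta' /\ frestr (L z.1) eta' = z.2.
  move=> [i eta] /=; have [h|h] := pselect (live i eta); last by exists fset0.
  by have [eta' h1 h2] := live_next h; exists eta'.
pose s := fix s n : F := if n is n'.+1 then nxt (n', s n') else fset0.
have ls n : live n (s n) by elim: n => [|n IH] //=; have [] := hn (n, s n) IH.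
have rs n : frestr (L n) (s n.+1) = s n by have [] := hn (n, s n) (ls n).
have rs' n n' : (n <= n')%N -> frestr (L n) (s n') = s n.
  move=> /subnK <-; elim: (n' - n)%N => [|j IH].
    rewrite add0n; apply/fsetP => x; rewrite [LHS]mem_frestr; apply: andb_idr => xs.
    by apply/mem_set; have [h _ _] := ls n; exact: h.
  rewrite -[RHS]IH addSn; apply/fsetP => x; rewrite [LHS]mem_frestr [RHS]mem_frestr.
  have [xL|xL] := boolP (x \in L n); rewrite ?andbT ?andbF//.
  rewrite -[in RHS]rs [RHS]mem_frestr; apply/esym/andb_idr => _.
  by move: xL; rewrite !inE; exact: Lnd (leq_addl _ _) _.
pose G : set E := \bigcup_n [set` s n].
have GL n : G `&` L n = [set` s n].
  apply/seteqP; split => x /=.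
    move=> [[j _ /= xs] Lx]; have [jn|/ltnW nj] := leqP j n.
      by move: xs; rewrite -(rs' _ _ jn) [x \in _]mem_frestr => /andP[].
    by rewrite -(rs' _ _ nj) [x \in _]mem_frestr xs; exact/mem_set.
  by move=> xs; split; [exists n|have [h _ _] := ls n; exact: h].
have Gf D : bounded_region D -> finite_set (G `&` D).
  move=> /Lcov[n Dn]; apply: (@sub_finite_set _ _ (G `&` L n)).
    by move=> x [Gx Dx]; split => //; exact: Dn.
  by rewrite GL; exact: finite_fset.
exists (Conf Gf) => n.
have -> : confr (L n) (Conf Gf) = s n by rewrite /confr /= GL; exact: set_fsetK.
have [_ _ [r r0 hr]] := ls n.
have := hr n (leqnn n); rewrite hh_diag /f indicE.
have [|_] := boolP (s n \in A n); first by rewrite inE.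
by rewrite mul0r => /(lt_le_trans r0); rewrite ltxx.
Qed.

End chain.
End projective_limit.

(** * Cylinder events and the extension of consistent densities to a measure *)

Section finite_conf.
Context {R : realType} {d : nat}.
Local Notation E := (euclid R d).
Local Notation F := (fconf R d).

Lemma conf_ext (g g' : conf R d) : points g = points g' -> g = g'.
Proof.
case: g => p hp; case: g' => q hq /= pq; rewrite pq in hp *.
by congr Conf; exact: Prop_irrelevance.
Qed.

Lemma fconf_locally_finite (eta : F) (L : set E) : bounded_region L -> finite_set ([set` eta] `&` L).
Proof. by move=> _; apply: finite_setIl; exact: finite_fset. Qed.

Definition conf_of (eta : F) : conf R d := Conf (@fconf_locally_finite eta).

Lemma confr_conf_of (L : set E) (eta : F) : bounded_Borel L -> confr L (conf_of eta) = frestr L eta.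
Proof.
move=> bL; apply/fsetP => x; rewrite [LHS]mem_confr// [RHS]mem_frestr.
apply/idP/andP => [|[xe]]; first by rewrite inE => -[/= xe Lx]; split => //; exact/mem_set.
by rewrite inE => Lx; exact/mem_set.
Qed.

Lemma restrict_confE (L : set E) (g : conf R d) : bounded_Borel L -> restrict_conf L g = conf_of (confr L g).
Proof.
move=> bL; apply: conf_ext; apply/seteqP; split => x /=.
  by move=> h; rewrite [_ \in _]mem_confr//; exact: mem_set.
by rewrite [_ \in _]mem_confr// inE.
Qed.

Lemma frestr_confr (L L' : set E) (g : conf R d) : bounded_Borel L -> bounded_Borel L' -> L `<=` L' ->
  frestr L (confr L' g) = confr L g.
Proof.
move=> bL bL' LL'; apply/fsetP => x; rewrite [LHS]mem_frestr mem_confr// [RHS]mem_confr//.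
apply/andP/idP => [[]|]; rewrite !inE; first by move=> [? ?] ?.
by move=> [gx Lx]; split => //; split => //; exact: LL'.
Qed.

Lemma measurable_conf dS (S : measurableType dS) (e : S -> conf R d) :
  (forall L n, bounded_Borel L -> measurable [set s | count_in L (e s) = n]) ->
  measurable_fun setT e.
Proof.
move=> me; apply: (@measurability _ _ _ _ _ _ (@count_events R d)) => //.
by move=> _ [_ [L bL [n ->]] <-]; rewrite setTI; exact: me.
Qed.

Lemma measurable_conf_of : measurable_fun setT (@conf_of : F -> conf R d).
Proof.
apply: measurable_conf => L n bL; have [mL _] := bL.
have h : measurable_fun setT (fun eta : F => #|` frestr L eta|%fset).
  apply: (measurableT_comp (@measurable_card_fconf R d)).
  exact: (measurable_frestr mL (@measurable_id _ F setT)).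
have := h measurableT [set n] I; rewrite setTI.
rewrite (_ : _ @^-1` _ = [set s | count_in L (conf_of s) = n])//.
by apply/seteqP; split => s /=; rewrite -(confr_conf_of s bL).
Qed.

(** The trace is embedded again as a configuration, so that no event of finite configurations has to
    be named. *)
Definition cyl_level (D : set (conf R d)) (n : nat) :=
  forall g, D g <-> D (conf_of (confr (box n) g)).

Lemma cyl_levelS D n n' : (n <= n')%N -> cyl_level D n -> cyl_level D n'.
Proof.
move=> nn' Dn g; rewrite Dn [X in _ <-> X]Dn confr_conf_of; last exact: box_bounded.
rewrite frestr_confr//; [exact: box_bounded|exact: box_bounded|exact: box_le].
Qed.

Definition cylinder : set (set (conf R d)) := [set D | measurable D /\ exists n, cyl_level D n].

Lemma cylinder0 : cylinder set0.
Proof. by split => //; exists 0%N => g. Qed.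

Lemma cylinderC : setC_closed cylinder.
Proof.
move=> D [mD [n Dn]]; split; first exact: measurableC.
exists n => g; have e := Dn g.
by split => h Dg; apply: h; [exact: (e.2 Dg)|exact: (e.1 Dg)].
Qed.

Lemma cylinderU : setU_closed cylinder.
Proof.
move=> D D' [mD [n Dn]] [mD' [n' Dn']]; split; first exact: measurableU.
exists (maxn n n') => g.
have h := cyl_levelS (leq_maxl n n') Dn g; have h' := cyl_levelS (leq_maxr n n') Dn' g.
by split => -[/h|/h'] ?; [left|right|left|right].
Qed.

Lemma confr_cylinder n (A : set F) : measurable A -> cylinder (confr (box n) @^-1` A).
Proof.
move=> mA; split.
  by rewrite -[X in measurable X]setTI; apply: measurable_confr => //; exact: box_bounded.
exists n => g /=; rewrite confr_conf_of; last exact: box_bounded.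
rewrite frestr_confr//; exact: box_bounded.
Qed.

End finite_conf.

(* The configurations, equipped with the algebra of cylinders only. *)
Definition cylconf (R : realType) (d : nat) : Type := conf R d.

HB.instance Definition _ (R : realType) (d : nat) := gen_eqMixin (cylconf R d).
HB.instance Definition _ (R : realType) (d : nat) := gen_choiceMixin (cylconf R d).
HB.instance Definition _ (R : realType) (d : nat) := isPointed.Build (cylconf R d) (conf0 R d).

Fact cyl_display : measure_display. Proof. exact: default_measure_display. Qed.

HB.instance Definition _ (R : realType) (d : nat) := isAlgebraOfSets.Build cyl_display
  (cylconf R d) (@cylinder0 R d) (@cylinderU R d) (@cylinderC R d).

Section construction.
Context {R : realType} {d : nat}.
Local Notation E := (euclid R d).
Local Notation F := (fconf R d).
Local Notation m := (lebesgue_space R d).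
Local Notation lp := (@lpm R d).
Hypothesis d0 : (0 < d)%N.

Definition loc (k : F -> R) (L : set E) (A : set F) : R :=
  \int[lp]_om (isub L om * (\1_A om * dens k L om)).

(* On a cylinder this sequence is eventually constant. *)
Definition rmass (k : F -> R) (D : set (conf R d)) : R :=
  limn (fun n => loc k (box n) (conf_of @^-1` D)).

(* The norm only serves to make the set function nonnegative off cylinders. *)
Definition cylmass (k : F -> R) (D : set (cylconf R d)) : \bar R := `|rmass k D|%:E.

Variables (k : F -> R) (M C : R).
Hypotheses (mk : measurable_fun setT k) (M0 : 0 <= M) (C1 : 1 <= C)
  (kM : forall eta, `|k eta| <= M * C ^+ #|` eta|%fset).
Hypothesis dens_ge0 : forall L, bounded_Borel L ->
  {ae lp, forall eta, 0 <= isub L eta * dens k L eta}.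
Hypothesis dens_total : forall L, bounded_Borel L ->
  \int[lp]_eta (isub L eta * dens k L eta) = 1.

Let C0 : 0 <= C. Proof. by rewrite (le_trans _ C1). Qed.

Let measurable_loc L (q : F -> R) : bounded_Borel L -> measurable_fun setT q ->
  measurable_fun setT (fun om => isub L om * (q om * dens k L om)).
Proof.
move=> [mL _] mq; apply: measurable_funM; first exact: measurable_isub.
by apply: measurable_funM => //; exact: measurable_dens.
Qed.

Lemma integrable_loc L (q : F -> R) : bounded_Borel L -> measurable_fun setT q ->
  (forall om, `|q om| <= 1) ->
  lp.-integrable setT (EFin \o (fun om => isub L om * (q om * dens k L om))).
Proof.
move=> bL mq q1; have [mL _] := bL; have Loo := bounded_lty bL.
have K0 : 0 <= M * expR (C * fine (m L)) by rewrite mulr_ge0// expR_ge0.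
have [] // := @integrable_dominated R d d0 (fun om => isub L om * (q om * dens k L om)) L C
  (M * expR (C * fine (m L))) C0 K0 mL Loo.
  exact: measurable_loc.
move=> om; rewrite normrM (ger0_norm (isub_ge0 _ _)) /ecard [leRHS]mulrCA ler_wpM2l//.
rewrite normrM -[leRHS]mul1r ler_pM//; exact: (dens_le d0 mk M0 C1 kM).
Qed.

Let indic_le1 (A : set F) om : `|\1_A om : R| <= 1.
Proof. by rewrite indicE; case: (_ \in _); rewrite ?normr1 ?normr0. Qed.

Lemma integrable_loc1 L A : bounded_Borel L -> measurable A ->
  lp.-integrable setT (EFin \o (fun om => isub L om * (\1_A om * dens k L om))).
Proof. by move=> bL mA; apply: integrable_loc. Qed.

Lemma loc_ge0 L A : bounded_Borel L -> measurable A -> 0 <= loc k L A.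
Proof.
move=> bL mA; have mf := @measurable_loc L (\1_A) bL (measurable_indic mA).
rewrite /loc /Rintegral (_ : (\int[lp]_om (isub L om * (\1_A om * dens k L om))%:E =
   \int[lp]_om `|isub L om * (\1_A om * dens k L om)|%:E)%E).
  by rewrite fine_ge0// integral_ge0// => y _; rewrite lee_fin.
apply: ae_eq_integral => //; [exact/measurable_EFinP| |].
  by apply/measurable_EFinP; exact: measurableT_comp.
apply: filterS (dens_ge0 bL) => om g0 _; rewrite ger0_norm//.
by rewrite mulrCA mulr_ge0.
Qed.

Lemma locT L : bounded_Borel L -> loc k L setT = 1.
Proof.
move=> bL; rewrite -[RHS](dens_total bL); apply: eq_Rintegral => om _.
by rewrite indicE mem_set// mul1r.
Qed.

Lemma locU L A B : bounded_Borel L -> measurable A -> measurable B -> A `&` B = set0 ->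
  loc k L (A `|` B) = loc k L A + loc k L B.
Proof.
move=> bL mA mB AB0; rewrite /loc -RintegralD//; [|exact: integrable_loc1|exact: integrable_loc1].
apply: eq_Rintegral => om _; rewrite -mulrDr -mulrDl; congr (_ * (_ * _)).
have h : ~ (A om /\ B om) by move=> ABo; have : (A `&` B) om by []; rewrite AB0.
rewrite !indicE in_setU.
have [Ao|_] := boolP (om \in A); have [Bo|_] := boolP (om \in B) => /=; rewrite ?addr0 ?add0r//.
by case: h; move: Ao Bo; rewrite !inE.
Qed.

(** L' is split at L, and integrating out the outer points turns one density into the other by
    [dens_consistent]. *)
Lemma loc_consistent L L' A : bounded_Borel L -> bounded_Borel L' -> L `<=` L' -> measurable A ->
  loc k L' (frestr L @^-1` A) = loc k L A.
Proof.
move=> bL bL' LL' mA; have [mL _] := bL; have [mL' _] := bL'; have Loo' := bounded_lty bL'.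
have mD : measurable (L' `\` L) by exact: measurableD.
have Doo : (m (L' `\` L) < +oo)%E.
  by apply: le_lt_trans Loo'; apply: le_measure; rewrite ?inE//; exact: subIsetl.
have mg := measurable_dens mk mL'.
pose phi (xi zeta : F) := \1_A xi * dens k L' (xi `|` zeta)%fset.
have mphi : measurable_fun setT (fun z : F * F => phi z.1 z.2).
  apply: measurable_funM; first by apply: (measurableT_comp (f := \1_A : F -> R)) => //; exact: measurable_indic.
  by apply: (measurableT_comp mg); apply: measurable_fconfU; [exact: measurable_fst|exact: measurable_snd].
pose K := M * expR (C * fine (m L')).
have K0 : 0 <= K by rewrite mulr_ge0// expR_ge0.
have gK (xi zeta : F) : `|dens k L' (xi `|` zeta)%fset| <= K * (C ^+ #|` xi|%fset * C ^+ #|` zeta|%fset).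
  apply: le_trans (dens_le d0 mk M0 C1 kM _ mL' Loo') _; apply: ler_wpM2l => //.
  by rewrite -exprD ler_weXn2l// cardfsU leq_subr.
have phiK (xi zeta : F) : `|phi xi zeta| <= K * (C ^+ #|` xi|%fset * C ^+ #|` zeta|%fset).
  by rewrite /phi normrM -[leRHS]mul1r; apply: ler_pM.
have := Rintegral_split_region d0 mL mL' Loo' LL' K0 C0 mphi phiK.
rewrite (_ : \int[lp]_om (isub L' om * phi (frestr L om) (om `\` frestr L om)%fset) =
    loc k L' (frestr L @^-1` A)); last first.
  apply: eq_Rintegral => om _; congr (_ * _); rewrite /phi; congr (_ * dens _ _ _).
    by rewrite fsetUDl fsetDv fsetD0; apply: fsetU_subr; apply/fsubsetP => x; rewrite [x \in _]mem_frestr => /andP[].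
move=> ->; apply: eq_Rintegral => xi _; congr (_ * _).
rewrite (dens_consistent d0 mk M0 C1 kM xi mL mL' Loo' LL') -RintegralZl//; last first.
  have [] // := @integrable_dominated R d d0 (fun zeta => isub (L' `\` L) zeta * dens k L' (xi `|` zeta)%fset)
    (L' `\` L) C (K * C ^+ #|` xi|%fset) C0 _ mD Doo.
  - by rewrite mulr_ge0// exprn_ge0.
  - apply: measurable_funM; first exact: measurable_isub.
    by apply: (measurableT_comp mg); exact: (measurable_fconfU (e := fun=> xi)).
  - move=> z; rewrite normrM (ger0_norm (isub_ge0 _ _)) /ecard [leRHS]mulrCA ler_wpM2l// -mulrA.
    exact: gK.
by apply: eq_Rintegral => zeta _; rewrite /phi mulrCA.
Qed.

Let box_bB n : bounded_Borel (@box R d n). Proof. exact: box_bounded. Qed.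

Let measurable_pre (D : set (conf R d)) : measurable D -> measurable (conf_of @^-1` D).
Proof. by move=> mD; rewrite -[X in measurable X]setTI; exact: measurable_conf_of. Qed.

Lemma rmassE (D : set (conf R d)) n : measurable D -> cyl_level D n ->
  rmass k D = loc k (box n) (conf_of @^-1` D).
Proof.
move=> mD Dn; rewrite /rmass; apply: norm_lim_near_cst.
exists n; [by []|] => n' /= nn'.
have e := loc_consistent (box_bB n) (box_bB n') (box_le nn') (measurable_pre mD).
transitivity (loc k (box n') (frestr (box n) @^-1` (conf_of @^-1` D))); last exact: e.
congr (loc k (box n') _); apply/seteqP; split => eta /=.
  by rewrite Dn confr_conf_of.
by rewrite [X in _ -> X]Dn confr_conf_of.
Qed.

Lemma rmass_ge0 D : cylinder D -> 0 <= rmass k D.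
Proof. by move=> [mD [n Dn]]; rewrite (rmassE mD Dn) loc_ge0//; exact: measurable_pre. Qed.

Lemma rmass0 : rmass k set0 = 0.
Proof.
rewrite (@rmassE _ 0%N)// /loc /Rintegral integral0_eq// => om _.
by rewrite indicE memNset// mul0r mulr0.
Qed.

Lemma rmassT : rmass k setT = 1.
Proof. by rewrite (@rmassE _ 0%N)// preimage_setT locT. Qed.

Lemma rmassU D D' : cylinder D -> cylinder D' -> D `&` D' = set0 ->
  rmass k (D `|` D') = rmass k D + rmass k D'.
Proof.
move=> cD cD' DD'; have [mU [n Un]] := cylinderU cD cD'.
have [mD [n1 Dn]] := cD; have [mD' [n2 Dn']] := cD'.
pose N := maxn n (maxn n1 n2).
have l1 : (n1 <= N)%N by rewrite !leq_max leqnn orbT.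
have l2 : (n2 <= N)%N by rewrite !leq_max leqnn !orbT.
rewrite (rmassE mU (cyl_levelS (leq_maxl n _ : n <= N)%N Un)).
rewrite (rmassE mD (cyl_levelS l1 Dn)) (rmassE mD' (cyl_levelS l2 Dn')) preimage_setU locU//.
- exact: measurable_pre.
- exact: measurable_pre.
- by rewrite -preimage_setI DD' preimage_set0.
Qed.

Lemma cylinderD (A B : set (conf R d)) : cylinder A -> cylinder B -> cylinder (A `\` B).
Proof.
by move=> cA cB; rewrite setDE -[A]setCK -setCU; apply: cylinderC; apply: cylinderU => //; exact: cylinderC.
Qed.

Lemma rmass_le D D' : cylinder D -> cylinder D' -> D `<=` D' -> rmass k D <= rmass k D'.
Proof.
move=> cD cD' DD'; rewrite -(setDUK DD') rmassU//; [|exact: cylinderD|].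
  by rewrite lerDl; apply: rmass_ge0; exact: cylinderD.
by rewrite setDE setIA setIAC setICr set0I.
Qed.

(** Continuity at the empty set: if the masses stayed above some e > 0, [chain_point] would yield a
    configuration lying in every D n. *)
Lemma rmass_cvg0 (D : nat -> set (conf R d)) : (forall n, cylinder (D n)) ->
  (forall n, D n.+1 `<=` D n) -> \bigcap_n D n = set0 -> rmass k (D n) @[n --> \oo] --> (0 : R).
Proof.
move=> cD Dd D0; apply/cvgrPdist_lt => e e0.
have Dd' n n' : (n <= n')%N -> D n' `<=` D n.
  move=> /subnK <-; elim: (n' - n)%N => [|j IH]; first by rewrite add0n.
  by rewrite addSn; apply: subset_trans IH; exact: Dd.
suff [N hN] : exists N, rmass k (D N) < e.
  exists N => // n /= Nn; rewrite sub0r normrN (ger0_norm (rmass_ge0 (cD n))).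
  by apply: le_lt_trans hN; apply: rmass_le => //; exact: Dd'.
apply: contrapT => no.
have he n : e <= rmass k (D n) by rewrite leNgt; apply/negP => h; apply: no; exists n.
have /choice[l hl] : forall n, exists l, cyl_level (D n) l by move=> n; have [_ [l hl]] := cD n; exists l.
(* Levels at which the D n are determined. The sum makes them nondecreasing and at least l n; the
   summand n makes the boxes exhaust the space. *)
pose N n := (n + \sum_(i < n.+1) l i)%N.
have lN n : (l n <= N n)%N by rewrite /N big_ord_recr/= addnA leq_addl.
have NS n : (N n <= N n.+1)%N.
  by rewrite /N [in leqRHS]big_ord_recr/= addSn -addnS leq_add2l (leq_trans (leq_addr (l n.+1) _))// leqnSn.
have Nn n : (n <= N n)%N by rewrite leq_addr.
have DN n : cyl_level (D n) (N n) by exact: cyl_levelS (lN n) (hl n).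
(* Indices are shifted by one so that the chain starts from the empty region and the full event. *)
pose L n : set E := if n is n'.+1 then box (N n') else set0.
pose A n : set F := if n is n'.+1 then conf_of @^-1` D n' else setT.
have bL n : bounded_Borel (L n).
  by case: n => [|n] /=; [split => //; exists 0 => x|exact: box_bB].
have LS n : L n `<=` L n.+1 by case: n => [|n] //=; exact: box_le.
have Lnd n n' : (n <= n')%N -> L n `<=` L n'.
  move=> /subnK <-; elim: (n' - n)%N => [|j IH]; first by rewrite add0n.
  by rewrite addSn; exact: subset_trans IH (LS _).
have Lcov (V : set E) : bounded_region V -> exists n, V `<=` L n.
  move=> bV; have [n hn] := bounded_region_box bV; exists n.+1 => /=.
  by apply: subset_trans hn _; exact: box_le.
have mA n : measurable (A n) by case: n => [|n] //=; apply: measurable_pre; have [] := cD n.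
have Adec n (eta : F) : subconf (L n.+1) eta -> A n.+1 eta -> A n (frestr (L n) eta).
  case: n => [|n] //= _ /Dd Dn; move: Dn; rewrite DN confr_conf_of//; exact: box_bB.
have hA n : e <= \int[lp]_om (isub (L n) om * (\1_(A n) om * dens k (L n) om)).
  case: n => [|n] /=.
    apply: le_trans (he 0%N) _; rewrite -[leRHS]/(loc k (L 0%N) setT) (locT (bL 0%N)) -rmassT; apply: rmass_le => //.
    by rewrite -setC0; apply: cylinderC; exact: cylinder0.
  by have := he n; rewrite (rmassE _ (DN n))//; have [] := cD n.
have [gam hg] := chain_point d0 mk M0 C1 kM dens_ge0 bL erefl Lnd Lcov mA Adec e0 hA.
suff : (\bigcap_n D n) gam by rewrite D0.
by move=> n _; apply/DN; exact: hg n.+1.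
Qed.

Let cylmass0 : cylmass k set0 = 0%E. Proof. by rewrite /cylmass rmass0 normr0. Qed.

Let cylmass_ge0 (A : set (cylconf R d)) : (0 <= cylmass k A)%E.
Proof. by rewrite lee_fin. Qed.

Let cylmassE (A : set (conf R d)) : cylinder A -> cylmass k A = (rmass k A)%:E.
Proof. by move=> cA; rewrite /cylmass ger0_norm// rmass_ge0. Qed.

(** Finite additivity together with continuity at the empty set, applied to the remainders of the
    union, which decrease to the empty set. *)
Let cylmass_semi_sigma_additive : semi_sigma_additive (cylmass k).
Proof.
move=> G mG tG mU; rewrite (cylmassE mU); under eq_fun do under eq_bigr do rewrite (cylmassE (mG _)).
pose S n := \big[setU/set0]_(i < n) G i.
have cS n : cylinder (S n).
  by rewrite /S; elim/big_ind: _ => //; [exact: cylinder0|exact: cylinderU|move=> i _; exact: mG].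
pose D n := (\bigcup_i G i) `\` S n.
have cD n : cylinder (D n) by apply: cylinderD.
have SE n : rmass k (S n) = \sum_(i < n) rmass k (G i).
  elim: n => [|n IH]; first by rewrite /S !big_ord0 rmass0.
  rewrite [RHS]big_ord_recr/= -IH /S big_ord_recr/= rmassU//; [exact: cS n|exact: mG n|].
  apply/seteqP; split => // x [+ Gx]; rewrite -bigcup_mkord => -[i /= ni Gi].
  by move: ni; rewrite (tG i n I I (ex_intro _ x (conj Gi Gx))) ltnn.
have US n : rmass k (\bigcup_i G i) = rmass k (S n) + rmass k (D n).
  rewrite -rmassU//; last by rewrite /D setDE setICA setICr setI0.
  congr rmass; rewrite /D setDUK// /S -bigcup_mkord.
  by move=> x [i _ Gi]; exists i.
have D0 : \bigcap_n D n = set0.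
  apply/seteqP; split => // x Dx; have [[i _ Gi] _] := Dx 0%N I.
  by have [_] := Dx i.+1 I; apply; rewrite /S -bigcup_mkord; exists i => /=.
have Dd n : D n.+1 `<=` D n.
  by move=> x [Ux nS]; split => // Sx; apply: nS; rewrite /S big_ord_recr; left.
have cv := rmass_cvg0 cD Dd D0.
rewrite (_ : (fun n => _) = EFin \o (fun n => rmass k (\bigcup_i G i) - rmass k (D n))).
  apply: cvg_EFin; first exact: nearW.
  rewrite -[X in _ --> X]subr0; apply: cvgB => //; exact: cvg_cst.
by apply/funext => n /=; rewrite sumEFin big_mkord -SE (US n) addrK.
Qed.

HB.instance Definition _ := isMeasure.Build cyl_display (cylconf R d) R (cylmass k)
  cylmass0 cylmass_ge0 cylmass_semi_sigma_additive.

Let I := g_sigma_algebraType (@measurable _ (cylconf R d)).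

Let ext : {measure set I -> \bar R} := measure_extension (cylmass k).

(** Count events are cylinders, because their region lies in a box; the Caratheodory extension thus
    covers the whole sigma-algebra. *)
Let measurable_ext (A : set (conf R d)) : measurable A -> measurable (A : set I).
Proof.
apply: smallest_sub; first exact: smallest_sigma_algebra.
move=> _ [L bL [n ->]]; apply: sub_sigma_algebra; split.
  by apply: sub_sigma_algebra; exists L => //; exists n.
have [_ /bounded_region_box[N LN]] := bL; exists N => g /=.
rewrite -[in X in _ <-> X]card_confr confr_conf_of// frestr_confr//; exact: box_bounded.
Qed.

Let limit_measure (A : set (conf R d)) : \bar R := ext A.

Let limit_measure0 : limit_measure set0 = 0%E. Proof. exact: measure0. Qed.

Let limit_measure_ge0 A : (0 <= limit_measure A)%E. Proof. exact: measure_ge0. Qed.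

Let limit_measure_semi_sigma_additive : semi_sigma_additive limit_measure.
Proof.
move=> G mG tG mU; apply: (@measure_semi_sigma_additive _ _ _ ext) => //.
  by move=> n; exact: measurable_ext.
exact: measurable_ext.
Qed.

HB.instance Definition _ := isMeasure.Build _ (conf R d) R limit_measure
  limit_measure0 limit_measure_ge0 limit_measure_semi_sigma_additive.

Let limit_measureE D : cylinder D -> limit_measure D = (rmass k D)%:E.
Proof. by move=> cD; rewrite -cylmassE//; apply: measurable_mu_extE. Qed.

Let limit_measureT : limit_measure setT = 1%E.
Proof.
rewrite limit_measureE; first by rewrite rmassT.
by rewrite -setC0; apply: cylinderC; exact: cylinder0.
Qed.

HB.instance Definition _ := Measure_isProbability.Build _ (conf R d) R limit_measure limit_measureT.

(** The trace on L is a function of the trace on a box containing L. The event is therefore a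
    cylinder, and its mass at the level of the box reduces to L by [loc_consistent]. *)
Lemma limit_measure_exists : exists mut : probability (conf R d) R,
  forall L (A : set F), bounded_Borel L -> measurable A ->
    mut (confr L @^-1` A) = (loc k L A)%:E.
Proof.
exists limit_measure => L A bL mA; have [mL /bounded_region_box[n Ln]] := bL.
have mfr : measurable (frestr L @^-1` A : set F).
  rewrite -[X in measurable X]setTI.
  exact: (measurable_frestr mL (@measurable_id _ F setT)).
have -> : confr L @^-1` A = confr (box n) @^-1` (frestr L @^-1` A).
  by apply/seteqP; split => g /=; rewrite (frestr_confr g bL (box_bB n) Ln).
have cA := confr_cylinder n mfr; have [mcA _] := cA.
have ln : cyl_level (confr (box n) @^-1` (frestr L @^-1` A)) n.
  by move=> g /=; rewrite confr_conf_of// (frestr_confr g (box_bB n) (box_bB n)).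
apply: etrans (limit_measureE cA) _; rewrite (rmassE mcA ln); congr EFin.
have e := loc_consistent bL (box_bB n) Ln mA; rewrite -[RHS]e /loc.
apply: eq_Rintegral => eta _.
have [h|h] := pselect (subconf (box n) eta); last by rewrite (isubE0 h) !mul0r.
congr (_ * (_ * _)); rewrite !indicE; congr (nat_of_bool _)%:R.
have fe : frestr (box n) eta = eta.
  by apply/fsetP => x; rewrite [LHS]mem_frestr; apply: andb_idr => xe; apply/mem_set; exact: h.
have pe : (conf_of @^-1` (confr (box n) @^-1` (frestr L @^-1` A))) eta <-> (frestr L @^-1` A) eta.
  have e2 : confr (box n) (conf_of eta) = eta by rewrite (confr_conf_of eta (box_bB n)) fe.
  by change (A (frestr L (confr (box n) (conf_of eta))) <-> A (frestr L eta)); rewrite e2.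
by apply/idP/idP; rewrite !inE => /pe.
Qed.

End construction.

Lemma integral_image_density dX (X : measurableType dX) dT (T : measurableType dT) (R : realType)
    (P : {measure set X -> \bar R}) (mu : {measure set T -> \bar R}) (phi : X -> T) (g : T -> R) :
  measurable_fun setT phi -> measurable_fun setT g -> (forall x, 0 <= g x) ->
  (forall A, measurable A -> P (phi @^-1` A) = \int[mu]_(x in A) (g x)%:E)%E ->
  forall f : T -> R, measurable_fun setT f ->
  (\int[P]_x (f (phi x))%:E = \int[mu]_x (f x * g x)%:E)%E.
Proof.
move=> mphi mg g0 PE f mf.
have key (q : T -> R) : measurable_fun setT q -> (forall x, 0 <= q x) ->
    (\int[P]_x (q (phi x))%:E = \int[mu]_x (q x * g x)%:E)%E.
  move=> mq q0.
  have mqE : measurable_fun setT (EFin \o q) by exact/measurable_EFinP.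
  have := @ge0_integral_pushforward _ _ X T R phi mphi P setT (EFin \o q) measurableT mqE.
  rewrite preimage_setT => <-; last by move=> x _; rewrite lee_fin.
  apply: (@integral_density _ T R mu _ (fun x => (g x)%:E)) => //.
  exact/measurable_EFinP.
rewrite [LHS]integralE [RHS]integralE; congr (_ - _)%E.
- transitivity (\int[P]_x (Num.max (f (phi x)) 0)%:E)%E.
    by apply: eq_integral => x _; rewrite funeposE EFin_max.
  rewrite (key (fun x => Num.max (f x) 0)); [|exact: measurable_maxr|by move=> x; rewrite le_max lexx orbT].
  by apply: eq_integral => x _; rewrite funeposE -EFin_max mulrC maxr_pMr// mulr0 mulrC.
- transitivity (\int[P]_x (Num.max (- f (phi x)) 0)%:E)%E.
    by apply: eq_integral => x _; rewrite funenegE EFin_max.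
  rewrite (key (fun x => Num.max (- f x) 0)); first last.
  + by move=> x; rewrite le_max lexx orbT.
  + by apply: measurable_maxr => //; exact: measurableT_comp.
  by apply: eq_integral => x _; rewrite funenegE -EFinN -EFin_max mulrC maxr_pMr// mulr0 mulrN mulrC.
Qed.

Section density_measure.
Context {R : realType} {d : nat}.
Local Notation F := (fconf R d).
Local Notation lp := (@lpm R d).
Variable k : F -> R.
Hypothesis mk : measurable_fun setT k.

Definition density_measure (A : set F) : \bar R := (\int[lp]_(x in A) `|k x|%:E)%E.

Let density_measure0 : density_measure set0 = 0%E.
Proof. by rewrite /density_measure integral_set0. Qed.

Let density_measure_ge0 A : (0 <= density_measure A)%E.
Proof. by apply: integral_ge0 => x _; rewrite lee_fin. Qed.

Let density_measure_semi_sigma_additive : semi_sigma_additive density_measure.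
Proof.
apply: semi_sigma_additive_nng_induced; last by move=> x; rewrite lee_fin.
by apply/measurable_EFinP; exact: measurableT_comp.
Qed.

HB.instance Definition _ := isMeasure.Build _ _ _ density_measure
  density_measure0 density_measure_ge0 density_measure_semi_sigma_additive.

Lemma density_measure_exists : exists rho : {measure set (fconf R d) -> \bar R},
  forall A, rho A = (\int[lp]_(x in A) `|k x|%:E)%E.
Proof. by exists density_measure. Qed.

End density_measure.

(** * Moments, correlation functional and uniqueness of the limit measure *)

Section limit_measure_properties.
Context {R : realType} {d : nat}.
Local Notation E := (euclid R d).
Local Notation F := (fconf R d).
Local Notation m := (lebesgue_space R d).
Local Notation lp := (@lpm R d).
Hypothesis d0 : (0 < d)%N.

Lemma Ki_Kf (G : F -> R) gam : Ki (Kf G) gam = G gam.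
Proof.
elim/(@fconf_ind R d): gam G => [|x A xA IH] G.
  by rewrite /Kf /Ki fpowerset0 !big_seq_fset1 fpowerset0 big_seq_fset1 fsetDv cardfs0 expr0 mul1r.
rewrite KiU1// (IH G) -[RHS](addrK (G A)); congr (_ - _).
rewrite -[in RHS](IH G) -(IH (fun B => G (x |` B)%fset)) /Ki -big_split/=.
apply: eq_big_seq => B; rewrite fpowersetE => BA; rewrite -mulrDr; congr (_ * _).
have xB : x \notin B by apply: contra xA; exact: (fsubsetP BA).
by rewrite /Kf (sum_fpowersetU1 _ xB) addrC.
Qed.

Lemma normr_Kf (G : F -> R) (K : R) eta : 0 <= K -> (forall eta, `|G eta| <= K) ->
  `|Kf G eta| <= K * 2 ^+ #|` eta|%fset.
Proof.
move=> K0 GK; apply: le_trans (ler_norm_sum _ _ _) _.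
apply: (@le_trans _ _ (\sum_(xi <- fpowerset eta) K)); first by apply: ler_sum => xi _.
by rewrite big_const_seq count_predT iter_addr_0 card_fpowerset -[leLHS]mulr_natr natrX.
Qed.

Lemma cylinder_sigma : measurable = <<s @cylinder R d >>.
Proof.
apply/seteqP; split.
  apply: smallest_sub; first exact: smallest_sigma_algebra.
  move=> _ [L bL [n ->]]; apply: sub_sigma_algebra; split.
    by apply: sub_sigma_algebra; exists L => //; exists n.
  have [_ /bounded_region_box[N LN]] := bL; exists N => g /=.
  rewrite -[in X in _ <-> X]card_confr confr_conf_of// frestr_confr//; exact: box_bounded.
apply: smallest_sub; first exact: sigma_algebra_measurable.
by move=> A [].
Qed.

(** Cylinders are stable under intersection and generate the sigma-algebra, and each one is an event
    about the trace on a box. *)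
Lemma probability_cylinder_unique (nu mut : probability (conf R d) R) :
  (forall n (A : set F), measurable A -> nu (confr (box n) @^-1` A) = mut (confr (box n) @^-1` A)) ->
  forall A : set (conf R d), measurable A -> nu A = mut A.
Proof.
move=> h A mA; apply: (@measure_unique _ R (conf R d) cylinder (fun=> setT) cylinder_sigma) => //.
- move=> B D cB cD; rewrite -[B `&` D]setCK setCI; apply: cylinderC.
  by apply: cylinderU; exact: cylinderC.
- by move=> _; rewrite -setC0; apply: cylinderC; exact: cylinder0.
- by apply/seteqP; split => // x _; exists 0%N.
- move=> D [mD [n Dn]].
  have mDc : measurable (conf_of @^-1` D : set F).
    by rewrite -[X in measurable X]setTI; exact: measurable_conf_of.
  have <- : confr (box n) @^-1` (conf_of @^-1` D) = D.
    by apply/seteqP; split => g /=; rewrite -Dn.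
  exact: h.
- by move=> _; rewrite [ltLHS](_ : _ = 1%E) ?ltry//; exact: probability_setT.
Qed.

Variables (k : F -> R) (M C : R).
Hypotheses (mk : measurable_fun setT k) (M0 : 0 <= M) (C1 : 1 <= C)
  (kM : forall eta, `|k eta| <= M * C ^+ #|` eta|%fset).
Hypothesis dens_ge0 : forall L, bounded_Borel L ->
  {ae lp, forall eta, 0 <= isub L eta * dens k L eta}.
Hypothesis k_ge0 : {ae lp, forall eta, 0 <= k eta}.
Variable mut : probability (conf R d) R.
Hypothesis mutE : forall L (A : set F), bounded_Borel L -> measurable A ->
    mut (confr L @^-1` A) = (loc k L A)%:E.

Let C0 : 0 <= C. Proof. by rewrite (le_trans _ C1). Qed.

(** The local density has its sign only almost everywhere; the absolute value gives the everywhere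
    nonnegative density that [integral_image_density] asks for. *)
Let mu_loc L (A : set F) : bounded_Borel L -> measurable A ->
  mut (confr L @^-1` A) = (\int[lp]_(om in A) `|isub L om * dens k L om|%:E)%E.
Proof.
move=> bL mA; have [mL _] := bL; rewrite mutE//.
have iL := integrable_loc1 d0 mk M0 C1 kM bL mA.
rewrite /loc /Rintegral fineK; last exact: integrable_fin_num iL.
rewrite [RHS]integral_mkcond; apply: ae_eq_integral => //.
- exact: measurable_int iL.
- apply/(measurable_restrictT _ mA); apply/measurable_EFinP; apply: measurable_funTS.
  apply: measurableT_comp => //; apply: measurable_funM; first exact: measurable_isub.
  exact: measurable_dens.
- apply: filterS (dens_ge0 bL) => om h _; rewrite patchE indicE.
  by case: ifPn => _; rewrite ?mul1r ?mul0r ?mulr0// ger0_norm.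
Qed.

Lemma mut_integral L (f : F -> R) : bounded_Borel L -> measurable_fun setT f ->
  (\int[mut]_g (f (confr L g))%:E = \int[lp]_om (isub L om * f om * dens k L om)%:E)%E.
Proof.
move=> bL mf; have [mL _] := bL.
have mi : measurable_fun setT (fun om => isub L om * dens k L om).
  by apply: measurable_funM; [exact: measurable_isub|exact: measurable_dens].
have mi' : measurable_fun setT (fun om => `|isub L om * dens k L om|) by exact: measurableT_comp.
rewrite (integral_image_density (g := fun om => `|isub L om * dens k L om|) (measurable_confr bL) mi'
  (fun _ => normr_ge0 _) (fun A => mu_loc bL) mf).
apply: ae_eq_integral => //.
- by apply/measurable_EFinP; exact: measurable_funM.
- apply/measurable_EFinP; apply: measurable_funM; last exact: measurable_dens.
  by apply: measurable_funM => //; exact: measurable_isub.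
- by apply: filterS (dens_ge0 bL) => om h _; rewrite ger0_norm// mulrCA mulrA.
Qed.

Lemma integrable_isub_dens L (f : F -> R) (K a : R) : bounded_Borel L -> measurable_fun setT f ->
  0 <= K -> 0 <= a -> (forall eta, `|f eta| <= K * a ^+ #|` eta|%fset) ->
  lp.-integrable setT (EFin \o (fun om => isub L om * f om * dens k L om)).
Proof.
move=> bL mf K0 a0 fK; have [mL _] := bL; have Loo := bounded_lty bL.
have KK : 0 <= K * (M * expR (C * fine (m L))) by rewrite !mulr_ge0// expR_ge0.
have [] // := @integrable_dominated R d d0 (fun om => isub L om * f om * dens k L om) L (a * C)
  (K * (M * expR (C * fine (m L)))) (mulr_ge0 a0 C0) KK mL Loo.
  apply: measurable_funM; last exact: measurable_dens.
  by apply: measurable_funM => //; exact: measurable_isub.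
move=> om; rewrite !normrM (ger0_norm (isub_ge0 _ _)) /ecard [leRHS]mulrCA -mulrA ler_wpM2l//.
rewrite exprMn mulrACA; apply: ler_pM => //; exact: (dens_le d0 mk M0 C1 kM).
Qed.

Lemma mut_moments : finite_moments mut.
Proof.
move=> L bL n.
have mc : measurable_fun setT (fun eta : F => (#|` eta|%fset%:R ^+ n : R)).
  apply: measurable_funX.
  exact: (measurableT_comp (f := fun j : nat => j%:R : R) _ (@measurable_card_fconf R d)).
(* By j < 2^j the power j^n is at most (2^n)^j, an exponential bound in the number j of points. *)
have b (eta : F) : `|#|` eta|%fset%:R ^+ n : R| <= 1 * (2 ^+ n) ^+ #|` eta|%fset.
  rewrite mul1r -exprM mulnC exprM ger0_norm ?exprn_ge0//.
  rewrite lerXn2r ?nnegrE ?exprn_ge0//.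
  by rewrite -natrX ler_nat ltnW// ltn_expl.
have e := mut_integral bL mc.
rewrite [X in (X < _)%E]e.
have i := integrable_isub_dens bL mc ler01 (exprn_ge0 n (ler0n _ 2)) b.
have := integrable_fin_num measurableT i.
by rewrite fin_numElt => /andP[].
Qed.

(** [dens_formula] for f = [Kf G], with [Ki_Kf], turns the integral of the K-transform against the
    local density into that of G against k. *)
Lemma mut_correlation (rho : {measure set (fconf R d) -> \bar R}) :
  (forall A, rho A = (\int[lp]_(x in A) `|k x|%:E)%E) -> is_correlation_measure mut rho.
Proof.
move=> rhoE G [mG [M1 GM] [N [L [bL G0]]]]; have [mL _] := bL; have Loo := bounded_lty bL.
have M10 : 0 <= M1 by apply: le_trans (GM fset0).
have Gs (eta : F) : ~ subconf L eta -> G eta = 0 by move=> h; apply: G0 => -[].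
have mKG := measurable_Kf mG.
have mk' : measurable_fun setT (fun x => `|k x|) by exact: measurableT_comp.
transitivity (\int[mut]_g (Kf G (confr L g))%:E)%E.
  by apply: eq_integral => g _; rewrite (Ktransform_Kf _ bL).
have KfM eta := normr_Kf eta M10 GM.
rewrite (mut_integral bL mKG).
have i1 := integrable_isub_dens bL mKG M10 (ler0n _ 2) KfM.
rewrite -[LHS](fineK (integrable_fin_num measurableT i1)).
have e : (\int[rho]_eta (G eta)%:E = \int[lp]_eta (G eta * `|k eta|)%:E)%E.
  apply: (@integral_image_density _ _ _ _ R rho lp id (fun x => `|k x|)) => //.
rewrite e (_ : (\int[lp]_eta (G eta * `|k eta|)%:E = \int[lp]_eta (isub L eta * G eta * k eta)%:E)%E); last first.
  apply: ae_eq_integral => //.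
  - by apply/measurable_EFinP; exact: measurable_funM.
  - apply/measurable_EFinP; apply: measurable_funM => //.
    by apply: measurable_funM => //; exact: measurable_isub.
  - apply: filterS k_ge0 => eta h _; rewrite ger0_norm//.
    by have [s|/Gs ->] := pselect (subconf L eta); [rewrite (isubE1 s) mul1r|rewrite mulr0].
have [i2 _] : lp.-integrable setT (EFin \o (fun eta => isub L eta * G eta * k eta)) /\
    `|\int[lp]_eta (isub L eta * G eta * k eta)| <= M1 * M * expR (C * fine (m L)).
  apply: (integrable_dominated d0 C0 (mulr_ge0 M10 M0) mL Loo).
    by apply: measurable_funM => //; apply: measurable_funM => //; exact: measurable_isub.
  move=> eta; rewrite !normrM (ger0_norm (isub_ge0 _ _)) /ecard [leRHS]mulrCA -!mulrA ler_wpM2l//.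
  by apply: ler_pM.
rewrite -[RHS](fineK (integrable_fin_num measurableT i2)); congr EFin.
have := dens_formula d0 mk M0 C1 kM mL Loo mKG M10 (ler1n _ 2) KfM.
rewrite /Rintegral => <-; congr fine; apply: eq_integral => eta _.
by rewrite Ki_Kf.
Qed.

(** [integral_confr] expresses the probability of a trace event under nu through k', and
    [dens_formula] identifies the result with [loc]; events about traces on boxes determine a
    probability. *)
Lemma mut_unique (nu : probability (conf R d) R) (k' : F -> R) (rho : {measure set (fconf R d) -> \bar R}) :
  is_correlation_measure nu rho -> measurable_fun setT k' ->
  (forall A, measurable A -> rho A = (\int[lp]_(eta in A) (k' eta)%:E)%E) ->
  {ae lp, forall eta, k eta = k' eta} ->
  forall A : set (conf R d), measurable A -> nu A = mut A.
Proof.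
move=> crho mk' rhoE kk'; apply: probability_cylinder_unique => n A mA.
have bL : bounded_Borel (@box R d n) by exact: box_bounded.
have [mL _] := bL; have Loo := bounded_lty bL.
have kM' : {ae lp, forall eta, `|k' eta| <= M * C ^+ #|` eta|%fset} by apply: filterS kk' => eta <-.
have mI : measurable_fun setT (\1_A : F -> R) by exact: measurable_indic.
have I1 eta : `|\1_A eta : R| <= 1 * 1 ^+ #|` eta|%fset.
  by rewrite expr1n mulr1 indicE; case: (_ \in _); rewrite ?normr1 ?normr0.
have [ii e] := integral_confr d0 crho mk' rhoE M0 C1 kM' bL mI ler01 (lexx 1) I1.
have mA' : measurable (confr (box n) @^-1` A).
  by rewrite -[X in measurable X]setTI; exact: measurable_confr.
rewrite mutE// -[LHS]fineK ?fin_num_measure//; congr EFin.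
have -> : fine (nu (confr (box n) @^-1` A)) = \int[nu]_g \1_A (confr (box n) g).
  rewrite /Rintegral; congr fine.
  have -> : (\int[nu]_g (\1_A (confr (box n) g))%:E = \int[nu]_g (\1_(confr (box n) @^-1` A) g)%:E)%E by [].
  by rewrite integral_indic// setIT.
rewrite e /loc.
have := dens_formula d0 mk M0 C1 kM mL Loo mI ler01 (lexx 1) I1.
rewrite (_ : \int[lp]_eta (isub (box n) eta * Ki \1_A eta * k eta) = \int[lp]_eta (isub (box n) eta * Ki \1_A eta * k' eta)); last first.
  rewrite /Rintegral; congr fine.
  have mK : measurable_fun setT (fun eta => isub (box n) eta * Ki (\1_A : F -> R) eta).
    by apply: measurable_funM; [exact: measurable_isub|exact: measurable_Ki].
  apply: ae_eq_integral => //.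
  - by apply/measurable_EFinP; exact: measurable_funM.
  - by apply/measurable_EFinP; exact: measurable_funM.
  - by apply: filterS kk' => eta -> _.
by move=> ->; apply: eq_Rintegral => eta _; rewrite mulrA.
Qed.

End limit_measure_properties.

(** * Local absolute continuity *)

Lemma pushforward_measure_exists d1 d2 (T1 : measurableType d1) (T2 : measurableType d2) (R : realType)
    (mu : {measure set T1 -> \bar R}) (f : T1 -> T2) : measurable_fun setT f ->
  exists nu : {measure set T2 -> \bar R}, forall A, nu A = mu (f @^-1` A).
Proof.
by move=> mf; exists (measure_function_pushforward__canonical__measure_function_Measure mu mf).
Qed.

Section poisson.
Context {R : realType} {d : nat}.
Local Notation E := (euclid R d).
Local Notation F := (fconf R d).
Local Notation m := (lebesgue_space R d).
Local Notation lp := (@lpm R d).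
Hypothesis d0 : (0 < d)%N.

Section partition.
Variables (I : finType) (q : E -> I).

Definition cell (i : I) : set E := [set x | q x = i].

Definition cell_count (eta : F) : {ffun I -> nat} :=
  [ffun i => #|` frestr (cell i) eta|%fset].

Hypothesis mq : forall i, measurable (cell i).

Lemma measurable_cell_count i : measurable_fun setT (fun eta : F => cell_count eta i).
Proof.
rewrite (_ : (fun eta => _) = (fun eta : F => #|` frestr (cell i) eta|%fset)).
  apply: (measurableT_comp (@measurable_card_fconf R d)).
  exact: (measurable_frestr (mq i) (@measurable_id _ F setT)).
by apply/funext => eta; rewrite /cell_count ffunE.
Qed.

(** There are countably many count vectors. Their codes split an event about counts into countably
    many pieces with at most one vector each, so two measures need only be compared on single
    vectors. *)
Definition cell_eventn (P : set {ffun I -> nat}) (n : nat) : set F :=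
  [set eta | P (cell_count eta) /\ choice.pickle (cell_count eta) = n].

Lemma cell_eventnE P n : cell_eventn P n = set0 \/
  exists kap : {ffun I -> nat}, P kap /\ cell_eventn P n = [set eta | cell_count eta = kap].
Proof.
have [[kap Pk ek]|no] := pselect (exists2 kap : {ffun I -> nat}, P kap & choice.pickle kap = n); [right|left].
  exists kap; split => //; apply/seteqP; rewrite /cell_eventn; split => eta /=; last by move=> ->.
  by move=> [_]; rewrite -ek => /(pcan_inj choice.pickleK).
by apply/seteqP; split => // eta [h1 h2]; apply: no; exists (cell_count eta).
Qed.

Lemma measurable_cell_count_eq (kap : {ffun I -> nat}) : measurable [set eta : F | cell_count eta = kap].
Proof.
rewrite (_ : [set _ | _] = \bigcap_(i in [set: I]) [set eta : F | cell_count eta i = kap i]).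
  apply: fin_bigcap_measurable => [|i _]; first exact: finite_finset.
  rewrite -[X in measurable X]setTI.
  have := measurable_cell_count i; move=> /(_ measurableT [set kap i]); exact.
apply/seteqP; split => eta /= h; first by move=> i _ /=; rewrite h.
by apply/ffunP => i; exact: h.
Qed.

Lemma cell_event_bigcup P : [set eta : F | P (cell_count eta)] = \bigcup_n cell_eventn P n.
Proof.
apply/seteqP; split => eta /=; first by move=> Pe; exists (choice.pickle (cell_count eta)).
by move=> [n _ []].
Qed.

Lemma measurable_cell_eventn P n : measurable (cell_eventn P n).
Proof.
have [->|[kap [_ ->]]] := cell_eventnE P n; first exact: measurable0.
exact: measurable_cell_count_eq.
Qed.

Lemma measurable_cell_event P : measurable [set eta : F | P (cell_count eta)].
Proof.
by rewrite cell_event_bigcup; apply: bigcupT_measurable => n; exact: measurable_cell_eventn.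
Qed.

Lemma cell_event_measure_eq (m1 m2 : {measure set F -> \bar R}) P :
  (forall kap, m1 [set eta | cell_count eta = kap] = m2 [set eta | cell_count eta = kap]) ->
  m1 [set eta | P (cell_count eta)] = m2 [set eta | P (cell_count eta)].
Proof.
move=> h; have tP : trivIset setT (cell_eventn P).
  by move=> i j _ _ [eta [[_ <-] [_ <-]]].
rewrite cell_event_bigcup !measure_bigcup//; [|by move=> i _; exact: measurable_cell_eventn..].
apply: eq_eseriesr => n _.
by have [->|[kap [_ ->]]] := cell_eventnE P n; [rewrite !measure0|exact: h].
Qed.

Section poisson_cells.
Variable L : set E.
Hypotheses (mL : measurable L) (Loo : (m L < +oo)%E).

Let cells (r : seq I) : set E := [set x | L x /\ q x \in r].

Let v i : R := fine (m (L `&` cell i)).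

Let cells_cons i r : cells (i :: r) = (L `&` cell i) `|` cells r.
Proof.
apply/seteqP; split => x; rewrite /cells/= inE.
  by move=> [Lx /orP[/eqP e|h]]; [left|right].
by move=> [[Lx ->]|[Lx h]]; split => //; rewrite ?eqxx// h orbT.
Qed.

Let measurable_cells r : measurable (cells r).
Proof.
elim: r => [|i r IH]; first by rewrite (_ : cells [::] = set0)//; apply/seteqP; split => x // [].
by rewrite cells_cons; apply: measurableU => //; exact: measurableI.
Qed.

Let cells_sub r : cells r `<=` L. Proof. by move=> x []. Qed.

Let cells_lty r : (m (cells r) < +oo)%E.
Proof. by apply: le_lt_trans Loo; apply: le_measure; rewrite ?inE//; exact: cells_sub. Qed.

Let cell_lty i : (m (L `&` cell i) < +oo)%E.
Proof. by apply: le_lt_trans Loo; apply: le_measure; rewrite ?inE//; exact: measurableI. Qed.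

Let cells_disj i r : i \notin r -> (L `&` cell i) `&` cells r = set0.
Proof. by move=> ir; apply/seteqP; split => // x [[_ /= qx] [_]]; rewrite qx (negbTE ir). Qed.

Let cells_measure r : uniq r -> fine (m (cells r)) = \sum_(i <- r) v i.
Proof.
elim: r => [_|i r IH /andP[ir ur]].
  rewrite big_nil (_ : cells [::] = set0) ?measure0//; by apply/seteqP; split => x // [].
rewrite big_cons -IH// cells_cons measureU//; [|exact: measurableI|exact: cells_disj].
have f1 : m (L `&` cell i) \is a fin_num by rewrite ge0_fin_numE//; exact: cell_lty.
have f2 : m (cells r) \is a fin_num by rewrite ge0_fin_numE//; exact: cells_lty.
by rewrite fineD.
Qed.

(** Induction over the cells: one cell is split off the region, its n-point part has mass v^n / n!,
    and the counts in the other cells depend only on the remaining points. *)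
Lemma lpm_cells (kap : {ffun I -> nat}) r : uniq r ->
  (\int[lp]_eta ((isub (cells r) eta)%:E * (\prod_(i <- r) (cell_count eta i == kap i)%:R)%:E) =
   (\prod_(i <- r) (v i ^+ kap i / (kap i)`!%:R))%:E)%E.
Proof.
elim: r => [_|i r IH /andP[ir ur]].
  have -> : cells [::] = set0 by apply/seteqP; split => x // [].
  have z0 : (m set0 < +oo)%E by rewrite measure0.
  have := integral_expcard d0 (@ler01 R) (@measurable0 _ E) z0.
  rewrite measure0 mulr0 expR0 big_nil => <-; apply: eq_integral => eta _.
  by rewrite big_nil mule1 expr1n mulr1.
have mh r' : measurable_fun setT (fun eta : F => (\prod_(i <- r') (cell_count eta i == kap i)%:R : R)%:E).
  apply/measurable_EFinP; apply: measurable_prod => j _.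
  exact: (measurableT_comp (f := fun a : nat => (a == kap j)%:R : R) _ (measurable_cell_count j)).
have h0 (r' : seq I) (eta : F) : (0 <= (\prod_(i <- r') (cell_count eta i == kap i)%:R : R)%:E)%E.
  by rewrite lee_fin prodr_ge0.
have mLi : measurable (L `&` cell i) by exact: measurableI.
have sLi : L `&` cell i `<=` cells (i :: r) by move=> x [Lx qx]; split => //; rewrite qx inE eqxx.
rewrite (integral_split_region d0 mLi (measurable_cells (i :: r)) sLi (h0 _) (mh _)).
have DE : cells (i :: r) `\` (L `&` cell i) = cells r.
  rewrite cells_cons; apply/seteqP; split => x /=; first by move=> [[|//] h1 h2].
  by move=> h; split; [right|move=> h2; have := cells_disj ir; move=> /seteqP[/(_ x) + _]; apply].
rewrite DE big_cons.
transitivity (\int[lp]_xi ((isub (L `&` cell i) xi * (#|` xi|%fset == kap i)%:R)%:E *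
    (\prod_(j <- r) (v j ^+ kap j / (kap j)`!%:R))%:E))%E.
  apply: eq_integral => xi _.
  have [xL|xL] := pselect (subconf (L `&` cell i) xi); last by rewrite (isubE0 xL) mul0r !mul0e.
  rewrite (isubE1 xL) mul1e mul1r -(IH ur) -ge0_integralZl//; first last.
  - by move=> z _; apply: mule_ge0; [rewrite lee_fin|exact: h0].
  - by apply: emeasurable_funM => //; apply/measurable_EFinP; exact: measurable_isub.
  apply: eq_integral => z _.
  have [zL|zL] := pselect (subconf (cells r) z); last by rewrite (isubE0 zL) !mul0e mule0.
  rewrite (isubE1 zL) !mul1e -EFinM big_cons; congr (_ * _)%:E.
    congr (_ == _)%:R; rewrite /cell_count ffunE; congr (#|` _|%fset).
    apply/fsetP => x; rewrite [LHS]mem_frestr in_fsetU.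
    apply/andP/idP => [[/orP[//|xz]]|xx].
      by rewrite inE => /= qx; have [_] := zL x xz; rewrite qx (negbTE ir).
    by split; [rewrite xx|apply/mem_set; have [] := xL x xx].
  apply: eq_big_seq => j jr; congr (_ == _)%:R; rewrite /cell_count !ffunE; congr (#|` _|%fset).
  apply/fsetP => x; rewrite [LHS]mem_frestr [RHS]mem_frestr in_fsetU.
  have [xj|_] := boolP (x \in cell j); rewrite ?andbF// !andbT orb_idl// => xx.
  move: xj; rewrite inE /cell/= => qj; have [_ qi] := xL x xx.
  by move: ir; rewrite -qi qj jr.
have c0 : (0 <= (\prod_(j <- r) (v j ^+ kap j / (kap j)`!%:R))%:E)%E.
  by rewrite lee_fin prodr_ge0// => j _; rewrite divr_ge0// exprn_ge0// fine_ge0.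
rewrite ge0_integralZr//; first last.
- by move=> x _; rewrite lee_fin mulr_ge0.
- apply/measurable_EFinP; apply: measurable_funM; first exact: measurable_isub.
  exact: (measurableT_comp (f := fun a : nat => (a == kap i)%:R : R) _ (@measurable_card_fconf R d)).
rewrite EFinM; congr (_ * _)%E; rewrite -(nrm_subconf d0 (kap i) mLi (cell_lty i)) /nrm.
by apply: eq_integral => x _; rewrite /lev ger0_norm// mulrC.
Qed.

(** The masses of the cells add up to that of L, so the factor exp(-m(L)) distributes over the cells
    and completes each of them to a Poisson weight. *)
Lemma lpm_cell_count (kap : {ffun I -> nat}) :
  (\int[lp]_(eta in [set eta | cell_count eta = kap]) (expR (- fine (m L)) * isub L eta)%:E =
  (\prod_i (expR (- v i) * v i ^+ kap i / (kap i)`!%:R))%:E)%E.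
Proof.
have LE : cells (enum I) = L by apply/seteqP; split => x; [case|split => //; rewrite mem_enum].
have := cells_measure (enum_uniq I); rewrite LE => ->.
have := lpm_cells kap (enum_uniq I); rewrite LE => e.
have -> : \prod_i (expR (- v i) * v i ^+ kap i / (kap i)`!%:R) =
    expR (- \sum_(i <- enum I) v i) * \prod_(i <- enum I) (v i ^+ kap i / (kap i)`!%:R).
  rewrite -sumrN expR_sum -big_split/= big_enum/=.
  by apply: eq_bigr => i _; rewrite mulrA.
rewrite EFinM -e.
rewrite -ge0_integralZl//; first last.
- by move=> z _; rewrite mule_ge0 ?lee_fin// prodr_ge0.
- apply: emeasurable_funM; first by apply/measurable_EFinP; exact: measurable_isub.
  apply/measurable_EFinP; apply: measurable_prod => j _.
  exact: (measurableT_comp (f := fun a : nat => (a == kap j)%:R : R) _ (measurable_cell_count j)).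
rewrite [LHS]integral_mkcond; apply: eq_integral => eta _; rewrite patchE.
case: ifPn => h.
  rewrite [X in (_ * (_ * X))%E](_ : _ = 1%E) ?mule1//.
  move: h; rewrite inE => /= ->; congr EFin; rewrite big1// => i _; by rewrite eqxx.
rewrite [X in (_ * (_ * X))%E](_ : _ = 0%E) ?mule0//; congr EFin.
have /existsP[i hi] : [exists i, cell_count eta i != kap i].
  rewrite -negb_forall; apply: contra h => /forallP h; apply/mem_set => /=.
  by apply/ffunP => i; apply/eqP; exact: h.
by rewrite (big_rem i) ?mem_enum//= (negbTE hi) mul0r.
Qed.

Lemma poisson_cell_count (pi : probability (conf R d) R) (kap : {ffun I -> nat}) :
  is_poisson pi -> bounded_Borel L ->
  pi (confr L @^-1` [set eta | cell_count eta = kap]) =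
  (\prod_i (expR (- v i) * v i ^+ kap i / (kap i)`!%:R))%:E.
Proof.
move=> pp bL.
have bc (j : 'I_#|I|) : bounded_Borel (L `&` cell (enum_val j)) by exact: bounded_BorelI.
have tc : trivIset setT (fun j : 'I_#|I| => L `&` cell (enum_val j)).
  by move=> i j _ _ [x [[_ /= qi] [_ qj]]]; apply: enum_val_inj; rewrite -qi qj.
have := pp _ _ bc tc (fun j => kap (enum_val j)).
rewrite (_ : [set g | _] = confr L @^-1` [set eta | cell_count eta = kap]).
  move=> ->; congr EFin; rewrite -(big_enum_val (I := I) (A := I) (fun i => expR (- v i) * v i ^+ kap i / (kap i)`!%:R))/=.
  by apply: eq_bigl.
have cc i g : cell_count (confr L g) i = count_in (L `&` cell i) g.
  rewrite /cell_count ffunE -card_confr; congr (#|` _|%fset); apply/fsetP => x.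
  rewrite [LHS]mem_frestr mem_confr// [RHS]mem_confr; last exact: bounded_BorelI.
  by rewrite !in_setI andbA.
apply/seteqP; split => g /= h.
  by apply/ffunP => i; rewrite cc -(enum_rankK i); exact: h.
by move=> j; rewrite -cc h.
Qed.

End poisson_cells.
End partition.

(* Indexing by maps [q] to a finite type makes this class stable under
   intersection: the pair of two such maps refines both partitions. *)
Definition cell_event : set (set F) :=
  [set B | exists (I : finType) (q : E -> I) (P : set {ffun I -> nat}),
    (forall i, measurable (cell q i)) /\ B = [set eta | P (cell_count q eta)]].

(** The counts in the cells of either partition are sums of counts in the cells of the common
    refinement. *)
Lemma cell_event_setI : setI_closed cell_event.
Proof.
move=> _ _ [I [q [P [mq ->]]]] [J [r [Q [mr ->]]]].
exists (I * J)%type, (fun x => (q x, r x)).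
exists [set kap | P [ffun i => (\sum_j kap (i, j))%N] /\ Q [ffun j => (\sum_i kap (i, j))%N]].
split.
  move=> [i j]; rewrite (_ : cell _ _ = cell q i `&` cell r j); first exact: measurableI.
  by apply/seteqP; split => x /=; rewrite /cell/=; [move=> [-> ->]|move=> [-> ->]].
(* The points are counted cell by cell; below this is applied to the part of eta in one cell of the
   other partition. *)
have cs (A : {fset E}) (K : finType) (s : E -> K) :
    #|` A|%fset = (\sum_k #|` frestr (cell s k) A|%fset)%N.
  elim/(@fconf_ind R d): A => [|x A xA IH].
    rewrite cardfs0 big1// => k _; apply/eqP; rewrite cardfs_eq0; apply/eqP/fsetP => y.
    by rewrite [LHS]mem_frestr !inE.
  rewrite cardfsU1 xA IH (bigD1 (s x))//= [in RHS](bigD1 (s x))//= addnA; congr (_ + _)%N.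
    have -> : frestr (cell s (s x)) (x |` A)%fset = (x |` frestr (cell s (s x)) A)%fset.
      apply/fsetP => y; rewrite [LHS]mem_frestr in_fset1U [RHS]in_fset1U [y \in frestr _ _]mem_frestr.
      by case: eqP => [->|//] /=; apply/mem_set.
    rewrite cardfsU1 [x \in frestr _ _]mem_frestr (negbTE xA) //.
  apply: eq_bigr => k ks; congr (#|` _|%fset); apply/fsetP => y.
  rewrite [LHS]mem_frestr [RHS]mem_frestr in_fset1U; case: eqP => [->|//] /=.
  rewrite (negbTE xA) /=; apply/esym/negbTE; apply: contra ks => /=.
  by rewrite inE /cell/= => ->.
have cE (eta : F) : cell_count q eta = [ffun i => (\sum_j cell_count (fun x => (q x, r x)) eta (i, j))%N] /\
    cell_count r eta = [ffun j => (\sum_i cell_count (fun x => (q x, r x)) eta (i, j))%N].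
  split; apply/ffunP => k; rewrite /cell_count !ffunE.
    rewrite (cs _ J r); apply: eq_bigr => j _; rewrite ffunE; congr (#|` _|%fset); apply/fsetP => x.
    rewrite !mem_frestr -andbA; congr (_ && _).
    by apply/andP/idP; rewrite !inE /cell/=; [move=> [-> ->]|move=> [-> ->]].
  rewrite (cs _ I q); apply: eq_bigr => j _; rewrite ffunE; congr (#|` _|%fset); apply/fsetP => x.
  rewrite !mem_frestr -andbA; congr (_ && _).
  by apply/andP/idP; rewrite !inE /cell/=; [move=> [-> ->]|move=> [-> ->]].
by apply/seteqP; split => eta /=; have [-> ->] := cE eta.
Qed.

(** The partition into D and its complement makes the count in D a cell event, and such counts
    generate the sigma-algebra by [measurable_fconf]. *)
Lemma cell_event_sigma : measurable = <<s cell_event >>.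
Proof.
apply/seteqP; split; last first.
  apply: smallest_sub; first exact: sigma_algebra_measurable.
  by move=> _ [I [q [P [mq ->]]]]; exact: measurable_cell_event.
move=> A mA; pose S : measurableType _ := g_sigma_algebraType cell_event.
have cS : count_measurable (fun eta : S => eta : F).
  move=> D mD _ Y mY; rewrite setTI; apply: sub_sigma_algebra.
  pose q (x : E) : bool := x \in D.
  have qT : cell q true = D.
    by apply/seteqP; split => x; rewrite /cell /q/=; [move/set_mem|move/mem_set].
  exists bool, q, [set kap | Y (kap true)%:R%:E]; split.
    case; first by rewrite qT.
    rewrite (_ : cell _ _ = ~` D); first exact: measurableC.
    apply/seteqP; split => x; rewrite /cell /q/=; first by move=> h /mem_set; rewrite h.
    by move=> h; apply/negbTE; rewrite notin_setE.
  have e (eta : F) : cmeas eta D = (cell_count q eta true)%:R%:E by rewrite cmeas_frestr ffunE qT.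
  by apply/seteqP; split => eta /=; rewrite e.
have := measurable_fconf cS measurableT mA; rewrite setTI; exact.
Qed.

Variable L : set E.
Hypothesis bL : bounded_Borel L.
Variable pi : probability (conf R d) R.
Hypothesis pp : is_poisson pi.

(** Both sides are measures in A that agree on single count vectors, hence on cell events, a
    generating class stable under intersection. *)
Lemma poisson_confr (A : set F) : measurable A ->
  pi (confr L @^-1` A) = (\int[lp]_(eta in A) (expR (- fine (m L)) * isub L eta)%:E)%E.
Proof.
have [mL _] := bL; have Loo := bounded_lty bL.
pose k eta := expR (- fine (m L)) * isub L eta.
have k0 eta : 0 <= k eta by rewrite mulr_ge0// expR_ge0.
have mk : measurable_fun setT k by apply: measurable_funM => //; exact: measurable_isub.
have [rho rhoE] := density_measure_exists mk.
have rhoE' B : rho B = (\int[lp]_(eta in B) (k eta)%:E)%E.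
  by rewrite rhoE; apply: eq_integral => x _; rewrite ger0_norm.
have mc := measurable_confr bL.
have [pim pimE] := pushforward_measure_exists pi mc.
rewrite -pimE -rhoE'; apply: (@measure_unique _ R F cell_event (fun=> setT) cell_event_sigma cell_event_setI) => //.
- move=> _; exists bool, (fun=> true), setT; split; last by apply/seteqP; split.
  case; first by rewrite (_ : cell _ _ = setT)//; apply/seteqP.
  by rewrite (_ : cell _ _ = set0)//; apply/seteqP; split.
- by apply/seteqP; split => // x _; exists 0%N.
- move=> _ [I [q [P [mq ->]]]]; apply: cell_event_measure_eq => // kap.
  by rewrite pimE rhoE' (lpm_cell_count mq mL Loo) (poisson_cell_count mq _ pp bL).
- by move=> _; rewrite pimE preimage_setT [ltLHS](_ : _ = 1%E) ?ltry//; exact: probability_setT.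
Qed.

(** The density exp(-m(L)) of the Poisson trace is strictly positive on configurations in L, so
    events that are null for it are Lebesgue-Poisson null there. *)
Lemma poisson_null (A : set F) : measurable A -> pi (confr L @^-1` A) = 0%E ->
  {ae lp, forall eta, A eta -> ~ subconf L eta}.
Proof.
have [mL _] := bL; have Loo := bounded_lty bL.
move=> mA; rewrite poisson_confr// => h.
have mf : measurable_fun setT (fun eta => (expR (- fine (m L)) * isub L eta)%:E).
  by apply/measurable_EFinP; apply: measurable_funM => //; exact: measurable_isub.
have := (ae_eq_integral_abs lp mA (measurable_funTS mf)).1.
rewrite (_ : (\int[lp]_(x in A) `|_| = 0)%E); last first.
  by rewrite -[RHS]h; apply: eq_integral => x _; rewrite gee0_abs// lee_fin mulr_ge0// expR_ge0.
move=> /(_ erefl); apply: filterS => eta h2 Ae s; have := h2 Ae => -[].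
by rewrite (isubE1 s) mulr1 => /eqP; rewrite gt_eqF// expR_gt0.
Qed.

End poisson.

(** [dens] integrates k along the unions of a fixed eta with a variable zeta, where an
    almost-everywhere bound gives no control. Clipping at the bound changes k on a null set only and
    makes the bound hold everywhere; a base of at least 1 makes it monotone in the number of
    points. *)
Lemma K_space_clip (R : realType) (d : nat) (C : R) (k : fconf R d -> R) : (0 < d)%N -> 0 < C -> K_space C k ->
  exists (M C1 : R) (kc : fconf R d -> R), [/\ 0 <= M, 1 <= C1, measurable_fun setT kc,
    forall eta : fconf R d, `|kc eta| <= M * C1 ^+ #|` eta|%fset &
    {ae @lpm R d, forall eta, kc eta = k eta}].
Proof.
move=> d0 C0 kK; have [mk [M M0 kM]] := K_space_bound d0 C0 kK.
pose C1 := Num.max C 1; pose b (eta : fconf R d) := M * C1 ^+ #|` eta|%fset.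
have C11 : 1 <= C1 by rewrite le_max lexx orbT.
have b0 eta : 0 <= b eta by rewrite mulr_ge0// exprn_ge0// (le_trans _ C11).
have mb : measurable_fun setT b by apply: measurable_funM => //; exact: measurable_weight.
pose kc eta := Num.max (- b eta) (Num.min (k eta) (b eta)).
exists M, C1, kc; split => //.
- by apply: measurable_maxr; [exact: measurableT_comp|exact: measurable_minr].
- move=> eta; rewrite -/(b eta) ler_norml /kc le_max lexx/= ge_max ge_min lexx orbT andbT.
  by rewrite (@le_trans _ _ 0)// oppr_le0.
apply: filterS kM => eta h.
have : `|k eta| <= b eta.
  apply: le_trans h _; rewrite ler_wpM2l// lerXn2r ?nnegrE ?(ltW C0)//.
    by rewrite (le_trans _ C11).
  by rewrite le_max lexx.
by rewrite ler_norml /kc => /andP[h1 h2]; rewrite (min_l h2) max_r.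
Qed.

(** Under mut the trace has a density with respect to the Lebesgue-Poisson measure on L, whose null
    sets are controlled by the Poisson trace through [poisson_null]. *)
Lemma limit_locally_absolutely_continuous (R : realType) (d : nat) (k : fconf R d -> R)
    (pi mut : probability (conf R d) R) : (0 < d)%N -> is_poisson pi -> measurable_fun setT k ->
  (forall L (A : set (fconf R d)), bounded_Borel L -> measurable A ->
    mut (confr L @^-1` A) = (loc k L A)%:E) ->
  locally_absolutely_continuous mut.
Proof.
move=> d0 pp mk mutE; exists pi => // L bL; have [mL _] := bL.
have rE : restrict_conf L = conf_of \o confr L by apply/funext => g /=; rewrite restrict_confE.
move=> N N0 A mA AN; move: (N0 A mA AN); rewrite /pushforward.
have -> : restrict_conf L @^-1` A = confr L @^-1` (conf_of @^-1` A).
  by rewrite rE.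
have mA' : measurable (conf_of @^-1` A : set (fconf R d)).
  by rewrite -[X in measurable X]setTI; exact: measurable_conf_of.
move=> h; have := poisson_null d0 bL pp mA' h => n.
rewrite mutE// /loc; congr EFin; rewrite /Rintegral -[RHS](_ : fine (\int[@lpm R d]_eta 0)%E = 0); last by rewrite integral0.
congr fine; apply: ae_eq_integral => //.
  apply/measurable_EFinP; apply: measurable_funM; first exact: measurable_isub.
  by apply: measurable_funM; [exact: measurable_indic|exact: measurable_dens].
apply: filterS n => eta h2 _; rewrite indicE.
have [Ae|_] := boolP (eta \in conf_of @^-1` A); last by rewrite mul0r mulr0.
by rewrite isubE0 ?mul0r//; apply: h2; move: Ae; rewrite inE.
Qed.

Theorem theorem3p9 (R : realType) (d : nat)
    (c : euclid R d -> euclid R d -> euclid R d -> euclid R d -> R)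
    (C0 : R) (mu : probability (conf R d) R) (kmu : fconf R d -> R)
    (k : R -> fconf R d -> R) :
  (0 < d)%N ->
  jump_rate c ->
  (c1 c < +oo)%E -> (c2 c < +oo)%E -> (c3 c < +oo)%E -> (c4 c < +oo)%E ->
  {ae (lebesgue_space R d \x lebesgue_space R d)%E,
    forall x, (a2 c x <= a1 c x)%E} ->
  0 < C0 ->
  finite_moments mu ->
  is_correlation_functional mu kmu ->
  K_space C0 kmu ->
  evolution c C0 kmu k ->
  forall t : R, 0 < t -> (t%:E < lifetime c C0)%E ->
  exists mut : probability (conf R d) R,
    [/\ finite_moments mut,
        is_correlation_functional mut (k t) &
        forall nu : probability (conf R d) R,
          finite_moments nu -> is_correlation_functional nu (k t) ->
          forall A : set (conf R d), measurable A -> nu A = mut A].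
Proof.
(* The Poisson measure pi comes from the local absolute continuity of mu and serves again for
   mut. *)
move=> d0 jr c1oo c2oo c3oo c4oo a21 C00 _ [[pi pp _] _ [rhomu crho rhoE]] kmuK evol t t0 tT.
have [kK _] := evol t t0 tT.
have mk : measurable_fun setT (k t) by have [] := K_space_bound d0 (Ct_gt0 jr C00 tT) kK.
have [M [C [kc [M0 C1 mkc kcM kcE]]]] := K_space_clip d0 (Ct_gt0 jr C00 tT) kK.
have dg := dens_ae_ge0 d0 jr c1oo c2oo c3oo c4oo a21 C00 kmuK evol crho rhoE t0 tT M0 C1 mkc kcM kcE.
have dt := dens_total d0 jr c1oo c2oo c3oo c4oo a21 C00 kmuK evol crho rhoE t0 tT M0 C1 mkc kcM kcE.
have k0 := evolved_ge0 d0 jr c1oo c2oo c3oo c4oo a21 C00 kmuK evol crho rhoE t0 tT.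
have kc0 : {ae @lpm R d, forall eta, 0 <= kc eta} by apply: filterS2 kcE k0 => eta ->.
have [mut mutE] := limit_measure_exists d0 mkc M0 C1 kcM dg dt.
exists mut; split.
- exact: (mut_moments d0 mkc M0 C1 kcM dg mutE).
- split => //; first exact: (limit_locally_absolutely_continuous d0 pp mkc mutE).
  (* The correlation measure is built with density |kc|, which is nonnegative everywhere; it has
     density [k t] as well, since the two agree almost everywhere. *)
  have [rho rhocE] := density_measure_exists mkc.
  exists rho; first exact: (mut_correlation d0 mkc M0 C1 kcM dg kc0 mutE rhocE).
  move=> A mA; rewrite rhocE; apply: ae_eq_integral => //.
  + by apply/measurable_EFinP; apply: measurable_funTS; exact: measurableT_comp.
  + by apply/measurable_EFinP; exact: measurable_funTS.
  + by apply: filterS2 kcE kc0 => eta -> h _; rewrite ger0_norm.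
- move=> nu _ [_ _ [rho crho' rhoE']].
  exact: (mut_unique d0 mkc M0 C1 kcM mutE crho' mk rhoE' kcE).
Qed.
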